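(* Consider the polynomial Liénard system $$\dot x=y,\qquad \dot y=-g(x)-f(x)y,\qquad g(x)=\sum_{i=r}^{m}a_ix^i,\quad f(x)=\sum_{i=s}^{n}b_ix^i,$$ where $m,n,r,s\in\mathbb{N}$, the coefficients are real and $a_ra_mb_sb_n\neq 0$. Put $F(x)=\int_0^x f(\xi)\,d\xi$ and $G(x)=\int_0^x g(\xi)\,d\xi$. The system has a linear type global center at the origin if and only if all of the following conditions hold: (i) $xg(x)>0$ for all $x\neq 0$; (ii) $r=1$, $s\ge 1$, $a_r>0$; (iii) either $m$ is odd, $m>2n+1$ and $a_m>0$; or $m=2n+1$ and $4(n+1)a_mb_n^{-2}>1$; (iv) for all $x_1<0<x_2$, if $G(x_1)=G(x_2)$ then $F(x_1)=F(x_2)$. Moreover, in this case the phase portrait in the Poincaré disc is the following: the origin is the only finite equilibrium, all other finite orbits are periodic orbits surrounding the origin, there are exactly two equilibria at infinity, namely the two endpoints of the $y$-axis, and a neighbourhood of each of these in the disc consists of one hyperbolic sector.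
   Context: Here $\mathbb{N}$ includes $0$ and the dot denotes the derivative with respect to the independent variable $t$. An equilibrium $p$ of a planar differential system is a center if it has a neighbourhood $U$ such that $U\setminus\{p\}$ is filled with periodic (closed) orbits. The period annulus of a center $p$ is the maximal connected set of periodic orbits surrounding $p$ and having $p$ in its boundary. A center $p$ is a global center if its period annulus is $\mathbb{R}^2\setminus\{p\}$. A (global) center is of linear type if the Jacobian matrix of the system at it has (nonzero) purely imaginary eigenvalues. The Poincaré disc is the Poincaré compactification of the plane, with points at infinity forming the boundary circle. *)

(* Defs.v *)
From HB Require Import structures.
From mathcomp Require Import all_boot all_order all_algebra.
From mathcomp Require Import all_classical all_reals all_analysis.
From mathcomp.real_closed Require Import complex.
From mathcomp Require Import ring.

Set Implicit Arguments.
Unset Strict Implicit.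
Unset Printing Implicit Defensive.

Import Order.TTheory GRing.Theory Num.Theory.
Import numFieldNormedType.Exports.

Local Open Scope classical_set_scope.
Local Open Scope ring_scope.

Section Vectors.
Context {R : realType}.

Definition vec2 (x y : R) : 'rV[R]_2 := \row_(j < 2) [:: x; y]`_j.
Definition vec3 (x y z : R) : 'rV[R]_3 := \row_(j < 3) [:: x; y; z]`_j.

End Vectors.

Section Dynamics.
Context {R : realType} {n : nat}.
Implicit Types (V : 'rV[R]_n -> 'rV[R]_n) (N : set 'rV[R]_n).

(* [reach V N q q'] : a solution arc of [dz/dt = V z] that stays in [N] leads
   from [q] to [q'] in nonnegative time. *)
Definition reach V N (q q' : 'rV[R]_n) : Prop :=
  exists (c : R -> 'rV[R]_n) (tau : R),
    [/\ 0 <= tau, c 0 = q, c tau = q' &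
        forall t, 0 <= t <= tau -> is_derive t (1 : R) c (V (c t)) /\ N (c t)].

Definition flow_orbit V (q : 'rV[R]_n) : set 'rV[R]_n :=
  [set q' | reach V setT q q' \/ reach V setT q' q].

Definition periodic_orbit V (O : set 'rV[R]_n) : Prop :=
  exists (c : R -> 'rV[R]_n) (T : R),
    [/\ 0 < T, forall t, is_derive t (1 : R) c (V (c t)),
        forall t, c (t + T) = c t, exists t, c t != c 0 & O = range c].

End Dynamics.

Section PlanarCenters.
Context {R : realType}.
Implicit Types (V : 'rV[R]_2 -> 'rV[R]_2) (p : 'rV[R]_2) (A O : set 'rV[R]_2).

Definition center V p : Prop :=
  V p = 0 /\
  exists2 U : set 'rV[R]_2, nbhs p U &
    forall q, (U `\ p) q ->
      exists O, [/\ periodic_orbit V O, O q & O `<=` U `\ p].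

(* By the Jordan curve theorem a closed orbit has exactly one bounded
   complementary component. *)
Definition surrounds O p : Prop :=
  ~ O p /\ bounded_set (connected_component (~` O) p).

Definition periodic_family V p A : Prop :=
  [/\ connected A,
      forall q, A q ->
        exists O, [/\ periodic_orbit V O, surrounds O p, O q & O `<=` A] &
      (closure A `\` A°) p].

Definition is_period_annulus V p A : Prop :=
  periodic_family V p A /\ forall B, periodic_family V p B -> B `<=` A.

Definition global_center V p : Prop :=
  center V p /\ is_period_annulus V p (~` [set p]).

Definition linear_type V p : Prop :=
  forall z : R[i],
    eigenvalue (map_mx (real_complex R) (jacobian V p)) z ->
    exists2 w : R, w != 0 & z = Complex 0 w.

End PlanarCenters.

Section PolynomialFields.
Context {R : realType}.

(* An element of [{poly {poly R}}] is read as a polynomial in R[x][y]: the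
   coefficient of [x^i y^j] in [P] is [P`_j`_i]. *)
Definition total_degree (P : {poly {poly R}}) : nat :=
  \max_(j < size P | (P`_j)%R != 0%R) (j + (size (P`_j)%R).-1)%N.

(* For [d >= total_degree P] and [z != 0] this is [z^d P(x/z, y/z)]. *)
Definition homogenize (d : nat) (P : {poly {poly R}}) (x y z : R) : R :=
  \sum_(j < size P) \sum_(i < size P`_j)
     P`_j`_i * x ^+ i * y ^+ j * z ^+ (d - (i + j))%N.

Definition poly_field : Type := ({poly {poly R}} * {poly {poly R}})%type.

Definition field_eval (X : poly_field) (q : 'rV[R]_2) : 'rV[R]_2 :=
  vec2 (X.1.[(q 0 1)%:P].[q 0 0]) (X.2.[(q 0 1)%:P].[q 0 0]).

Definition field_degree (X : poly_field) : nat :=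
  maxn (total_degree X.1) (total_degree X.2).

Definition central_projection (q : 'rV[R]_2) : 'rV[R]_3 :=
  (Num.sqrt (1 + q 0 0 ^+ 2 + q 0 1 ^+ 2))^-1 *: vec3 (q 0 0) (q 0 1) 1.

(* The central projection [(x, y) |-> (x, y, 1) / D], with
   [D = sqrt (1 + x^2 + y^2)], maps the plane onto the open northern hemisphere
   of the unit sphere.  The push-forward of a field [X = (P, Q)] of degree [d],
   multiplied by [D^(1-d)], is the tangential part [W - <W, z> z] of
   [W = (P*, Q*, 0)], where [P*, Q*] are the degree-[d] homogenizations.  This
   expression extends it to the equator, which represents the points at
   infinity. *)
Definition poincare_field (X : poly_field) (z : 'rV[R]_3) : 'rV[R]_3 :=
  let d := field_degree X in
  let P := homogenize d X.1 (z 0 0) (z 0 1) (z 0 2) in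
  let Q := homogenize d X.2 (z 0 0) (z 0 1) (z 0 2) in
  let s := P * z 0 0 + Q * z 0 1 in
  vec3 (P - s * z 0 0) (Q - s * z 0 1) (- s * z 0 2).

(* The disc is kept as the closed northern hemisphere; the usual picture is its
   image under the homeomorphism [(z0, z1, z2) |-> (z0, z1)]. *)
Definition poincare_disc : set 'rV[R]_3 :=
  [set z | z 0 0 ^+ 2 + z 0 1 ^+ 2 + z 0 2 ^+ 2 = 1 /\ 0 <= z 0 2].

Definition points_at_infinity : set 'rV[R]_3 :=
  poincare_disc `&` [set z | z 0 2 = 0].

Definition equilibrium_at_infinity (X : poly_field) (z : 'rV[R]_3) : Prop :=
  points_at_infinity z /\ poincare_field X z = 0.

Definition quadrant : set 'rV[R]_2 := [set w | 0 <= w 0 0 /\ 0 <= w 0 1].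

Definition saddle (w : 'rV[R]_2) : 'rV[R]_2 := vec2 (w 0 0) (- w 0 1).

(* Some neighbourhood [N] of [e] in the disc is a single hyperbolic sector: the
   oriented orbit arcs in [N] correspond, under a homeomorphism taking [e] to
   the origin, to those in a neighbourhood [S] of the corner of a quadrant
   bounded by two separatrices of a saddle. *)
Definition one_hyperbolic_sector (X : poly_field) (e : 'rV[R]_3) : Prop :=
  exists (N : set 'rV[R]_3) (S : set 'rV[R]_2)
         (h : 'rV[R]_3 -> 'rV[R]_2) (k : 'rV[R]_2 -> 'rV[R]_3),
    [/\ N `<=` poincare_disc /\ within poincare_disc (nbhs e) N,
        S `<=` quadrant /\ within quadrant (nbhs (0 : 'rV[R]_2)) S,
        [/\ {within N, continuous h}, {within S, continuous k},
            forall z, N z -> S (h z) /\ k (h z) = z &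
            forall w, S w -> N (k w) /\ h (k w) = w],
        h e = 0 &
        forall z z', N z -> N z' ->
          reach (poincare_field X) N z z' <-> reach saddle S (h z) (h z')].

End PolynomialFields.
Arguments poly_field : clear implicits.

Lemma homogenizeE (R : realType) d (P : {poly {poly R}}) (x y z : R) :
  (total_degree P <= d)%N -> z != 0 ->
  homogenize d P x y z = z ^+ d * P.[(y / z)%:P].[x / z].
Proof.
move=> hd z0; rewrite /homogenize (horner_coef P) horner_sum mulr_sumr.
apply: eq_bigr => j _; rewrite -polyC_exp hornerM hornerC.
rewrite horner_coef mulr_suml mulr_sumr; apply: eq_bigr => i _.
have hij : (i + j <= d)%N.
  apply: leq_trans hd; rewrite /total_degree.
  have Pj : P`_j != 0 by rewrite -size_poly_gt0; exact: leq_ltn_trans (leq0n i) (ltn_ord i).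
  apply: (@leq_trans (j + (size (P`_j)%R).-1)); last first.
    by rewrite (bigD1 j) //= leq_maxl.
  by rewrite addnC leq_add2l -ltnS prednK // size_poly_gt0.
rewrite -{2}(subnK hij) !exprD !expr_div_n.
field; rewrite ?expf_neq0 //.
Qed.

Lemma is_derive_mx (R : realType) m n (c : R -> 'M[R]_(m,n)) t v :
  is_derive t (1:R) c v <-> forall i j, is_derive t (1:R) (fun u => c u i j) (v i j).
Proof.
split.
- move=> [dc <-] i j; have h := (derivable_mxP _ _ _).1 dc i j.
  apply: DeriveDef => //. by rewrite derive_mx // mxE.
- move=> h. have dc : derivable c t 1 by apply/derivable_mxP => i j; exact: ex_derive.
  apply: DeriveDef => //; rewrite derive_mx //; apply/matrixP => i j; rewrite mxE.
  exact: derive_val.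
Qed.

Lemma is_derive_inv_sqrt (R : realType) (u v : R -> R) (t P Q : R) :
  is_derive t (1:R) u P -> is_derive t (1:R) v Q ->
  let D := fun t => Num.sqrt (1 + u t ^+ 2 + v t ^+ 2) in
  is_derive t (1:R) (fun t => (D t)^-1) (- (D t) ^- 3 * (u t * P + v t * Q)).
Proof.
move=> hu hv D.
have pos : 0 < 1 + u t ^+ 2 + v t ^+ 2 :> R.
  by rewrite -addrA ltr_pwDl // addr_ge0 // sqr_ge0.
have Dn : D t != 0 by rewrite gt_eqF // sqrtr_gt0.
have h2 : is_derive t (1:R) (cst 1 + u ^+ 2 + v ^+ 2) (0 + (2%:R * u t ^+ 1) *: P + (2%:R * v t ^+1) *: Q).
  exact: is_deriveD.
have h3 := @is_derive1_comp R Num.sqrt (cst 1 + u ^+ 2 + v ^+ 2) t _ _ (is_derive1_sqrt pos) h2.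
have h4 := @is_deriveV R D t _ 1 Dn h3.
have -> : - (D t) ^- 3 * (u t * P + v t * Q) = - D t ^- 2 *: ((2 * D t)^-1 * (0 + (2 * u t ^+ 1) *: P + (2 * v t ^+ 1) *: Q)).
  rewrite /GRing.scale /= add0r !expr1.
  move: (D t) Dn => e en; field; exact: en.
exact: h4.
Qed.

(* Up to the positive time rescaling factor [D^(d-1)], the central projection
   maps solutions of [X] to solutions of [poincare_field X]. *)
Lemma central_projection_flow (R : realType) (X : poly_field R) (c : R -> 'rV[R]_2) (t : R) :
  (0 < field_degree X)%N ->
  is_derive t (1 : R) c (field_eval X (c t)) ->
  is_derive t (1 : R) (fun u => central_projection (c u))
    (Num.sqrt (1 + c t 0 0 ^+ 2 + c t 0 1 ^+ 2) ^+ (field_degree X).-1 *: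
       poincare_field X (central_projection (c t))).
Proof.
move=> hd /is_derive_mx hc.
have hx := hc 0 0. have hy := hc 0 1.
rewrite /field_eval /vec2 !mxE /= in hx hy.
set P := X.1.[_].[_] in hx. set Q := X.2.[_].[_] in hy.
set D := Num.sqrt _.
set x := c t 0 0; set y := c t 0 1.
have DD : D ^+ 2 = 1 + x ^+ 2 + y ^+ 2 by rewrite sqr_sqrtr // -addrA addr_ge0 // addr_ge0 // sqr_ge0.
have pos u v : 0 < 1 + u ^+ 2 + v ^+ 2 :> R by rewrite -addrA ltr_pwDl // addr_ge0 // sqr_ge0.
have D0 : 0 < D by rewrite sqrtr_gt0.
have Dn : D != 0 by rewrite gt_eqF.
have hD : is_derive t (1:R) (fun u => (Num.sqrt (1 + c u 0 0 ^+ 2 + c u 0 1 ^+ 2))^-1)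
   (- D ^- 3 * (x * P + y * Q)).
  exact: is_derive_inv_sqrt hx hy.
have hz : central_projection (c t) = vec3 (x / D) (y / D) D^-1.
  apply/rowP => j; rewrite !mxE -/D; case: j => [[|[|[|//]]]] ? /=; rewrite ?mulr1 // mulrC //.
have e k : X.1 = k \/ X.2 = k -> homogenize (field_degree X) k (x/D) (y/D) D^-1 = D ^- (field_degree X) * k.[y%:P].[x].
  move=> hk. rewrite homogenizeE ?invr_eq0 //; last first.
    by rewrite /field_degree leq_max; case: hk => ->; rewrite leqnn ?orbT.
  by rewrite invrK !divfK // exprVn.
have eD : D ^- (field_degree X) = D ^- (field_degree X).-1 / D.
  by rewrite -{1}(prednK hd) exprSr invfM mulrC.
have Dn' : D ^+ (field_degree X).-1 != 0 by rewrite expf_neq0.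
apply/is_derive_mx => i j; rewrite ord1 hz /poincare_field !mxE /= .
rewrite !e; try by [left|right]. 
rewrite -/x -/y -/P -/Q eD.
case: j => [[|[|[|//]]]] ? /=.


- have h := is_deriveM hD hx.
  rewrite (_ : (fun u => _) = ((fun u => (Num.sqrt (1 + c u 0 0 ^+ 2 + c u 0 1 ^+ 2))^-1) * (fun u => c u 0 0))); last by apply/funext => u; rewrite /central_projection /vec3 !mxE /=.
  apply: (is_derive_eq h). rewrite /GRing.scale /= -/x -/y -/D.
  by clearbody D x y P Q; clear -Dn' Dn; move: (D ^+ (_).-1) Dn' => Dk Dk0; field; rewrite Dk0 Dn.
- have h := is_deriveM hD hy.
  rewrite (_ : (fun u => _) = ((fun u => (Num.sqrt (1 + c u 0 0 ^+ 2 + c u 0 1 ^+ 2))^-1) * (fun u => c u 0 1))); last by apply/funext => u; rewrite /central_projection /vec3 !mxE /=.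
  apply: (is_derive_eq h). rewrite /GRing.scale /= -/x -/y -/D.
  by clearbody D x y P Q; clear -Dn' Dn; move: (D ^+ (_).-1) Dn' => Dk Dk0; field; rewrite Dk0 Dn.
- rewrite (_ : (fun u => _) = ((fun u => (Num.sqrt (1 + c u 0 0 ^+ 2 + c u 0 1 ^+ 2))^-1) )); last by apply/funext => u; rewrite /central_projection /vec3 !mxE /= mulr1.
  apply: (is_derive_eq hD). rewrite -/x -/y -/D.
  by clearbody D x y P Q; clear -Dn' Dn; move: (D ^+ (_).-1) Dn' => Dk Dk0; field; rewrite Dk0 Dn.
Qed.

Section Lienard.
Context {R : realType}.

Definition poly_between (lo hi : nat) (a : nat -> R) : {poly R} :=
  \sum_(lo <= i < hi.+1) a i *: 'X^i.

(* [x' = y], [y' = - g(x) - f(x) y]; here ['X] is the variable [y]. *)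
Definition lienard (f g : {poly R}) : poly_field R :=
  ('X, - g%:P - f%:P * 'X).

(* The oriented integral of [u] from [0] to [x]. *)
Definition integral_from0 (u : R -> R) (x : R) : R :=
  if 0 <= x then \int[@lebesgue_measure R]_(t in `[0, x]) u t
  else - \int[@lebesgue_measure R]_(t in `[x, 0]) u t.

End Lienard.

(* Main.v *)
(* Let [F] and [G] be the primitives of [f] and [g].  Condition (iii) is equivalent to
     (n + 1) y^2 + x f(x) y + x g(x) >= eta x^(2n+2),  eta > 0,  |x| large,
   which makes [y / x^(n+1)] strictly decreasing, so that every orbit crosses all four
   half axes; without it a curve [y = - F(x) / 2 - K f(x)], up to reflections, bounds a
   region from which orbits do not return.

   The two halves of an orbit over [x < 0] and [x > 0] are compared through [y + F(x)],
   whose derivative along orbits is [- g(x)], at points with equal [G].  Under (iv) they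
   match and all orbits close.  If (iv) fails, let [sigma] be the involution with
   [G (sigma x) = G x]; the function [F - F o sigma] satisfies a nontrivial polynomial
   equation over [R[x]], so it vanishes or has constant sign next to [0], and also past
   any point up to which it vanishes identically.  A constant sign makes orbits spiral.

   Near the endpoints of the vertical axis, the inverse [rho] of the abscissa of the right
   tip of a cycle is constant along orbits, and a perturbation [theta] of [x / y] is
   strictly increasing: they play the roles of [w0 * w1] and [w0 - w1] for the saddle. *)

Require Import Defs.
From HB Require Import structures.
From mathcomp Require Import all_boot all_order all_algebra.
From mathcomp Require Import all_classical all_reals all_analysis.
From mathcomp Require Import ring lra zify.
From mathcomp.real_closed Require Import complex.

Set Implicit Arguments.
Unset Strict Implicit.
Unset Printing Implicit Defensive.

Import Order.TTheory GRing.Theory Num.Theory.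
Import numFieldNormedType.Exports.

Local Open Scope classical_set_scope.
Local Open Scope ring_scope.

(** * Calculus of one real variable *)

(** Three obstacles shape the proof. Polynomial fields are not complete, while a periodic orbit must
    be defined for all time. Solutions are therefore taken from a truncated, globally Lipschitz
    field, and bounds valid during one quarter of a turn show that the truncation is not felt; a
    closed arc then extends by periodicity. Next, the two points where a sign of [F - F o sigma]
    must be excluded differ in nature. At [0] the difference may well have finite order, and only
    the dynamics, namely spiralling, rules out a sign. At a later point [s > 0] the difference
    vanishes on the left and is smooth, hence flat, whereas its algebraic equation has a coefficient
    of finite order at [s]: this contradiction is purely algebraic and stands in for analytic
    continuation. Finally, at the ends of the vertical axis the linear part of the compactified
    field vanishes, so linearization says nothing about the sector. It is recognized from two
    coordinates on a compact neighbourhood, one constant and one increasing along orbits;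
    compactness makes the resulting bijection a homeomorphism, and reachability is compared through
    these coordinates alone. *)

Ltac shares_variable H :=
  match goal with v : ?S |- ?G =>
    lazymatch S with realType => fail | forall _, _ => fail | _ => idtac end;
    lazymatch type of S with Prop => fail | _ => idtac end;
    match G with context [v] => idtac end;
    let T := type of H in match T with context [v] => idtac end
  end.

Ltac clear_unshared := repeat match goal with H : ?T |- _ =>
  lazymatch type of T with Prop => idtac end;
  lazymatch T with forall _, _ => idtac | _ => tryif shares_variable H then fail else idtac end;
  clear H
end.

(* [lra] reifies every hypothesis in the context, hence the restriction to those
   with a variable in common with the goal. *)
Ltac linarith := first [ solve [ clear_unshared; lra ] | lra ].

Section Calculus.
Context {R : realType}.
Implicit Types (u v : R -> R) (a b c l s t : R).

Lemma der_eq u t a b : is_derive t (1 : R) u a -> a = b ->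
  is_derive t (1 : R) u b.
Proof. by move=> h <-. Qed.

Lemma derC t c : is_derive t (1 : R) (fun=> c) 0.
Proof. exact: is_derive_cst. Qed.

Lemma derI t : is_derive t (1 : R) (fun s => s) 1.
Proof. exact: is_derive_id. Qed.

Lemma derD u v t a b : is_derive t (1 : R) u a -> is_derive t (1 : R) v b ->
  is_derive t (1 : R) (fun s => u s + v s) (a + b).
Proof. exact: is_deriveD. Qed.

Lemma derN u t a : is_derive t (1 : R) u a ->
  is_derive t (1 : R) (fun s => - u s) (- a).
Proof. exact: is_deriveN. Qed.

Lemma derM u v t a b : is_derive t (1 : R) u a -> is_derive t (1 : R) v b ->
  is_derive t (1 : R) (fun s => u s * v s) (a * v t + u t * b).
Proof.
move=> hu hv; apply: (der_eq (is_deriveM hu hv)).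
by rewrite /GRing.scale /= addrC mulrC.
Qed.

Lemma derX n u t a : is_derive t (1 : R) u a ->
  is_derive t (1 : R) (fun s => u s ^+ n) (n%:R * u t ^+ n.-1 * a).
Proof.
move=> hu; elim: n => [|n IHn].
  by rewrite !mul0r; apply: (der_eq (derC t 1)).
rewrite (_ : (fun s => _) = fun s => u s ^+ n * u s).
  by apply: (der_eq (derM IHn hu)); case: n {IHn} => [|n] /=;
    rewrite ?exprS -?natr1; ring.
by apply/funext => s; rewrite exprSr.
Qed.

Lemma derV u t a : u t != 0 -> is_derive t (1 : R) u a ->
  is_derive t (1 : R) (fun s => (u s)^-1) (- (u t) ^- 2 * a).
Proof. by move=> u0 hu; exact: is_deriveV. Qed.

Lemma der_comp u v t a b : is_derive t (1 : R) v b ->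
  is_derive (v t) (1 : R) u a -> is_derive t (1 : R) (fun s => u (v s)) (a * b).
Proof. by move=> hv hu; exact: is_derive1_comp. Qed.

Lemma der_poly (p : {poly R}) u t a : is_derive t (1 : R) u a ->
  is_derive t (1 : R) (fun s => p.[u s]) ((p^`()).[u t] * a).
Proof.
by move=> hu; apply: (der_comp (u := horner p) hu).
Qed.

Lemma der_sqrt u t a : 0 < u t -> is_derive t (1 : R) u a ->
  is_derive t (1 : R) (fun s => Num.sqrt (u s)) ((2 * Num.sqrt (u t))^-1 * a).
Proof. by move=> u0 hu; exact: (der_comp hu (is_derive1_sqrt u0)). Qed.

Lemma der_exp u t a : is_derive t (1 : R) u a ->
  is_derive t (1 : R) (fun s => expR (u s)) (expR (u t) * a).
Proof. by move=> hu; exact: (der_comp hu (is_derive_expR _)). Qed.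

Lemma der_ln u t a : 0 < u t -> is_derive t (1 : R) u a ->
  is_derive t (1 : R) (fun s => ln (u s)) ((u t)^-1 * a).
Proof. by move=> u0 hu; exact: (der_comp hu (is_derive1_ln u0)). Qed.

Ltac der_step := first
 [ eassumption
 | notypeclasses refine (derC _ _)
 | notypeclasses refine (derI _)
 | notypeclasses refine (derN _)
 | notypeclasses refine (derD _ _)
 | notypeclasses refine (derM _ _)
 | notypeclasses refine (derX _ _)
 | notypeclasses refine (der_poly _ _)
 | notypeclasses refine (der_exp _) ].
Ltac der := notypeclasses refine (der_eq _ _); [repeat der_step | cbn beta].

Lemma der_unique u t a b : is_derive t (1 : R) u a ->
  is_derive t (1 : R) u b -> a = b.
Proof. by move=> [_ <-] [_ <-]. Qed.

Lemma der_shift u c t a : is_derive (t + c) (1 : R) u a ->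
  is_derive t (1 : R) (fun s => u (s + c)) a.
Proof.
move=> h; apply: (der_eq (der_comp (derD (derI t) (derC t c)) h)).
by rewrite addr0 mulr1.
Qed.

Lemma der_rev u c t a : is_derive (c - t) (1 : R) u a ->
  is_derive t (1 : R) (fun s => u (c - s)) (- a).
Proof.
move=> h; apply: (der_eq (der_comp (derD (derC t c) (derN (derI t))) h)).
by rewrite add0r mulrN1.
Qed.

Lemma der_cont u t a : is_derive t (1 : R) u a -> {for t, continuous u}.
Proof.
by move=> [h _]; apply/differentiable_continuous; rewrite -derivable1_diffP.
Qed.

Lemma cont_within a b u : (forall t, a <= t <= b -> {for t, continuous u}) ->
  {within `[a, b], continuous u}.
Proof.
move=> h; apply: continuous_in_subspaceT => t.
by rewrite inE /= in_itv /= => tab; apply: h.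
Qed.

Lemma der_within a b u du :
  (forall t, a <= t <= b -> is_derive t (1 : R) u (du t)) ->
  {within `[a, b], continuous u}.
Proof. by move=> h; apply: cont_within => t /h /der_cont. Qed.

Lemma mean_value a b u du : a < b ->
  (forall t, a < t < b -> is_derive t (1 : R) u (du t)) ->
  {within `[a, b], continuous u} ->
  exists2 c, a < c < b & u b - u a = du c * (b - a).
Proof.
move=> ab hd hc.
have [c cab e] := @MVT R u du a b ab (fun t tab => hd t tab) hc.
by exists c.
Qed.

Lemma nondecr a b u du : a <= b ->
  (forall t, a <= t <= b -> is_derive t (1 : R) u (du t)) ->
  (forall t, a < t < b -> 0 <= du t) -> u a <= u b.
Proof.
rewrite le_eqVlt => /predU1P[->//|ab] hd h0.
have hd' t : a < t < b -> is_derive t (1 : R) u (du t).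
  by move=> /andP[t1 t2]; apply: hd; rewrite !ltW.
have [c cab e] := mean_value ab hd' (der_within hd).
by rewrite -subr_ge0 e mulr_ge0 ?h0// subr_ge0 ltW.
Qed.

Lemma incr a b u du : a < b ->
  (forall t, a <= t <= b -> is_derive t (1 : R) u (du t)) ->
  (forall t, a < t < b -> 0 < du t) -> u a < u b.
Proof.
move=> ab hd h0.
have hd' t : a < t < b -> is_derive t (1 : R) u (du t).
  by move=> /andP[t1 t2]; apply: hd; rewrite !ltW.
have [c cab e] := mean_value ab hd' (der_within hd).
by rewrite -subr_gt0 e mulr_gt0 ?h0// subr_gt0.
Qed.

Lemma der_bound a b u v du dv : a <= b ->
  (forall t, a <= t <= b -> is_derive t (1 : R) u (du t)) ->
  (forall t, a <= t <= b -> is_derive t (1 : R) v (dv t)) ->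
  (forall t, a < t < b -> `|du t| <= dv t) -> `|u b - u a| <= v b - v a.
Proof.
move=> ab hu hv h; rewrite ler_norml; apply/andP; split.
- have : v a + u a <= v b + u b.
    apply: (@nondecr a b (fun t => v t + u t) (fun t => dv t + du t) ab).
      by move=> t /[dup] /hu ? /hv ?; apply: derD.
    by move=> t /h; rewrite ler_norml => /andP[] *; linarith.
  by move=> *; linarith.
- have : v a - u a <= v b - u b.
    apply: (@nondecr a b (fun t => v t - u t) (fun t => dv t - du t) ab).
      by move=> t /[dup] /hu ? /hv ?; apply: derD => //; apply: derN.
    by move=> t /h; rewrite ler_norml => /andP[] *; linarith.
  by move=> *; linarith.
Qed.

Lemma ivt_c u a b l : a <= b -> {within `[a, b], continuous u} ->
  u a <= l <= u b -> exists2 c, a <= c <= b & u c = l.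
Proof.
move=> ab uc /andP[h1 h2].
have [|c] := @IVT R u a b l ab uc; last by rewrite in_itv; exists c.
by rewrite ge_min le_max h1 h2 orbT.
Qed.

Lemma ivt_d u a b l : a <= b -> {within `[a, b], continuous u} ->
  u b <= l <= u a -> exists2 c, a <= c <= b & u c = l.
Proof.
move=> ab uc /andP[h1 h2].
have [|c] := @IVT R u a b l ab uc; last by rewrite in_itv; exists c.
by rewrite ge_min le_max h1 h2 orbT.
Qed.

(** The infimum of the times where [u >= l]. Arguments of the form: as long as the solution stays in
    a region, are all reduced to the interval before this time. *)
Lemma first_hit u a b l : a <= b -> {within `[a, b], continuous u} ->
  u a < l -> l <= u b ->
  exists2 c, a < c <= b & u c = l /\ forall t, a <= t < c -> u t < l.
Proof.
move=> ab uc ual lub.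
pose E := [set t | a <= t <= b /\ l <= u t].
have Eb : E b by split => //; rewrite ab lexx.
have hE : has_inf E by split; [exists b | exists a => t [/andP[]]].
set c := inf E.
have ac : a <= c by apply: lb_le_inf; [exists b | move=> t [/andP[]]].
have cb : c <= b by apply: ge_inf => //; case: hE.
have before t : a <= t < c -> u t < l.
  move=> /andP[at_ tc]; rewrite ltNge; apply/negP => lt_.
  suff : c <= t by rewrite leNgt tc.
  by apply: ge_inf; [case: hE | split => //; rewrite at_ ltW // (lt_le_trans tc)].
have after : l <= u c.
  rewrite leNgt; apply/negP => ucv.
  have cab : `[a, b]%classic c by rewrite /= in_itv /= ac cb.
  have cc := (subspace_continuousP _ _).1 uc c cab.
  have := cc [set z | z < l]; rewrite /= => /(_ _)[].
    by apply: open_nbhs_nbhs; split => //; exact: open_lt.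
  move=> e /= e0 he.
  have [t Et tce] := inf_adherent e0 hE.
  case: Et => tab lt_.
  have ct : c <= t by apply: ge_inf => //; case: hE.
  have : u t < l.
    apply: (he t); last by rewrite /= in_itv /=.
    by rewrite /ball /= ler0_norm ?subr_le0 // opprB ltrBlDr addrC.
  by rewrite ltNge lt_.
have acs : a < c.
  rewrite lt_neqAle ac andbT; apply/eqP => e.
  by move: after; rewrite -e leNgt ual.
exists c; first by rewrite acs cb.
split => //; apply/eqP; rewrite eq_le after andbT leNgt; apply/negP => uc'.
have uc2 : {within `[a, c], continuous u}.
  apply: continuous_subspaceW uc => z; rewrite /= !in_itv /= => /andP[-> /=] h.
  exact: le_trans cb.
have [|d /andP[ad dc] ud] := ivt_c (l := l) ac uc2; first by rewrite !ltW.
have dc' : d < c.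
  by rewrite lt_neqAle dc andbT; apply/eqP => e; move: uc'; rewrite -e ud ltxx.
by have := before d; rewrite ad dc' ud ltxx => /(_ isT).
Qed.

(* On the last interval before [b] where [u < 0] the inequality [k t <= K]
   gives [(u e^{-Kt})' >= 0]. *)
Lemma gronwall_pos a b (K : R) u du k : a <= b ->
  {within `[a, b], continuous u} ->
  (forall t, a < t < b -> is_derive t (1 : R) u (du t)) ->
  (forall t, a < t < b -> k t <= K) ->
  (forall t, a < t < b -> k t * u t <= du t) -> 0 <= u a -> 0 <= u b.
Proof.
move=> ab uc hd hk h0 ua; rewrite leNgt; apply/negP => ub.
(* Reversing time turns the last zero of [u] before [b] into a first hit of level [0]. *)
pose w t := - u (- t).
have wc : {within `[- b, - a], continuous w}.
  apply/subspace_continuousP => t; rewrite /= in_itv /= => tab.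
  apply: cvgN.
  have tab' : `[a, b]%classic (- t) by rewrite /= in_itv /=; linarith.
  have hc := (subspace_continuousP _ _).1 uc _ tab'.
  apply: (@cvg_comp _ _ _ (fun t => - t) u _ _ _ _ hc) => A /=.
  rewrite /within /nbhs /= => -[e /= e0 he]; exists e => //= z ze zab.
  apply: he => /=; last by rewrite in_itv /=; move: zab; rewrite in_itv /=; linarith.
  by move: ze; rewrite /ball /= -opprD normrN.
have bla : - b <= - a by linarith.
have ub' : 0 < - u b by linarith.
have wN : {within `[- b, - a], continuous (fun t => - w t)}.
  by move=> t; apply: continuousN; apply: wc.
have [||c /andP[bc ca] [wc0 wneg]] := first_hit (l := 0) bla wN.
- by rewrite /w !opprK.
- by rewrite /w !opprK.
have uc0 : u (- c) = 0 by move: wc0; rewrite /w opprK.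
have ung t : - c < t <= b -> u t < 0.
  by move=> ?; have := wneg (- t); rewrite /w !opprK; apply; linarith.
pose z t := u t * expR (- K * t).
have cb : - c < b by linarith.
have zc : {within `[- c, b], continuous z}.
  have uc3 : {within `[- c, b], continuous u}.
    by apply: (continuous_subspaceW _ uc) => t; rewrite /= !in_itv /=; linarith.
  have ec : {within `[- c, b], continuous (fun t => expR (- K * t))}.
    apply: continuous_subspaceT => t.
    by apply: (der_cont (a := expR (- K * t) * (0 * t + - K * 1)));
      repeat der_step.
  move=> t; apply: (@continuousM R (subspace `[- c, b]) u (fun t => expR (- K * t))).
    exact: uc3.
  exact: ec.
have hz t : - c < t < b ->
   is_derive t (1 : R) z (du t * expR (- K * t) + u t * (expR (- K * t) * (0 * t + - K * 1))).
  move=> tcb; apply: derM; first by apply: hd; linarith.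
  by repeat der_step.
have [d dcb] := mean_value cb hz zc.
rewrite [z (- c)]/z uc0 mul0r subr0.
set e := expR _ => dz.
have e0 : 0 < e by exact: expR_gt0.
have zb : z b < 0 by rewrite /z nmulr_rlt0 // expR_gt0.
have dab : a < d < b by linarith.
have := h0 d dab; have := hk d dab; have := ung d _.
set D := du d in dz *; set U := u d in dz *; set k' := k d => h1 h2 h3.
have {}h1 : U < 0 by apply: h1; linarith.
suff : 0 <= z b by linarith.
rewrite [z b]dz [X in X * _](_ : _ = (D - K * U) * e); last by ring.
apply: mulr_ge0; last by linarith.
by apply: mulr_ge0; [nra | linarith].
Qed.

End Calculus.


Ltac der_step := first
 [ eassumption
 | notypeclasses refine (derC _ _)
 | notypeclasses refine (derI _)
 | notypeclasses refine (derN _)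
 | notypeclasses refine (derD _ _)
 | notypeclasses refine (derM _ _)
 | notypeclasses refine (derX _ _)
 | notypeclasses refine (der_poly _ _)
 | notypeclasses refine (der_exp _) ].
Ltac der := notypeclasses refine (der_eq _ _); [repeat der_step | cbn beta].

Section Tools.
Context {R : realType}.
Implicit Types (u v : R -> R) (a b c l s t : R) (p q : {poly R}).

Lemma gronwall_pos_c a b (K : R) u du k : a <= b ->
  (forall t, a <= t <= b -> is_derive t (1 : R) u (du t)) ->
  (forall t, a <= t <= b -> k t <= K) ->
  (forall t, a <= t <= b -> k t * u t <= du t) -> 0 <= u a -> 0 <= u b.
Proof.
move=> ab hd hk h0; apply: (gronwall_pos (K := K) (du := du) (k := k) ab).
- exact: der_within hd.
- by move=> t tab; apply: hd; linarith.
- by move=> t tab; apply: hk; linarith.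
- by move=> t tab; apply: h0; linarith.
Qed.

Lemma gronwall_exp a b (K : R) u du : a <= b ->
  (forall t, a <= t <= b -> is_derive t (1 : R) u (du t)) ->
  (forall t, a <= t <= b -> du t <= K * u t) ->
  u b <= u a * expR (K * (b - a)).
Proof.
move=> ab hd h0; rewrite -subr_ge0.
pose w t := u a * expR (K * (t - a)) - u t.
have wE : w b = u a * expR (K * (b - a)) - u b by [].
rewrite -wE; apply: (@gronwall_pos_c a b K w
  (fun t => u a * (expR (K * (t - a)) * K) - du t) (fun=> K) ab).
- by move=> t /hd hu; der; ring.
- by [].
- by move=> t /h0; rewrite /w; linarith.
- by rewrite /w subrr mulr0 expR0; linarith.
Qed.

(** The factor [k] is merely bounded, possibly discontinuous, so [u] is compared with the
    exponential of the worst rate instead of being divided by an integrating factor. *)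
Lemma linear_pos a b (K : R) u k : a <= b ->
  (forall t, a <= t <= b -> is_derive t (1 : R) u (k t * u t)) ->
  (forall t, a <= t <= b -> `|k t| <= K) -> 0 < u a -> 0 < u b.
Proof.
move=> ab hd hk ua; pose w t := u t - u a * expR (- K * (t - a)).
have K0 : 0 <= K by apply: le_trans (hk a _); rewrite ?lexx.
have ub0 t : a <= t <= b -> 0 <= u t.
  move=> tab; apply: (@gronwall_pos_c a t K u (fun t => k t * u t) k);
    last exact: ltW; first by linarith.
  - by move=> s sat; apply: hd; linarith.
  - by move=> s sat; apply: le_trans (ler_norm _) (hk _ _); linarith.
  - by [].
have : 0 <= w b.
  apply: (@gronwall_pos_c a b K w
    (fun t => k t * u t + u a * (expR (- K * (t - a)) * K)) (fun t => - K) ab).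
  - by move=> t /hd hu; der; ring.
  - by move=> *; linarith.
  - move=> t tab; rewrite /w.
    have := ub0 t tab; have := hk t tab; rewrite ler_norml => /andP[h _].
    by move: (u t) (k t) (expR _) h => U k' e *; nra.
  - by rewrite /w subrr mulr0 expR0; linarith.
by rewrite /w subr_ge0; apply: lt_le_trans; rewrite mulr_gt0 ?expR_gt0.
Qed.

Lemma linear_zero a b (K : R) u k : a <= b ->
  (forall t, a <= t <= b -> is_derive t (1 : R) u (k t * u t)) ->
  (forall t, a <= t <= b -> `|k t| <= K) -> u a = 0 -> u b = 0.
Proof.
move=> ab hd hk ua; apply/eqP; rewrite eq_le; apply/andP; split.
- rewrite -oppr_ge0; apply: (@gronwall_pos_c a b K (fun t => - u t)
    (fun t => - (k t * u t)) k ab).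
  - by move=> t /hd hu; der.
  - by move=> t /hk; apply: le_trans; exact: ler_norm.
  - by move=> t _; rewrite mulrN.
  - by rewrite ua oppr0.
- apply: (@gronwall_pos_c a b K u (fun t => (k t * u t)) k ab) => //.
  - by move=> t /hk; apply: le_trans; exact: ler_norm.
  - by rewrite ua.
Qed.

Lemma der0_const u t : (forall s, is_derive s (1 : R) u 0) -> u t = u 0.
Proof. by move=> h; exact: is_derive_0_is_cst. Qed.

Lemma der_integral u t : continuous u ->
  is_derive t (1 : R) (integral_from0 u) (u t).
Proof.
move=> uc; set mu := @lebesgue_measure R.
(* The base point lies to the left of both [0] and [t], so that near [t] the two branches of
   [integral_from0] are differences of values of one integral with variable upper end. *)
pose a := Num.min 0 t - 1; pose I x := \int[mu]_(s in `[a, x]) u s.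
have m0 : Num.min 0 t <= 0 :> R by rewrite ge_min lexx.
have mt : Num.min 0 t <= t by rewrite ge_min lexx orbT.
have a0 : a < 0 by move: m0; rewrite /a; move: (Num.min 0 t) => M; linarith.
have at_ : a < t by move: mt; rewrite /a; move: (Num.min 0 t) => M; linarith.
have int c d : mu.-integrable `[c, d] (EFin \o u).
  apply: continuous_compact_integrable; first exact: segment_compact.
  exact: continuous_subspaceT.
have IB c d : a < c -> c <= d -> \int[mu]_(s in `[c, d]) u s = I d - I c.
  move=> ac cd; rewrite /I Rintegral_itvB ?bnd_simp //; last exact: ltW.
  rewrite Rintegral_itv_obnd_cbnd //.
  by apply: integrableS (int c d) => //; apply: subset_itvr; rewrite bnd_simp.
have IE z : a < z -> integral_from0 u z = I z - I 0.
  move=> az; rewrite /integral_from0; case: ifPn => [z0|]; first exact: IB.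
  by rewrite -ltNge => z0; rewrite IB // ?opprB // ltW.
have [dI dIt] : derivable I t 1 /\ derive1 I t = u t.
  by apply: (@continuous_FTC1_closed R u a t (t + 1)) => //; [linarith | exact: uc].
have hI : is_derive t (1 : R) I (u t) by rewrite -dIt derive1E; exact: derivableP.
have hd : is_derive t (1 : R) (fun z => I z - I 0) (u t) by der; ring.
apply: near_eq_is_derive hd.
near=> z; rewrite IE // .
near: z; exact: (@open_nbhs_nbhs _ t _ (conj (@open_gt R a) at_)).
Unshelve. all: by end_near. Qed.

Definition prim p : {poly R} := \sum_(i < size p) (p`_i / i.+1%:R) *: 'X^(i.+1).

Lemma deriv_prim p : (prim p)^`() = p.
Proof.
rewrite /prim raddf_sum /= [RHS](_ : p = \sum_(i < size p) p`_i *: 'X^i).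
  apply: eq_bigr => i _; rewrite derivZ derivXn /= -scalerMnr scalerMnl -mulr_natr.
  by rewrite divfK // pnatr_eq0.
by rewrite -{1}[p]coefK poly_def.
Qed.

Lemma prim0 p : (prim p).[0] = 0.
Proof.
rewrite /prim horner_sum big1 // => i _.
by rewrite hornerZ hornerXn expr0n mulr0.
Qed.

Lemma der_prim p u t a : is_derive t (1 : R) u a ->
  is_derive t (1 : R) (fun s => (prim p).[u s]) (p.[u t] * a).
Proof. by move=> hu; der; rewrite deriv_prim. Qed.

Lemma integral_from0_poly p t : integral_from0 (horner p) t = (prim p).[t].
Proof.
pose w t := integral_from0 (horner p) t - (prim p).[t].
have w0 s : is_derive s (1 : R) w 0.
  have h1 := der_integral s (@continuous_horner R p).
  have h2 := der_prim p (derI s).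
  by der; rewrite mulr1 subrr.
have := der0_const t w0; rewrite /w prim0 subr0 /integral_from0 lexx.
by rewrite set_itv1 Rintegral_set1 => /eqP; rewrite subr_eq0 => /eqP.
Qed.

Lemma poly_bound p (B : R) : exists2 K : R, 0 < K & forall t, `|t| <= B -> `|p.[t]| <= K.
Proof.
exists (\sum_(i < size p) `|p`_i| * `|B| ^+ i + 1) => [|t tB].
  by apply: ltr_wpDl => //; apply: sumr_ge0 => i _; rewrite mulr_ge0 // exprn_ge0.
apply: (@le_trans _ _ (\sum_(i < size p) `|p`_i| * `|B| ^+ i)); last by linarith.
rewrite horner_coef; apply: le_trans (ler_norm_sum _ _ _) _.
apply: ler_sum => i _; rewrite normrM normrX ler_wpM2l //.
by apply: lerXn2r; rewrite ?nnegrE //; apply: le_trans tB (ler_norm _).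
Qed.

Lemma poly_lip p (B : R) : exists2 K : R, 0 < K &
  forall s t, `|s| <= B -> `|t| <= B -> `|p.[s] - p.[t]| <= K * `|s - t|.
Proof.
have [K K0 hK] := poly_bound p^`() B; exists K => // s t.
wlog ts : s t / t <= s.
  move=> H sB tB; case/orP: (le_total t s) => h; first exact: H.
  by rewrite distrC [`|s - t|]distrC H.
move=> sB tB; rewrite (ger0_norm (_ : 0 <= s - t)); last by linarith.
rewrite mulrBr.
apply: (@der_bound R t s (horner p) (fun t => K * t) (fun t => p^`().[t]) (fun=> K)) => //.
- by move=> z _; der; ring.
- move=> z ztx; apply: hK; move: sB tB; rewrite !ler_norml; linarith.
Qed.

(** The coefficient at [N] need not be the leading one; the barrier argument also applies this where
    it is zero. *)
Lemma poly_asym p N : (size p <= N.+1)%N -> exists2 C : R, 0 < C &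
  forall t, 1 <= `|t| -> `|p.[t] - p`_N * t ^+ N| <= C * `|t| ^+ N.-1.
Proof.
move=> sp; exists (\sum_(i < N) `|p`_i| + 1) => [|t t1].
  by apply: ltr_wpDl => //; apply: sumr_ge0.
rewrite (horner_coef_wide t sp) big_ord_recr /= addrK.
apply: le_trans (ler_norm_sum _ _ _) _.
apply: (@le_trans _ _ (\sum_(i < N) `|p`_i| * `|t| ^+ N.-1)).
  apply: ler_sum => i _; rewrite normrM normrX ler_wpM2l //.
  by apply: ler_weXn2l => //; case: N i {sp} => [[]//|N] i /=; rewrite -ltnS.
by rewrite -mulr_suml ler_wpM2r ?exprn_ge0 //; linarith.
Qed.

End Tools.

(** * Existence and uniqueness of solutions *)

Section GeometricLimits.
Context {R : realType}.

Lemma exp2_small (C e : R) : 0 < e -> exists k, C / 2 ^+ k < e.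
Proof.
move=> e0; have [k hk] : exists k : nat, C / e < k%:R.
  exists (Num.bound `|C / e|).
  exact: le_lt_trans (ler_norm _) (archi_boundP (normr_ge0 _)).
exists k; rewrite ltr_pdivrMr ?exprn_gt0 // mulrC -ltr_pdivrMr //.
apply: lt_trans hk _; rewrite -natrX ltr_nat; exact: ltn_expl.
Qed.

Lemma le_exp2 (a C : R) : (forall k, a <= C / 2 ^+ k) -> a <= 0.
Proof.
move=> h; rewrite leNgt; apply/negP => a0.
by have [k hk] := exp2_small C a0; have := h k; rewrite leNgt hk.
Qed.

(** The intervals of radius [2 C / 2^k] about [u k] are nested, and the limit is the supremum of
    their left ends. *)
Lemma geo_limit (u : nat -> R) (C : R) :
  (forall k, `|u k.+1 - u k| <= C / 2 ^+ k) ->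
  exists l, forall k, `|u k - l| <= 2 * C / 2 ^+ k.
Proof.
move=> hu; pose r k : R := 2 * C / 2 ^+ k.
have rS k : r k.+1 = r k / 2.
  by rewrite /r exprS invfM; ring.
have rE k : C / 2 ^+ k = r k / 2 by rewrite /r; field; rewrite expf_neq0.
have r0 k : 0 <= r k.
  have := hu k; rewrite rE => h.
  by have := le_trans (normr_ge0 _) h; linarith.
have stepa k : u k - r k <= u k.+1 - r k.+1.
  by have := hu k; rewrite rE rS ler_norml => /andP[]; linarith.
have stepb k : u k.+1 + r k.+1 <= u k + r k.
  by have := hu k; rewrite rE rS ler_norml => /andP[]; linarith.
have mona j k : u k - r k <= u (j + k)%N - r (j + k)%N.
  by elim: j => [|j IH] //; apply: le_trans IH (stepa _).
have monb j k : u (j + k)%N + r (j + k)%N <= u k + r k.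
  by elim: j => [|j IH] //; apply: le_trans (stepb _) IH.
have ab j k : u j - r j <= u k + r k.
  apply: le_trans (mona k j) _; rewrite addnC; apply: le_trans (monb j k).
  by have := r0 (j + k)%N; linarith.
pose E := [set u k - r k | k in [set: nat]].
have hE : has_sup E.
  split; first by exists (u 0%N - r 0%N); exists 0%N.
  by exists (u 0%N + r 0%N) => _ [k _ <-].
exists (sup E) => k.
have h1 : u k - r k <= sup E by apply: ub_le_sup; [case: hE | exists k].
have h2 : sup E <= u k + r k by apply: ge_sup; [case: hE | move=> _ [j _ <-]].
by rewrite -/(r k) ler_norml; apply/andP; split; linarith.
Qed.

End GeometricLimits.

Section Picard.
Context {R : realType}.
Variables (V1 V2 : R -> R -> R) (L : R).
Hypothesis L0 : 0 < L.
Hypothesis lip1 : forall x y x' y' : R,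
  `|V1 x y - V1 x' y'| <= L * (`|x - x'| + `|y - y'|).
Hypothesis lip2 : forall x y x' y' : R,
  `|V2 x y - V2 x' y'| <= L * (`|x - x'| + `|y - y'|).

Lemma lip_continuous (V : R -> R -> R) (u v : R -> R) :
  (forall x y x' y' : R, `|V x y - V x' y'| <= L * (`|x - x'| + `|y - y'|)) ->
  continuous u -> continuous v -> continuous (fun t => V (u t) (v t)).
Proof.
move=> lipV uc vc t; apply/cvgrPdist_lt => e e0.
have d0 : 0 < e / (2 * L) by rewrite divr_gt0 // mulr_gt0.
have /cvgrPdist_lt /(_ _ d0) hu := uc t.
have /cvgrPdist_lt /(_ _ d0) hv := vc t.
near=> s; apply: le_lt_trans (lipV _ _ _ _) _.
have h1 : `|u t - u s| < e / (2 * L) by near: s.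
have h2 : `|v t - v s| < e / (2 * L) by near: s.
have -> : e = L * (e / (2 * L) + e / (2 * L)) by field; rewrite gt_eqF.
by rewrite ltr_pM2l //; apply: ltrD.
Unshelve. all: by end_near. Qed.

Lemma integral_from0_at0 (u : R -> R) : integral_from0 u 0 = 0.
Proof. by rewrite /integral_from0 lexx set_itv1 Rintegral_set1. Qed.

(** In the norm weighted by [exp (K |t|)] integration contracts by [1 / K]. This gives Picard
    solutions on the whole line at once, without gluing short intervals. *)
Lemma integral_diff_bound (a b : R -> R) (M K : R) : 0 < K ->
  continuous a -> continuous b ->
  (forall s : R, `|a s - b s| <= M * expR (K * `|s|)) ->
  forall t : R, `|integral_from0 a t - integral_from0 b t| <= M / K * expR (K * `|t|).
Proof.
move=> K0 ac bc hab.
have M0 : 0 <= M.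
  by have := le_trans (normr_ge0 _) (hab 0); rewrite normr0 mulr0 expR0 mulr1.
have MK : 0 <= M / K by rewrite divr_ge0 // ltW.
have pos (I J a' b' : R -> R) (t : R) : 0 <= t -> I 0 = J 0 ->
    (forall s : R, is_derive s (1 : R) I (a' s)) ->
    (forall s : R, is_derive s (1 : R) J (b' s)) ->
    (forall s, `|a' s - b' s| <= M * expR (K * `|s|)) ->
    `|I t - J t| <= M / K * expR (K * `|t|).
  move=> t0 IJ dI dJ h.
  have d1 (s : R) : 0 <= s <= t -> is_derive s (1 : R) (fun s => I s - J s) (a' s - b' s).
    by move=> _; have h1 := dI s; have h2 := dJ s; der.
  have d2 (s : R) : 0 <= s <= t ->
      is_derive s (1 : R) (fun s => M / K * expR (K * s)) (M * expR (K * s)).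
    by move=> _; der; field; rewrite gt_eqF.
  have d3 (s : R) : 0 < s < t -> `|a' s - b' s| <= M * expR (K * s).
    by move=> /andP[s0 _]; have := h s; rewrite (gtr0_norm s0).
  have := der_bound t0 d1 d2 d3.
  rewrite IJ subrr subr0 mulr0 expR0 mulr1 (ger0_norm t0); linarith.
move=> t; case: (lerP 0 t) => t0.
  apply: (pos _ _ a b) => //; first by rewrite !integral_from0_at0.
    by move=> s; exact: der_integral.
  by move=> s; exact: der_integral.
have H : `|integral_from0 a (0 - - t) - integral_from0 b (0 - - t)| <=
    M / K * expR (K * `|- t|).
  apply: (pos (fun s => integral_from0 a (0 - s)) (fun s => integral_from0 b (0 - s))
    (fun s => - a (0 - s)) (fun s => - b (0 - s)) (- t)).
  - by linarith.
  - by rewrite subr0 !integral_from0_at0.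
  - by move=> s; apply: der_rev; exact: der_integral.
  - by move=> s; apply: der_rev; exact: der_integral.
  - by move=> s; rewrite -opprD normrN; have := hab (0 - s); rewrite sub0r normrN.
by move: H; rewrite sub0r opprK normrN.
Qed.

Variables x0 y0 : R.

Definition picard_step (c : (R -> R) * (R -> R)) : (R -> R) * (R -> R) :=
  (fun t => x0 + integral_from0 (fun s => V1 (c.1 s) (c.2 s)) t,
   fun t => y0 + integral_from0 (fun s => V2 (c.1 s) (c.2 s)) t).

Definition picard_iter k := iter k picard_step (fun=> x0, fun=> y0).

Lemma picard_step_der c t : continuous c.1 -> continuous c.2 ->
  is_derive t (1 : R) (picard_step c).1 (V1 (c.1 t) (c.2 t)) /\
  is_derive t (1 : R) (picard_step c).2 (V2 (c.1 t) (c.2 t)).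
Proof.
move=> h1 h2; split.
- have := @der_integral R _ t (lip_continuous lip1 h1 h2) => h.
  by rewrite /picard_step /=; der; rewrite add0r.
- have := @der_integral R _ t (lip_continuous lip2 h1 h2) => h.
  by rewrite /picard_step /=; der; rewrite add0r.
Qed.

Lemma picard_iter_cont k :
  continuous (picard_iter k).1 /\ continuous (picard_iter k).2.
Proof.
elim: k => [|k [h1 h2]]; first by split => t; exact: cvg_cst.
by split => t; have [d1 d2] := picard_step_der t h1 h2;
  [exact: der_cont d1 | exact: der_cont d2].
Qed.

(** With this weight the two components together contract by [2 L / K = 1 / 2] at each iteration. *)
Let K : R := 4 * L.
Let A : R := (`|V1 x0 y0| + `|V2 x0 y0|) / K.
Let K0 : 0 < K. Proof. by rewrite mulr_gt0. Qed.

Lemma picard_geometric k t :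
  `|(picard_iter k.+1).1 t - (picard_iter k).1 t| +
  `|(picard_iter k.+1).2 t - (picard_iter k).2 t| <=
  A * expR (K * `|t|) / 2 ^+ k.
Proof.
elim: k t => [|k IH] t.
  have ac (a b : R) : a + b - a = b by ring.
  rewrite /picard_iter /= !ac expr0 divr1 /A mulrDl mulrDl.
  have c0 : continuous (fun _ : R => 0 : R) by move=> s; exact: cvg_cst.
  have I0 : integral_from0 (fun=> 0) t = 0 :> R.
    have -> : (fun=> 0) = horner (0 : {poly R}) by apply/funext => s; rewrite horner0.
    by rewrite integral_from0_poly /prim size_poly0 big_ord0 horner0.
  have e1 (s : R) : 1 <= expR (K * `|s|).
    by rewrite -expR0 ler_expR mulr_ge0 // ltW.
  have b (c : R) : `|integral_from0 (fun=> c) t| <= `|c| / K * expR (K * `|t|).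
    have H : `|integral_from0 (fun=> c) t - integral_from0 (fun=> 0) t| <=
        `|c| / K * expR (K * `|t|).
      apply: integral_diff_bound => //; first by move=> s; exact: cvg_cst.
      by move=> s; rewrite subr0 ler_peMr.
    by move: H; rewrite I0 subr0.
  exact: lerD.
have [h1 h2] := picard_iter_cont k.
have [h1' h2'] := picard_iter_cont k.+1.
have b V : (forall x y x' y' : R, `|V x y - V x' y'| <= L * (`|x - x'| + `|y - y'|)) ->
   `|integral_from0 (fun s => V ((picard_iter k.+1).1 s) ((picard_iter k.+1).2 s)) t -
     integral_from0 (fun s => V ((picard_iter k).1 s) ((picard_iter k).2 s)) t|
     <= L * (A / 2 ^+ k) / K * expR (K * `|t|).
  move=> lipV; apply: (integral_diff_bound K0).
  - exact: lip_continuous.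
  - exact: lip_continuous.
  move=> s; apply: le_trans (lipV _ _ _ _) _.
  rewrite -mulrA ler_pM2l // mulrAC; exact: IH.
have := lerD (b _ lip1) (b _ lip2).
rewrite [picard_iter k.+2]iterS [picard_iter k.+1 in X in _ -> X]iterS -/(picard_iter k).
have ac (p q z : R) : p + q - (p + z) = q - z by ring.
rewrite /= -/(picard_iter k.+1) !ac => /le_trans; apply; rewrite exprS /K le_eqVlt; apply/orP; left.
by apply/eqP; field; rewrite expf_neq0 ?(gt_eqF L0).
Qed.

Theorem picard_lindelof : exists x y : R -> R,
  [/\ x 0 = x0, y 0 = y0 &
      forall t, is_derive t (1 : R) x (V1 (x t) (y t)) /\
                is_derive t (1 : R) y (V2 (x t) (y t))].
Proof.
have lim1 t : exists l, forall k,
    `|(picard_iter k).1 t - l| <= 2 * (A * expR (K * `|t|)) / 2 ^+ k.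
  apply: geo_limit => k; apply: le_trans (picard_geometric k t).
  by rewrite lerDl.
have lim2 t : exists l, forall k,
    `|(picard_iter k).2 t - l| <= 2 * (A * expR (K * `|t|)) / 2 ^+ k.
  apply: geo_limit => k; apply: le_trans (picard_geometric k t).
  by rewrite lerDr.
have [x hx] := choice lim1; have [y hy] := choice lim2.
have A0 : 0 <= A by rewrite divr_ge0 ?addr_ge0 // ltW.
have limcont (u : nat -> R -> R) (z : R -> R) : (forall k, continuous (u k)) ->
    (forall t k, `|u k t - z t| <= 2 * (A * expR (K * `|t|)) / 2 ^+ k) ->
    continuous z.
  move=> uc uz t; apply/cvgrPdist_lt => e e0.
  have e4 : 0 < e / 4 by linarith.
  have [k hk] := exp2_small (2 * (A * expR (K * (`|t| + 1)))) e4.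
  have /cvgrPdist_lt /(_ _ e4) hu := uc k t.
  have /cvgrPdist_lt /(_ _ ltr01) hid := @cvg_id _ (nbhs t).
  have ht s : `|s| <= `|t| + 1 -> `|u k s - z s| < e / 4.
    move=> st; apply: le_lt_trans (uz s k) (le_lt_trans _ hk).
    rewrite ler_wpM2r ?invr_ge0 ?exprn_ge0 // ler_wpM2l // ler_wpM2l //.
    by rewrite ler_expR ler_pM2l.
  near=> s.
  have h1 : `|u k t - u k s| < e / 4 by near: s.
  have st : `|s| <= `|t| + 1.
    have : `|t - s| < 1 by near: s.
    by have := ler_normB t (t - s); rewrite opprB addrC subrK; linarith.
  have h2 := ht _ st; have h3 : `|u k t - z t| < e / 4 by apply: ht; linarith.
  move: h1 h2 h3; rewrite !ltr_norml; linarith.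
have xc : continuous x.
  by apply: (limcont (fun k => (picard_iter k).1)) => // k; case: (picard_iter_cont k).
have yc : continuous y.
  by apply: (limcont (fun k => (picard_iter k).2)) => // k; case: (picard_iter_cont k).
have bnd k s : `|(picard_iter k).1 s - x s| + `|(picard_iter k).2 s - y s| <=
   4 * A / 2 ^+ k * expR (K * `|s|).
  apply: le_trans (lerD (hx s k) (hy s k)) _.
  by rewrite le_eqVlt; apply/orP; left; apply/eqP; field; exact: expf_neq0.
have fix_ V (z : R -> R) z0 (u : nat -> R -> R) :
    (forall x y x' y' : R, `|V x y - V x' y'| <= L * (`|x - x'| + `|y - y'|)) ->
    (forall k t, u k.+1 t = z0 +
      integral_from0 (fun s => V ((picard_iter k).1 s) ((picard_iter k).2 s)) t) ->
    (forall t k, `|u k t - z t| <= 2 * (A * expR (K * `|t|)) / 2 ^+ k) ->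
    forall t, z t = z0 + integral_from0 (fun s => V (x s) (y s)) t.
  move=> lipV uS uz t; apply/eqP; rewrite -subr_eq0 -normr_le0.
  apply: (le_exp2 (C := 2 * (A * expR (K * `|t|)) + A * expR (K * `|t|))) => k.
  have [h1 h2] := picard_iter_cont k.
  have b : `|integral_from0 (fun s => V ((picard_iter k).1 s) ((picard_iter k).2 s)) t -
     integral_from0 (fun s => V (x s) (y s)) t|
     <= L * (4 * A / 2 ^+ k) / K * expR (K * `|t|).
    apply: (integral_diff_bound K0); try exact: lip_continuous.
    by move=> s; apply: le_trans (lipV _ _ _ _) _; rewrite -mulrA ler_pM2l.
  have a := uz t k.+1; rewrite uS in a.
  have -> : z t - (z0 + integral_from0 (fun s => V (x s) (y s)) t) =
    - (z0 + integral_from0 (fun s => V ((picard_iter k).1 s) ((picard_iter k).2 s)) t - z t) +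
    (integral_from0 (fun s => V ((picard_iter k).1 s) ((picard_iter k).2 s)) t -
     integral_from0 (fun s => V (x s) (y s)) t) by ring.
  apply: le_trans (ler_normD _ _) _; rewrite normrN.
  apply: le_trans (lerD a b) _.
  pose q := A * expR (K * `|t|) / 2 ^+ k.
  have q0 : 0 <= q.
    apply: mulr_ge0; first by apply: mulr_ge0 => //; exact: expR_ge0.
    by rewrite invr_ge0 exprn_ge0.
  have p0 : (2 : R) ^+ k != 0 by exact: expf_neq0.
  rewrite [X in X <= _](_ : _ = q + q); last first.
    by rewrite /q exprS /K; field; rewrite p0 (gt_eqF L0).
  rewrite [X in _ <= X](_ : _ = 3 * q); last by rewrite /q; field.
  by linarith.
have xE := fix_ V1 x x0 (fun k => (picard_iter k).1) lip1 (fun k t => erefl) hx.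
have yE := fix_ V2 y y0 (fun k => (picard_iter k).2) lip2 (fun k t => erefl) hy.
exists x, y; split.
- by rewrite xE integral_from0_at0 addr0.
- by rewrite yE integral_from0_at0 addr0.
- move=> t; have [] := @picard_step_der (x, y) t xc yc; rewrite /picard_step /=.
  by rewrite -(funext xE) -(funext yE).
Unshelve. all: by end_near. Qed.

End Picard.

Section LipschitzUniqueness.
Context {R : realType}.
Variables (V1 V2 : R -> R -> R) (L : R).
Hypothesis L0 : 0 < L.
Hypothesis lip1 : forall x y x' y' : R,
  `|V1 x y - V1 x' y'| <= L * (`|x - x'| + `|y - y'|).
Hypothesis lip2 : forall x y x' y' : R,
  `|V2 x y - V2 x' y'| <= L * (`|x - x'| + `|y - y'|).

(** Gronwall's inequality for the squared distance. The scalar factor [lam] is there for time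
    reversal, which is the case [lam = -1]. *)
Lemma lip_dependence (lam x y x' y' : R -> R) (M a b : R) : a <= b -> 0 <= M ->
  (forall t : R, a <= t <= b -> `|lam t| <= M) ->
  (forall t : R, a <= t <= b ->
     is_derive t (1 : R) x (lam t * V1 (x t) (y t)) /\
     is_derive t (1 : R) y (lam t * V2 (x t) (y t))) ->
  (forall t : R, a <= t <= b ->
     is_derive t (1 : R) x' (lam t * V1 (x' t) (y' t)) /\
     is_derive t (1 : R) y' (lam t * V2 (x' t) (y' t))) ->
  (x b - x' b) ^+ 2 + (y b - y' b) ^+ 2 <=
  ((x a - x' a) ^+ 2 + (y a - y' a) ^+ 2) * expR (4 * M * L * (b - a)).
Proof.
move=> ab M0 hl h h'.
apply: (@gronwall_exp R a b (4 * M * L)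
  (fun t => (x t - x' t) ^+ 2 + (y t - y' t) ^+ 2)
  (fun t => 2 * (x t - x' t) * (lam t * (V1 (x t) (y t) - V1 (x' t) (y' t))) +
            2 * (y t - y' t) * (lam t * (V2 (x t) (y t) - V2 (x' t) (y' t))))) => //.
- by move=> t tab; have [h1 h2] := h t tab; have [h3 h4] := h' t tab; der; ring.
- move=> t tab; have := hl t tab.
  have := lip1 (x t) (y t) (x' t) (y' t); have := lip2 (x t) (y t) (x' t) (y' t).
  set v1 := V1 _ _ - _; set v2 := V2 _ _ - _; set dx := x t - _; set dy := y t - _.
  move=> h2 h1 hM.
  set S := `|dx| + `|dy| in h1 h2.
  have S0 : 0 <= S by rewrite addr_ge0.
  have b1 : `|2 * dx * (lam t * v1)| <= 2 * `|dx| * (M * (L * S)).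
    rewrite !normrM (ger0_norm (_ : 0 <= 2 :> R)) // ler_wpM2l ?mulr_ge0 //.
    by apply: ler_pM.
  have b2 : `|2 * dy * (lam t * v2)| <= 2 * `|dy| * (M * (L * S)).
    rewrite !normrM (ger0_norm (_ : 0 <= 2 :> R)) // ler_wpM2l ?mulr_ge0 //.
    by apply: ler_pM.
  have := ler_norm (2 * dx * (lam t * v1)); have := ler_norm (2 * dy * (lam t * v2)).
  have : 2 * `|dx| * (M * (L * S)) + 2 * `|dy| * (M * (L * S)) <=
         4 * M * L * (dx ^+ 2 + dy ^+ 2).
    have ML : 0 <= M * L by rewrite mulr_ge0 // ltW.
    have -> : 2 * `|dx| * (M * (L * S)) + 2 * `|dy| * (M * (L * S)) =
       (M * L) * (2 * S ^+ 2) by rewrite /S; ring.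
    have -> : 4 * M * L * (dx ^+ 2 + dy ^+ 2) =
       (M * L) * (4 * (dx ^+ 2 + dy ^+ 2)) by ring.
    rewrite ler_wpM2l // /S -(real_normK (num_real dx)) -(real_normK (num_real dy)).
    by have := sqr_ge0 (`|dx| - `|dy|); nra.
  by linarith.
Qed.

Lemma lip_unique (lam x y x' y' : R -> R) (M a b : R) : a <= b -> 0 <= M ->
  (forall t : R, a <= t <= b -> `|lam t| <= M) ->
  (forall t : R, a <= t <= b ->
     is_derive t (1 : R) x (lam t * V1 (x t) (y t)) /\
     is_derive t (1 : R) y (lam t * V2 (x t) (y t))) ->
  (forall t : R, a <= t <= b ->
     is_derive t (1 : R) x' (lam t * V1 (x' t) (y' t)) /\
     is_derive t (1 : R) y' (lam t * V2 (x' t) (y' t))) ->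
  x a = x' a -> y a = y' a -> x b = x' b /\ y b = y' b.
Proof.
move=> ab M0 hl h h' ex ey.
have := lip_dependence ab M0 hl h h'.
rewrite ex ey !subrr expr0n addr0 mul0r => D0.
have := sqr_ge0 (x b - x' b); have := sqr_ge0 (y b - y' b) => h1 h2.
have e1 : (x b - x' b) ^+ 2 = 0 by linarith.
have e2 : (y b - y' b) ^+ 2 = 0 by linarith.
by split; apply/eqP; rewrite -subr_eq0 -sqrf_eq0; apply/eqP.
Qed.

End LipschitzUniqueness.

Section Solutions.
Context {R : realType}.
Implicit Types (f g : {poly R}).

Definition acc f g (x y : R) : R := - g.[x] - f.[x] * y.

Definition solves f g (x y : R -> R) (t : R) : Prop :=
  is_derive t (1 : R) x (y t) /\ is_derive t (1 : R) y (acc f g (x t) (y t)).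

Definition sol f g (x y : R -> R) : Prop := forall t : R, solves f g x y t.

Definition seg f g (x y : R -> R) (tau : R) : Prop :=
  forall t : R, 0 <= t <= tau -> solves f g x y t.

(** Clamping both arguments makes a polynomial field globally Lipschitz without changing it on the
    box of half side [B]. A solution known to stay in the box is thus a solution of the original
    system. *)
Definition clamp (B z : R) : R := Num.max (- B) (Num.min B z).

Lemma clampE (B z : R) : `|z| <= B -> clamp B z = z.
Proof.
rewrite ler_norml => /andP[h1 h2]; rewrite /clamp (min_idPr h2).
exact: (max_idPr h1).
Qed.

Lemma clamp_bound (B z : R) : 0 <= B -> `|clamp B z| <= B.
Proof.
move=> B0; rewrite /clamp ler_norml le_max lexx /= ge_max ge_min lexx /=.
by rewrite andbT; linarith.
Qed.

Lemma clamp_lip (B z w : R) : `|clamp B z - clamp B w| <= `|z - w|.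
Proof.
have n1 := ler_norm (z - w); have := ler_norm (w - z).
rewrite [`|w - z|]distrC => n2; move: (`|z - w|) n1 n2 => d n1 n2.
rewrite ler_norml /clamp.
by case: (lerP B z) => h1; case: (lerP B w) => h2;
  case: (lerP (- B) B) => h3; try (case: (lerP (- B) z) => h4);
  try (case: (lerP (- B) w) => h5); linarith.
Qed.

Lemma acc_lip f g (B : R) : exists2 K : R, 0 < K & forall x y x' y' : R,
  `|x| <= B -> `|y| <= B -> `|x'| <= B -> `|y'| <= B ->
  `|acc f g x y - acc f g x' y'| <= K * (`|x - x'| + `|y - y'|).
Proof.
have [Kg Kg0 hg] := poly_lip g B; have [Kf Kf0 hf] := poly_lip f B.
have [Bf Bf0 bf] := poly_bound f B.
exists (Kg + Kf * `|B| + Bf) => [|x y x' y' hx hy hx' hy'].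
  by have := normr_ge0 B; nra.
rewrite /acc [X in `|X|](_ : _ = - (g.[x] - g.[x']) - (f.[x] - f.[x']) * y
   - f.[x'] * (y - y')); last by ring.
apply: le_trans (ler_normB _ _) _.
have h1 := hg x x' hx hx'; have h2 := hf x x' hx hx'; have h3 := bf x' hx'.
have h4 : `|f.[x'] * (y - y')| <= Bf * `|y - y'| by rewrite normrM ler_wpM2r.
have h5 : `|(f.[x] - f.[x']) * y| <= Kf * `|B| * `|x - x'|.
  rewrite normrM mulrAC; apply: ler_pM => //.
  exact: le_trans hy (ler_norm _).
have h6 := ler_normB (- (g.[x] - g.[x'])) ((f.[x] - f.[x']) * y).
rewrite normrN in h6.
have p1 : 0 <= Bf * `|x - x'| by rewrite mulr_ge0 // ltW.
have p2 : 0 <= Kg * `|y - y'| by rewrite mulr_ge0 // ltW.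
have p3 : 0 <= Kf * `|B| * `|y - y'| by rewrite !mulr_ge0 // ltW.
by linarith.
Qed.

Definition tV1 (B x y : R) : R := clamp B y.
Definition tV2 f g (B x y : R) : R := acc f g (clamp B x) (clamp B y).

Lemma trunc_lip f g (B : R) : 0 <= B -> exists2 L : R, 0 < L &
  (forall x y x' y' : R, `|tV1 B x y - tV1 B x' y'| <= L * (`|x - x'| + `|y - y'|)) /\
  (forall x y x' y' : R,
     `|tV2 f g B x y - tV2 f g B x' y'| <= L * (`|x - x'| + `|y - y'|)).
Proof.
move=> B0; have [K K0 hK] := acc_lip f g B.
exists (K + 1) => //; first by linarith.
split=> x y x' y'.
- have := clamp_lip B y y'; rewrite /tV1.
  have := normr_ge0 (x - x'); have := normr_ge0 (y - y'); nra.
- have := hK _ _ _ _ (clamp_bound x B0) (clamp_bound y B0)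
    (clamp_bound x' B0) (clamp_bound y' B0).
  have := clamp_lip B y y'; have := clamp_lip B x x'; rewrite /tV2.
  have := normr_ge0 (x - x'); have := normr_ge0 (y - y'); nra.
Qed.

Definition tsol f g (B : R) (x y : R -> R) (t : R) : Prop :=
  is_derive t (1 : R) x (tV1 B (x t) (y t)) /\
  is_derive t (1 : R) y (tV2 f g B (x t) (y t)).

Lemma tsol_exists f g (B x0 y0 : R) : 0 <= B -> exists x y : R -> R,
  [/\ x 0 = x0, y 0 = y0 & forall t : R, tsol f g B x y t].
Proof.
move=> B0; have [L L0 [h1 h2]] := trunc_lip f g B0.
exact: (picard_lindelof L0 h1 h2 x0 y0).
Qed.

Lemma tsolE f g (B : R) (x y : R -> R) (t : R) : `|x t| <= B -> `|y t| <= B ->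
  tsol f g B x y t <-> solves f g x y t.
Proof. by move=> hx hy; rewrite /tsol /tV1 /tV2 !clampE. Qed.

Lemma tsol_unique f g (B a b : R) (x y x' y' : R -> R) : 0 <= B -> a <= b ->
  (forall t : R, a <= t <= b -> tsol f g B x y t) ->
  (forall t : R, a <= t <= b -> tsol f g B x' y' t) ->
  x a = x' a -> y a = y' a -> x b = x' b /\ y b = y' b.
Proof.
move=> B0 ab h h'; have [L L0 [h1 h2]] := trunc_lip f g B0.
apply: (lip_unique L0 h1 h2 (lam := fun=> 1) (M := 1)) => //.
- by move=> t _; rewrite normr1.
- by move=> t /h [? ?]; rewrite !mul1r.
- by move=> t /h' [? ?]; rewrite !mul1r.
Qed.

Lemma tsol_unique_back f g (B a b : R) (x y x' y' : R -> R) : 0 <= B -> a <= b ->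
  (forall t : R, a <= t <= b -> tsol f g B x y t) ->
  (forall t : R, a <= t <= b -> tsol f g B x' y' t) ->
  x b = x' b -> y b = y' b -> x a = x' a /\ y a = y' a.
Proof.
move=> B0 ab h h' ex ey; have [L L0 [h1 h2]] := trunc_lip f g B0.
have := @lip_unique R _ _ L L0 h1 h2 (fun=> -1) (fun t => x (b - t))
  (fun t => y (b - t)) (fun t => x' (b - t)) (fun t => y' (b - t)) 1 0 (b - a).
rewrite !subr0 !subKr; apply => //.
- by linarith.
- by move=> t _; rewrite normrN normr1.
- move=> t tab; have [] := h (b - t); first by linarith.
  by move=> d1 d2; rewrite !mulN1r; split; apply: der_rev.
- move=> t tab; have [] := h' (b - t); first by linarith.
  by move=> d1 d2; rewrite !mulN1r; split; apply: der_rev.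
Qed.

Lemma within_bounded (a b : R) (u : R -> R) : {within `[a, b], continuous u} ->
  exists2 B : R, 0 <= B & forall t : R, a <= t <= b -> `|u t| <= B.
Proof.
move=> uc; case: (lerP a b) => ab; last by exists 0 => // t tab; linarith.
have [c _ hc] := EVT_max ab uc; have [d _ hd] := EVT_min ab uc.
exists (`|u c| + `|u d|) => [|t tab]; first by rewrite addr_ge0.
have tab' : t \in `[a, b] by rewrite in_itv.
have := hc t tab'; have := hd t tab'.
have := ler_norm (u c); have := ler_norm (- u d); rewrite normrN.
have := normr_ge0 (u c); have := normr_ge0 (u d).
by rewrite ler_norml; linarith.
Qed.

Lemma solves_bounded f g (a b : R) (x y : R -> R) :
  (forall t : R, a <= t <= b -> solves f g x y t) ->
  exists2 B : R, 0 <= B & forall t : R, a <= t <= b -> `|x t| <= B /\ `|y t| <= B.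
Proof.
move=> h.
have xc : {within `[a, b], continuous x} by apply: der_within => t /h [].
have yc : {within `[a, b], continuous y}.
  by apply: (der_within (du := fun t => acc f g (x t) (y t))) => t /h [].
have [B1 B10 h1] := within_bounded xc; have [B2 B20 h2] := within_bounded yc.
exists (B1 + B2) => [|t tab]; first by linarith.
by have := h1 t tab; have := h2 t tab; split; linarith.
Qed.

Lemma solves_unique f g (a b : R) (x y x' y' : R -> R) : a <= b ->
  (forall t : R, a <= t <= b -> solves f g x y t) ->
  (forall t : R, a <= t <= b -> solves f g x' y' t) ->
  x a = x' a -> y a = y' a -> x b = x' b /\ y b = y' b.
Proof.
move=> ab h h'; have [B B0 hB] := solves_bounded h.
have [B' B'0 hB'] := solves_bounded h'.
apply: (@tsol_unique f g (B + B')) => //; first by linarith.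
- by move=> t tab; have [? ?] := hB t tab; apply/tsolE; [linarith | linarith | exact: h].
- by move=> t tab; have [? ?] := hB' t tab; apply/tsolE; [linarith | linarith | exact: h'].
Qed.

Lemma solves_unique_back f g (a b : R) (x y x' y' : R -> R) : a <= b ->
  (forall t : R, a <= t <= b -> solves f g x y t) ->
  (forall t : R, a <= t <= b -> solves f g x' y' t) ->
  x b = x' b -> y b = y' b -> x a = x' a /\ y a = y' a.
Proof.
move=> ab h h'; have [B B0 hB] := solves_bounded h.
have [B' B'0 hB'] := solves_bounded h'.
apply: (@tsol_unique_back f g (B + B')) => //; first by linarith.
- by move=> t tab; have [? ?] := hB t tab; apply/tsolE; [linarith | linarith | exact: h].
- by move=> t tab; have [? ?] := hB' t tab; apply/tsolE; [linarith | linarith | exact: h'].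
Qed.

Lemma sol_unique f g (x y x' y' : R -> R) (a : R) : sol f g x y -> sol f g x' y' ->
  x a = x' a -> y a = y' a -> forall t, x t = x' t /\ y t = y' t.
Proof.
move=> h h' ex ey t; case: (lerP a t) => at_.
- by apply: (@solves_unique f g a t).
- by apply: (@solves_unique_back f g t a) => //; exact: ltW.
Qed.

Lemma sol_shift f g (x y : R -> R) (c : R) : sol f g x y ->
  sol f g (fun t => x (t + c)) (fun t => y (t + c)).
Proof. by move=> h t; have [h1 h2] := h (t + c); split; apply: der_shift. Qed.

(** One solution of the truncated field is started at the beginning of the first arc and identified
    with both arcs by uniqueness, so that differentiability at the junction needs no argument. *)
Lemma seg_cat f g (x y x' y' : R -> R) (s t : R) : 0 <= s -> 0 <= t ->
  seg f g x y s -> seg f g x' y' t -> x s = x' 0 -> y s = y' 0 ->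
  exists X Y : R -> R, [/\ seg f g X Y (s + t),
    forall r : R, 0 <= r <= s -> X r = x r /\ Y r = y r &
    forall r : R, 0 <= r <= t -> X (r + s) = x' r /\ Y (r + s) = y' r].
Proof.
move=> s0 t0 h h' ex ey.
have [B B0 hB] := solves_bounded h; have [B' B'0 hB'] := solves_bounded h'.
have C0 : 0 <= B + B' by linarith.
have [X [Y [X0 Y0 hX]]] := tsol_exists f g (x 0) (y 0) C0.
have e1 r : 0 <= r <= s -> X r = x r /\ Y r = y r.
  move=> /andP[r0 rs]; apply: (@tsol_unique f g (B + B') 0 r) => // u urs.
  have urs' : 0 <= u <= s by linarith.
  by have [? ?] := hB u urs'; apply/tsolE; [linarith | linarith | exact: h].
have e2 r : 0 <= r <= t -> X (r + s) = x' r /\ Y (r + s) = y' r.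
  move=> /andP[r0 rs].
  apply: (@tsol_unique f g (B + B') 0 r (fun u => X (u + s)) (fun u => Y (u + s))) => //.
  - by move=> u _; have [? ?] := hX (u + s); split; apply: der_shift.
  - move=> u urs; have urs' : 0 <= u <= t by linarith.
    by have [? ?] := hB' u urs'; apply/tsolE; [linarith | linarith | exact: h'].
  - by rewrite add0r; have [|-> _] := e1 s; [linarith|].
  - by rewrite add0r; have [|_ ->] := e1 s; [linarith|].
exists X, Y; split => // r rst.
case: (lerP r s) => rs.
  have rs' : 0 <= r <= s by linarith.
  have [E1 E2] := e1 r rs'; have [? ?] := hB r rs'.
  by apply/(@tsolE f g (B + B')); rewrite ?E1 ?E2; [linarith | linarith | exact: hX].
have rs' : 0 <= r - s <= t by linarith.
have [E1 E2] := e2 _ rs'; have [? ?] := hB' _ rs'; rewrite subrK in E1 E2.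
by apply/(@tsolE f g (B + B')); rewrite ?E1 ?E2; [linarith | linarith | exact: hX].
Qed.

Definition periodic (x y : R -> R) (T : R) : Prop :=
  forall t : R, x (t + T) = x t /\ y (t + T) = y t.

Lemma periodic_reduce (x y : R -> R) (T : R) : 0 < T -> periodic x y T ->
  forall t : R, exists2 s : R, 0 <= s < T & x t = x s /\ y t = y s.
Proof.
move=> T0 per.
have pern (k : nat) t : x (t + k%:R * T) = x t /\ y (t + k%:R * T) = y t.
  elim: k t => [|k IH] t; first by rewrite mul0r addr0.
  rewrite -natr1 mulrDl mul1r addrA; have [-> ->] := per (t + k%:R * T).
  exact: IH.
have perz (z : int) t : x (t + z%:~R * T) = x t /\ y (t + z%:~R * T) = y t.
  case: z => k; first exact: pern.
  rewrite NegzE mulrNz mulNr.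
  by have [e1 e2] := pern k.+1 (t - k.+1%:R * T); rewrite subrK in e1 e2.
move=> t; exists (t - (Num.floor (t / T))%:~R * T).
  have h1 := floor_le_tmp (t / T); have h2 := floorD1_gt (t / T).
  rewrite ler_pdivlMr // in h1.
  by rewrite intrD ltr_pdivrMr // mulrDl mul1r in h2; linarith.
by have [e1 e2] := perz (- Num.floor (t / T)) t; rewrite mulrNz mulNr in e1 e2.
Qed.

(** The truncated solution is global and, by uniqueness, [T]-periodic. It therefore never leaves the
    box that contains the given arc, and solves the original system for all time. *)
Lemma seg_periodic f g (x y : R -> R) (T : R) : 0 < T ->
  seg f g x y T -> x T = x 0 -> y T = y 0 ->
  exists X Y : R -> R, [/\ sol f g X Y, periodic X Y T &
    forall r : R, 0 <= r <= T -> X r = x r /\ Y r = y r].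
Proof.
move=> T0 h ex ey; have [B B0 hB] := solves_bounded h.
have [X [Y [X0 Y0 hX]]] := tsol_exists f g (x 0) (y 0) B0.
have e1 r : 0 <= r <= T -> X r = x r /\ Y r = y r.
  move=> /andP[r0 rs]; apply: (@tsol_unique f g B 0 r) => // u urs.
  have urs' : 0 <= u <= T by linarith.
  by have [? ?] := hB u urs'; apply/tsolE => //; exact: h.
have hXT t : tsol f g B (fun u => X (u + T)) (fun u => Y (u + T)) t.
  by have [? ?] := hX (t + T); split; apply: der_shift.
have [EX EY] : X T = x T /\ Y T = y T by apply: e1; linarith.
have per : periodic X Y T.
  move=> t; case: (lerP 0 t) => t0.
    apply: (@tsol_unique f g B 0 t (fun u => X (u + T)) (fun u => Y (u + T))) => //.
      by rewrite add0r EX X0.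
    by rewrite add0r EY Y0.
  apply: (@tsol_unique_back f g B t 0 (fun u => X (u + T)) (fun u => Y (u + T))) => //.
  - exact: ltW.
  - by rewrite add0r EX X0.
  - by rewrite add0r EY Y0.
exists X, Y; split => // t.
have [s sT [E1 E2]] := periodic_reduce T0 per t.
have sT' : 0 <= s <= T by linarith.
have [E3 E4] := e1 s sT'; have [? ?] := hB s sT'.
by apply/(@tsolE f g B); rewrite ?E1 ?E2 ?E3 ?E4.
Qed.

(* The half turn [(x, y) -> (- x, - y)] turns [(f, g)] into [(flip f, - flip g)];
   [y -> - y] with time reversal turns it into [(- f, g)].  They exchange the
   quarters of an orbit. *)
Definition flip (p : {poly R}) : {poly R} := p \Po (- 'X).

Lemma flipE p (x : R) : (flip p).[x] = p.[- x].
Proof. by rewrite /flip horner_comp hornerN hornerX. Qed.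

Lemma flipK p : flip (flip p) = p.
Proof. by rewrite /flip -comp_polyA [(- 'X) \Po _]raddfN /= comp_polyX opprK comp_polyXr. Qed.

Lemma solves_rev_y f g (x y : R -> R) (c t : R) : solves f g x y (c - t) ->
  solves (- f) g (fun t => x (c - t)) (fun t => - y (c - t)) t.
Proof.
move=> [h1 h2]; split; first exact: der_rev.
have h := derN (der_rev h2); apply: (der_eq h).
by rewrite /acc hornerN; ring.
Qed.

Lemma solves_rot f g (x y : R -> R) (t : R) : solves f g x y t ->
  solves (flip f) (- flip g) (fun t => - x t) (fun t => - y t) t.
Proof.
move=> [h1 h2]; split; first exact: derN.
apply: (der_eq (derN h2)).
by rewrite /acc !hornerN !flipE !opprK; ring.
Qed.

Lemma prim_flip p (x : R) : (prim (flip p)).[x] = - (prim p).[- x].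
Proof.
pose w x := (prim (flip p)).[x] + (prim p).[- x].
have w0 s : is_derive s (1 : R) w 0.
  have h1 := der_prim (flip p) (derI s).
  have h2 := der_prim p (derN (derI s)).
  by rewrite /w; der; rewrite flipE; ring.
have := der0_const x w0; rewrite /w oppr0 !prim0 addr0 => /eqP.
by rewrite addr_eq0 => /eqP.
Qed.

Lemma primN p (x : R) : (prim (- p)).[x] = - (prim p).[x].
Proof.
pose w x := (prim (- p)).[x] + (prim p).[x].
have w0 s : is_derive s (1 : R) w 0.
  have h1 := der_prim (- p) (derI s).
  have h2 := der_prim p (derI s).
  by rewrite /w; der; rewrite hornerN; ring.
have := der0_const x w0; rewrite /w !prim0 addr0 => /eqP.
by rewrite addr_eq0 => /eqP.
Qed.

End Solutions.

(** * Quarters of an orbit *)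

Section Quarters.
Context {R : realType}.
Implicit Types (f g : {poly R}).

Definition restoring g : Prop := forall x : R, x != 0 -> 0 < x * g.[x].

(** A damping that vanishes at the origin and a nondegenerate minimum of the potential: together
    they keep an orbit from sliding into the origin without turning. *)
Definition weak_at0 f g : Prop := exists c C d : R,
  [/\ 0 < c, 0 < C, 0 < d & forall x : R, `|x| <= d ->
      `|f.[x]| <= C * `|x| /\ c * x ^+ 2 <= 2 * (prim g).[x]].

(* Behind every monotonicity used at infinity; it makes [y / x^(N+1)] strictly
   decreasing along orbits, hence forces them to turn back. *)
Definition far_rotating f g (N : nat) (X eta : R) : Prop :=
  forall x y : R, X <= `|x| -> eta * x ^+ (2 * N + 2) <=
    N.+1%:R * y ^+ 2 + x * f.[x] * y + x * g.[x].

Definition tame f g : Prop := [/\ restoring g, weak_at0 f g &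
  exists N X eta, [/\ 1 <= X, 0 < eta & far_rotating f g N X eta]].

Lemma tameN f g : tame f g -> tame (- f) g.
Proof.
move=> [h1 [c [C [d [c0 C0 d0 h2]]]] [N [X [eta [X1 e0 h3]]]]]; split => //.
- exists c, C, d; split => // x /h2.
  by rewrite hornerN normrN.
- exists N, X, eta; split => // x y /h3 h; have := h (- y).
  by rewrite hornerN sqrrN mulrN mulrN mulNr.
Qed.

Lemma tame_rot f g : tame f g -> tame (flip f) (- flip g).
Proof.
move=> [h1 [c [C [d [c0 C0 d0 h2]]]] [N [X [eta [X1 e0 h3]]]]]; split => //.
- move=> x x0; rewrite hornerN flipE mulrN -mulNr.
  by apply: h1; rewrite oppr_eq0.
- exists c, C, d; split => // x; rewrite -[`|x|]normrN => /h2.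
  by rewrite flipE sqrrN primN prim_flip opprK.
- exists N, X, eta; split => // x y; rewrite -[`|x|]normrN => /h3 h.
  have := h (- y); rewrite hornerN !flipE sqrrN.
  rewrite (_ : (- x) ^+ (2 * N + 2) = x ^+ (2 * N + 2)); last first.
    by rewrite exprNn -signr_odd oddD mul2n odd_double mul1r.
  by rewrite mulrN -mulNr !mulNr opprK mulrN.
Qed.

Lemma tame_rev f g : tame f g -> tame (- flip f) (- flip g).
Proof. by move=> h; apply: tameN; exact: tame_rot. Qed.

Lemma restoring_pos g : restoring g -> forall x : R, 0 < x -> 0 < g.[x].
Proof. by move=> h x x0; have := h x; rewrite gt_eqF // pmulr_rgt0 // => /(_ isT). Qed.

Lemma restoring_0 g : restoring g -> g.[0] = 0.
Proof.
move=> h; apply/eqP; rewrite -normr_le0 leNgt; apply/negP => g0.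
have [K K0 hK] := poly_lip g 1.
pose e := Num.min 1 (`|g.[0]| / (2 * K)).
have e0 : 0 < e by rewrite /e lt_min ltr01 divr_gt0 // mulr_gt0.
have e1 : e <= 1 by rewrite /e ge_min lexx.
have e2 : K * e <= `|g.[0]| / 2.
  have : e <= `|g.[0]| / (2 * K) by rewrite /e ge_min lexx orbT.
  rewrite ler_pdivlMr ?mulr_gt0 //; linarith.
have ge : 0 < g.[e] by exact: restoring_pos.
have gme : g.[- e] < 0.
  have := h (- e); rewrite oppr_eq0 gt_eqF // nmulr_rgt0 ?oppr_lt0 //; exact.
have h0 : `|0 : R| <= 1 by rewrite normr0.
have he : `|e| <= 1 by rewrite gtr0_norm.
have hme : `|- e| <= 1 by rewrite normrN.
have := hK e 0 he h0; have := hK (- e) 0 hme h0.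
rewrite !subr0 normrN (gtr0_norm e0) !ler_norml.
case: (lerP 0 g.[0]) => s0; [rewrite (ger0_norm s0) in g0 e2 |
  rewrite (ltr0_norm s0) in g0 e2]; linarith.
Qed.

Lemma G_incr g (a b : R) : restoring g -> 0 <= a -> a < b ->
  (prim g).[a] < (prim g).[b].
Proof.
move=> h a0 ab; apply: (@incr R a b (horner (prim g)) (horner g) ab).
- by move=> t _; have := der_prim g (derI t); rewrite mulr1.
- by move=> t tab; apply: restoring_pos => //; linarith.
Qed.

Lemma G_pos g (x : R) : restoring g -> x != 0 -> 0 < (prim g).[x].
Proof.
move=> h; case: (ltgtP x 0) => // x0 _; last first.
  by have := G_incr h (lexx 0) x0; rewrite prim0.
have h' : restoring (- flip g).
  move=> z z0; rewrite hornerN flipE mulrN -mulNr.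
  by apply: h; rewrite oppr_eq0.
have := @G_incr _ 0 (- x) h'; rewrite prim0 primN prim_flip !opprK; apply; linarith.
Qed.

Lemma G_ge0 g (x : R) : restoring g -> 0 <= (prim g).[x].
Proof.
move=> h; case: (eqVneq x 0) => [->|x0]; first by rewrite prim0.
by apply: ltW; exact: G_pos.
Qed.

Lemma G_inj g (a b : R) : restoring g -> 0 <= a -> 0 <= b ->
  (prim g).[a] <= (prim g).[b] -> a <= b.
Proof.
move=> h a0 b0; rewrite leNgt => ab; rewrite leNgt; apply: contra ab.
exact: G_incr.
Qed.

Definition energy g (x y : R) : R := Num.sqrt (y ^+ 2 + 2 * (prim g).[x]).

Lemma energy_ge g (x y : R) : restoring g -> `|y| <= energy g x y.
Proof.
move=> h; rewrite /energy -sqrtr_sqr; apply: ler_wsqrtr.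
by have := G_ge0 x h; linarith.
Qed.

Lemma energy_ge_G g (x y z : R) : restoring g -> 0 <= z ->
  z ^+ 2 <= y ^+ 2 + 2 * (prim g).[x] -> z <= energy g x y.
Proof.
by move=> h z0 hz; rewrite /energy -(ger0_norm z0) -sqrtr_sqr; apply: ler_wsqrtr.
Qed.

(** The derivative of the energy [E] is [- f(x) y^2 / E], and [|y| <= E]. Thanks to the square root
    in [E] the bound is [|f(x)|] times the horizontal displacement, whatever the size of [E]. The
    sign [sg] is that of [y] on the arc. *)
Lemma energy_variation f g (x y : R -> R) (a b C sg : R) : restoring g -> a <= b ->
  (forall t : R, a <= t <= b -> solves f g x y t) ->
  sg = 1 \/ sg = -1 ->
  (forall t : R, a <= t <= b -> 0 <= sg * y t) ->
  (forall t : R, a <= t <= b -> x t != 0 \/ y t != 0) ->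
  (forall t : R, a <= t <= b -> `|f.[x t]| <= C) ->
  `|energy g (x b) (y b) - energy g (x a) (y a)| <= C * (sg * (x b - x a)).
Proof.
move=> h ab hs hsg hy hn hC.
rewrite mulrBr [X in _ <= X]mulrBr.
have E0 t : a <= t <= b -> 0 < y t ^+ 2 + 2 * (prim g).[x t].
  move=> /hn [n|n]; first by have := G_pos h n; have := sqr_ge0 (y t); linarith.
  have : 0 < y t ^+ 2 by rewrite exprn_even_gt0.
  by have := G_ge0 (x t) h; linarith.
apply: (@der_bound R a b (fun t => energy g (x t) (y t)) (fun t => C * (sg * x t))
  (fun t => - f.[x t] * y t ^+ 2 / energy g (x t) (y t)) (fun t => C * (sg * y t))) => //.
- move=> t tab; have [h1 h2] := hs t tab; have p0 := E0 t tab.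
  have hp := der_prim g h1.
  have hin : is_derive t (1 : R) (fun t => y t ^+ 2 + 2 * (prim g).[x t])
     (- 2 * f.[x t] * y t ^+ 2).
    by der; rewrite /acc; ring.
  have hq := @der_sqrt R (fun t => y t ^+ 2 + 2 * (prim g).[x t]) t _ p0 hin.
  apply: (der_eq hq); rewrite -/(energy g (x t) (y t)).
  by field; rewrite gt_eqF // sqrtr_gt0.
- by move=> t tab; have [h1 h2] := hs t tab; der; ring.
- move=> t tab0; have tab : a <= t <= b by linarith.
  have e0 : 0 < energy g (x t) (y t) by rewrite sqrtr_gt0; exact: E0.
  have ye := energy_ge (x t) (y t) h.
  have -> : sg * y t = `|y t|.
    have := hy t tab; case: hsg => ->; rewrite ?mul1r ?mulN1r.
      by move=> ?; rewrite ger0_norm.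
    by move=> ?; rewrite ler0_norm //; linarith.
  rewrite mulNr normrM normrN normrM normfV (gtr0_norm e0) ler_pdivrMr //.
  rewrite -mulrA; apply: ler_pM => //; first exact: hC.
  by rewrite normrX expr2 ler_wpM2l.
Qed.

Lemma positive_bound g (a b : R) : restoring g -> 0 < a -> a <= b ->
  exists2 c : R, 0 < c & forall x, a <= x <= b -> c <= g.[x].
Proof.
move=> h a0 ab.
have gc : {within `[a, b], continuous (horner g)}.
  by apply: continuous_subspaceT; exact: continuous_horner.
have [c cab hc] := EVT_min ab gc; exists g.[c].
  by apply: restoring_pos => //; move: cab; rewrite in_itv /=; linarith.
by move=> x xab; apply: hc; rewrite in_itv.
Qed.

(* [y + F(x)] has derivative [- g(x)]. *)
Lemma no_linger f g (x y : R -> R) (t0 a b Y : R) : restoring g -> 0 < a ->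
  (forall t : R, t0 <= t -> [/\ solves f g x y t, a <= x t <= b & `|y t| <= Y]) -> False.
Proof.
move=> h a0 hs.
have [_ xt0 _] := hs t0 (lexx _); have ab : a <= b by linarith.
have [c c0 hc] := positive_bound h a0 ab.
have [K K0 hK] := poly_bound (prim f) b.
pose Z t := y t + (prim f).[x t].
have Zb t : t0 <= t -> `|Z t| <= Y + K.
  move=> /hs [_ xt yt]; apply: le_trans (ler_normD _ _) _.
  by apply: lerD => //; apply: hK; rewrite ger0_norm; linarith.
pose T := t0 + (2 * (Y + K) + 1) / c.
have YK : 0 <= Y + K by exact: le_trans (normr_ge0 _) (Zb t0 (lexx _)).
have tT : t0 <= T by rewrite /T lerDl divr_ge0 //; linarith.
have : Z T + c * T <= Z t0 + c * t0.
  rewrite -lerN2; apply: (@nondecr R t0 T (fun t => - (Z t + c * t))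
    (fun t => g.[x t] - c) tT).
  - move=> t /andP[tt _]; have [[h1 h2] _ _] := hs t tt.
    by have hp := der_prim f h1; rewrite /Z; der; rewrite /acc; ring.
  - by move=> t /andP[/ltW tt _]; have [_ xt _] := hs t tt; have := hc _ xt; linarith.
have -> : c * T = c * t0 + (2 * (Y + K) + 1) by rewrite /T; field; rewrite gt_eqF.
have := Zb T tT; have := Zb t0 (lexx _); rewrite !ler_norml; linarith.
Qed.

Lemma limit_ge0 (y : R -> R) (T : R) : 0 <= T ->
  {within `[0, T], continuous y} -> 0 < y 0 ->
  (forall t : R, 0 <= t < T -> 0 < y t) -> 0 <= y T.
Proof.
move=> T0 yc y0 hy; rewrite leNgt; apply/negP => yT.
have nyc : {within `[0, T], continuous (fun t => - y t)}.
  by move=> t; apply: continuousN; apply: yc.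
have [||c /andP[c0 cT] [yc0 _]] := first_hit (l := 0) T0 nyc; rewrite ?oppr_lt0 //.
  by rewrite oppr_ge0 ltW.
have : c != T by apply/eqP => e; move: yc0 yT; rewrite e => /eqP; rewrite oppr_eq0 => /eqP ->; rewrite ltxx.
move=> cT'; have := hy c; rewrite lt_neqAle cT' cT ltW //= => /(_ isT).
by rewrite -oppr_lt0 yc0 ltxx.
Qed.

End Quarters.

Section QuarterTurns.
Context {R : realType}.
Implicit Types (f g : {poly R}).

Lemma nonneg_trajectory f g (x y : R -> R) (T : R) : 0 <= T ->
  (forall t : R, 0 <= t <= T -> solves f g x y t) ->
  (forall t : R, 0 <= t < T -> 0 < y t) -> 0 < y 0 ->
  (forall t : R, 0 <= t <= T -> 0 <= y t) /\
  (forall s t : R, 0 <= s -> s < t -> t <= T -> x s < x t).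
Proof.
move=> T0 hs hy y0; split.
- move=> t /andP[t0]; rewrite le_eqVlt => /predU1P[->|tT]; last first.
    by apply/ltW/hy; rewrite t0.
  apply: (limit_ge0 T0) => //.
  by apply: (der_within (du := fun t => acc f g (x t) (y t))) => s /hs [].
- move=> s t s0 st tT; apply: (@incr R s t x y st).
  + by move=> u ust; have [|? _] := hs u => //; linarith.
  + by move=> u ust; apply: hy; linarith.
Qed.

(** Up to the abscissa [X] the energy bounds [y]. Beyond it [y^2 / x^(2N+2) + 2 eta ln x] does not
    increase, which bounds [ln x]; the energy then bounds [y] again on the enlarged range of [x]. *)
Lemma forward_bound f g (x0 y0 : R) : tame f g -> 0 <= x0 -> 0 < y0 ->
  exists2 B : R, 0 < B & forall (x y : R -> R) (T : R), 0 <= T ->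
    x 0 = x0 -> y 0 = y0 ->
    (forall t : R, 0 <= t <= T -> solves f g x y t) ->
    (forall t : R, 0 <= t < T -> 0 < y t) -> x T + y T < B.
Proof.
move=> [h _ [N [X' [eta [X'1 e0 hfar]]]]] x00 y00.
pose X := Num.max X' x0.
have XX : X' <= X by rewrite /X le_max lexx.
have Xx : x0 <= X by rewrite /X le_max lexx orbT.
have X0 : 1 <= X by linarith.
have [C C0 hC] := poly_bound f X.
pose w0 := energy g x0 y0; have w00 : 0 <= w0 by exact: sqrtr_ge0.
pose Y := w0 + C * X.
have Y0 : 0 <= Y by rewrite addr_ge0 // mulr_ge0; linarith.
(* When the abscissa is [X] the nonincreasing quantity is at most [Y^2 + 2 eta ln X], which equals
   [2 eta ln X1]. *)
pose X1 := X * expR (Y ^+ 2 / (2 * eta)).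
have XX1 : X <= X1.
  rewrite /X1 ler_peMr //; first by linarith.
  by rewrite -expR0 ler_expR divr_ge0 ?sqr_ge0 // mulr_ge0 // ltW.
have [C' C'0 hC'] := poly_bound f X1.
exists (X1 + (w0 + C' * X1) + 1) => [|x y T T0 ex ey hs hy].
  have CX : 0 <= C' * X1 by apply: mulr_ge0; linarith.
  by linarith.
have y0p : 0 < y 0 by rewrite ey.
have [ynn xinc] := nonneg_trajectory T0 hs hy y0p.
have xmono s t : 0 <= s -> s <= t -> t <= T -> x s <= x t.
  move=> s0; rewrite le_eqVlt => /predU1P[-> //|st] tT.
  by apply: ltW; exact: xinc.
have xge t : 0 <= t <= T -> x0 <= x t.
  by move=> /andP[t0 tT]; rewrite -ex; apply: xmono.
have nz t : 0 <= t <= T -> x t != 0 \/ y t != 0.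
  move=> /andP[]; rewrite le_eqVlt => /predU1P[<- _|t0 tT].
    by right; rewrite ey gt_eqF.
  by left; rewrite gt_eqF //; have := xinc 0 t (lexx _) t0 tT; rewrite ex; linarith.
have estim (s M K : R) : 0 <= s <= T -> x s <= M -> 0 <= K ->
    (forall z : R, `|z| <= M -> `|f.[z]| <= K) -> y s <= w0 + K * M.
  move=> /andP[s0 sT] xsM K0 hK.
  have := @energy_variation R f g x y 0 s K 1 h s0 _ (or_introl erefl).
  have H1 t : 0 <= t <= s -> solves f g x y t by move=> ?; apply: hs; linarith.
  have H2 t : 0 <= t <= s -> 0 <= 1 * y t by move=> ?; rewrite mul1r; apply: ynn; linarith.
  have H3 t : 0 <= t <= s -> x t != 0 \/ y t != 0 by move=> ?; apply: nz; linarith.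
  have H4 t : 0 <= t <= s -> `|f.[x t]| <= K.
    move=> /andP[t0 ts]; apply: hK; rewrite ger0_norm.
      by apply: le_trans xsM; apply: xmono.
    by apply: le_trans x00 (xge _ _); linarith.
  move=> /(_ H1 H2 H3 H4); rewrite mul1r ex ey -/w0 ler_norml => /andP[_ H].
  have := energy_ge (x s) (y s) h; rewrite ler_norml => /andP[_ H5].
  have KM : K * (x s - x0) <= K * M by rewrite ler_wpM2l //; linarith.
  by linarith.
have xT : x T <= X1.
  rewrite leNgt; apply/negP => X1T.
  have xc : {within `[0, T], continuous x} by apply: der_within => t /hs [].
  have [|s /andP[s0 sT] xs] := ivt_c (l := X) T0 xc.
    by rewrite ex Xx /=; linarith.
  have ys : y s <= Y by apply: estim => //; [rewrite s0 | rewrite xs | exact: ltW].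
  have sT' : s < T.
    by rewrite lt_neqAle sT andbT; apply/eqP => e; move: X1T; rewrite -e xs; linarith.
  have Xt t : s <= t <= T -> X <= x t.
    by move=> /andP[st tT]; rewrite -xs; apply: xmono.
  pose Q t := y t ^+ 2 * (x t)^-1 ^+ (2 * N + 2) + 2 * eta * ln (x t).
  have : Q T <= Q s.
    rewrite -lerN2; apply: (@nondecr R s T (fun t => - Q t)
      (fun t => 2 * y t * (x t)^-1 ^+ (2 * N + 3) *
         (N.+1%:R * y t ^+ 2 + x t * f.[x t] * y t + x t * g.[x t]
          - eta * x t ^+ (2 * N + 2))) sT).
    - move=> t tsT; have [|h1 h2] := hs t; first by linarith.
      have xp : 0 < x t by have := Xt t tsT; linarith.
      have hV := @derV R x t _ (lt0r_neq0 xp) h1.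
      have hL := @der_ln R x t _ xp h1.
      rewrite /Q; der; rewrite /acc (_ : (2 * N + 2).-1 = (2 * N + 1)%N); last first.
        by rewrite addn2 addn1.
      have -> : (2 * N + 2)%:R = 2 * N.+1%:R :> R by rewrite -natrM mulnS addnC.
      rewrite !exprD !exprVn.
      move: (x t ^+ N) (expf_neq0 N (lt0r_neq0 xp)) => p pn.
      by field; rewrite pn (gt_eqF xp).
    - move=> t tsT; rewrite !mulr_ge0 //.
      + by apply: ynn; linarith.
      + by rewrite exprn_ge0 // invr_ge0; have := Xt t; linarith.
      + rewrite subr_ge0; apply: hfar; have := Xt t; move=> H; rewrite ger0_norm; linarith.
  rewrite /Q; have Q0 : 0 <= y T ^+ 2 * (x T)^-1 ^+ (2 * N + 2).
    by rewrite mulr_ge0 ?sqr_ge0 // exprn_ge0 // invr_ge0; linarith.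
  have Qs : y s ^+ 2 * (x s)^-1 ^+ (2 * N + 2) <= Y ^+ 2.
    rewrite -[leRHS]mulr1; apply: ler_pM.
    - exact: sqr_ge0.
    - by rewrite exprn_ge0 // invr_ge0 xs; linarith.
    - by rewrite lerXn2r ?nnegrE //; apply: ynn; linarith.
    - by rewrite xs exprn_ile1 ?invr_ge0 ?invf_le1 //; linarith.
  have lnT : ln X1 < ln (x T) by rewrite ltr_ln ?posrE //; linarith.
  have lnX : ln X1 = ln X + Y ^+ 2 / (2 * eta).
    by rewrite /X1 lnM ?posrE ?expR_gt0 ?expRK //; linarith.
  rewrite xs => H.
  have : 2 * eta * ln (x T) <= Y ^+ 2 + 2 * eta * ln X by rewrite xs in Qs; linarith.
  apply/negP; rewrite -ltNge.
  have -> : Y ^+ 2 + 2 * eta * ln X = 2 * eta * ln X1.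
    by rewrite lnX; field; rewrite gt_eqF.
  by rewrite ltr_pM2l //; linarith.
have := estim T X1 C' _ xT (ltW C'0) hC'; rewrite lexx T0 => /(_ isT).
by linarith.
Qed.

Lemma norm_pair_cont (x y : R -> R) : continuous x -> continuous y ->
  continuous (fun t => `|x t| + `|y t|).
Proof.
move=> xc yc t; apply: cvgD.
  by apply: (@cvg_norm _ _ _ _ _ x (x t)); exact: xc.
by apply: (@cvg_norm _ _ _ _ _ y (y t)); exact: yc.
Qed.

Lemma tsol_cont f g (B : R) (x y : R -> R) : (forall t, tsol f g B x y t) ->
  continuous x /\ continuous y.
Proof.
by move=> h; split=> t; have [h1 h2] := h t; [exact: der_cont h1 | exact: der_cont h2].
Qed.

(** In a box larger than the a priori bound the truncated solution is genuine as long as [y > 0]: it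
    cannot reach the edge of the box. It cannot keep [y > 0] forever either, since it would linger
    over a compact range of positive abscissae. *)
Theorem quarter_forward f g (x0 y0 : R) : tame f g -> 0 <= x0 -> 0 < y0 ->
  exists (x y : R -> R) (tau : R),
  [/\ 0 < tau, x 0 = x0 /\ y 0 = y0, seg f g x y tau,
      forall t : R, 0 <= t < tau -> 0 < y t & y tau = 0 /\ x0 < x tau].
Proof.
move=> hfg x00 y00; have [B B0 hB] := forward_bound hfg x00 y00.
pose B' := Num.max B (x0 + y0 + 1).
have BB' : B <= B' by rewrite /B' le_max lexx.
have BB'2 : x0 + y0 + 1 <= B' by rewrite /B' le_max lexx orbT.
have B'0 : 0 <= B' by linarith.
have [x [y [ex ey hxy]]] := tsol_exists f g x0 y0 B'0.
have [xc yc] := tsol_cont hxy.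
pose u t := `|x t| + `|y t|.
have uc := norm_pair_cont xc yc.
have u0 : u 0 < B' by rewrite /u ex ey (ger0_norm x00) (gtr0_norm y00); linarith.
have y0p : 0 < y 0 by rewrite ey.
have insolves t : u t <= B' -> solves f g x y t.
  rewrite /u => ut; apply/(@tsolE R f g B') => //.
    by have := normr_ge0 (y t); linarith.
  by have := normr_ge0 (x t); linarith.
have inside T : 0 <= T -> (forall t : R, 0 <= t < T -> 0 < y t) -> u T < B'.
  move=> T0 hy; rewrite ltNge; apply/negP => uT.
  have [c /andP[c0 cT] [uc0 ucl]] :=
    first_hit T0 (continuous_subspaceT (A := `[0, T]) uc) u0 uT.
  have hc t : 0 <= t <= c -> solves f g x y t.
    move=> /andP[t0]; rewrite le_eqVlt => /predU1P[->|tc].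
      by apply: insolves; rewrite /u uc0.
    by apply: insolves; apply: ltW; apply: ucl; rewrite t0.
  have hyc t : 0 <= t < c -> 0 < y t by move=> /andP[? ?]; apply: hy; linarith.
  have := hB x y c (ltW c0) ex ey hc hyc.
  have [ynn xinc] := nonneg_trajectory (ltW c0) hc hyc y0p.
  have := xinc 0 c (lexx _) c0 (lexx _); rewrite ex => xc0.
  have yc0 : 0 <= y c by apply: ynn; rewrite lexx ltW.
  by move: uc0; rewrite /u !ger0_norm //; linarith.
have [T T0 yT] : exists2 T, 0 < T & y T <= 0.
  apply: contrapT => noT.
  have hy t : 0 <= t -> 0 < y t.
    rewrite le_eqVlt => /predU1P[<- //|t0]; rewrite ltNge; apply/negP => yt.
    by apply: noT; exists t.
  have hin t : 0 <= t -> u t < B'.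
    by move=> t0; apply: inside => // s /andP[s0 _]; exact: hy.
  have hsol t : 0 <= t -> solves f g x y t.
    by move=> t0; apply: insolves; apply: ltW; exact: hin.
  have xinc s t : 0 <= s -> s < t -> x s < x t.
    move=> s0 st; apply: (@incr R s t x y st).
      by move=> r srt; have [|? _] := hsol r => //; linarith.
    by move=> r srt; apply: hy; linarith.
  have [hr _ _] := hfg.
  (* Time starts at [1] because [x0] may be [0], while the abscissae must stay away from [0]. *)
  apply: (@no_linger R f g x y 1 (x 1) B' B' hr).
    by have := xinc 0 1 (lexx _) ltr01; rewrite ex; linarith.
  move=> t t1; have t0 : 0 <= t by linarith.
  have := hin t t0; rewrite /u => ut; split; first exact: hsol.
    apply/andP; split; last first.
      by have := ler_norm (x t); have := normr_ge0 (y t); linarith.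
    by move: t1; rewrite le_eqVlt => /predU1P[<-//|t1]; apply: ltW; apply: xinc; linarith.
  by have := normr_ge0 (x t); linarith.
have nyc : {within `[0, T], continuous (fun t => - y t)}.
  by apply: continuous_subspaceT => t; apply: cvgN; exact: yc.
have [||c /andP[c0 cT] [yc0 ybef]] := first_hit (l := 0) (ltW T0) nyc.
- by rewrite oppr_lt0.
- by rewrite oppr_ge0.
have hyc t : 0 <= t < c -> 0 < y t by move=> /ybef; rewrite oppr_lt0.
have hc t : 0 <= t <= c -> solves f g x y t.
  move=> /andP[t0 tc]; apply: insolves; apply: ltW; apply: inside => // s sT.
  by apply: hyc; linarith.
exists x, y, c; split => //.
have [_ xinc] := nonneg_trajectory (ltW c0) hc hyc y0p.
split; last by rewrite -ex; apply: xinc.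
by apply/eqP; rewrite -oppr_eq0 yc0.
Qed.

End QuarterTurns.

Section QuarterDown.
Context {R : realType}.
Implicit Types (f g : {poly R}).

(* [(- y) e^{Kt}] increases while [x >= 0] and [|f(x)| <= K]. *)
Lemma below_axis f g (x y : R -> R) (T : R) : restoring g -> 0 < T ->
  (forall t : R, 0 <= t <= T -> solves f g x y t) ->
  (forall t : R, 0 <= t < T -> 0 < x t) -> 0 <= x T -> y 0 = 0 ->
  forall t : R, 0 < t <= T -> y t < 0.
Proof.
move=> h T0 hs hx xT ey t /andP[t0 tT].
have [B B0 hB] := solves_bounded hs.
have [K K0 hK] := poly_bound f B.
have xnn s : 0 <= s <= T -> 0 <= x s.
  move=> /andP[s0]; rewrite le_eqVlt => /predU1P[->//|sT].
  by apply/ltW/hx; rewrite s0.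
have hf s : 0 <= s <= T -> `|f.[x s]| <= K by move=> /hB [? _]; apply: hK.
have ynp s : 0 <= s <= T -> y s <= 0.
  move=> /andP[s0 sT]; rewrite -oppr_ge0.
  apply: (@gronwall_pos_c R 0 s K (fun t => - y t)
    (fun t => - acc f g (x t) (y t)) (fun t => - f.[x t]) s0).
  - by move=> r rs; have [|_ ?] := hs r; [linarith | der].
  - move=> r rs; have [|] := andP (_ : - K <= f.[x r] <= K); last by linarith.
    by rewrite -ler_norml; apply: hf; linarith.
  - move=> r rs; rewrite /acc; have : 0 <= g.[x r]; last by linarith.
    have : 0 <= x r by apply: xnn; linarith.
    rewrite le_eqVlt => /predU1P[<-|?]; first by rewrite restoring_0.
    by apply/ltW/restoring_pos.
  - by rewrite ey oppr0.
have := @incr R 0 t (fun t => - y t * expR (K * t))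
  (fun t => ((K - f.[x t]) * - y t + g.[x t]) * expR (K * t)) t0.
rewrite ey oppr0 mul0r => H; rewrite -oppr_gt0 -(pmulr_lgt0 _ (expR_gt0 (K * t))).
apply: H.
- by move=> s st; have [|_ ?] := hs s; [linarith | der; rewrite /acc; ring].
- move=> s st; rewrite pmulr_lgt0 ?expR_gt0 //.
  have gs : 0 < g.[x s] by apply: restoring_pos => //; apply: hx; linarith.
  have ys : y s <= 0 by apply: ynp; linarith.
  have : `|f.[x s]| <= K by apply: hf; linarith.
  by rewrite ler_norml => /andP[_ ?]; nra.
Qed.

Lemma down_bound f g (x0 : R) : restoring g -> 0 < x0 ->
  exists2 B : R, 0 < B & forall (x y : R -> R) (T : R), 0 < T ->
    x 0 = x0 -> y 0 = 0 ->
    (forall t : R, 0 <= t <= T -> solves f g x y t) ->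
    (forall t : R, 0 <= t < T -> 0 < x t) -> 0 <= x T -> `|x T| + `|y T| < B.
Proof.
move=> h x00; have [C C0 hC] := poly_bound f x0.
pose w0 := energy g x0 0; have w00 : 0 <= w0 by exact: sqrtr_ge0.
have Cx : 0 <= C * x0 by rewrite mulr_ge0 // ltW.
exists (x0 + (w0 + C * x0) + 1) => [|x y T T0 ex ey hs hx xT]; first by linarith.
have yneg := below_axis h T0 hs hx xT ey.
have xnn s : 0 <= s <= T -> 0 <= x s.
  move=> /andP[s0]; rewrite le_eqVlt => /predU1P[->//|sT].
  by apply/ltW/hx; rewrite s0.
have ynp s : 0 <= s <= T -> y s <= 0.
  move=> /andP[]; rewrite le_eqVlt => /predU1P[<- _|s0 sT]; first by rewrite ey.
  by apply/ltW/yneg; rewrite s0.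
have xmono t : 0 <= t <= T -> x t <= x0.
  move=> /andP[t0 tT]; rewrite -ex -lerN2.
  apply: (@nondecr R 0 t (fun s => - x s) (fun s => - y s) t0).
    by move=> s st; have [|? _] := hs s; [linarith | der].
  by move=> s st; rewrite oppr_ge0; apply: ynp; linarith.
have := @energy_variation R f g x y 0 T C (-1) h (ltW T0) hs (or_intror erefl).
have H2 t : 0 <= t <= T -> 0 <= -1 * y t.
  by move=> /ynp ?; rewrite mulN1r oppr_ge0.
have H3 t : 0 <= t <= T -> x t != 0 \/ y t != 0.
  move=> /andP[]; rewrite le_eqVlt => /predU1P[<- _|t0 tT].
    by left; rewrite ex gt_eqF.
  by right; rewrite lt_eqF // yneg // t0.
have H4 t : 0 <= t <= T -> `|f.[x t]| <= C.
  by move=> tT; apply: hC; rewrite ger0_norm ?xmono ?xnn.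
move=> /(_ H2 H3 H4); rewrite mulN1r ex ey -/w0 ler_norml => /andP[_ H].
have TT : 0 <= T <= T by rewrite lexx ltW.
have := energy_ge (x T) (y T) h; have := xmono T TT.
have KM : C * - (x T - x0) <= C * x0 by rewrite ler_wpM2l //; [exact: ltW | linarith].
by rewrite (ger0_norm xT); linarith.
Qed.

(* Near the origin the energy cannot decrease to zero, for
   [|f(x)| <= C |x|] makes its variation quadratic in [x]. *)
Lemma reaches_axis f g (x0 Y : R) (x y : R -> R) : tame f g -> 0 < x0 ->
  x 0 = x0 -> y 0 = 0 ->
  (forall t : R, 0 <= t -> [/\ solves f g x y t, 0 < x t & `|y t| <= Y]) ->
  (forall t : R, 0 < t -> y t < 0) -> False.
Proof.
move=> [h [c [C [d [c0 C0 d0 h2]]]] _] x00 ex ey hs yneg.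
have xdec s t : 0 <= s -> s < t -> x t < x s.
  move=> s0 st; rewrite -ltrN2; apply: (@incr R s t (fun s => - x s) (fun s => - y s) st).
    by move=> r srt; have [|[? _] _ _] := hs r; [linarith | der].
  by move=> r srt; rewrite oppr_gt0; apply: yneg; linarith.
(* At abscissa [d1] the energy is at least [sqrt c * d1]. From there to the axis it varies by at
   most [C d1^2], which the third bound makes at most half of that value, namely the [m] below. *)
pose d1 := Num.min (Num.min d x0) (Num.sqrt c / (2 * C)).
have sc0 : 0 < Num.sqrt c by rewrite sqrtr_gt0.
have d1d : d1 <= d by rewrite /d1 !ge_min lexx.
have d1x : d1 <= x0 by rewrite /d1 !ge_min lexx orbT.
have d1c : d1 <= Num.sqrt c / (2 * C) by rewrite /d1 !ge_min lexx !orbT.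
have d10 : 0 < d1 by rewrite /d1 !lt_min d0 x00 divr_gt0 // mulr_gt0.
pose m := Num.sqrt c * d1 / 2.
have m0 : 0 < m by rewrite divr_gt0 // mulr_gt0.
have [K K0 hK] := poly_lip (prim g) d1.
(* Below [xi] the potential accounts for at most half of [m^2] in the squared energy, so that
   [y^2 > (m / 2)^2] there and [x] decreases at a definite rate. *)
pose xi := Num.min d1 (m ^+ 2 / (4 * K)).
have xi0 : 0 < xi by rewrite /xi lt_min d10 divr_gt0 ?exprn_gt0 // mulr_gt0.
have xid : xi <= d1 by rewrite /xi ge_min lexx.
have xiK : 4 * K * xi <= m ^+ 2.
  have : xi <= m ^+ 2 / (4 * K) by rewrite /xi ge_min lexx orbT.
  by rewrite ler_pdivlMr ?mulr_gt0 // mulrC.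
case: (pselect (exists2 t, 0 <= t & x t < xi)) => [[t2 t20 xt2]|no]; last first.
  apply: (@no_linger R f g x y 0 xi x0 Y h xi0) => t t0.
  have [? ? ?] := hs t t0; split => //; apply/andP; split.
    by rewrite leNgt; apply/negP => xt; apply: no; exists t.
  move: t0; rewrite le_eqVlt => /predU1P[<-|t0]; first by rewrite ex.
  by rewrite -ex; apply/ltW/xdec.
have xc : {within `[0, t2], continuous x}.
  by apply: der_within => t tt; have [|[]] := hs t; first by linarith.
have [|t1 /andP[t10 t12] xt1] := ivt_d (l := d1) t20 xc.
  by rewrite ex d1x andbT; linarith.
have far t : t2 <= t -> y t <= - (m / 2).
  move=> tt; have t1t : t1 <= t by linarith.
  have tpos : 0 < t.
    have : t1 < t2 by (rewrite lt_neqAle t12 andbT; apply/eqP => e; move: xt2; rewrite -e xt1; linarith).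
    linarith.
  have xt : x t <= x t2.
    by move: tt; rewrite le_eqVlt => /predU1P[->//|tt]; apply/ltW/xdec.
  have [_ xtp _] := hs t (ltW tpos).
  have := @energy_variation R f g x y t1 t (C * d1) (-1) h t1t _ (or_intror erefl).
  have H1 s : t1 <= s <= t -> solves f g x y s.
    by move=> st; have [] := hs s; [linarith|].
  have H2 s : t1 <= s <= t -> 0 <= -1 * y s.
    move=> st; rewrite mulN1r oppr_ge0.
    have : 0 <= s by linarith.
    by rewrite le_eqVlt => /predU1P[<-|s0]; [rewrite ey | apply/ltW/yneg].
  have H3 s : t1 <= s <= t -> x s != 0 \/ y s != 0.
    by move=> st; left; rewrite gt_eqF //; have [] := hs s; [linarith|].
  have H4 s : t1 <= s <= t -> `|f.[x s]| <= C * d1.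
    move=> /andP[s1 st]; have [|_ xs _] := hs s; first by linarith.
    have xs1 : x s <= d1.
      rewrite -xt1; move: s1; rewrite le_eqVlt => /predU1P[->//|s1].
      by apply/ltW/xdec => //.
    have [|h3 _] := h2 (x s); first by rewrite gtr0_norm //; linarith.
    by apply: le_trans h3 _; rewrite gtr0_norm // ler_wpM2l // ltW.
  move=> /(_ H1 H2 H3 H4); rewrite mulN1r xt1 ler_norml => /andP[H _].
  have E1 : Num.sqrt c * d1 <= energy g d1 (y t1).
    apply: energy_ge_G => //; first by rewrite mulr_ge0 // ltW.
    rewrite exprMn sqr_sqrtr ?(ltW c0) //.
    have [|_] := h2 d1; first by rewrite gtr0_norm.
    by have := sqr_ge0 (y t1); linarith.
  have V : C * d1 * - (x t - d1) <= m.
    have Cd : C * d1 <= Num.sqrt c / 2.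
      by move: d1c; rewrite ler_pdivlMr ?mulr_gt0 //; linarith.
    have : C * d1 * - (x t - d1) <= (Num.sqrt c / 2) * d1.
      apply: ler_pM => //; first by rewrite mulr_ge0 // ltW.
        by linarith.
      by linarith.
    by rewrite /m; linarith.
  have E2 : m <= energy g (x t) (y t).
    by move: E1 V H; rewrite /m; linarith.
  have E3 : m ^+ 2 <= y t ^+ 2 + 2 * (prim g).[x t].
    have := E2; rewrite -(ler_pXn2r (n := 2)) ?nnegrE ?sqrtr_ge0 ?(ltW m0) //.
    rewrite /energy sqr_sqrtr //.
    by have := sqr_ge0 (y t); have := G_ge0 (x t) h; linarith.
  have E4 : (prim g).[x t] <= K * x t.
    have xtd : `|x t| <= d1 by rewrite gtr0_norm //; linarith.
    have zd : `|0 : R| <= d1 by rewrite normr0 ltW.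
    have := hK (x t) 0 xtd zd; rewrite prim0 !subr0 (gtr0_norm xtp) => H5.
    exact: le_trans (ler_norm _) H5.
  have xKt : K * x t <= K * xi by rewrite ler_wpM2l ?(ltW K0) //; linarith.
  have yt := yneg t tpos.
  rewrite leNgt; apply/negP => yt2.
  have : y t ^+ 2 < (m / 2) ^+ 2 by nra.
  have -> : (m / 2) ^+ 2 = m ^+ 2 / 4 by field.
  by have : 0 < m ^+ 2 := exprn_gt0 2 m0; move: E3 E4 xKt xiK; clear; linarith.
have [_ xt20 _] := hs t2 t20.
pose T := t2 + 2 * x t2 / m.
have tT : t2 <= T by rewrite /T lerDl divr_ge0 ?mulr_ge0 // ltW.
have : x T + m / 2 * T <= x t2 + m / 2 * t2.
  rewrite -lerN2; apply: (@nondecr R t2 T (fun t => - (x t + m / 2 * t))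
    (fun t => - y t - m / 2) tT).
    by move=> r rt; have [|[? _] _ _] := hs r; [linarith | der; ring].
  by move=> r /andP[/ltW /far]; linarith.
have -> : m / 2 * T = m / 2 * t2 + x t2 by rewrite /T; field; rewrite gt_eqF.
have [|_ xT _] := hs T; first by linarith.
by linarith.
Qed.

Theorem quarter_down f g (x0 : R) : tame f g -> 0 < x0 ->
  exists (x y : R -> R) (tau : R),
  [/\ 0 < tau, x 0 = x0 /\ y 0 = 0, seg f g x y tau,
      forall t : R, 0 < t <= tau -> y t < 0 & x tau = 0].
Proof.
move=> hfg x00; have [h _ _] := hfg; have [B B0 hB] := down_bound f h x00.
pose B' := B + x0 + 1.
have B'0 : 0 <= B' by rewrite /B'; linarith.
have [x [y [ex ey hxy]]] := tsol_exists f g x0 0 B'0.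
have [xc yc] := tsol_cont hxy.
pose u t := `|x t| + `|y t|.
have uc := norm_pair_cont xc yc.
have u0 : u 0 < B' by rewrite /u ex ey normr0 addr0 gtr0_norm // /B'; linarith.
have insolves t : u t <= B' -> solves f g x y t.
  rewrite /u => ut; apply/(@tsolE R f g B') => //.
    by have := normr_ge0 (y t); move: (`|x t|) ut => z; linarith.
  by have := normr_ge0 (x t); move: (`|y t|) ut => z; linarith.
have inside T : 0 < T -> (forall t : R, 0 <= t < T -> 0 < x t) -> 0 <= x T -> u T < B'.
  move=> T0 hx xT; rewrite ltNge; apply/negP => uT.
  have [c /andP[c0 cT] [uc0 ucl]] :=
    first_hit (ltW T0) (continuous_subspaceT (A := `[0, T]) uc) u0 uT.
  have hc t : 0 <= t <= c -> solves f g x y t.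
    move=> /andP[t0]; rewrite le_eqVlt => /predU1P[->|tc].
      by apply: insolves; rewrite /u uc0.
    by apply: insolves; apply: ltW; apply: ucl; rewrite t0.
  have hxc t : 0 <= t < c -> 0 < x t by move=> /andP[? ?]; apply: hx; linarith.
  have xc0 : 0 <= x c.
    by move: cT; rewrite le_eqVlt => /predU1P[->//|cT]; apply/ltW/hx; rewrite cT ltW.
  have := hB x y c c0 ex ey hc hxc xc0.
  by move: uc0; rewrite /u /B'; move: (`|x c|) => z; linarith.
have [T T0 xT] : exists2 T, 0 < T & x T <= 0.
  apply: contrapT => noT.
  have hx t : 0 <= t -> 0 < x t.
    rewrite le_eqVlt => /predU1P[<-|t0]; first by rewrite ex.
    by rewrite ltNge; apply/negP => xt; apply: noT; exists t.
  have hin t : 0 <= t -> u t < B'.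
    rewrite le_eqVlt => /predU1P[<- //|t0].
    by apply: inside => // [s /andP[s0 _]|]; [exact: hx | apply/ltW/hx/ltW].
  have hsol t : 0 <= t -> solves f g x y t.
    by move=> t0; apply: insolves; apply: ltW; exact: hin.
  apply: (@reaches_axis f g x0 B' x y hfg x00 ex ey) => t t0.
    split; [exact: hsol | exact: hx |].
    have := hin t t0; rewrite /u; have := normr_ge0 (x t).
    by move: (`|y t|) => z; linarith.
  apply: (@below_axis f g x y t h t0) => //; last by rewrite t0 lexx.
  - by move=> s /andP[s0 _]; exact: hsol.
  - by move=> s /andP[s0 _]; exact: hx.
  - by apply/ltW/hx/ltW.
have nxc : {within `[0, T], continuous (fun t => - x t)}.
  by apply: continuous_subspaceT => t; apply: cvgN; exact: xc.
have [||c /andP[c0 cT] [xc0 xbef]] := first_hit (l := 0) (ltW T0) nxc.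
- by rewrite ex oppr_lt0.
- by rewrite oppr_ge0.
have xc1 : x c = 0 by apply/eqP; rewrite -oppr_eq0 xc0.
have hxc t : 0 <= t < c -> 0 < x t by move=> /xbef; rewrite oppr_lt0.
have hc t : 0 <= t <= c -> solves f g x y t.
  move=> /andP[]; rewrite le_eqVlt => /predU1P[<- _|t0].
    by apply: insolves; exact: ltW.
  move=> tc; apply: insolves; apply: ltW; apply: inside => //.
    by move=> s sT; apply: hxc; linarith.
  by move: tc; rewrite le_eqVlt => /predU1P[->|tc]; [rewrite xc1 | apply/ltW/hxc; rewrite ltW].
exists x, y, c; split => // t; apply: (below_axis h c0 hc hxc) => //.
by rewrite xc1.
Qed.

End QuarterDown.

(** * Half orbits and cycles *)

Section Comparison.
Context {R : realType}.
Implicit Types (f g : {poly R}).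

Lemma within_comp (a b c d : R) (u v : R -> R) :
  {within `[a, b], continuous u} -> {within `[c, d], continuous v} ->
  (forall t : R, a <= t <= b -> c <= u t <= d) ->
  {within `[a, b], continuous (fun t => v (u t))}.
Proof.
move=> uc vc h; apply/subspace_continuousP => t tab.
have tab' : a <= t <= b by move: tab; rewrite /= in_itv.
have cu := (subspace_continuousP _ _).1 uc t tab.
have utd : `[c, d]%classic (u t) by rewrite /= in_itv /= h.
have cv := (subspace_continuousP _ _).1 vc (u t) utd.
apply: (@cvg_comp _ _ _ u v _ (within `[c, d]%classic (nbhs (u t)))) cv => A hA.
have := cu (fun z => c <= z <= d -> A z).
rewrite /nbhs /= => H; have {}H := H _; move: H.
have : nbhs (u t) (fun z => c <= z <= d -> A z).
  by move: hA; rewrite /within /=; apply: filterS => z hz ?; apply: hz; rewrite /= in_itv.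
move=> hB H; have := H hB; rewrite /within /=; apply: filterS => z hz zab.
apply: hz => //; apply: h; by move: zab; rewrite /= in_itv.
Qed.

Lemma within_limit_ge0 (a b : R) (u : R -> R) : a < b ->
  {within `[a, b], continuous u} -> (forall t : R, a <= t < b -> 0 <= u t) -> 0 <= u b.
Proof.
move=> ab uc h; rewrite leNgt; apply/negP => ub.
have ua : 0 <= u a by apply: h; rewrite lexx.
have [|c /andP[ac cb] uE] := ivt_d (l := u b / 2) (ltW ab) uc; first by linarith.
move: cb; rewrite le_eqVlt => /predU1P[e|cb]; first by move: uE ub; rewrite e; linarith.
by have := h c; rewrite ac cb uE => /(_ isT); linarith.
Qed.

(** The derivative may vanish at the ends, as it does for the potential along a quarter arc. Hence
    continuity of the inverse is stated on the closed interval and differentiability only inside. *)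
Lemma inverse_function (H dH : R -> R) (a b : R) : a < b ->
  (forall t : R, a <= t <= b -> is_derive t (1 : R) H (dH t)) ->
  (forall t : R, a < t < b -> 0 < dH t) ->
  exists S : R -> R, [/\ forall t : R, a <= t <= b -> S (H t) = t,
    forall h : R, H a <= h <= H b -> a <= S h <= b /\ H (S h) = h,
    {within `[H a, H b], continuous S} &
    forall h : R, H a < h < H b -> a < S h < b /\
      is_derive h (1 : R) S (dH (S h))^-1].
Proof.
move=> ab hd hp.
have Hinc s t : a <= s -> s < t -> t <= b -> H s < H t.
  move=> as_ st tb; apply: (@incr R s t H dH st).
    by move=> r rst; apply: hd; linarith.
  by move=> r rst; apply: hp; linarith.
have Hc : {within `[a, b], continuous H} by apply: der_within hd.
have ex h : exists s, H a <= h <= H b -> a <= s <= b /\ H s = h.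
  case: (pselect (H a <= h <= H b)) => [hab|no]; last by exists a.
  by have [s sab sE] := ivt_c (ltW ab) Hc hab; exists s.
have [S hS] := choice ex.
have HS h : H a <= h <= H b -> a <= S h <= b /\ H (S h) = h by exact: hS.
have SH t : a <= t <= b -> S (H t) = t.
  move=> tab; have [|] := HS (H t).
    have Hle u v : a <= u -> u <= v -> v <= b -> H u <= H v.
      move=> au; rewrite le_eqVlt => /predU1P[-> //|uv] vb.
      exact/ltW/Hinc.
    by move: tab => /andP[at_ tb]; rewrite !Hle.
  move=> Sab SE; apply/eqP; rewrite eq_le !leNgt; apply/andP; split; apply/negP => lt_.
    by have := Hinc t (S (H t)); rewrite SE ltxx; case/andP: tab => -> _; case/andP: Sab => _ ->; rewrite lt_ => /(_ isT isT isT).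
  by have := Hinc (S (H t)) t; rewrite SE ltxx; case/andP: tab => _ ->; case/andP: Sab => -> _; rewrite lt_ => /(_ isT isT isT).
exists S; split => //.
  exact: (@segment_can_le_continuous R a b H S (ltW ab) Hc (fun t tab => SH t tab)).
move=> h hab; have [|Sab SE] := HS h; first by linarith.
have Sab' : a < S h < b.
  case/andP: Sab; rewrite le_eqVlt => /predU1P[e|->].
    by move: hab; rewrite -SE -e ltxx.
  rewrite le_eqVlt => /predU1P[e|->] //.
  by move: hab; rewrite -SE e ltxx andbF.
split => //; rewrite -[X in is_derive X _ _ _]SE.
have Snear : \forall z \near S h, a < z < b.
  have : nbhs (S h) `]a, b[%classic.
    by apply: open_nbhs_nbhs; split; [exact: itv_open | rewrite /= in_itv].
  by apply: filterS => z; rewrite /= in_itv.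
apply: is_derive_inverse.
- by near=> z; apply: SH; have : a < z < b by [near: z]; linarith.
- near=> z; have zab : a < z < b by near: z.
  by apply: (der_cont (a := dH z)); apply: hd; linarith.
- by apply: hd; linarith.
- by rewrite gt_eqF // hp.
Unshelve. all: by end_near. Qed.

(* Along the matched arcs the difference [D] of the values of [y + F(x)]
   satisfies [D' >= k D] with [k = g1 / y2 >= 0]. *)
Theorem compare_arcs f1 g1 f2 g2 (x1 y1 x2 y2 : R -> R) (t1 t2 : R) :
  restoring g1 -> restoring g2 -> 0 < t1 -> 0 < t2 ->
  seg f1 g1 x1 y1 t1 -> seg f2 g2 x2 y2 t2 ->
  x1 0 = 0 -> x2 0 = 0 -> y1 0 = y2 0 ->
  (forall t : R, 0 <= t < t1 -> 0 < y1 t) -> y1 t1 = 0 ->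
  (forall t : R, 0 <= t < t2 -> 0 < y2 t) -> y2 t2 = 0 ->
  (forall u1 u2 : R, 0 < u1 -> 0 < u2 -> (prim g1).[u1] = (prim g2).[u2] ->
     (prim g1).[u1] <= (prim g1).[x1 t1] -> (prim f1).[u1] <= (prim f2).[u2]) ->
  (prim g1).[x1 t1] <= (prim g2).[x2 t2] ->
  (prim g1).[x1 t1] = (prim g2).[x2 t2] /\ (prim f2).[x2 t2] <= (prim f1).[x1 t1].
Proof.
move=> r1 r2 t10 t20 s1 s2 ex1 ex2 ey yp1 yt1 yp2 yt2 hF hG.
have y10 : 0 < y1 0 by apply: yp1; rewrite lexx.
have y20 : 0 < y2 0 by apply: yp2; rewrite lexx.
have [_ xi1] := nonneg_trajectory (ltW t10) s1 yp1 y10.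
have [_ xi2] := nonneg_trajectory (ltW t20) s2 yp2 y20.
have xp1 t : 0 < t <= t1 -> 0 < x1 t.
  by move=> /andP[a b]; rewrite -ex1; apply: xi1.
have xp2 t : 0 < t <= t2 -> 0 < x2 t.
  by move=> /andP[a b]; rewrite -ex2; apply: xi2.
pose H1 t := (prim g1).[x1 t]; pose H2 t := (prim g2).[x2 t].
have d1 t : 0 <= t <= t1 -> is_derive t (1 : R) H1 (g1.[x1 t] * y1 t).
  by move=> /s1 [h _]; apply: der_prim.
have d2 t : 0 <= t <= t2 -> is_derive t (1 : R) H2 (g2.[x2 t] * y2 t).
  by move=> /s2 [h _]; apply: der_prim.
have p1 t : 0 < t < t1 -> 0 < g1.[x1 t] * y1 t.
  by move=> tt; rewrite mulr_gt0 ?yp1 ?restoring_pos ?xp1 //; linarith.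
have p2 t : 0 < t < t2 -> 0 < g2.[x2 t] * y2 t.
  by move=> tt; rewrite mulr_gt0 ?yp2 ?restoring_pos ?xp2 //; linarith.
have [S [SH HS Sc Sd]] := inverse_function t20 d2 p2.
have H10 : H1 0 = 0 by rewrite /H1 ex1 prim0.
have H20 : H2 0 = 0 by rewrite /H2 ex2 prim0.
have Hinc s t : 0 <= s -> s < t -> t <= t1 -> H1 s < H1 t.
  move=> s0 st tt; apply: (@incr R s t H1 (fun t => g1.[x1 t] * y1 t) st).
    by move=> r rst; apply: d1; linarith.
  by move=> r rst; apply: p1; linarith.
have Hrange t : 0 <= t <= t1 -> H2 0 <= H1 t <= H2 t2.
  move=> /andP[t0 tt]; rewrite H20; apply/andP; split; first exact: G_ge0.
  apply: le_trans hG; move: tt; rewrite le_eqVlt => /predU1P[->//|tt].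
  by apply/ltW/Hinc.
have Hrange' t : 0 < t < t1 -> H2 0 < H1 t < H2 t2.
  move=> /andP[t0 tt]; rewrite H20 -H10 Hinc ?(ltW tt) //=.
  by apply: lt_le_trans hG; apply: Hinc => //; exact: ltW.
(* The time on the second arc at which the potential equals that of the first arc at time [t]. *)
pose s t := S (H1 t).
have sc : {within `[0, t1], continuous s}.
  by apply: (within_comp (c := H2 0) (d := H2 t2)) => //; exact: der_within d1.
have srange t : 0 <= t <= t1 -> 0 <= s t <= t2 by move=> /Hrange /HS [].
have srange' t : 0 < t < t1 -> 0 < s t < t2 by move=> /Hrange' /Sd [].
have S0 : S 0 = 0 by rewrite -{1}H20 SH // lexx ltW.
have s0 : s 0 = 0 by rewrite /s H10 S0.
have srange'' t : 0 <= t < t1 -> 0 <= s t < t2.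
  move=> /andP[]; rewrite le_eqVlt => /predU1P[<- _|t0 tt].
    by rewrite s0 lexx t20.
  have : 0 < s t < t2 by apply: srange'; rewrite t0.
  by move=> /andP[/ltW -> ->].
have sE t : 0 <= t <= t1 -> H2 (s t) = H1 t by move=> /Hrange /HS [].
have sd t : 0 < t < t1 -> is_derive t (1 : R) s
    ((g1.[x1 t] * y1 t) * (g2.[x2 (s t)] * y2 (s t))^-1).
  move=> tt; have [_ hS] := Sd _ (Hrange' t tt).
  have h1 : is_derive t (1 : R) H1 (g1.[x1 t] * y1 t) by apply: d1; linarith.
  by apply: (der_eq (der_comp h1 hS)); rewrite mulrC.
pose Z1 t := y1 t + (prim f1).[x1 t]; pose Z2 t := y2 t + (prim f2).[x2 t].
have dZ1 t : 0 <= t <= t1 -> is_derive t (1 : R) Z1 (- g1.[x1 t]).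
  by move=> /s1 [h h']; have hp := der_prim f1 h; rewrite /Z1; der; rewrite /acc; ring.
have dZ2 t : 0 <= t <= t2 -> is_derive t (1 : R) Z2 (- g2.[x2 t]).
  by move=> /s2 [h h']; have hp := der_prim f2 h; rewrite /Z2; der; rewrite /acc; ring.
pose D t := Z1 t - Z2 (s t).
have Z2c : {within `[0, t1], continuous (fun t => Z2 (s t))}.
  by apply: (within_comp (c := 0) (d := t2)) => //; exact: der_within dZ2.
have Dc : {within `[0, t1], continuous D}.
  move=> t; apply: (@continuousB R R (subspace `[0, t1]) Z1 (fun t => Z2 (s t))).
    exact: (der_within dZ1).
  exact: Z2c.
have y2c : {within `[0, t1], continuous (fun t => y2 (s t))}.
  apply: (within_comp (c := 0) (d := t2)) => //.
  by apply: (der_within (du := fun t => acc f2 g2 (x2 t) (y2 t))) => t /s2 [].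
have FF t : 0 < t <= t1 -> (prim f1).[x1 t] <= (prim f2).[x2 (s t)].
  move=> /andP[t0 tt]; have tt' : 0 <= t <= t1 by rewrite tt ltW.
  apply: hF; first by apply: xp1; rewrite t0.
  - apply: xp2; have /andP[st0 ->] := srange t tt'; rewrite andbT lt_neqAle st0 andbT.
    apply/eqP => e; have := sE t tt'; rewrite -e H20 => /esym H1t.
    by have := Hinc 0 t (lexx _) t0 tt; rewrite H10 H1t ltxx.
  - exact: (esym (sE t tt')).
  - by move: tt; rewrite le_eqVlt => /predU1P[->//|tt]; apply/ltW/Hinc => //; exact: ltW.
(* The coefficient [g1 / y2] may blow up where the second arc ends, so Gronwall's inequality is used
   up to [t < t1] and the end is reached by continuity. *)
have Dnn t : 0 <= t < t1 -> 0 <= D t.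
  move=> /andP[t0 tt].
  have sub (u : R -> R) : {within `[0, t1], continuous u} -> {within `[0, t], continuous u}.
    apply: continuous_subspaceW => z; rewrite /= !in_itv /= => /andP[-> zt] /=.
    exact: le_trans zt (ltW tt).
  have [c ct hc] := EVT_min t0 (sub _ y2c).
  have c' : 0 <= c <= t by move: ct; rewrite in_itv.
  have yc0 : 0 < y2 (s c) by apply: yp2; apply: srange''; linarith.
  have gc : {within `[0, t], continuous (fun t => g1.[x1 t])}.
    apply: (der_within (du := fun t => g1^`().[x1 t] * y1 t)) => r rt.
    by have [|h _] := s1 r; [linarith | exact: der_poly].
  have [K K0 hK] := within_bounded gc.
  apply: (@gronwall_pos R 0 t (K / y2 (s c)) D
    (fun t => g1.[x1 t] * (y1 t - y2 (s t)) / y2 (s t))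
    (fun t => g1.[x1 t] / y2 (s t)) t0 (sub _ Dc)).
  - move=> r rt; have rt' : 0 < r < t1 by linarith.
    have hs := sd r rt'; have hz1 : is_derive r (1 : R) Z1 (- g1.[x1 r]) by apply: dZ1; linarith.
    have /andP[sr0 sr1] := srange' r rt'.
    have hz2 : is_derive (s r) (1 : R) Z2 (- g2.[x2 (s r)]) by apply: dZ2; linarith.
    have hc2 := der_comp (u := Z2) hs hz2.
    rewrite /D; der.
    have n1 : y2 (s r) != 0 by rewrite gt_eqF // yp2 // sr1 ltW.
    have n2 : g2.[x2 (s r)] != 0.
      by rewrite gt_eqF // restoring_pos // xp2 // sr0 ltW.
    by field; rewrite n1 n2.
  - move=> r rt; have rt' : 0 <= r <= t by linarith.
    have y2r : y2 (s c) <= y2 (s r) by apply: hc; rewrite in_itv.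
    have := hK r rt' => gK.
    apply: (@le_trans _ _ (K / y2 (s r))).
      rewrite ler_wpM2r ?invr_ge0 //; last exact: le_trans (ler_norm _) gK.
      by linarith.
    by rewrite ler_wpM2l // lef_pV2 ?posrE //; linarith.
  - move=> r rt; have rt' : 0 < r <= t1 by linarith.
    have gr : 0 < g1.[x1 r] by rewrite restoring_pos // xp1.
    have yr : 0 < y2 (s r) by apply: yp2; apply: srange''; linarith.
    rewrite mulrAC ler_wpM2r ?invr_ge0 ?(ltW yr) // ler_wpM2l ?(ltW gr) //.
    by rewrite /D /Z1 /Z2; have := FF r rt'; linarith.
  - by rewrite /D /Z1 /Z2 s0 ey ex1 ex2 !prim0 subrr.
have t1t1 : 0 < t1 <= t1 by rewrite t10 lexx.
have t1t1' : 0 <= t1 <= t1 by rewrite ltW // lexx.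
have := within_limit_ge0 t10 Dc Dnn; rewrite /D /Z1 /Z2 yt1 add0r => Dt.
have Ft := FF t1 t1t1.
(* If the second arc continued beyond the matched time, [y2 > 0] there, together with [F1 <= F2],
   would make [D] negative. *)
have st1 : s t1 = t2.
  have := srange t1 t1t1' => /andP[a]; rewrite le_eqVlt => /predU1P[//|b].
  by have := yp2 (s t1); rewrite a b => /(_ isT); linarith.
split; first by have := sE t1 t1t1'; rewrite st1.
by move: Dt; rewrite st1 yt2; linarith.
Qed.

End Comparison.

Section Cycles.
Context {R : realType}.
Implicit Types (f g : {poly R}).

Lemma flipN (p : {poly R}) : flip (- p) = - flip p.
Proof. by rewrite /flip raddfN. Qed.

Lemma prim_flipE f (x : R) : (prim (- flip f)).[x] = (prim f).[- x].
Proof. by rewrite primN prim_flip opprK. Qed.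

Definition ordered_below f g (h : R) : Prop := forall u1 u2 : R, u1 < 0 -> 0 < u2 ->
  (prim g).[u1] = (prim g).[u2] -> (prim g).[u2] <= h -> (prim f).[u1] <= (prim f).[u2].

Lemma rev_y_seg f g (x y : R -> R) (T : R) : seg f g x y T ->
  seg (- f) g (fun t => x (T - t)) (fun t => - y (T - t)) T.
Proof. by move=> h t tT; apply: solves_rev_y; apply: h; linarith. Qed.

Lemma rot_seg f g (x y : R -> R) (T : R) : seg f g x y T ->
  seg (flip f) (- flip g) (fun t => - x t) (fun t => - y t) T.
Proof. by move=> h t tT; apply: solves_rot; apply: h. Qed.

Lemma rot_segK f g (x y : R -> R) (T : R) : seg (flip f) (- flip g) x y T ->
  seg f g (fun t => - x t) (fun t => - y t) T.
Proof. by move=> /rot_seg; rewrite flipN !flipK opprK. Qed.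

(** The half orbit joins a quarter down to the vertical axis and the half turn of a forward quarter.
    Both arcs must start on the axis to be compared, so the first is run backwards, which replaces
    [f] by [- f]. The two implications come from taking the arcs in either order; a strict ordering
    uses only the first, the balanced case uses both. *)
Theorem lower_half f g (l : R) : tame f g -> 0 < l ->
  exists (x y : R -> R) (T l' : R),
  [/\ [/\ 0 < T, 0 < l', x 0 = l /\ y 0 = 0 & x T = - l' /\ y T = 0],
      seg f g x y T, forall t : R, 0 < t < T -> y t < 0,
      ordered_below f g (prim g).[l] -> (prim g).[l] <= (prim g).[- l'] ->
        (prim g).[l] = (prim g).[- l'] /\ (prim f).[l] <= (prim f).[- l'] &
      ordered_below (- f) g (prim g).[- l'] -> (prim g).[- l'] <= (prim g).[l] ->
        (prim g).[l] = (prim g).[- l']].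
Proof.
move=> hfg l0; have [rg _ _] := hfg.
have [x1 [y1 [t1 [t10 [ex1 ey1] s1 yn1 xt1]]]] := quarter_down hfg l0.
have y1t : 0 < - y1 t1 by rewrite oppr_gt0 yn1 // t10 lexx.
have hfg' := tame_rot hfg; have [rg' _ _] := hfg'.
have [x2 [y2 [t2 [t20 [ex2 ey2] s2 yp2 [yt2 xt2]]]]] :=
  quarter_forward hfg' (lexx 0) y1t.
have s2' := rot_segK s2.
have [||X [Y [sXY e1 e2]]] := seg_cat (ltW t10) (ltW t20) s1 s2'.
  by rewrite ex2 oppr0.
  by rewrite ey2 opprK.
exists X, Y, (t1 + t2), (x2 t2).
have t12 : 0 < t1 + t2 by linarith.
have [X0 Y0] : X 0 = x1 0 /\ Y 0 = y1 0 by apply: e1; rewrite lexx ltW.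
have [XT YT] : X (t1 + t2) = - x2 t2 /\ Y (t1 + t2) = - y2 t2.
  by rewrite addrC; apply: e2; rewrite lexx ltW.
have s1r := rev_y_seg s1.
have ny1 t : 0 <= t < t1 -> 0 < - y1 (t1 - t).
  by move=> tt; rewrite oppr_gt0; apply: yn1; linarith.
split => //.
- by split; [linarith | linarith | rewrite X0 Y0 | rewrite XT YT yt2 oppr0].
- move=> t /andP[t0 tT]; case: (lerP t t1) => tt.
    by have [|_ ->] := e1 t; [rewrite ltW | apply: yn1; rewrite t0].
  have [|_] := e2 (t - t1); first by linarith.
  by rewrite subrK => ->; rewrite oppr_lt0; apply: yp2; linarith.
- move=> ord Gle.
  have := @compare_arcs R (- f) g (flip f) (- flip g) _ _ x2 y2 t1 t2 rg rg' t10 t20 s1r s2.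
  rewrite !subrr !subr0 xt1 ex2 ey2 ex1 ey1 oppr0.
  move=> /(_ erefl erefl erefl ny1 erefl yp2 yt2).
  rewrite !prim_flipE prim_flip primN => -[] //; last first.
    by move=> -> ; rewrite lerN2.
  move=> u1 u2 u10 u20; rewrite prim_flipE prim_flip primN lerN2 => e u1l.
  by apply: ord => //; rewrite oppr_lt0.
- move=> ord Gle.
  have := @compare_arcs R (flip f) (- flip g) (- f) g x2 y2 _ _ t2 t1 rg' rg t20 t10 s2 s1r.
  rewrite !subrr !subr0 xt1 ex2 ey2 ex1 ey1 oppr0.
  move=> /(_ erefl erefl erefl yp2 yt2 ny1 erefl).
  rewrite !prim_flipE => -[] //.
  move=> u1 u2 u10 u20; rewrite prim_flipE prim_flip primN lerN2 => e u1l.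
  have := ord (- u1) u2; rewrite !primN lerN2; apply=> //; first by rewrite oppr_lt0.
  by rewrite -e.
Qed.

Definition balanced f g : Prop := forall u1 u2 : R, u1 < 0 -> 0 < u2 ->
  (prim g).[u1] = (prim g).[u2] -> (prim f).[u1] = (prim f).[u2].

Lemma balanced_rot f g : balanced f g -> balanced (flip f) (- flip g).
Proof.
move=> H u1 u2 u10 u20; rewrite !prim_flipE !prim_flip => e; congr (- _).
by apply/esym/H => //; [rewrite oppr_lt0 | rewrite oppr_gt0].
Qed.

Lemma balancedN f g : balanced f g -> balanced (- f) g.
Proof. by move=> H u1 u2 u10 u20 e; rewrite !primN (H _ _ u10 u20 e). Qed.

Lemma balanced_ordered f g h : balanced f g -> ordered_below f g h.
Proof. by move=> H u1 u2 u10 u20 e _; rewrite (H _ _ u10 u20 e). Qed.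

(** Each half turn preserves the potential at the tips, and the potential is injective on the
    positive half axis, so two half turns close up. *)
Theorem cycle_structure f g (l : R) : tame f g -> balanced f g -> 0 < l ->
  exists (x y : R -> R) (t1 T l' : R),
  [/\ [/\ 0 < t1, t1 < T, 0 < l' & (prim g).[- l'] = (prim g).[l]],
      sol f g x y, periodic x y T,
      [/\ x 0 = l, y 0 = 0, x t1 = - l' & y t1 = 0] &
      (forall t : R, 0 < t < t1 -> y t < 0) /\ (forall t : R, t1 < t < T -> 0 < y t)].
Proof.
move=> hfg hb l0; have [rg _ _] := hfg.
have half f' g' k : tame f' g' -> balanced f' g' -> 0 < k ->
    exists (x y : R -> R) (T l' : R),
  [/\ [/\ 0 < T, 0 < l', x 0 = k /\ y 0 = 0 & x T = - l' /\ y T = 0],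
      seg f' g' x y T, forall t : R, 0 < t < T -> y t < 0 &
      (prim g').[- l'] = (prim g').[k]].
  move=> h b k0; have [x [y [T [l' [H1 H2 H3 H4 H5]]]]] := lower_half h k0.
  exists x, y, T, l'; split => //.
  case: (lerP (prim g').[k] (prim g').[- l']) => Gle.
    by have [-> _] := H4 (balanced_ordered b) Gle.
  by rewrite (H5 (balanced_ordered (balancedN b)) (ltW Gle)).
have [x1 [y1 [t1 [l' [[t10 l'0 [ex1 ey1] [xt1 yt1]] s1 yn1 G1]]]]] := half _ _ _ hfg hb l0.
have [x2 [y2 [t2 [l2 [[t20 l20 [ex2 ey2] [xt2 yt2]] s2 yn2 G2]]]]] :=
  half _ _ _ (tame_rot hfg) (balanced_rot hb) l'0.
have s2' := rot_segK s2.
have El : l2 = l.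
  move: G2; rewrite !prim_flipE opprK G1 => e.
  by apply/eqP; rewrite eq_le; apply/andP; split;
    apply: (G_inj rg (ltW _) (ltW _)) => //; rewrite e.
have [||X [Y [sXY e1 e2]]] := seg_cat (ltW t10) (ltW t20) s1 s2'.
  by rewrite ex2.
  by rewrite ey2 oppr0.
have t12 : 0 < t1 + t2 by linarith.
have [X0 Y0] : X 0 = x1 0 /\ Y 0 = y1 0 by apply: e1; rewrite lexx ltW.
have [X1 Y1] : X t1 = x1 t1 /\ Y t1 = y1 t1 by apply: e1; rewrite lexx ltW.
have [XT YT] : X (t1 + t2) = - x2 t2 /\ Y (t1 + t2) = - y2 t2.
  by rewrite addrC; apply: e2; rewrite lexx ltW.
have [||x [y [sxy per e3]]] := seg_periodic t12 sXY.
  by rewrite XT xt2 opprK El X0 ex1.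
  by rewrite YT yt2 oppr0 Y0 ey1.
exists x, y, t1, (t1 + t2), l'; split => //.
- by split => //; linarith.
- have [|-> ->] := e3 0; first by rewrite lexx ltW.
  by have [|-> ->] := e3 t1; [linarith | rewrite X0 Y0 X1 Y1].
- split => t tt.
    have [|_ ->] := e3 t; first by linarith.
    by have [|_ ->] := e1 t; [linarith | exact: yn1].
  have [|_ ->] := e3 t; first by linarith.
  have [|_] := e2 (t - t1); first by linarith.
  by rewrite subrK => ->; rewrite oppr_gt0; apply: yn2; linarith.
Qed.

(** The crossing with [x > 0] provides the right tip; the two crossings together show that the orbit
    is not constant. *)
Definition has_cycle f g (x0 y0 : R) : Prop := exists (x y : R -> R) (T : R),
  [/\ sol f g x y, 0 < T, periodic x y T, x 0 = x0 /\ y 0 = y0 &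
      (exists2 t, 0 < x t & y t = 0) /\ (exists2 t, x t < 0 & y t = 0)].

Lemma has_cycle_rot f g (x0 y0 : R) :
  has_cycle (flip f) (- flip g) (- x0) (- y0) -> has_cycle f g x0 y0.
Proof.
move=> [x [y [T [h T0 per [ex ey] [[t t1 t2] [s s1 s2]]]]]].
exists (fun t => - x t), (fun t => - y t), T; split => //.
- by move=> r; have := solves_rot (h r); rewrite flipN !flipK opprK.
- by move=> r; have [-> ->] := per r.
- by rewrite ex ey !opprK.
- split; [exists s | exists t]; rewrite ?s2 ?t2 ?oppr0 //.
    by rewrite oppr_gt0.
  by rewrite oppr_lt0.
Qed.

Lemma has_cycle_rev f g (x0 y0 : R) :
  has_cycle (- f) g x0 (- y0) -> has_cycle f g x0 y0.
Proof.
move=> [x [y [T [h T0 per [ex ey] [[t t1 t2] [s s1 s2]]]]]].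
exists (fun t => x (0 - t)), (fun t => - y (0 - t)), T; split => //.
- by move=> r; have := solves_rev_y (h (0 - r)); rewrite opprK.
- move=> r; have [e1 e2] := per (0 - (r + T)).
  by rewrite opprD addrA subrK in e1 e2; rewrite opprD addrA e1 e2.
- by rewrite !subr0 ex ey opprK.
- by split; [exists (0 - t) | exists (0 - s)]; rewrite subKr ?t2 ?s2 ?oppr0.
Qed.

Lemma has_cycle_axis f g (x0 : R) : tame f g -> balanced f g -> x0 != 0 ->
  has_cycle f g x0 0.
Proof.
move=> hfg hb; have pos f' g' k : tame f' g' -> balanced f' g' -> 0 < k -> has_cycle f' g' k 0.
  move=> h b k0; have [x [y [t1 [T [l' [[t10 tT l'0 _] sxy per [ex ey xt yt] _]]]]]] :=
    cycle_structure h b k0.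
  exists x, y, T; split => //; first exact: lt_trans tT.
  split; first by exists 0; rewrite ?ex.
  by exists t1; rewrite // xt oppr_lt0.
case: (ltgtP x0 0) => // x00 _; last exact: pos.
apply: has_cycle_rot; rewrite oppr0; apply: pos.
- exact: tame_rot.
- exact: balanced_rot.
- by rewrite oppr_gt0.
Qed.

(** From [x >= 0], [y > 0] a forward quarter leads to the horizontal axis, through whose points
    cycles are already known; backward uniqueness puts the starting point on such a cycle. The
    symmetries settle the other points off the axis. *)
Theorem has_cycle_all f g (x0 y0 : R) : tame f g -> balanced f g ->
  x0 != 0 \/ y0 != 0 -> has_cycle f g x0 y0.
Proof.
have quad f' g' a b : tame f' g' -> balanced f' g' -> 0 <= a -> 0 < b -> has_cycle f' g' a b.
  move=> h hb a0 b0.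
  have [x [y [t [t0 [ex ey] sxy _ [yt xt]]]]] := quarter_forward h a0 b0.
  have xt0 : x t != 0 by rewrite gt_eqF //; linarith.
  have [X [Y [T [sXY T0 per [eX eY] [[s s1 s2] [r r1 r2]]]]]] := has_cycle_axis h hb xt0.
  exists (fun u => X (u - t)), (fun u => Y (u - t)), T.
  have sXY' := sol_shift (- t) sXY.
  split => //.
  - by move=> u; have [e1 e2] := per (u - t); rewrite !(addrAC u T) e1 e2.
  - rewrite -ex -ey.
    have [||-> ->] := @solves_unique_back R f' g' 0 t (fun u => X (u - t))
      (fun u => Y (u - t)) x y (ltW t0) (fun u _ => sXY' u) sxy.
    + by rewrite subrr eX.
    + by rewrite subrr eY yt.
    + by [].
  - by split; [exists (s + t) | exists (r + t)]; rewrite addrK.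
have half f' g' a b : tame f' g' -> balanced f' g' -> 0 < b -> has_cycle f' g' a b.
  move=> h hb b0; case: (lerP 0 a) => a0; first exact: quad.
  apply: has_cycle_rot; apply: has_cycle_rev; rewrite opprK; apply: quad => //.
  - by apply: tameN; exact: tame_rot.
  - by apply: balancedN; exact: balanced_rot.
  - by rewrite oppr_ge0 ltW.
move=> h hb; case: (ltgtP y0 0) => y00.
- move=> _; apply: has_cycle_rev; apply: half; rewrite ?oppr_gt0 //.
    exact: tameN.
  exact: balancedN.
- by move=> _; exact: half.
- by rewrite y00 => -[] // x00; exact: has_cycle_axis.
Qed.

End Cycles.

(** * Necessity of the growth condition *)

Section Escape.
Context {R : realType}.
Implicit Types (f g p q : {poly R}).

Lemma coefM_top p q (m n : nat) : (size p <= m.+1)%N -> (size q <= n.+1)%N ->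
  (p * q)`_(m + n) = p`_m * q`_n.
Proof.
move=> sp sq; have hm : (m < (m + n).+1)%N by rewrite ltnS leq_addr.
rewrite coefM (bigD1 (Ordinal hm)) //= addKn big1 ?addr0 // => -[i /= ilt] /eqP ne.
have {}ne : i <> m by move=> e; apply: ne; apply: val_inj.
case: (ltngtP i m) => // im.
- by rewrite [q`_ _]nth_default ?mulr0 //; apply: leq_trans sq _; lia.
- by rewrite [p`_ _]nth_default ?mul0r //; exact: leq_trans sp _.
Qed.

Lemma size_prim p n : (size p <= n)%N -> (size (prim p) <= n.+1)%N.
Proof.
move=> sp; rewrite /prim; apply: (leq_trans (size_sum _ _ _)).
apply/bigmax_leqP => i _; apply: leq_trans (size_scale_leq _ _) _.
by rewrite size_polyXn; have := ltn_ord i; lia.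
Qed.

Lemma coef_prim p i : (prim p)`_i.+1 = p`_i / i.+1%:R.
Proof.
have := congr1 (fun q : {poly R} => q`_i) (deriv_prim p).
rewrite /= coef_deriv => <-; by rewrite -[X in _ = X / _]mulr_natr mulfK.
Qed.

Definition all_periodic f g : Prop := forall x0 y0 : R, x0 != 0 \/ y0 != 0 ->
  exists (x y : R -> R) (T : R),
  [/\ sol f g x y, 0 < T, periodic x y T, x 0 = x0 & y 0 = y0].

Lemma all_periodicN f g : all_periodic f g -> all_periodic (- f) g.
Proof.
move=> H x0 y0 nz; have [|x [y [T [h T0 per ex ey]]]] := H x0 (- y0).
  by case: nz => ?; [left | right; rewrite oppr_eq0].
exists (fun t => x (0 - t)), (fun t => - y (0 - t)), T; split => //.
- by move=> r; exact: solves_rev_y.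
- move=> r; have [e1 e2] := per (0 - (r + T)).
  by rewrite opprD addrA subrK in e1 e2; rewrite opprD addrA e1 e2.
- by rewrite subr0.
- by rewrite subr0 ey opprK.
Qed.

Lemma all_periodic_rot f g : all_periodic f g -> all_periodic (flip f) (- flip g).
Proof.
move=> H x0 y0 nz; have [|x [y [T [h T0 per ex ey]]]] := H (- x0) (- y0).
  by case: nz => ?; [left | right]; rewrite oppr_eq0.
exists (fun t => - x t), (fun t => - y t), T; split => //.
- by move=> r; exact: solves_rot.
- by move=> r; have [-> ->] := per r.
- by rewrite ex opprK.
- by rewrite ey opprK.
Qed.

(** Along orbits the derivative of [y - p(x)] is [- (f + p') (y - p)] plus a term that is
    nonnegative for [x >= X]. An orbit started on the graph of [p] stays above it, so it moves to
    the right forever. *)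
Lemma barrier_escape f g p (X : R) : 1 <= X ->
  (forall x : R, X <= x -> 0 < p.[x] /\
     p.[x] * p^`().[x] + f.[x] * p.[x] + g.[x] <= 0) ->
  ~ all_periodic f g.
Proof.
move=> X1 hp H; have X0 : X + 1 != 0 by rewrite gt_eqF //; linarith.
have [x [y [T [h T0 per ex ey]]]] := H (X + 1) p.[X + 1] (or_introl X0).
have step t : 0 <= t -> (forall s : R, 0 <= s <= t -> X <= x s) ->
    X + 1 <= x t /\ 0 < y t.
  move=> t0 hx.
  have [B B0 hB] := @solves_bounded R f g 0 t x y (fun s _ => h s).
  have [K K0 hK] := poly_bound (f + p^`()) B.
  have above s : 0 <= s <= t -> 0 <= y s - p.[x s].
    move=> /andP[s0 st]; apply: (@gronwall_pos_c R 0 s K (fun s => y s - p.[x s])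
      (fun s => acc f g (x s) (y s) - p^`().[x s] * y s)
      (fun s => - (f + p^`()).[x s]) s0).
    - by move=> r _; have [h1 h2] := h r; der.
    - move=> r rs; have rt : 0 <= r <= t by linarith.
      have [/hK + _] := hB r rt; rewrite ler_norml; linarith.
    - move=> r rs; have [|_ +] := hp (x r); first by apply: hx; linarith.
      by rewrite /acc hornerD; linarith.
    - by rewrite ex ey subrr.
  have ypos s : 0 <= s <= t -> 0 < y s.
    by move=> st; have := above s st; have [|+ _] := hp (x s); [exact: hx | linarith].
  split; last by apply: ypos; rewrite t0 lexx.
  rewrite -ex; apply: (@nondecr R 0 t x y t0).
    by move=> s _; have [] := h s.
  by move=> s st; apply/ltW/ypos; linarith.
have xge t : 0 <= t -> X <= x t.
  move=> t0; rewrite leNgt; apply/negP => xt.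
  have nxc : {within `[0, t], continuous (fun s => - x s)}.
    by apply: (der_within (du := fun s => - y s)) => s _; have [h1 _] := h s; der.
  have [||c /andP[c0 ct] [xc bef]] := first_hit (l := - X) t0 nxc.
  - by rewrite ex; linarith.
  - by rewrite lerN2 ltW.
  have [|+ _] := step c (ltW c0).
    move=> s /andP[s0]; rewrite le_eqVlt => /predU1P[->|sc]; first by linarith.
    by have := bef s; rewrite s0 sc => /(_ isT); linarith.
  by linarith.
have ypos t : 0 <= t -> 0 < y t.
  by move=> t0; have [|//] := step t t0; move=> s /andP[s0 _]; exact: xge.
have : x 0 < x T.
  apply: (@incr R 0 T x y T0); first by move=> s _; have [] := h s.
  by move=> s /andP[/ltW s0 _]; exact: ypos.
by have [e _] := per 0; rewrite add0r in e; rewrite e ltxx.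
Qed.

(* The barrier is [y = - F(x) / 2 - K f(x)]: the terms of degree [2 n + 1] cancel
   up to a nonpositive coefficient, and for large [K] the next one is negative. *)
Theorem slow_growth_escape f g (n : nat) : size f = n.+1 -> (size g <= 2 * n + 2)%N ->
  4 * n.+1%:R * g`_(2 * n + 1) <= f`_n ^+ 2 -> ~ all_periodic f g.
Proof.
move=> sf sg hg.
(* Reversing time and the sign of [y] changes the sign of [f]. With [f_n < 0] the barrier has the
   positive top coefficient [- f_n / (2 (n + 1))]. *)
wlog b0 : f sf hg / f`_n < 0.
  move=> W; case: (ltgtP f`_n 0) => b0.
  - exact: W.
  - move=> H; apply: (W (- f)); rewrite ?size_polyN ?coefN ?sqrrN ?oppr_lt0 //.
    exact: all_periodicN.
  - have : f != 0 by rewrite -size_poly_eq0 sf.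
    by rewrite -lead_coef_eq0 lead_coefE sf /= b0 eqxx.
set b := f`_n in b0 hg; pose F := prim f.
have sF : (size F <= n.+2)%N by apply: size_prim; rewrite sf.
have Fn : F`_n.+1 = b / n.+1%:R by rewrite coef_prim.
have n0 : (0 : R) < n.+1%:R by rewrite ltr0n.
have FfE : (F * f)`_(2 * n + 1) = b ^+ 2 / n.+1%:R.
  have -> : (2 * n + 1 = n.+1 + n)%N by lia.
  by rewrite (coefM_top sF) ?sf // Fn expr2 mulrAC.
have ffE : (f * f)`_(2 * n) = b ^+ 2.
  have -> : (2 * n = n + n)%N by lia.
  by rewrite coefM_top ?sf // -expr2.
have szM p q k l : (size p <= k)%N -> (size q <= l)%N -> (size (p * q)%R <= (k + l).-1)%N.
  by move=> h1 h2; apply: leq_trans (size_polyMleq _ _) _; lia.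
have szd p k : (size p <= k.+1)%N -> (size p^`() <= k)%N.
  case: (eqVneq p 0) => [->|p0] h; first by rewrite deriv0 size_poly0.
  by rewrite -ltnS; apply: leq_trans (lt_size_deriv p0) h.
(* For the barrier [p], the product [x (p p' + f p + g)] expands as [x R0 + K R1 + K^2 R2]. In
   degree [2 n + 1] the coefficient of [R0] is nonpositive by hypothesis, that of [R1] is negative
   and that of [R2] vanishes. *)
pose R0 := g - 4^-1 *: (F * f).
pose R1 := 'X * (2^-1 *: (F * f)^`() - f * f).
pose R2 := 'X * (f * f^`()).
have sFf : (size (F * f)%R <= (2 * n + 1).+1)%N.
  by apply: leq_trans (szM _ _ _ _ sF (eq_leq sf)) _; lia.
have sff : (size (f * f)%R <= (2 * n).+1)%N.
  by apply: leq_trans (szM _ _ _ _ (eq_leq sf) (eq_leq sf)) _; lia.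
have s0 : (size R0 <= (2 * n + 1).+1)%N.
  rewrite /R0; apply: leq_trans (size_polyD _ _) _; rewrite geq_max size_polyN.
  apply/andP; split; first by apply: leq_trans sg _; lia.
  exact: leq_trans (size_scale_leq _ _) sFf.
have s1 : (size R1 <= (2 * n + 1).+1)%N.
  rewrite /R1; apply: leq_trans (szM _ _ 2%N (2 * n + 1)%N _ _) _; last by lia.
    by rewrite size_polyX.
  apply: leq_trans (size_polyD _ _) _; rewrite geq_max size_polyN.
  apply/andP; split; last by apply: leq_trans sff _; lia.
  by apply: leq_trans (size_scale_leq _ _) _; exact: szd.
have s2 : (size R2 <= (2 * n + 1).+1)%N.
  rewrite /R2; apply: leq_trans (szM _ _ 2%N (2 * n)%N _ _) _; last by lia.
    by rewrite size_polyX.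
  apply: leq_trans (szM _ _ n.+1 n _ _) _; [by rewrite sf | by apply: szd; rewrite sf | lia].
have c0 : R0`_(2 * n + 1) <= 0.
  rewrite /R0 coefB coefZ FfE.
  have : g`_(2 * n + 1) <= b ^+ 2 / (4 * n.+1%:R).
    by rewrite ler_pdivlMr ?mulr_gt0 // mulrC.
  have -> : b ^+ 2 / (4 * n.+1%:R) = 4^-1 * (b ^+ 2 / n.+1%:R).
    by field; rewrite gt_eqF.
  by rewrite subr_le0.
have c1 : R1`_(2 * n + 1) = - (b ^+ 2 / (2 * n.+1%:R)).
  rewrite /R1 coefXM addn1 /= coefB coefZ coef_deriv.
  have FfE' := FfE; rewrite addn1 in FfE'; rewrite FfE' ffE -[b ^+ 2 / _ *+ _]mulr_natr.
  have -> : (2 * n).+1%:R = 2 * n.+1%:R - 1 :> R.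
    by rewrite -!natr1 natrM; ring.
  by field; rewrite gt_eqF.
have c2 : R2`_(2 * n + 1) = 0.
  rewrite /R2 coefXM addn1 /= nth_default //.
  case: (n) sf => [|k] sf'; first by rewrite (size1_polyC (eq_leq sf')) derivC mulr0 size_poly0.
  apply: leq_trans (szM _ _ k.+2 k.+1 _ _) _; [by rewrite sf' | by apply: szd; rewrite sf' | lia].
have [C0 C00 h0] := poly_asym s0; have [C1 C10 h1] := poly_asym s1.
have [C2 C20 h2] := poly_asym s2.
rewrite !addn1 /= in h0 h1 h2 c0 c1 c2.
pose r := b ^+ 2 / (2 * n.+1%:R).
have r0 : 0 < r by rewrite divr_gt0 ?exprn_even_gt0 ?mulr_gt0 //= lt_eqF.
(* The negative term [K r x^(2n+1)] then exceeds the error [C0 x^(2n+1)] of [x R0] by a full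
   [x^(2n+1)], which absorbs the remaining errors for large [x]. *)
pose K := (C0 + 1) / r.
have K0 : 0 < K by rewrite divr_gt0 //; linarith.
pose p : {poly R} := - 2^-1 *: F - K *: f.
have sp : (size p <= n.+2)%N.
  apply: leq_trans (size_polyD _ _) _; rewrite geq_max size_polyN.
  apply/andP; split; apply: leq_trans (size_scale_leq _ _) _ => //.
  by rewrite sf.
have cp : p`_n.+1 = - b / (2 * n.+1%:R).
  rewrite /p coefB !coefZ Fn [f`_ _]nth_default ?sf //.
  by field; rewrite gt_eqF.
have cp0 : 0 < p`_n.+1 by rewrite cp divr_gt0 ?mulr_gt0 ?oppr_gt0.
have [C3 C30 h3] := poly_asym sp.
pose X := 1 + (K * C1 + K ^+ 2 * C2) + C3 / p`_n.+1.
have KC : 0 <= K * C1 + K ^+ 2 * C2.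
  by rewrite addr_ge0 // mulr_ge0 ?exprn_ge0 // ltW.
have C3p : 0 <= C3 / p`_n.+1 by rewrite divr_ge0 // ltW.
apply: (@barrier_escape f g p X); first by rewrite /X; linarith.
move=> x Xx; have x1 : 1 <= x by move: Xx; rewrite /X; linarith.
have x0 : 0 < x by linarith.
have nx : 1 <= `|x| by rewrite gtr0_norm.
split.
  have := h3 x nx; rewrite (gtr0_norm x0) /= ler_norml => /andP[H _].
  have : C3 * x ^+ n < p`_n.+1 * x ^+ n.+1.
    rewrite exprS mulrA ltr_pM2r ?exprn_gt0 //.
    rewrite -ltr_pdivrMl // mulrC; move: Xx; rewrite /X; linarith.
  by linarith.
have E : x * (p.[x] * p^`().[x] + f.[x] * p.[x] + g.[x]) =
    x * R0.[x] + K * R1.[x] + K ^+ 2 * R2.[x].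
  have dF : F^`() = f by exact: deriv_prim.
  rewrite /R0 /R1 /R2 /p !(derivB, derivZ, derivM, dF) !(hornerD, hornerN, hornerM, hornerZ, hornerX).
  by field.
rewrite -(pmulr_rle0 _ x0) E.
have := h0 x nx; have := h1 x nx; have := h2 x nx.
rewrite c1 c2 mul0r subr0 (gtr0_norm x0) !ler_norml => /andP[_ B2] /andP[_ B1] /andP[_ B0].
set z := x ^+ (2 * n) in B0 B1 B2; have z0 : 0 < z by exact: exprn_gt0.
have xzE : x ^+ (2 * n).+1 = x * z by rewrite exprS.
rewrite xzE in B0 B1.
have B0' : R0.[x] <= C0 * z.
  have : R0`_(2 * n).+1 * (x * z) <= 0.
    by apply: mulr_le0_ge0 => //; apply: mulr_ge0; exact: ltW.
  by linarith.
have B1' : K * R1.[x] <= K * (- (b ^+ 2 / (2 * n.+1%:R)) * (x * z) + C1 * z).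
  by rewrite ler_wpM2l ?(ltW K0) // -lerBlDl.
have B2' : K ^+ 2 * R2.[x] <= K ^+ 2 * (C2 * z) by rewrite ler_wpM2l ?exprn_ge0 ?(ltW K0).
have B0'' : x * R0.[x] <= x * (C0 * z) by rewrite ler_wpM2l // ltW.
have Kr : K * (b ^+ 2 / (2 * n.+1%:R)) = C0 + 1 by rewrite -/r /K divfK // gt_eqF.
have Xz : (K * C1 + K ^+ 2 * C2) * z <= x * z.
  by rewrite ler_wpM2r ?(ltW z0) //; move: Xx; rewrite /X; linarith.
have : K * (- (b ^+ 2 / (2 * n.+1%:R)) * (x * z) + C1 * z) =
  - (K * (b ^+ 2 / (2 * n.+1%:R))) * (x * z) + K * C1 * z by ring.
rewrite Kr => E2; rewrite E2 in B1'.
by linarith.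
Qed.

End Escape.

(** * Necessity of the symmetry condition *)

Section Spiral.
Context {R : realType}.
Implicit Types (f g : {poly R}).

Definition strictly_ordered f g (h : R) : Prop := forall u1 u2 : R, u1 < 0 -> 0 < u2 ->
  (prim g).[u1] = (prim g).[u2] -> (prim g).[u2] <= h -> (prim f).[u1] < (prim f).[u2].

Lemma half_turn_shrinks f g (h l : R) : tame f g -> strictly_ordered f g h ->
  0 < l -> (prim g).[l] <= h -> exists (x y : R -> R) (T l' : R),
  [/\ 0 < T /\ 0 < l', seg f g x y T, x 0 = l /\ y 0 = 0, x T = - l' /\ y T = 0 &
      (prim g).[- l'] < (prim g).[l]].
Proof.
move=> hfg ord l0 Gl.
have [x [y [T [l' [[T0 l'0 [ex ey] [xT yT]] s _ H _]]]]] := lower_half hfg l0.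
exists x, y, T, l'; split => //; rewrite ltNge; apply/negP => Gle.
have [|e Fle] := H _ Gle.
  by move=> u1 u2 u10 u20 e Gu; apply/ltW/ord => //; exact: le_trans Gl.
have := ord (- l') l; rewrite oppr_lt0 => /(_ l'0 l0 (esym e) Gl).
by rewrite ltNge Fle.
Qed.

Lemma strictly_ordered_rot f g h : strictly_ordered f g h ->
  strictly_ordered (flip f) (- flip g) h.
Proof.
move=> H u1 u2 u10 u20; rewrite !prim_flipE !prim_flip ltrN2 => e u2h.
by apply: H => //; [rewrite oppr_lt0 | rewrite oppr_gt0 | rewrite e].
Qed.

Lemma sol_rest f g (x y : R -> R) (t : R) : restoring g -> sol f g x y ->
  x t = 0 -> y t = 0 -> forall s, x s = 0 /\ y s = 0.
Proof.
move=> rg h xt yt.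
have z : sol f g (fun=> 0) (fun=> 0).
  move=> s; split; first exact: derC.
  by apply: (der_eq (derC s 0)); rewrite /acc restoring_0 // mulr0 subr0 oppr0.
exact: (sol_unique h z xt yt).
Qed.

(** By compactness a periodic orbit has a crossing of the half axis [x >= 0] nearest to the origin.
    Two half turns from it lead to a strictly nearer crossing of the same orbit. *)
Theorem spiral_not_periodic f g (h : R) : tame f g -> 0 < h ->
  strictly_ordered f g h -> ~ all_periodic f g.
Proof.
move=> hfg h0 ord per; have [rg _ _] := hfg.
have [K K0 hK] := poly_lip (prim g) 1.
pose l := Num.min 1 (h / K).
have l0 : 0 < l by rewrite /l lt_min ltr01 divr_gt0.
have l1 : l <= 1 by rewrite /l ge_min lexx.
have Gl : (prim g).[l] <= h.
  have lK : l <= h / K by rewrite /l ge_min lexx orbT.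
  have n1 : `|l| <= 1 by rewrite gtr0_norm.
  have n0 : `|0 : R| <= 1 by rewrite normr0.
  have := hK l 0 n1 n0; rewrite prim0 !subr0 (gtr0_norm l0) => H.
  apply: le_trans (ler_norm _) (le_trans H _).
  by rewrite mulrC -ler_pdivlMr.
have [|X [Y [T [sXY T0 pXY eX eY]]]] := per l 0; first by left; rewrite gt_eqF.
pose A := `[0, T]%classic `&` (Y @^-1` [set 0] `&` X @^-1` [set z | 0 <= z]).
have Xc : continuous X by move=> t; have [h1 _] := sXY t; exact: der_cont h1.
have Yc : continuous Y by move=> t; have [_ h1] := sXY t; exact: der_cont h1.
have cA : compact A.
  apply: compact_closedI; first exact: segment_compact.
  apply: closedI.
    exact: ((continuous_closedP Y).1 Yc _ (@closed_eq R 0)).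
  exact: ((continuous_closedP X).1 Xc _ (@closed_ge R 0)).
have A0 : A 0 by rewrite /A /= in_itv /= lexx ltW // eX eY ltW.
have [tm Atm hmin] := compact_EVT_min (ex_intro A 0 A0) cA (continuous_subspaceT Xc).
rewrite inE in Atm; have [tmT [/= Ytm Xtm]] := Atm.
have xm0 : 0 < X tm.
  rewrite lt_neqAle Xtm andbT; apply/eqP => e.
  have [e0 _] := sol_rest rg sXY (esym e) Ytm 0.
  by move: l0; rewrite -eX e0 ltxx.
have xml : X tm <= l.
  by rewrite -eX; apply: hmin; rewrite inE.
have Gxm : (prim g).[X tm] <= h.
  apply: le_trans Gl; move: xml; rewrite le_eqVlt => /predU1P[->//|xml].
  by apply/ltW/G_incr => //; exact: ltW.
have [x1 [y1 [t1 [l1' [[t10 l10] s1 [ex1 ey1] [xt1 yt1] G1]]]]] :=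
  half_turn_shrinks hfg ord xm0 Gxm.
have G1h : (prim (- flip g)).[l1'] <= h by rewrite prim_flipE; exact: le_trans (ltW G1) Gxm.
have [x2 [y2 [t2 [l2 [[t20 l20] s2 [ex2 ey2] [xt2 yt2] G2]]]]] :=
  half_turn_shrinks (tame_rot hfg) (strictly_ordered_rot ord) l10 G1h.
have s2' := rot_segK s2.
have sh := sol_shift tm sXY.
have [|| E1 E2] := @solves_unique R f g 0 t1 _ _ x1 y1 (ltW t10) (fun t _ => sh t) s1.
  by rewrite add0r ex1.
  by rewrite add0r ey1.
have sh2 := sol_shift (t1 + tm) sXY.
have [|| E3 E4] := @solves_unique R f g 0 t2 _ _ _ _ (ltW t20) (fun t _ => sh2 t) s2'.
  by rewrite add0r E1 xt1 ex2.
  by rewrite add0r E2 yt1 ey2 oppr0.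
have [s sT [Es1 Es2]] := periodic_reduce T0 pXY (t2 + (t1 + tm)).
have Xs : X s = l2 by rewrite -Es1 E3 xt2 opprK.
have : X tm <= X s.
  apply: hmin; rewrite inE /A /= in_itv /= -Es2 E4 yt2 oppr0 Xs (ltW l20).
  by split; [linarith | ].
rewrite Xs leNgt => /negP; apply.
rewrite ltNge; apply/negP => le_.
have : (prim g).[X tm] <= (prim g).[l2].
  move: le_; rewrite le_eqVlt => /predU1P[->//|lt_].
  by apply/ltW/G_incr => //; exact: ltW.
by move: G1 G2; rewrite !prim_flipE opprK => *; linarith.
Qed.

End Spiral.

(** * An algebraic equation satisfied by [F - F o sigma] *)

Section Elimination.
Context {R : realType}.
Implicit Types (F G : {poly R}).

(* [M] is the matrix of multiplication by [F(x) - F(z)] on the free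
   [R[x]]-module [R[x][z] / (G(z) - G(x))]. *)
Lemma eliminate F G : (1 < size G)%N -> exists2 A : {poly {poly R}}, A != 0 &
  forall x z : R, G.[x] = G.[z] -> A.[(F.[x] - F.[z])%:P].[x] = 0.
Proof.
move=> sG; pose c := lead_coef G.
have G0 : G != 0 by rewrite -size_poly_gt0 ltnW.
have c0 : c != 0 by rewrite lead_coef_eq0.
pose G1 := c^-1 *: G.
have sG1 : size G1 = size G by rewrite size_scale // invr_eq0.
pose p : {poly {poly R}} := map_poly polyC G1 - G1%:P.
have smap : size (map_poly (@polyC R) G1) = size G.
  by rewrite size_map_inj_poly ?sG1 //; exact: polyC_inj.
have lt1 : (size (G1%:P : {poly {poly R}}) < size (map_poly (@polyC R) G1))%N.
  by rewrite smap; apply: leq_ltn_trans (size_polyC_leq1 _) sG.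
have pm : p \is monic.
  rewrite monicE lead_coefDl ?size_polyN // lead_coef_map_inj //; last exact: polyC_inj.
  by rewrite lead_coefZ mulVf // polyC1.
have sp : size p = size G.
  by rewrite /p size_polyDl ?size_polyN // smap.
pose q : {poly {poly R}} := F%:P - map_poly polyC F.
pose d := (size p).-1.
have spd : size p = d.+1 by rewrite prednK // sp ltnW.
pose M : 'M[{poly R}]_d := \matrix_(i, j) (Pdiv.Ring.rmodp (q * 'X^j) p)`_i.
exists (char_poly M); first by rewrite monic_neq0 // char_poly_monic.
move=> x z Gxz; pose ev := horner_eval x.
have evh (B : {poly {poly R}}) (t : R) : (map_poly ev B).[t] = B.[t%:P].[x].
  by have := horner_map (horner_eval x) B t%:P; rewrite /= !horner_evalE hornerC.
have evC (B : {poly R}) (t : R) : (map_poly ev (map_poly polyC B)).[t] = B.[t].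
  congr horner; rewrite -map_poly_comp; apply: map_poly_id => u _ /=.
  by rewrite /ev horner_evalE hornerC.
rewrite -evh map_char_poly; set D := F.[x] - F.[z].
have evp : (map_poly ev p).[z] = 0.
  rewrite rmorphB /= hornerD hornerN evC map_polyC /= hornerC horner_evalE.
  by rewrite /G1 !hornerZ Gxz subrr.
have evq : (map_poly ev q).[z] = D.
  by rewrite rmorphB /= hornerD hornerN evC map_polyC /= hornerC horner_evalE.
apply/rootP; rewrite -eigenvalue_root_char; apply/eigenvalueP.
(* At a [z] with [G(z) = G(x)], reduction modulo [p] does not change values at [z]; so the powers of
   [z] form a left eigenvector with eigenvalue [F(x) - F(z)]. *)
exists (\row_j z ^+ j).
  apply/rowP => j; rewrite !mxE.
  have -> : \sum_j0 (\row_j1 z ^+ j1) 0 j0 * (map_mx ev M) j0 j =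
      (map_poly ev (Pdiv.Ring.rmodp (q * 'X^j) p)).[z].
    rewrite (@horner_coef_wide _ d); last first.
      apply: leq_trans (size_poly _ _) _; rewrite -ltnS -spd.
      by rewrite Pdiv.Ring.ltn_rmodpN0 // monic_neq0.
    apply: eq_bigr => i _; rewrite !mxE mulrC coef_map; congr (_ * _).
  have := Pdiv.RingMonic.rdivp_eq pm (q * 'X^j) => /(congr1 (fun B => (map_poly ev B).[z])).
  rewrite rmorphD !rmorphM /= map_polyXn hornerD !hornerM evp mulr0 add0r hornerXn evq.
  by move=> <-.
apply/eqP => /rowP /(_ (Ordinal (_ : (0 < d)%N))).
have d0 : (0 < d)%N by rewrite -ltnS -spd sp.
by move=> /(_ d0) /eqP; rewrite !mxE expr0 oner_eq0.
Qed.

End Elimination.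

(** * Vanishing of [F - F o sigma] when all orbits are periodic *)

Section Balance.
Context {R : realType}.
Implicit Types (f g : {poly R}).

Lemma poly_right_order (p : {poly R}) (a : R) : p != 0 -> exists (k : nat) (e c : R),
  [/\ 0 < e, 0 < c & forall x : R, a < x < a + e -> c * (x - a) ^+ k <= `|p.[x]|].
Proof.
move=> p0; have [k [q]] := multiplicity_XsubC p a; rewrite p0 /= => qa pE.
have qa0 : 0 < `|q.[a]| by rewrite normr_gt0.
have [K K0 hK] := poly_lip q (`|a| + 1).
pose e := Num.min 1 (`|q.[a]| / (2 * K)).
have e0 : 0 < e by rewrite /e lt_min ltr01 divr_gt0 // mulr_gt0.
have e1 : e <= 1 by rewrite /e ge_min lexx.
have eK : K * e <= `|q.[a]| / 2.
  have : e <= `|q.[a]| / (2 * K) by rewrite /e ge_min lexx orbT.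
  by rewrite ler_pdivlMr ?mulr_gt0 // => H; linarith.
exists k, e, (`|q.[a]| / 2); split => //; first by rewrite divr_gt0.
move=> x /andP[ax xe].
rewrite pE hornerM horner_exp hornerXsubC normrM normrX [`|x - a|]gtr0_norm; last by linarith.
rewrite ler_wpM2r ?exprn_ge0 //; first by linarith.
have xa1 : `|x| <= `|a| + 1.
  have := ler_normD a (x - a); rewrite addrC subrK.
  by rewrite [`|x - a|]gtr0_norm; linarith.
have aa1 : `|a| <= `|a| + 1 by linarith.
have := hK a x aa1 xa1; rewrite distrC [`|a - x|]distrC [`|x - a|]gtr0_norm; last by linarith.
move=> H; have := ler_distD q.[x] q.[a] 0; rewrite !subr0 distrC => H2.
have : K * (x - a) <= K * e by rewrite ler_wpM2l ?(ltW K0) //; linarith.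
by linarith.
Qed.

Lemma sign_constant (u : R -> R) (a b : R) :
  (forall t : R, a < t < b -> {for t, continuous u}) ->
  (forall t : R, a < t < b -> u t != 0) ->
  (forall t : R, a < t < b -> 0 < u t) \/ (forall t : R, a < t < b -> u t < 0).
Proof.
move=> uc un; case: (pselect (exists2 t, a < t < b & u t < 0)) => [[s sab us]|no].
  right => t tab; rewrite ltNge; apply/negP => ut.
  have wc (c d : R) : a < c -> d < b -> {within `[c, d], continuous u}.
    by move=> ac db; apply: cont_within => z zcd; apply: uc; linarith.
  have [c cab uc0] : exists2 c, a < c < b & u c = 0.
    case: (lerP s t) => st.
      have [||c cc ?] := @ivt_c R u s t 0 st; [apply: wc; linarith | linarith |].
      by exists c => //; linarith.
    have [||c cc ?] := @ivt_d R u t s 0 (ltW st); [apply: wc; linarith | linarith |].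
    by exists c => //; linarith.
  by have := un c cab; rewrite uc0 eqxx.
left => t tab; rewrite lt_neqAle eq_sym un //= leNgt; apply/negP => ut.
by apply: no; exists t.
Qed.

(* If [psi * D ^ k = 0] with both factors continuous and never simultaneously
   zero, then [D ^ 2 - psi ^ 2] has no zero. *)
Lemma vanishing_dichotomy (D psi : R -> R) (k : nat) (a b : R) :
  (forall t : R, a < t < b -> {for t, continuous D}) ->
  (forall t : R, a < t < b -> {for t, continuous psi}) ->
  (forall t : R, a < t < b -> psi t * D t ^+ k = 0) ->
  (forall t : R, a < t < b -> D t = 0 -> psi t != 0) ->
  (forall t : R, a < t < b -> D t = 0) \/
  (forall t : R, a < t < b -> D t != 0 /\ psi t = 0).
Proof.
move=> Dc pc H H0; pose u t := D t ^+ 2 - psi t ^+ 2.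
have uc t : a < t < b -> {for t, continuous u}.
  move=> tab; apply: (@continuousB R R R (fun t => D t ^+ 2) (fun t => psi t ^+ 2)).
    exact: (continuous_comp (Dc t tab) (@exprn_continuous R 2 (D t))).
  exact: (continuous_comp (pc t tab) (@exprn_continuous R 2 (psi t))).
have alt t : a < t < b -> D t != 0 -> psi t = 0.
  move=> tab Dn; have /eqP := H t tab; rewrite mulf_eq0 expf_eq0 (negbTE Dn) andbF orbF.
  by move/eqP.
have un t : a < t < b -> u t != 0.
  move=> tab; rewrite /u; case: (eqVneq (D t) 0) => [D0|Dn].
    by rewrite D0 expr0n sub0r oppr_eq0 expf_eq0 /= H0.
  by rewrite (alt t tab Dn) expr0n subr0 expf_eq0.
have [up|un'] := sign_constant uc un; [right | left] => t tab.
  have Dn : D t != 0.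
    apply/eqP => D0; have := up t tab; rewrite /u D0 expr0n sub0r oppr_gt0.
    by rewrite ltNge sqr_ge0.
  by split => //; exact: alt.
apply/eqP; apply: contraT => Dn; have := un' t tab.
by rewrite /u (alt t tab Dn) expr0n subr0 ltNge sqr_ge0.
Qed.

(* The functions rational in [x] and [sigma x]; the class is closed under
   differentiation since [sigma' = g / g(sigma)]. *)
Inductive branch_fun g (sigma : R -> R) : (R -> R) -> Prop :=
| BranchX p : branch_fun g sigma (fun x => p.[x])
| BranchS p : branch_fun g sigma (fun x => p.[sigma x])
| BranchI : branch_fun g sigma (fun x => (g.[sigma x])^-1)
| BranchA u v : branch_fun g sigma u -> branch_fun g sigma v ->
    branch_fun g sigma (fun x => u x + v x)
| BranchM u v : branch_fun g sigma u -> branch_fun g sigma v ->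
    branch_fun g sigma (fun x => u x * v x).

Section Flatness.
Variables (g : {poly R}) (sigma : R -> R) (b : R).
Hypothesis sd : forall x : R, 0 < x < b ->
  g.[sigma x] != 0 /\ is_derive x (1 : R) sigma (g.[x] / g.[sigma x]).

Lemma branch_derivative e : branch_fun g sigma e -> exists2 e', branch_fun g sigma e' &
  forall x : R, 0 < x < b -> is_derive x (1 : R) e (e' x).
Proof.
elim=> [p|p||u v _ [u' hu du] _ [v' hv dv]|u v hu0 [u' hu du] hv0 [v' hv dv]].
- exists (fun x => p^`().[x]); first exact: BranchX.
  by move=> x _; have := der_poly p (derI x); rewrite mulr1.
- exists (fun x => p^`().[sigma x] * (g.[x] * (g.[sigma x])^-1)).
    by apply: BranchM; [exact: BranchS | apply: BranchM; [exact: BranchX | exact: BranchI]].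
  by move=> x /sd [_ h]; exact: der_poly.
- exists (fun x => (- g^`()).[sigma x] * (g.[x] * (g.[sigma x])^-1) *
      ((g.[sigma x])^-1 * (g.[sigma x])^-1)).
    apply: BranchM; last by apply: BranchM; exact: BranchI.
    by apply: BranchM; [exact: BranchS | apply: BranchM; [exact: BranchX | exact: BranchI]].
  move=> x /sd [n h]; have h1 := der_poly g h.
  apply: (der_eq (@derV R (fun x => g.[sigma x]) x _ n h1)).
  by rewrite hornerN; field.
- exists (fun x => u' x + v' x); first exact: BranchA.
  by move=> x xb; have h1 := du x xb; have h2 := dv x xb; exact: derD.
- exists (fun x => u' x * v x + u x * v' x).
    by apply: BranchA; exact: BranchM.
  by move=> x xb; have h1 := du x xb; have h2 := dv x xb; exact: derM.
Qed.

(** The derivative vanishes to the left of [a] and stays in the class, which allows an induction on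
    [N]: [e] vanishes at [a] by continuity, and integrating the bound on the derivative gains one
    power of [x - a]. *)
Lemma branch_flat (a c : R) (N : nat) e : branch_fun g sigma e -> 0 < a -> a < c -> c < b ->
  (forall x : R, 0 < x < a -> e x = 0) ->
  exists2 C : R, 0 <= C & forall x : R, a <= x <= c -> `|e x| <= C * (x - a) ^+ N.
Proof.
move=> + a0 ac cb; elim: N e => [|N IH] e he e0; have [e' he' de] := branch_derivative he.
  have ec : {within `[a, c], continuous e}.
    by apply: (der_within (du := e')) => x xac; apply: de; linarith.
  have [C C0 hC] := within_bounded ec.
  by exists C => // x /hC; rewrite expr0 mulr1.
have e'0 x : 0 < x < a -> e' x = 0.
  move=> xa; have xb : 0 < x < b by linarith.
  apply: (der_unique (de x xb)).
  apply: (near_eq_is_derive _ (derC x 0)).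
  near=> z; apply/esym/e0.
  have : z \in `]0, a[ by near: z; apply: (@near_in_itvoo R 0 a); rewrite in_itv.
  by rewrite in_itv.
have [C C0 hC] := IH e' he' e'0.
exists C => // x /andP[ax xc].
have ea : e a = 0.
  have a2 : a / 2 < a by linarith.
  have wc : {within `[a / 2, a], continuous e}.
    by apply: (der_within (du := e')) => z za; apply: de; linarith.
  have wcN : {within `[a / 2, a], continuous (fun x => - e x)}.
    by move=> z; apply: continuousN; exact: wc.
  apply/eqP; rewrite eq_le; apply/andP; split.
    rewrite -oppr_ge0; apply: (within_limit_ge0 a2 wcN) => z za.
    by rewrite e0 ?oppr0 //; linarith.
  by apply: (within_limit_ge0 a2 wc) => z za; rewrite e0 //; linarith.
have := @der_bound R a x e (fun t => C * (t - a) ^+ N.+1) e'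
  (fun t => C * (N.+1%:R * (t - a) ^+ N)) ax.
rewrite ea !subr0 subrr expr0n mulr0 subr0; apply.
- by move=> t tax; apply: de; linarith.
- by move=> t _; der; rewrite /=; ring.
- move=> t tax; have tac : a <= t <= c by linarith.
  apply: le_trans (hC t tac) _; rewrite ler_wpM2l // ler_peMl ?exprn_ge0 //; first by linarith.
  by rewrite ler1n.
Unshelve. all: by end_near. Qed.

End Flatness.

Lemma poly2_lip (B : {poly {poly R}}) (M : R) : exists2 C : R, 0 <= C &
  forall x t : R, `|x| <= M -> `|t| <= M -> `|B.[t%:P].[x] - B.[0].[x]| <= C * `|t|.
Proof.
elim/poly_ind: B => [|B c [C C0 hC]].
  by exists 0 => // x t _ _; rewrite !horner0 subrr normr0 mul0r.
have [K K0 hK] := poly_bound B.[0] M.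
exists (K + C * `|M|) => [|x t xM tM]; first by rewrite addr_ge0 ?mulr_ge0 // ltW.
rewrite !hornerMXaddC mulr0 add0r hornerD hornerM hornerC addrK normrM.
rewrite ler_wpM2r //.
have := ler_distD B.[0].[x] B.[t%:P].[x] 0; rewrite !subr0 => H; apply: le_trans H _.
rewrite addrC lerD ?hK //; apply: le_trans (hC x t xM tM) _.
by rewrite ler_wpM2l // (le_trans tM) // ler_norm.
Qed.

Lemma poly2_continuous (B : {poly {poly R}}) (u : R -> R) (x : R) :
  {for x, continuous u} -> {for x, continuous (fun x => B.[(u x)%:P].[x])}.
Proof.
move=> uc; elim/poly_ind: B => [|B c IH].
  have -> : (fun x => (0 : {poly {poly R}}).[(u x)%:P].[x]) = fun=> 0.
    by apply/funext => z; rewrite !horner0.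
  exact: cvg_cst.
have -> : (fun x => (B * 'X + c%:P).[(u x)%:P].[x]) =
    fun x => B.[(u x)%:P].[x] * u x + c.[x].
  by apply/funext => z; rewrite hornerMXaddC hornerD hornerM hornerC.
apply: (@continuousD R R R (fun x => B.[(u x)%:P].[x] * u x) (fun x => c.[x])).
  exact: (@continuousM R R (fun x => B.[(u x)%:P].[x]) u).
exact: continuous_horner.
Qed.

Lemma restoring_size g : restoring g -> (1 < size (prim g))%N.
Proof.
move=> rg; rewrite ltnNge; apply/negP => /size1_polyC e.
by have := G_pos rg (oner_neq0 R); rewrite e hornerC -(hornerC (prim g)`_0 0) -e prim0 ltxx.
Qed.

Lemma restoring_flip g : restoring g -> restoring (- flip g).
Proof.
move=> h z z0; rewrite hornerN flipE mulrN -mulNr.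
by apply: h; rewrite oppr_eq0.
Qed.

(** Minus the inverse of the reflected potential. Building it only up to the given pair avoids a
    comparison of the ranges of the potential on the two sides. *)
Lemma level_branch g (u1 u2 : R) : restoring g -> u1 < 0 -> 0 < u2 ->
  (prim g).[u1] = (prim g).[u2] -> exists sigma : R -> R,
  [/\ sigma u2 = u1, {within `[0, u2], continuous sigma},
      forall x : R, 0 < x <= u2 -> sigma x < 0 /\ (prim g).[sigma x] = (prim g).[x] &
      forall x : R, 0 < x < u2 -> g.[sigma x] != 0 /\
        is_derive x (1 : R) sigma (g.[x] / g.[sigma x])].
Proof.
move=> rg u10 u20 e; have rg' := restoring_flip rg.
have u1p : 0 < - u1 by linarith.
pose H := horner (prim (- flip g)).
have dH t : 0 <= t <= - u1 -> is_derive t (1 : R) H ((- flip g).[t]).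
  by move=> _; have := der_prim (- flip g) (derI t); rewrite mulr1.
have pH t : 0 < t < - u1 -> 0 < (- flip g).[t].
  by move=> /andP[t0 _]; exact: restoring_pos.
have [S [SH HS Sc Sd]] := inverse_function u1p dH pH.
have H0 : H 0 = 0 by rewrite /H prim0.
have Hu : H (- u1) = (prim g).[u2] by rewrite /H prim_flipE opprK.
have rng x : 0 <= x <= u2 -> H 0 <= (prim g).[x] <= H (- u1).
  move=> /andP[x0 xu]; rewrite H0 Hu G_ge0 //=.
  by move: xu; rewrite le_eqVlt => /predU1P[->//|xu]; apply/ltW/G_incr.
have Gd x : is_derive x (1 : R) (horner (prim g)) g.[x].
  by have := der_prim g (derI x); rewrite mulr1.
exists (fun x => - S (prim g).[x]); split.
- by rewrite -Hu SH ?opprK // lexx ltW.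
- have wc : {within `[0, u2], continuous (fun x => S (prim g).[x])}.
    apply: (within_comp (c := H 0) (d := H (- u1)) (u := horner (prim g))) => //.
    exact: (der_within (du := horner g)).
  by move=> z; apply: continuousN; exact: wc.
- move=> x /andP[x0 xu]; have [|Sx SE] := HS (prim g).[x].
    by apply: rng; rewrite xu ltW.
  rewrite /H prim_flipE in SE; split => //; rewrite oppr_lt0 lt_neqAle eq_sym.
  case/andP: Sx => -> _; rewrite andbT; apply/eqP => S0.
  move: SE; rewrite S0 oppr0 prim0 => /esym Gx.
  by have := G_pos rg (lt0r_neq0 x0); rewrite Gx ltxx.
- move=> x /andP[x0 xu]; have [|Sx SE] := Sd (prim g).[x].
    by rewrite H0 Hu G_pos ?lt0r_neq0 //= G_incr // ltW.
  rewrite hornerN flipE in SE; case/andP: Sx => S0 _.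
  have gS : g.[- S (prim g).[x]] != 0.
    have := rg (- S (prim g).[x]); rewrite oppr_eq0 gt_eqF // => /(_ isT) gg.
    by apply/eqP => g0; move: gg; rewrite g0 mulr0 ltxx.
  split => //; apply: (der_eq (derN (der_comp (Gd x) SE))).
  by rewrite invrN; ring.
Qed.

Lemma level_inj g (u v : R) : restoring g -> u < 0 -> v < 0 ->
  (prim g).[u] = (prim g).[v] -> u = v.
Proof.
move=> rg u0 v0 e; have rg' := restoring_flip rg.
have le (a b : R) : a < 0 -> b < 0 -> (prim g).[a] = (prim g).[b] -> b <= a.
  move=> a0 b0 E; rewrite -lerN2; apply: (G_inj rg'); [linarith | linarith |].
  by rewrite !prim_flipE !opprK E.
by apply/eqP; rewrite eq_le !le.
Qed.

Theorem balanced_of_periodic f g : tame f g -> all_periodic f g -> balanced f g.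
Proof.
move=> hfg per u1 u2 u10 u20 e; have [rg _ _] := hfg.
have [sigma [su sc sl sd]] := level_branch rg u10 u20 e.
pose D x := (prim f).[x] - (prim f).[sigma x].
have [A A0 hA] := eliminate (prim f) (restoring_size rg).
(* The equation is [A1(x, D) D^k = 0], where [al(x) = A1(x, 0)] is not the zero polynomial. So [D]
   and [psi = A1(x, D)] vanish together only at zeros of [al]. *)
have [k [A1]] := multiplicity_XsubC A 0; rewrite A0 /= => /negP rA AE.
pose al := A1.[0].
have al0 : al != 0 by apply/eqP => h; apply: rA; exact/rootP.
pose psi x := A1.[(D x)%:P].[x].
have psiD x : 0 < x <= u2 -> psi x * D x ^+ k = 0.
  move=> xu; have [_ Gs] := sl x xu; have := hA x (sigma x) (esym Gs).
  by rewrite AE hornerM horner_exp hornerXsubC subr0 hornerM horner_exp hornerC.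
have psi0 x : D x = 0 -> psi x = al.[x] by move=> h; rewrite /psi h.
have bD : branch_fun g sigma D.
  rewrite /D (_ : (fun x => _) = fun x => (prim f).[x] + (- prim f).[sigma x]).
    by apply: BranchA; [exact: BranchX | exact: BranchS].
  by apply/funext => x; rewrite hornerN.
have [D' _ dD] := branch_derivative sd bD.
have Dc x : 0 < x < u2 -> {for x, continuous D} by move=> /dD; exact: der_cont.
have pc x : 0 < x < u2 -> {for x, continuous psi}.
  by move=> /Dc; exact: poly2_continuous.
have Dwc : {within `[0, u2], continuous D}.
  move=> z; apply: (@continuousB R R (subspace `[0, u2]) (horner (prim f))
    (fun x => (prim f).[sigma x])).
    by apply: continuous_subspaceT; exact: continuous_horner.
  apply: (@continuous_comp (subspace `[0, u2]) R R sigma (horner (prim f))).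
    exact: sc.
  exact: continuous_horner.
have [K K0 hK] := poly2_lip A1 (u2 + 0).
(* Just to the right of [a] the polynomial [al] has no zero, so there [D] vanishes either
   identically or nowhere. *)
have dich (a : R) : 0 <= a -> a < u2 -> exists2 d : R, a < d <= u2 &
   (forall t : R, a < t < d -> D t = 0) \/
   (forall t : R, a < t < d -> D t != 0 /\ psi t = 0).
  move=> a0 au; have [j [ee [c [e0 c0 hj]]]] := poly_right_order a al0.
  pose d := Num.min u2 (a + ee).
  have du : d <= u2 by rewrite /d ge_min lexx.
  have de : d <= a + ee by rewrite /d ge_min lexx orbT.
  exists d; first by rewrite du andbT /d lt_min au /=; linarith.
  apply: (@vanishing_dichotomy D psi k a d).
  - by move=> t td; apply: Dc; linarith.
  - by move=> t td; apply: pc; linarith.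
  - by move=> t td; apply: psiD; linarith.
  - move=> t td /psi0 ->; rewrite -normr_gt0; have tt : a < t < a + ee by linarith.
    by apply: lt_le_trans (hj t tt); rewrite mulr_gt0 ?exprn_gt0 //; linarith.
(* A sign of [D] next to [0] is a strict ordering of [F] at low levels, and orbits spiral. The
   reflection [x -> - x] with time reversal exchanges the two signs. *)
have near0 : exists2 d : R, 0 < d <= u2 & forall t : R, 0 < t < d -> D t = 0.
  have [d d0u [|dn]] := dich 0 (lexx _) u20; first by exists d.
  exfalso; have [||Dp|Dm] := @sign_constant D 0 d.
  - by move=> t td; apply: Dc; linarith.
  - by move=> t /dn [].
  - have h0 : 0 < (prim g).[d / 2] by apply: G_pos => //; rewrite gt_eqF //; linarith.
    apply: (spiral_not_periodic hfg h0 _ per) => v1 v2 v10 v20 ev Gv.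
    have v2d : v2 <= d / 2 by apply: (G_inj rg) => //; linarith.
    have [|sv Gs] := sl v2; first by linarith.
    have -> : v1 = sigma v2 by apply: (level_inj rg) => //; rewrite Gs.
    by rewrite -subr_gt0; apply: Dp; linarith.
  - have h0 : 0 < (prim g).[d / 2] by apply: G_pos => //; rewrite gt_eqF //; linarith.
    apply: (spiral_not_periodic (tame_rev hfg) h0); last first.
      by apply: all_periodicN; exact: all_periodic_rot.
    move=> v1 v2 v10 v20; rewrite !prim_flipE => ev Gv.
    have v1d : - v1 <= d / 2 by apply: (G_inj rg); [linarith | linarith | rewrite ev].
    have [|sv Gs] := sl (- v1); first by linarith.
    have -> : - v2 = sigma (- v1) by apply: (level_inj rg); rewrite ?oppr_lt0 // Gs.
    by rewrite -subr_lt0; apply: Dm; linarith.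
pose E := [set x : R | 0 < x <= u2 /\ forall t : R, 0 < t < x -> D t = 0].
have [d0 d0u Dd0] := near0.
have Ed : E d0 by split.
have hE : has_sup E by split; [exists d0 | exists u2 => x [/andP[]]].
set s := sup E.
have ds : d0 <= s by apply: ub_le_sup => //; case: hE.
have su2 : s <= u2 by apply: ge_sup; [exists d0 | move=> x [/andP[]]].
have Ds t : 0 < t < s -> D t = 0.
  move=> /andP[t0 ts]; have st : 0 < s - t by linarith.
  have [x [_ Dx] xs] := sup_adherent st hE.
  by rewrite -/s subKr in xs; apply: Dx; rewrite t0.
have sE : s = u2.
  apply/eqP; rewrite eq_le su2 /= leNgt; apply/negP => s_u.
  have s0 : 0 < s by linarith.
  have [d dsu [D0|Dn]] := dich s (ltW s0) s_u.
    have Dss : D s = 0.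
      have s2 : s / 2 < s by linarith.
      have wc : {within `[s / 2, s], continuous D}.
        by apply: cont_within => z zs; apply: Dc; linarith.
      have wcN : {within `[s / 2, s], continuous (fun x => - D x)}.
        by move=> z; apply: continuousN; exact: wc.
      apply/eqP; rewrite eq_le; apply/andP; split.
        rewrite -oppr_ge0; apply: (within_limit_ge0 s2 wcN) => z za.
        by rewrite Ds ?oppr0 //; linarith.
      by apply: (within_limit_ge0 s2 wc) => z za; rewrite Ds //; linarith.
    have : d <= s.
      apply: ub_le_sup; first by case: hE.
      split; first by linarith.
      move=> t /andP[t0 td]; case: (ltgtP t s) => ts.
      - by apply: Ds; rewrite t0.
      - by apply: D0; rewrite ts.
      - by rewrite ts.
    by linarith.
  (* The case [D != 0], [psi = 0] to the right of [s > 0]. Since [psi = 0], [|al|] is at most a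
     constant times [|D|], and [D] is flat at [s]; taking one order more than that of [al] at [s]
     gives the contradiction near [s]. *)
  have [j [ee [c [e0 c0 hj]]]] := poly_right_order s al0.
  pose r := (s + d) / 2; have sr : s < r by rewrite /r; linarith.
  have ru : r < u2 by rewrite /r; linarith.
  have [C C0 hC] := branch_flat sd j.+1 bD s0 sr ru Ds.
  have Dwc' : {within `[s, r], continuous D}.
    by apply: cont_within => z zs; apply: Dc; linarith.
  have [M M0 hM] := within_bounded Dwc'.
  have [K' K'0 hK'] := poly2_lip A1 (u2 + M).
  pose x := s + Num.min (Num.min ((r - s) / 2) (ee / 2)) (c / (2 * (K' * C + 1))).
  have KC : 0 < 2 * (K' * C + 1) by have := mulr_ge0 K'0 C0; linarith.
  set mn := Num.min _ _ in x.
  have m1 : mn <= (r - s) / 2 by rewrite /mn !ge_min lexx.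
  have m2 : mn <= ee / 2 by rewrite /mn !ge_min lexx orbT.
  have m3 : mn <= c / (2 * (K' * C + 1)) by rewrite /mn !ge_min lexx !orbT.
  have mp : 0 < mn by rewrite /mn !lt_min !divr_gt0 ?subr_gt0.
  have xs : x - s = mn by rewrite /x addrC addKr.
  have xsr : s <= x <= r by linarith.
  have xd : s < x < d by move: m1; rewrite /r in sr *; linarith.
  have [_ px] := Dn x xd.
  have a1 := hC x xsr; have a2 : c * (x - s) ^+ j <= `|al.[x]| by apply: hj; linarith.
  have xM : `|x| <= u2 + M.
    have [sx xr] := andP xsr; rewrite gtr0_norm ?(lt_le_trans s0) //.
    by rewrite ler_wpDr // (le_trans xr) // ltW.
  have DM : `|D x| <= u2 + M by rewrite ler_wpDl ?hM // ltW.
  have := hK' x (D x) xM DM; rewrite -/(psi x) px sub0r normrN -/al => a3.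
  have p0 : 0 < (x - s) ^+ j by rewrite exprn_gt0 // xs.
  have : c * (x - s) ^+ j <= K' * (C * ((x - s) * (x - s) ^+ j)).
    by apply: le_trans a2 (le_trans a3 _); rewrite -exprS ler_wpM2l.
  rewrite [X in _ <= X](_ : _ = (K' * C * (x - s)) * (x - s) ^+ j); last by ring.
  rewrite ler_pM2r // xs; move: m3; rewrite ler_pdivlMr // => m3 H.
  by have := mulr_ge0 (mulr_ge0 K'0 C0) (ltW mp); linarith.
have Du t : 0 < t < u2 -> D t = 0 by rewrite -sE; exact: Ds.
have : D u2 = 0.
  have u22 : u2 / 2 < u2 by linarith.
  have wc : {within `[u2 / 2, u2], continuous D}.
    apply: continuous_subspaceW Dwc => z; rewrite /= !in_itv /=; linarith.
  have wcN : {within `[u2 / 2, u2], continuous (fun x => - D x)}.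
    by move=> z; apply: continuousN; exact: wc.
  apply/eqP; rewrite eq_le; apply/andP; split.
    rewrite -oppr_ge0; apply: (within_limit_ge0 u22 wcN) => z za.
    by rewrite Du ?oppr0 //; linarith.
  by apply: (within_limit_ge0 u22 wc) => z za; rewrite Du //; linarith.
by rewrite /D su => /eqP; rewrite subr_eq0 => /eqP ->.
Qed.

End Balance.

(** * The level of a cycle *)

Section RightTip.
Context {R : realType}.
Variables f g : {poly R}.
Hypothesis hfg : tame f g.
Hypothesis hb : balanced f g.

Let rg : restoring g. Proof. by case: hfg. Qed.

Definition reaches_tip (x y l : R) : Prop := 0 < l /\ exists (u v : R -> R) (t : R),
  [/\ sol f g u v, u 0 = x, v 0 = y, u t = l & v t = 0].

(* The abscissa of the rightmost point of the cycle through [(x, y)]; [0] at the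
   origin, where [xget] falls back on its default. *)
Definition right_tip (x y : R) : R := xget 0 [set l | reaches_tip x y l].

Lemma tip_unique (l l' t : R) (u v : R -> R) : 0 < l -> sol f g u v ->
  u 0 = l -> v 0 = 0 -> 0 < u t -> v t = 0 -> u t = l.
Proof.
move=> l0 h eu ev ut vt.
have [x [y [t1 [T [l1 [[t10 t1T l10 Gl] sxy per [ex ey xt yt] [lo up]]]]]]] :=
  cycle_structure hfg hb l0.
have E := @sol_unique R f g u v x y 0 h sxy (etrans eu (esym ex)) (etrans ev (esym ey)).
have [s sT [e1 e2]] := periodic_reduce (lt_trans t10 t1T) per t.
have [Eu Ev] := E t; rewrite Eu e1 in ut *; rewrite Ev e2 in vt.
case: (ltgtP s t1) => st.
- case: (ltgtP s 0) => s0; first by linarith.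
    by have := lo s; rewrite s0 st vt ltxx => /(_ isT).
  by rewrite s0.
- by have := up s; rewrite st vt ltxx; case/andP: sT => _ -> /(_ isT).
- by move: ut; rewrite st xt oppr_gt0; linarith.
Qed.

Lemma reaches_tip_unique (x y l l' : R) :
  reaches_tip x y l -> reaches_tip x y l' -> l = l'.
Proof.
move=> [l0 [u [v [t [h eu ev ut vt]]]]] [l'0 [u' [v' [t' [h' eu' ev' ut' vt']]]]].
have E := @sol_unique R f g u v u' v' 0 h h' (etrans eu (esym eu')) (etrans ev (esym ev')).
have hs := sol_shift t h.
have [Eu Ev] := E t'.
have := @tip_unique l l' (t' - t) _ _ l0 hs; rewrite !add0r !subrK Eu Ev ut' vt'.
by move=> /(_ ut vt l'0 erefl).
Qed.

Lemma reaches_tip_exists (x y : R) : x != 0 \/ y != 0 -> exists l, reaches_tip x y l.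
Proof.
move=> nz; have [u [v [T [h T0 per [eu ev] [[t t1 t2] _]]]]] := has_cycle_all hfg hb nz.
by exists (u t); split => //; exists u, v, t.
Qed.

Lemma right_tipP (x y : R) : x != 0 \/ y != 0 -> reaches_tip x y (right_tip x y).
Proof.
move=> /reaches_tip_exists [l hl]; rewrite /right_tip.
by case: xgetP => [l' -> //|/(_ l)].
Qed.

Lemma right_tipE (x y l : R) : reaches_tip x y l -> right_tip x y = l.
Proof.
move=> hl; rewrite /right_tip; case: xgetP => [l' _ hl'|/(_ l) //].
exact: reaches_tip_unique hl' hl.
Qed.

Lemma right_tip0 : right_tip 0 0 = 0.
Proof.
rewrite /right_tip; case: xgetP => // l _ [l0 [u [v [t [h eu ev ut vt]]]]].
by have [e _] := sol_rest rg h eu ev t; move: l0; rewrite -ut e ltxx.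
Qed.

Lemma right_tip_gt0 (x y : R) : x != 0 \/ y != 0 -> 0 < right_tip x y.
Proof. by move=> /right_tipP []. Qed.

Lemma right_tip_ge0 (x y : R) : 0 <= right_tip x y.
Proof.
case: (eqVneq x 0) => [->|x0]; last by apply/ltW/right_tip_gt0; left.
case: (eqVneq y 0) => [->|y0]; last by apply/ltW/right_tip_gt0; right.
by rewrite right_tip0.
Qed.

Lemma right_tip_axis (l : R) : 0 < l -> right_tip l 0 = l.
Proof.
move=> l0; apply: right_tipE; split => //.
have [u [v [T [h _ _ [eu ev] _]]]] := has_cycle_axis hfg hb (lt0r_neq0 l0).
by exists u, v, 0.
Qed.

Lemma right_tip_flow (u v : R -> R) (t : R) : sol f g u v ->
  right_tip (u t) (v t) = right_tip (u 0) (v 0).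
Proof.
move=> h; case: (pselect (u 0 != 0 \/ v 0 != 0)) => [nz|z].
  have [l0 [u' [v' [s [h' eu' ev' ut' vt']]]]] := right_tipP nz.
  apply: right_tipE; split => //.
  have E := @sol_unique R f g u v u' v' 0 h h' (esym eu') (esym ev').
  exists (fun r => u (r + t)), (fun r => v (r + t)), (s - t).
  by rewrite !add0r !subrK; have [-> ->] := E s; split => //; exact: sol_shift.
have u0 : u 0 = 0 by apply/eqP/negPn/negP => h1; apply: z; left.
have v0 : v 0 = 0 by apply/eqP/negPn/negP => h1; apply: z; right.
by have [-> ->] := sol_rest rg h u0 v0 t; rewrite u0 v0.
Qed.

Lemma on_cycle (x0 y0 : R) : x0 != 0 \/ y0 != 0 ->
  exists (x y : R -> R) (t1 T l' s : R),
  [/\ [/\ 0 < t1, t1 < T, 0 < l' & (prim g).[- l'] = (prim g).[right_tip x0 y0]],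
      sol f g x y /\ periodic x y T,
      [/\ x 0 = right_tip x0 y0, y 0 = 0, x t1 = - l' & y t1 = 0],
      (forall t : R, 0 < t < t1 -> y t < 0) /\ (forall t : R, t1 < t < T -> 0 < y t) &
      [/\ 0 <= s < T, x s = x0 & y s = y0]].
Proof.
move=> nz; have [l0 [u [v [t [h eu ev ut vt]]]]] := right_tipP nz.
have [x [y [t1 [T [l1 [[t10 t1T l10 Gl] sxy per [ex ey xt yt] lu]]]]]] :=
  cycle_structure hfg hb l0.
have hs := sol_shift t h.
have E' := @sol_unique R f g (fun r => u (r + t)) (fun r => v (r + t)) x y 0 hs sxy.
rewrite !add0r ut vt ex ey in E'; have {}E' := E' erefl erefl.
have [s sT [e1 e2]] := periodic_reduce (lt_trans t10 t1T) per (- t).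
exists x, y, t1, T, l1, s; split => //; split => //.
- by rewrite -e1; have [<- _] := E' (- t); rewrite addNr eu.
- by rewrite -e2; have [_ <-] := E' (- t); rewrite addNr ev.
Qed.

(** The truncated solution with the new initial data stays within [e] of the bounded reference arc,
    hence in the box of half side [B + e], where the truncation is not felt. *)
Lemma dependence (u v : R -> R) (T e : R) : sol f g u v -> 0 <= T -> 0 < e ->
  exists2 d : R, 0 < d & forall u' v' : R -> R, sol f g u' v' ->
    `|u' 0 - u 0| < d -> `|v' 0 - v 0| < d ->
    forall t : R, 0 <= t <= T -> `|u' t - u t| < e /\ `|v' t - v t| < e.
Proof.
move=> h T0 e0.
have [B B0 hB] := @solves_bounded R f g 0 T u v (fun t _ => h t).
have B10 : 0 <= B + e by linarith.
have [L L0 [lip1 lip2]] := trunc_lip f g B10.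
pose E := expR (4 * 1 * L * T); have E0 : 0 < E by exact: expR_gt0.
have E1 : 1 <= E by rewrite -expR0 ler_expR !mulr_ge0 // ltW.
(* Initial gaps below [d = e / (2 E)] in both coordinates give a squared distance at most
   [2 d^2 E = e^2 / (2 E) < e^2]. *)
exists (e / (2 * E)); first by rewrite divr_gt0 // mulr_gt0.
move=> u' v' h' du dv t /andP[t0 tT].
have [x [y [ex ey hxy]]] := tsol_exists f g (u' 0) (v' 0) B10.
have dE : e / (2 * E) * E = e / 2 by field; rewrite gt_eqF.
have d0 : 0 < e / (2 * E) by rewrite divr_gt0 // mulr_gt0.
have close s : 0 <= s <= T -> `|x s - u s| < e /\ `|y s - v s| < e.
  move=> /andP[s0 sT].
  have := @lip_dependence R _ _ L L0 lip1 lip2 (fun=> 1) x y u v 1 0 s s0 ler01.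
  have a1 r : 0 <= r <= s -> `|(1 : R)| <= 1 by rewrite normr1.
  have a2 r : 0 <= r <= s -> is_derive r (1 : R) x (1 * tV1 (B + e) (x r) (y r)) /\
       is_derive r (1 : R) y (1 * tV2 f g (B + e) (x r) (y r)).
    by move=> _; have [? ?] := hxy r; rewrite !mul1r.
  have a3 r : 0 <= r <= s -> is_derive r (1 : R) u (1 * tV1 (B + e) (u r) (v r)) /\
       is_derive r (1 : R) v (1 * tV2 f g (B + e) (u r) (v r)).
    move=> rs; have rT : 0 <= r <= T by linarith.
    have [b1 b2] := hB r rT; rewrite !mul1r.
    by apply/(@tsolE R f g (B + e)); [linarith | linarith | exact: h].
  move=> /(_ a1 a2 a3); rewrite ex ey subr0 => H.
  have Es : expR (4 * 1 * L * s) <= E.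
    by rewrite ler_expR ler_wpM2l // !mulr_ge0 // ltW.
  pose dd := e / (2 * E).
  have q1 : (u' 0 - u 0) ^+ 2 + (v' 0 - v 0) ^+ 2 <= 2 * dd ^+ 2.
    have n1 : (u' 0 - u 0) ^+ 2 <= dd ^+ 2.
      by rewrite -(real_normK (num_real (_ - _))) lerXn2r ?nnegrE // ltW.
    have n2 : (v' 0 - v 0) ^+ 2 <= dd ^+ 2.
      by rewrite -(real_normK (num_real (_ - _))) lerXn2r ?nnegrE // ltW.
    by linarith.
  have q2 : (x s - u s) ^+ 2 + (y s - v s) ^+ 2 <= 2 * dd ^+ 2 * E.
    apply: le_trans H _; apply: (ler_pM _ _ q1 Es); last exact: expR_ge0.
    by rewrite addr_ge0 ?sqr_ge0.
  have q3 : 2 * dd ^+ 2 * E < e ^+ 2.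
    have -> : 2 * dd ^+ 2 * E = e ^+ 2 / (2 * E) by rewrite /dd; field; rewrite gt_eqF.
    rewrite ltr_pdivrMr ?mulr_gt0 // ltr_pMr ?exprn_gt0 //; linarith.
  have s1 := sqr_ge0 (x s - u s); have s2 := sqr_ge0 (y s - v s).
  split; rewrite -(ltr_pXn2r (n := 2)) ?nnegrE ?(ltW e0) // real_normK ?num_real //; linarith.
have hx s : 0 <= s <= T -> solves f g x y s.
  move=> sT; have [c1 c2] := close s sT; have [b1 b2] := hB s sT.
  have n1 := ler_normD (x s - u s) (u s); have n2 := ler_normD (y s - v s) (v s).
  rewrite !subrK in n1 n2.
  by apply/(@tsolE R f g (B + e)); [linarith | linarith | exact: hxy].
have [|||-> ->] := @solves_unique R f g 0 t u' v' x y t0 (fun s _ => h' s).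
- by move=> s st; apply: hx; linarith.
- by rewrite ex.
- by rewrite ey.
by apply: close; rewrite t0.
Qed.

(** Just before the right tip [y > 0], just after it [y < 0]. A nearby solution has the same signs
    at these two times, so it crosses the axis in between, close to the tip. *)
Lemma right_tip_cont_pos (x0 y0 e : R) : x0 != 0 \/ y0 != 0 -> 0 < e ->
  exists2 d : R, 0 < d & forall x y : R, `|x - x0| < d -> `|y - y0| < d ->
    `|right_tip x y - right_tip x0 y0| < e.
Proof.
move=> nz e0; have l0 := right_tip_gt0 nz.
have [x [y [t1 [T [l1 [s [[t10 t1T l10 Gl] [sxy per] [ex ey xt yt] [lo up] [sT xs ys]]]]]]]] :=
  on_cycle nz.
set l := right_tip x0 y0 in l0 Gl ex *.
pose e' := Num.min (e / 2) (l / 2).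
have e'0 : 0 < e' by rewrite /e' lt_min !divr_gt0.
have e'1 : e' <= e / 2 by rewrite /e' ge_min lexx.
have e'2 : e' <= l / 2 by rewrite /e' ge_min lexx orbT.
clearbody e'.
pose u r := x (r + s); pose v r := y (r + s).
have huv : sol f g u v by exact: sol_shift.
have [ET _] : x T = x 0 /\ y T = y 0 by have := per 0; rewrite add0r.
have [tau [tau0 tau1 tau2 tau3 hx]] : exists tau, [/\ 0 < tau, tau < T - s, tau < T - t1,
    tau < t1 & forall r, `|r - T| <= tau -> `|x r - l| < e'].
  have xc : {for T, continuous x} by have [h1 _] := sxy T; exact: der_cont h1.
  have /cvgrPdist_lt /(_ _ e'0) /nbhs_ballP [d /= d0 hd] := xc.
  pose m := Num.min (Num.min (d / 2) ((T - s) / 2)) (Num.min ((T - t1) / 2) (t1 / 2)).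
  have m0 : 0 < m by rewrite /m !lt_min; apply/andP; split; apply/andP; split; linarith.
  have m1 : m <= d / 2 by rewrite /m !ge_min lexx.
  have m2 : m <= (T - s) / 2 by rewrite /m !ge_min lexx orbT.
  have m3 : m <= (T - t1) / 2 by rewrite /m !ge_min lexx !orbT.
  have m4 : m <= t1 / 2 by rewrite /m !ge_min lexx !orbT.
  exists m; split; [by [] | linarith | linarith | linarith |].
  move=> r rT; rewrite distrC -ex -ET; apply: hd; rewrite /ball /= distrC; linarith.
have T0 : 0 <= T - s + tau by linarith.
pose p1 := v (T - s - tau); pose p2 := - v (T - s + tau).
have p10 : 0 < p1 by rewrite /p1 /v; apply: up; linarith.
have p20 : 0 < p2.
  rewrite /p2 /v oppr_gt0 (_ : T - s + tau + s = tau + T); last by ring.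
  by have [_ ->] := per tau; apply: lo; rewrite tau0.
pose ee := Num.min e' (Num.min p1 p2).
have ee0 : 0 < ee by rewrite /ee lt_min e'0 lt_min p10 p20.
have ee1 : ee <= e' by rewrite /ee ge_min lexx.
have ee2 : ee <= p1 by rewrite /ee !ge_min lexx orbT.
have ee3 : ee <= p2 by rewrite /ee !ge_min lexx !orbT.
have [d d0 hd] := dependence huv T0 ee0.
(* The second bound keeps the nearby point away from the origin. *)
pose d' := Num.min d (Num.max `|x0| `|y0|).
have d'0 : 0 < d'.
  by rewrite /d' lt_min d0 lt_max !normr_gt0; case: nz => ->; rewrite ?orbT.
exists d' => // x1 y1 dx dy.
have nz1 : x1 != 0 \/ y1 != 0.
  case: (eqVneq x1 0) => [e1|]; last by left.
  case: (eqVneq y1 0) => [e2|]; last by right.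
  move: dx dy; rewrite e1 e2 !sub0r !normrN /d' !lt_min.
  by move=> /andP[_ +] /andP[_ +]; rewrite !lt_max !ltxx /= orbF => a b; linarith.
have [u' [v' [T' [h' T'0 per' [eu' ev'] _]]]] := has_cycle_all hfg hb nz1.
have dx' : `|u' 0 - u 0| < d.
  by rewrite eu' /u add0r xs; apply: lt_le_trans dx _; rewrite /d' ge_min lexx.
have dy' : `|v' 0 - v 0| < d.
  by rewrite ev' /v add0r ys; apply: lt_le_trans dy _; rewrite /d' ge_min lexx.
have H := hd u' v' h' dx' dy'.
have vc (a b : R) : {within `[a, b], continuous v'}.
  by apply: cont_within => r _; have [_ h1] := h' r; exact: der_cont h1.
have [||r rr vr] := @ivt_d R v' (T - s - tau) (T - s + tau) 0 _ (vc _ _); first by linarith.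
  have [|_ h1] := H (T - s - tau); first by linarith.
  have [|_ h2] := H (T - s + tau); first by linarith.
  move: h1 h2; rewrite -/p1 !ltr_norml; move: ee3; rewrite /p2; linarith.
have [|h1 _] := H r; first by linarith.
have h2 : `|u r - l| < e'.
  by apply: hx; rewrite ler_norml; linarith.
have ur : `|u' r - l| < 2 * e'.
  have := ler_distD (u r) (u' r) l; linarith.
have ur0 : 0 < u' r by move: ur; rewrite ltr_norml; linarith.
rewrite (@right_tipE x1 y1 (u' r)); first by linarith.
by split => //; exists u', v', r.
Qed.

(** If the tip lay at or beyond [x1], the arc between it and the point would meet the abscissa [x1],
    where the energy is at least [2 w]. On that piece the energy varies by at most [w / 2], yet it
    is below [w] at a point near the origin. *)
Lemma right_tip_cont0 (e : R) : 0 < e ->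
  exists2 d : R, 0 < d & forall x y : R, `|x| < d -> `|y| < d -> right_tip x y < e.
Proof.
move=> e0; have [_ [c [C [d [c0 C0 d0 h2]]]] _] := hfg.
have sc0 : 0 < Num.sqrt c by rewrite sqrtr_gt0.
pose x1 := Num.min (Num.min e d) (Num.sqrt c / (8 * C)).
have x10 : 0 < x1 by rewrite /x1 !lt_min e0 d0 divr_gt0 // mulr_gt0.
have x1e : x1 <= e by rewrite /x1 !ge_min lexx.
have x1d : x1 <= d by rewrite /x1 !ge_min lexx orbT.
have x1c : C * x1 <= Num.sqrt c / 8.
  have : x1 <= Num.sqrt c / (8 * C) by rewrite /x1 !ge_min lexx !orbT.
  by rewrite ler_pdivlMr ?mulr_gt0 //; linarith.
clearbody x1.
pose w := Num.sqrt c * x1 / 2; have w0 : 0 < w by rewrite divr_gt0 // mulr_gt0.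
have [K K0 hK] := poly_lip (prim g) 1.
pose dd := Num.min (Num.min x1 1) (Num.min (w / 2) (w ^+ 2 / (8 * K))).
have dd0 : 0 < dd by rewrite /dd lt_min lt_min x10 ltr01 lt_min !divr_gt0 ?exprn_gt0 ?mulr_gt0.
have dd1 : dd <= x1 by rewrite /dd !ge_min lexx.
have dd2 : dd <= 1 by rewrite /dd !ge_min lexx orbT.
have dd3 : dd <= w / 2 by rewrite /dd !ge_min lexx !orbT.
have dd4 : K * dd <= w ^+ 2 / 8.
  have : dd <= w ^+ 2 / (8 * K) by rewrite /dd !ge_min lexx !orbT.
  by rewrite ler_pdivlMr ?mulr_gt0 //; linarith.
exists dd => // x0 y0 dx dy; rewrite ltNge; apply/negP => el.
have nz : x0 != 0 \/ y0 != 0.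
  case: (eqVneq x0 0) => [e1|]; last by left.
  case: (eqVneq y0 0) => [e2|]; last by right.
  by move: el; rewrite e1 e2 right_tip0; linarith.
have wq : energy g x0 y0 < w.
  rewrite /energy -(ger0_norm (ltW w0)) -sqrtr_sqr ltr_sqrt ?exprn_gt0 //.
  have x01 : `|x0| <= 1 by linarith.
  have z1 : `|0 : R| <= 1 by rewrite normr0.
  have := hK x0 0 x01 z1; rewrite prim0 !subr0 => Gx.
  have := ler_norm (prim g).[x0] => Gx2.
  have Kx : K * `|x0| <= K * dd by apply: ler_wpM2l; exact: ltW.
  have : y0 ^+ 2 <= (w / 2) ^+ 2.
    rewrite -(real_normK (num_real y0)) lerXn2r ?nnegrE //; linarith.
  have -> : (w / 2) ^+ 2 = w ^+ 2 / 4 by field.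
  by move: (exprn_gt0 2 w0) Gx Gx2 Kx dd4; clear; linarith.
have [x [y [t1 [T [l1 [s [[t10 t1T l10 Gl] [sxy per] [ex ey xt yt] [lo up] [sT xs ys]]]]]]]] :=
  on_cycle nz.
have xc (a b : R) : {within `[a, b], continuous x}.
  by apply: cont_within => r _; have [h1 _] := sxy r; exact: der_cont h1.
have [ET EyT] : x T = x 0 /\ y T = y 0 by have := per 0; rewrite add0r.
have final (a b sg : R) : a <= b -> sg = 1 \/ sg = -1 ->
    (forall t : R, a <= t <= b -> 0 <= sg * y t) ->
    (forall t : R, a <= t <= b -> `|x t| <= x1) ->
    (x a = x1 /\ x b = x0 /\ y b = y0) \/ (x b = x1 /\ x a = x0 /\ y a = y0) -> False.
  move=> ab hsg hy hx ends.
  have nzt t : a <= t <= b -> x t != 0 \/ y t != 0.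
    move=> _; case: (eqVneq (x t) 0) => [e1|]; last by left.
    case: (eqVneq (y t) 0) => [e2|]; last by right.
    have [z1 _] := sol_rest rg sxy e1 e2 0.
    by have := right_tip_gt0 nz; rewrite -ex z1 ltxx.
  have fb t : a <= t <= b -> `|f.[x t]| <= C * x1.
    move=> tab; have xx := hx t tab; have [|h3 _] := h2 (x t); first by linarith.
    by apply: le_trans h3 _; rewrite ler_wpM2l // ltW.
  have := @energy_variation R f g x y a b (C * x1) sg rg ab (fun t _ => sxy t) hsg hy nzt fb.
  have xab : sg * (x b - x a) <= 2 * x1.
    have [aa bb] : a <= a <= b /\ a <= b <= b by rewrite !lexx ab.
    have := hx a aa; have := hx b bb; rewrite !ler_norml.
    by case: hsg => ->; rewrite ?mul1r ?mulN1r; linarith.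
  have Cx : C * x1 * (sg * (x b - x a)) <= w / 2.
    apply: le_trans (_ : C * x1 * (2 * x1) <= _).
      by rewrite ler_wpM2l // mulr_ge0 // ltW.
    rewrite /w; have : C * x1 * x1 <= Num.sqrt c / 8 * x1 by rewrite ler_wpM2r // ltW.
    by linarith.
  have wx1 z : Num.sqrt c * x1 <= energy g x1 z.
    apply: energy_ge_G => //; first by rewrite mulr_ge0 // ltW.
    rewrite exprMn sqr_sqrtr ?(ltW c0) //.
    have [|_] := h2 x1; first by rewrite gtr0_norm.
    by have := sqr_ge0 z; linarith.
  have sw : Num.sqrt c * x1 = 2 * w by rewrite /w; field.
  rewrite sw in wx1.
  case: ends => [[xa [xb yb]]|[xb [xa ya]]]; rewrite ler_norml => /andP[H1 H2].
    have := wx1 (y a); rewrite -xa; rewrite xb yb in H1 H2 Cx; move: wq H1 H2 Cx; clear; linarith.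
  by have := wx1 (y b); rewrite -xb; rewrite xa ya in H1 H2 Cx; move: wq H1 H2 Cx; clear; linarith.
have lx1 : x1 <= x 0 by rewrite ex; linarith.
have x0x1 : - x1 <= x0 <= x1 by move: dx; rewrite ltr_norml; linarith.
case: (lerP t1 s) => st.
  have xm r q : s <= r -> r <= q -> q <= T -> x r <= x q.
    move=> sr rq qT; apply: (@nondecr R r q x y rq).
      by move=> z _; have [] := sxy z.
    move=> z /andP[rz zq]; apply/ltW/up.
    by rewrite (le_lt_trans (le_trans st sr) rz) (lt_le_trans zq qT).
  have [||r /andP[sr rT] xr] := @ivt_c R x s T x1 _ (xc _ _); first by linarith.
    by rewrite xs ET lx1 andbT; linarith.
  apply: (final s r 1 sr (or_introl erefl)); last by right.
    move=> t /andP[ts tr]; rewrite mul1r.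
    have : t <= T by exact: le_trans tr rT.
    rewrite le_eqVlt => /predU1P[->|tT]; first by rewrite EyT ey.
    have : t1 <= t by exact: le_trans st ts.
    by rewrite le_eqVlt => /predU1P[<-|tt1]; [rewrite yt | apply/ltW/up; rewrite tt1].
  move=> t /andP[ts tr]; rewrite ler_norml.
  have xst := xm s t (lexx _) ts (le_trans tr rT); have xtr := xm t r ts tr rT.
  by rewrite xs in xst; rewrite xr in xtr; rewrite xtr andbT (le_trans _ xst) //; case/andP: x0x1.
have xm r q : 0 <= r -> r <= q -> q <= s -> x q <= x r.
  move=> sr rq qT; rewrite -lerN2; apply: (@nondecr R r q (fun t => - x t) (fun t => - y t) rq).
    by move=> z _; have [h1 _] := sxy z; der.
  move=> z /andP[rz zq]; rewrite oppr_ge0; apply/ltW/lo.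
  by rewrite (le_lt_trans sr rz) (lt_trans (lt_le_trans zq qT) st).
have [||r /andP[r0 rs] xr] := @ivt_d R x 0 s x1 _ (xc _ _); first by linarith.
  by rewrite xs lx1; linarith.
apply: (final r s (-1) rs (or_intror erefl)); last by left.
  move=> t /andP[tr ts]; rewrite mulN1r oppr_ge0.
  have : 0 <= t by exact: le_trans r0 tr.
  rewrite le_eqVlt => /predU1P[<-|t0]; first by rewrite ey.
  by apply/ltW/lo; rewrite t0 (le_lt_trans ts st).
move=> t /andP[tr ts]; rewrite ler_norml.
have xtr := xm r t r0 tr ts; have xst := xm t s (le_trans r0 tr) ts (lexx _).
by rewrite xs in xst; rewrite xr in xtr; rewrite xtr andbT (le_trans _ xst) //; case/andP: x0x1.
Qed.

(** The tips bound the abscissae of the cycle, and the energy variation counted from the right tip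
    bounds [y]. This properness bounds the inside of a cycle and makes the level tend to infinity at
    infinity. *)
Lemma right_tip_proper (M : R) : exists2 B : R, 0 < B & forall x y : R,
  right_tip x y <= M -> `|x| <= B /\ `|y| <= B.
Proof.
pose M1 := Num.max M 1; have M10 : 0 < M1 by rewrite /M1 lt_max ltr01 orbT.
have MM1 : M <= M1 by rewrite /M1 le_max lexx.
have [_ [_ [_ [_ [m [[_ _ m0 Gm] _ _ _ _]]]]]] := cycle_structure hfg hb M10.
pose B := M1 + m; have B0 : 0 < B by rewrite addr_gt0.
have [C C0 hC] := poly_bound f B.
pose w := energy g M1 0; have w0 : 0 <= w by exact: sqrtr_ge0.
have CB : 0 < C * (2 * B) by rewrite !mulr_gt0.
exists (B + (w + C * (2 * B))) => [|x0 y0 hM]; first by linarith.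
case: (pselect (x0 != 0 \/ y0 != 0)) => [nz|z]; last first.
  have -> : x0 = 0 by apply/eqP/negPn/negP => h1; apply: z; left.
  have -> : y0 = 0 by apply/eqP/negPn/negP => h1; apply: z; right.
  by rewrite normr0; split; linarith.
have l0 := right_tip_gt0 nz.
have [x [y [t1 [T [l1 [s [[t10 t1T l10 Gl] [sxy per] [ex ey xt yt] [lo up] [sT xs ys]]]]]]]] :=
  on_cycle nz.
set l := right_tip x0 y0 in l0 hM Gl ex.
have lM : l <= M1 by linarith.
have Glm : (prim g).[l] <= (prim g).[M1].
  by move: lM; rewrite le_eqVlt => /predU1P[->//|lM]; apply/ltW/G_incr => //; exact: ltW.
have l1m : l1 <= m.
  apply: (G_inj (restoring_flip rg)); [exact: ltW | exact: ltW |].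
  by rewrite !prim_flipE Gl Gm.
have [ET EyT] : x T = x 0 /\ y T = y 0 by have := per 0; rewrite add0r.
have nzt t : x t != 0 \/ y t != 0.
  case: (eqVneq (x t) 0) => [e1|]; last by left.
  case: (eqVneq (y t) 0) => [e2|]; last by right.
  by have [z1 _] := sol_rest rg sxy e1 e2 0; move: l0; rewrite -ex z1 ltxx.
have wl : energy g l 0 <= w.
  by rewrite /w /energy; apply: ler_wsqrtr; rewrite lerD2l ler_wpM2l.
have final (a b sg : R) : a <= b -> sg = 1 \/ sg = -1 ->
    (forall t : R, a <= t <= b -> 0 <= sg * y t) ->
    (forall t : R, a <= t <= b -> - l1 <= x t <= l) ->
    (x a = l /\ y a = 0 /\ x b = x0 /\ y b = y0) \/
    (x b = l /\ y b = 0 /\ x a = x0 /\ y a = y0) ->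
    `|x0| <= B + (w + C * (2 * B)) /\ `|y0| <= B + (w + C * (2 * B)).
  move=> ab hsg hy hx ends.
  have xB t : a <= t <= b -> `|x t| <= B.
    by move=> /hx; rewrite ler_norml /B; linarith.
  have fb t : a <= t <= b -> `|f.[x t]| <= C by move=> /xB; exact: hC.
  have [aa bb] : a <= a <= b /\ a <= b <= b by rewrite !lexx ab.
  have := @energy_variation R f g x y a b C sg rg ab (fun t _ => sxy t) hsg hy (fun t _ => nzt t) fb.
  have xab : C * (sg * (x b - x a)) <= C * (2 * B).
    rewrite ler_wpM2l ?(ltW C0) //.
    have := xB a aa; have := xB b bb; rewrite !ler_norml.
    by case: hsg => ->; rewrite ?mul1r ?mulN1r; linarith.
  have xba := xB a aa; have xbb := xB b bb.
  have yq := energy_ge x0 y0 rg.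
  case: ends => [[xa [ya [xb yb]]]|[xb [yb [xa ya]]]]; rewrite ler_norml => /andP[H1 H2].
    rewrite xa ya xb yb in H1 H2 xab xbb; split; first by linarith.
    by move: yq wl H2 xab B0; clear; linarith.
  rewrite xa ya xb yb in H1 H2 xab xba; split; first by linarith.
  by move: yq wl H1 xab B0; clear; linarith.
case: (lerP t1 s) => st.
  have ynn t : t1 <= t <= T -> 0 <= y t.
    move=> /andP[]; rewrite le_eqVlt => /predU1P[<- _|tt1]; first by rewrite yt.
    by rewrite le_eqVlt => /predU1P[->|tT]; [rewrite EyT ey | apply/ltW/up; rewrite tt1].
  have xm r q : t1 <= r -> r <= q -> q <= T -> x r <= x q.
    move=> sr rq qT; apply: (@nondecr R r q x y rq).
      by move=> z _; have [] := sxy z.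
    by move=> z zrq; apply: ynn; linarith.
  apply: (final s T 1 _ (or_introl erefl)); first by linarith.
  - by move=> t ts; rewrite mul1r; apply: ynn; linarith.
  - move=> t ts; have := xm t1 t (lexx _); have := xm t T; rewrite xt ET ex; linarith.
  - by right; rewrite ET ex EyT.
have ynp t : 0 <= t <= t1 -> y t <= 0.
  move=> /andP[]; rewrite le_eqVlt => /predU1P[<- _|tt1]; first by rewrite ey.
  by rewrite le_eqVlt => /predU1P[->|tT]; [rewrite yt | apply/ltW/lo; rewrite tt1].
have xm r q : 0 <= r -> r <= q -> q <= t1 -> x q <= x r.
  move=> sr rq qT; rewrite -lerN2; apply: (@nondecr R r q (fun t => - x t) (fun t => - y t) rq).
    by move=> z _; have [h1 _] := sxy z; der.
  by move=> z zrq; rewrite oppr_ge0; apply: ynp; linarith.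
apply: (final 0 s (-1) _ (or_intror erefl)); first by linarith.
- by move=> t ts; rewrite mulN1r oppr_ge0; apply: ynp; linarith.
- move=> t ts; have := xm 0 t (lexx _); have := xm t t1; rewrite xt ex; linarith.
- by left.
Qed.

End RightTip.

(** * Conditions on the coefficients *)

Section Conditions.
Context {R : realType}.
Implicit Types (f g p : {poly R}).

Lemma coef_between (lo hi : nat) (a : nat -> R) (i : nat) :
  (poly_between lo hi a)`_i = if (lo <= i <= hi)%N then a i else 0.
Proof.
rewrite /poly_between coef_sum.
under eq_bigr => j _ do rewrite coefZ coefXn.
case: ifPn => h.
  have hi' : i \in index_iota lo hi.+1 by rewrite mem_index_iota ltnS.
  rewrite (bigD1_seq i) //=; last exact: iota_uniq.
  rewrite eqxx mulr1 big1 ?addr0 // => j ji.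
  by rewrite eq_sym (negbTE ji) mulr0.
rewrite big_seq big1 // => j; rewrite mem_index_iota ltnS => hj.
by case: eqP => [e|_]; rewrite ?mulr0 //; move: h; rewrite e hj.
Qed.

Lemma size_between (lo hi : nat) (a : nat -> R) : (lo <= hi)%N -> a hi != 0 ->
  size (poly_between lo hi a) = hi.+1.
Proof.
move=> lh ah; apply/eqP; rewrite eqn_leq; apply/andP; split.
  apply/leq_sizeP => j hj; rewrite coef_between.
  by rewrite [(j <= hi)%N]leqNgt hj andbF.
rewrite ltnNge; apply/negP => /leq_sizeP /(_ hi (leqnn _)) /eqP.
by rewrite coef_between lh leqnn (negbTE ah).
Qed.

Lemma weak_at0_of f g : f.[0] = 0 -> g.[0] = 0 -> 0 < g`_1 -> weak_at0 f g.
Proof.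
move=> f0 g0 g1; pose h := drop_poly 2 (prim g).
have Gc0 : (prim g)`_0 = 0 by rewrite -horner_coef0 prim0.
have Gc1 : (prim g)`_1 = 0 by rewrite coef_prim -horner_coef0 g0 mul0r.
have GE x : (prim g).[x] = x ^+ 2 * h.[x].
  rewrite -[in LHS](poly_take_drop 2 (prim g)) hornerD hornerM hornerXn.
  rewrite (_ : take_poly 2 (prim g) = 0) ?horner0 ?add0r 1?mulrC //.
  by apply/polyP => -[|[|i]]; rewrite coef_take_poly coef0 /= ?Gc0 ?Gc1.
have h0 : h.[0] = g`_1 / 2 by rewrite horner_coef0 coef_drop_poly add0n coef_prim.
have [K K0 hK] := poly_lip h 1; have [L L0 hL] := poly_lip f 1.
pose d := Num.min 1 (g`_1 / (4 * K)).
have d0 : 0 < d by rewrite /d lt_min ltr01 divr_gt0 // mulr_gt0.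
have d1 : d <= 1 by rewrite /d ge_min lexx.
have d2 : K * d <= g`_1 / 4.
  have : d <= g`_1 / (4 * K) by rewrite /d ge_min lexx orbT.
  by rewrite ler_pdivlMr ?mulr_gt0 //; linarith.
exists (g`_1 / 2), L, d; split => //; first by rewrite divr_gt0.
move=> x xd; have x1 : `|x| <= 1 by linarith.
have z1 : `|0 : R| <= 1 by rewrite normr0.
split; first by have := hL x 0 x1 z1; rewrite f0 !subr0.
rewrite GE; have := hK x 0 x1 z1; rewrite h0 subr0 ler_norml => /andP[H _].
have Kx : K * `|x| <= K * d by apply: ler_wpM2l => //; exact: ltW.
have : g`_1 / 4 <= h.[x] by linarith.
by have := sqr_ge0 x; nra.
Qed.

(** Completing the square: the form [(n + 1) y^2 - B p |y| + A p^2], with [p = |x|^(n+1)], is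
    positive definite exactly when [B^2 < 4 (n + 1) A]. *)
Lemma far_rotating_of f g (n : nat) (A B X : R) : 0 <= B -> B ^+ 2 < 4 * n.+1%:R * A ->
  (forall x : R, X <= `|x| -> `|x * f.[x]| <= B * `|x| ^+ n.+1 /\
     A * x ^+ (2 * n + 2) <= x * g.[x]) ->
  far_rotating f g n X (A - B ^+ 2 / (4 * n.+1%:R)).
Proof.
move=> B0 BA h x y /h [hf hg].
have n0 : (0 : R) < n.+1%:R by rewrite ltr0n.
pose p := `|x| ^+ n.+1; have p0 : 0 <= p by rewrite exprn_ge0.
have pE : x ^+ (2 * n + 2) = p ^+ 2.
  rewrite /p -exprM mulnC -normrX ger0_norm; first by congr (_ ^+ _); lia.
  by rewrite mulnC exprM exprn_ge0 // sqr_ge0.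
rewrite pE in hg *.
have h1 : - (B * p * `|y|) <= x * f.[x] * y.
  have : `|x * f.[x] * y| <= B * p * `|y| by rewrite normrM ler_wpM2r.
  by rewrite ler_norml => /andP[].
have h2 : 0 <= n.+1%:R * (`|y| - B * p / (2 * n.+1%:R)) ^+ 2.
  by rewrite mulr_ge0 ?sqr_ge0 // ltW.
have E : n.+1%:R * (`|y| - B * p / (2 * n.+1%:R)) ^+ 2 =
   n.+1%:R * y ^+ 2 - B * p * `|y| + B ^+ 2 / (4 * n.+1%:R) * p ^+ 2.
  rewrite -[y ^+ 2](real_normK (num_real y)); field; rewrite gt_eqF //.
rewrite mulrBl; move: h1 h2 hg; rewrite E.
by move: (n.+1%:R * _) (B ^+ 2 / _ * _) => u v; linarith.
Qed.

Lemma linear_factor_bound f (n : nat) (d : R) : 0 < d -> (0 < n)%N -> size f = n.+1 ->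
  exists2 X : R, 1 <= X & forall x : R, X <= `|x| ->
    `|x * f.[x]| <= (`|f`_n| + d) * `|x| ^+ n.+1.
Proof.
move=> d0 n0 sf; have [C C0 hC] := poly_asym (eq_leq sf).
exists (1 + C / d) => [|x Xx]; first by rewrite lerDl divr_ge0 // ltW.
have Cd : 0 <= C / d by rewrite divr_ge0 // ltW.
have x1 : 1 <= `|x| by linarith.
have := hC x x1 => H; rewrite normrM.
have fb : `|f.[x]| <= `|f`_n| * `|x| ^+ n + C * `|x| ^+ n.-1.
  have := ler_normD (f.[x] - f`_n * x ^+ n) (f`_n * x ^+ n).
  by rewrite subrK normrM normrX; linarith.
have Cx : C * `|x| ^+ n.-1 <= d * `|x| ^+ n.
  rewrite -[in X in _ <= X](prednK n0) exprS mulrA ler_wpM2r ?exprn_ge0 //.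
  have : C / d <= `|x| by linarith.
  by rewrite ler_pdivrMr // mulrC.
rewrite exprS mulrCA ler_wpM2l //; linarith.
Qed.

Lemma far_rotating_of_conditions f g (m n : nat) :
  size f = n.+1 -> size g = m.+1 -> (0 < n)%N ->
  [/\ odd m, (2 * n + 1 < m)%N & 0 < g`_m] \/
  (m = (2 * n + 1)%N /\ f`_n ^+ 2 < 4 * n.+1%:R * g`_m) ->
  exists X eta : R, [/\ 1 <= X, 0 < eta & far_rotating f g n X eta].
Proof.
move=> sf sg n0 H.
have p0 : (0 : R) < n.+1%:R by rewrite ltr0n.
suff [A [B [X [X1 B0 BA h]]]] : exists A B X : R, [/\ 1 <= X, 0 <= B,
    B ^+ 2 < 4 * n.+1%:R * A &
    forall x : R, X <= `|x| -> `|x * f.[x]| <= B * `|x| ^+ n.+1 /\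
      A * x ^+ (2 * n + 2) <= x * g.[x]].
  exists X, (A - B ^+ 2 / (4 * n.+1%:R)); split => //; last exact: far_rotating_of.
  by rewrite subr_gt0 ltr_pdivrMr ?mulr_gt0 // mulrC.
have [C C0 hC] := poly_asym (eq_leq sg).
have geven (k : nat) (x : R) : x ^+ (2 * k) = `|x| ^+ (2 * k).
  by rewrite !exprM real_normK ?num_real.
case: H => [[om nm gm]|[em dm]].
- have [X X1 hX] := linear_factor_bound ltr01 n0 sf.
  pose B := `|f`_n| + 1; have B0 : 0 <= B by rewrite addr_ge0.
  (* As [g] grows faster than [x^(2n+1)] in this case, any [A] is allowed; this one satisfies the
     discriminant condition. *)
  pose A := B ^+ 2 + 1; have A0 : 0 < A by have := sqr_ge0 B; rewrite /A; linarith.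
  exists A, B, (X + 2 * C / g`_m + 2 * A / g`_m).
  have c1 : 0 <= 2 * C / g`_m by rewrite divr_ge0 ?mulr_ge0 // ltW.
  have c2 : 0 <= 2 * A / g`_m by rewrite divr_ge0 ?mulr_ge0 // ltW.
  split => //; first by linarith.
    have n1 : (1 : R) <= n.+1%:R by rewrite ler1n.
    have : 1 * A <= n.+1%:R * A by rewrite ler_wpM2r // ltW.
    have := sqr_ge0 B; rewrite /A; linarith.
  move=> x Xx; split; first by apply: hX; linarith.
  have x1 : 1 <= `|x| by linarith.
  have x0 : 0 < `|x| by linarith.
  have [j mE] : exists j, (m = 2 * n + 1 + 2 * j.+1)%N.
    have ek : ~~ odd (m - (2 * n + 1)).
      by rewrite oddB ?(ltnW nm) // om oddD mul2n odd_double.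
    have := odd_double_half (m - (2 * n + 1)); rewrite (negbTE ek) add0n -mul2n.
    move: (_./2) => q qE; exists q.-1; clear -qE nm; lia.
  have me : x * x ^+ m = `|x| ^+ m.+1.
    rewrite -exprS (_ : m.+1 = 2 * (n + j.+2))%N; last by clear -mE; lia.
    exact: geven.
  have := hC x x1 => hh.
  have : `|x * (g.[x] - g`_m * x ^+ m)| <= `|x| * (C * `|x| ^+ m.-1) by rewrite normrM ler_wpM2l.
  rewrite ler_norml => /andP[+ _]; rewrite mulrBr [x * (_ * x ^+ m)]mulrCA me [`|x| * (C * _)]mulrCA -exprS.
  rewrite prednK; last by clear -mE; lia.
  move=> h1.
  have h2 : C * `|x| ^+ m <= g`_m / 2 * `|x| ^+ m.+1.
    rewrite exprS mulrA ler_wpM2r ?exprn_ge0 //.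
    have : 2 * C / g`_m <= `|x| by linarith.
    by rewrite ler_pdivrMr //; linarith.
  have h3 : A * x ^+ (2 * n + 2) <= g`_m / 2 * `|x| ^+ m.+1.
    have -> : x ^+ (2 * n + 2) = `|x| ^+ (2 * n + 2).
      by rewrite (_ : 2 * n + 2 = 2 * n.+1)%N; [exact: geven | clear; lia].
    rewrite (_ : m.+1 = (2 * n + 2) + 2 * j.+1)%N; last by clear -mE; lia.
    rewrite [`|x| ^+ (2 * n + 2 + _)]exprD [X in _ <= X]mulrCA [A * _]mulrC ler_wpM2l ?exprn_ge0 //.
    have : 2 * A / g`_m <= `|x| by linarith.
    rewrite ler_pdivrMr // => h4.
    have h5 : `|x| <= `|x| ^+ (2 * j.+1) by rewrite ler_eXnr.
    have h6 : `|x| * g`_m <= `|x| ^+ (2 * j.+1) * g`_m by rewrite ler_wpM2r // ltW.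
    by move: h4 h6; clear; linarith.
  by linarith.
- set a := g`_m in dm hC *.
  pose gap := 4 * n.+1%:R * a - f`_n ^+ 2.
  have gap0 : 0 < gap by rewrite subr_gt0.
  (* Replacing [a] by [a - d] and [|f_n|] by [|f_n| + d] costs at most [d S] in the discriminant
     when [d <= 1]; the choice of [d] spends half of the gap. *)
  pose S := 2 * `|f`_n| + 1 + 4 * n.+1%:R.
  have S0 : 0 < S by have := normr_ge0 f`_n; rewrite /S; linarith.
  pose d := Num.min 1 (gap / (2 * S)).
  have d0 : 0 < d by rewrite /d lt_min ltr01 divr_gt0 // mulr_gt0.
  have d1 : d <= 1 by rewrite /d ge_min lexx.
  have d2 : d * S <= gap / 2.
    have : d <= gap / (2 * S) by rewrite /d ge_min lexx orbT.
    by rewrite ler_pdivlMr ?mulr_gt0 //; linarith.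
  have [X X1 hX] := linear_factor_bound d0 n0 sf.
  have Cd : 0 <= C / d by rewrite divr_ge0 // ltW.
  exists (a - d), (`|f`_n| + d), (X + C / d); split.
  + by linarith.
  + by rewrite addr_ge0 // ltW.
  + have -> : (`|f`_n| + d) ^+ 2 = f`_n ^+ 2 + 2 * `|f`_n| * d + d * d.
      by rewrite -[f`_n ^+ 2](real_normK (num_real _)); ring.
    have dd : d * d <= d * 1 by rewrite ler_wpM2l // ltW.
    by move: dd d2 gap0; rewrite /gap /S; linarith.
  move=> x Xx; split; first by apply: hX; linarith.
  have x1 : 1 <= `|x| by linarith.
  have := hC x x1 => hh.
  have me : x * x ^+ m = `|x| ^+ m.+1.
    rewrite -exprS (_ : m.+1 = 2 * n.+1)%N; last by clear -em; lia.
    exact: geven.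
  have : `|x * (g.[x] - a * x ^+ m)| <= `|x| * (C * `|x| ^+ m.-1) by rewrite normrM ler_wpM2l.
  rewrite ler_norml => /andP[+ _]; rewrite mulrBr [x * (_ * x ^+ m)]mulrCA me [`|x| * (C * _)]mulrCA -exprS.
  rewrite prednK; last by clear -em; lia.
  have -> : x ^+ (2 * n + 2) = `|x| ^+ m.+1.
    by rewrite (_ : 2 * n + 2 = 2 * n.+1)%N; [rewrite geven; congr (_ ^+ _); clear -em; lia | clear; lia].
  have h2 : C * `|x| ^+ m <= d * `|x| ^+ m.+1.
    rewrite exprS mulrA ler_wpM2r ?exprn_ge0 //.
    have : C / d <= `|x| by linarith.
    by rewrite ler_pdivrMr // mulrC.
  by linarith.
Qed.

Lemma tame_of_conditions f g (m n : nat) : restoring g -> f.[0] = 0 -> 0 < g`_1 ->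
  size f = n.+1 -> size g = m.+1 -> (0 < n)%N ->
  [/\ odd m, (2 * n + 1 < m)%N & 0 < g`_m] \/
  (m = (2 * n + 1)%N /\ f`_n ^+ 2 < 4 * n.+1%:R * g`_m) -> tame f g.
Proof.
move=> rg f0 g1 sf sg n0 H; split => //; first exact: (weak_at0_of f0 (restoring_0 rg) g1).
by have [X [eta h]] := far_rotating_of_conditions sf sg n0 H; exists n, X, eta.
Qed.

(** At [X] and at [- X] the leading term of [g] dominates, so [a x^(m+1)] inherits the sign of
    [x g(x)] at both points. *)
Lemma restoring_lead g (m : nat) : restoring g -> size g = m.+1 ->
  odd m /\ 0 < g`_m.
Proof.
move=> rg sg; set a := g`_m.
have a0 : a != 0.
  have : g != 0 by rewrite -size_poly_eq0 sg.
  by rewrite -lead_coef_eq0 lead_coefE sg.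
have m0 : (0 < m)%N.
  rewrite lt0n; apply/eqP => e; move: a0.
  by rewrite /a e -horner_coef0 restoring_0 // eqxx.
have na : 0 < `|a| by rewrite normr_gt0.
have [C C0 hC] := poly_asym (eq_leq sg).
pose X := 1 + C / `|a|.
have CX : 0 < C / `|a| by rewrite divr_gt0.
have key (x : R) : `|x| = X -> 0 < a * x ^+ m.+1.
  move=> xX; have x1 : 1 <= `|x| by rewrite xX /X; linarith.
  have x0 : x != 0 by rewrite -normr_gt0; linarith.
  have := rg x x0 => pos; rewrite exprS mulrCA.
  have := hC x x1; rewrite -/a => H.
  have H2 : `|x * g.[x] - x * (a * x ^+ m)| < `|x * (a * x ^+ m)|.
    rewrite -mulrBr !normrM ltr_pM2l ?normr_gt0 //; apply: le_lt_trans H _.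
    rewrite normrX -[in X in _ < X](prednK m0) exprS mulrA ltr_pM2r ?exprn_gt0 ?normr_gt0 //.
    by rewrite xX /X mulrDr mulr1 mulrC divfK ?gt_eqF //; linarith.
  rewrite ltNge; apply/negP => neg.
  by move: H2; rewrite (ler0_norm neg) ltr_norml; linarith.
have X0 : 0 <= X by rewrite /X; linarith.
have k1 := key X (ger0_norm X0).
have k2 := key (- X) (etrans (normrN _) (ger0_norm X0)).
have apos : 0 < a by move: k1; rewrite pmulr_lgt0 // exprn_gt0 // /X; linarith.
split => //; apply: contraT => om.
by move: k2; rewrite exprNn -signr_odd /= om expr1 mulN1r mulrN oppr_gt0; linarith.
Qed.

Lemma growth_necessary f g (m n : nat) : restoring g -> all_periodic f g ->
  size f = n.+1 -> size g = m.+1 ->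
  [/\ odd m, (2 * n + 1 < m)%N & 0 < g`_m] \/
  (m = (2 * n + 1)%N /\ f`_n ^+ 2 < 4 * n.+1%:R * g`_m).
Proof.
move=> rg per sf sg; have [om gm] := restoring_lead rg sg.
case: (ltngtP m (2 * n + 1)%N) => [mn|mn|mE].
- exfalso; apply: (slow_growth_escape sf _ _ per); first by rewrite sg; lia.
  by rewrite [g`_ _]nth_default ?sg // mulr0 sqr_ge0.
- by left.
- right; split => //; rewrite ltNge; apply/negP => le_.
  apply: (slow_growth_escape sf _ _ per); first by rewrite sg mE addn2 addn1.
  by rewrite -mE.
Qed.

(** The polynomial [g(x) / x] has no zero and is positive at [0]. *)
Lemma restoring_of g : g.[0] = 0 -> 0 < g`_1 -> (forall x : R, x != 0 -> g.[x] != 0) ->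
  restoring g.
Proof.
move=> g0 g1 gn; pose h := drop_poly 1 g.
have gE x : g.[x] = x * h.[x].
  rewrite -[in LHS](poly_take_drop 1 g) hornerD hornerM hornerX.
  rewrite (_ : take_poly 1 g = 0) ?horner0 ?add0r 1?mulrC //.
  by apply/polyP => -[|i]; rewrite coef_take_poly coef0 /= // -horner_coef0.
have h0 : h.[0] = g`_1 by rewrite horner_coef0 coef_drop_poly.
have hn x : h.[x] != 0.
  case: (eqVneq x 0) => [->|x0]; first by rewrite h0 gt_eqF.
  by have := gn x x0; rewrite gE mulf_eq0 negb_or => /andP[].
move=> x x0; rewrite gE mulrA -expr2 pmulr_rgt0 ?exprn_even_gt0 //.
have [||pos|neg] := @sign_constant R (horner h) (- `|x| - 1) (`|x| + 1).
- by move=> t _; exact: continuous_horner.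
- by move=> t _; exact: hn.
- by apply: pos; have := ler_norm x; have := ler_norm (- x); rewrite normrN; linarith.
- have : h.[0] < 0 by apply: neg; have := normr_ge0 x; linarith.
  by rewrite h0 ltNge (ltW g1).
Qed.

End Conditions.

(** * The center in the plane *)

Section RowVectors.
Context {R : realType}.

Lemma nbhs_rV n (q : 'rV[R]_n) (A : set 'rV[R]_n) :
  nbhs q A <-> exists2 d : R, 0 < d &
    forall z : 'rV[R]_n, (forall j, `|q 0 j - z 0 j| < d) -> A z.
Proof.
split.
- move=> /nbhs_ballP [d d0 hd]; exists d => // z hz; apply: hd.
  by split => // i j; rewrite !ord1; exact: hz.
- move=> [d d0 hd]; apply/nbhs_ballP; exists d => // z [_ hz].
  by apply: hd => j; exact: hz.
Qed.

Lemma vec2_0 (x y : R) : vec2 x y 0 0 = x. Proof. by rewrite mxE. Qed.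
Lemma vec2_1 (x y : R) : vec2 x y 0 1 = y. Proof. by rewrite mxE. Qed.
Lemma vec3_0 (x y z : R) : vec3 x y z 0 0 = x. Proof. by rewrite mxE. Qed.
Lemma vec3_1 (x y z : R) : vec3 x y z 0 1 = y. Proof. by rewrite mxE. Qed.
Lemma vec3_2 (x y z : R) : vec3 x y z 0 2 = z. Proof. by rewrite mxE. Qed.

Lemma ord2_ind (P : 'I_2 -> Prop) : P 0 -> P 1 -> forall j, P j.
Proof.
move=> h0 h1 [[|[|//]] h]; [rewrite (_ : Ordinal h = 0) // | rewrite (_ : Ordinal h = 1) //];
  exact: val_inj.
Qed.

Lemma ord3_ind (P : 'I_3 -> Prop) : P 0 -> P 1 -> P 2 -> forall j, P j.
Proof.
move=> h0 h1 h2 [[|[|[|//]]] h]; [rewrite (_ : Ordinal h = 0) // |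
  rewrite (_ : Ordinal h = 1) // | rewrite (_ : Ordinal h = 2) //]; exact: val_inj.
Qed.

Lemma rV2_eq (p q : 'rV[R]_2) : p 0 0 = q 0 0 -> p 0 1 = q 0 1 -> p = q.
Proof. by move=> h0 h1; apply/rowP; apply: ord2_ind. Qed.

Lemma rV3_eq (p q : 'rV[R]_3) : p 0 0 = q 0 0 -> p 0 1 = q 0 1 -> p 0 2 = q 0 2 -> p = q.
Proof. by move=> h0 h1 h2; apply/rowP; apply: ord3_ind. Qed.

Lemma vec2E (q : 'rV[R]_2) : vec2 (q 0 0) (q 0 1) = q.
Proof. by apply: rV2_eq; rewrite ?vec2_0 ?vec2_1. Qed.

Lemma rV2_neq0 (q : 'rV[R]_2) : q != 0 <-> (q 0 0 != 0 \/ q 0 1 != 0).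
Proof.
split.
- move=> qn; case: (eqVneq (q 0 0) 0) => [e0|]; last by left.
  case: (eqVneq (q 0 1) 0) => [e1|]; last by right.
  by move: qn; rewrite (_ : q = 0) ?eqxx //; apply: rV2_eq; rewrite mxE.
- by move=> [] /eqP h; apply/eqP => e; apply: h; rewrite e mxE.
Qed.

Lemma der_vec2 (x y : R -> R) (t a b : R) :
  is_derive t (1 : R) (fun s => vec2 (x s) (y s)) (vec2 a b) <->
  is_derive t (1 : R) x a /\ is_derive t (1 : R) y b.
Proof.
have E0 : (fun s => vec2 (x s) (y s) 0 0) = x by apply/funext => s; rewrite vec2_0.
have E1 : (fun s => vec2 (x s) (y s) 0 1) = y by apply/funext => s; rewrite vec2_1.
split.
- move/is_derive_mx => h; have := h 0 0; have := h 0 1.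
  by rewrite E0 E1 vec2_0 vec2_1.
- move=> [h0 h1]; apply/is_derive_mx => i; rewrite ord1; apply: ord2_ind.
    by rewrite E0 vec2_0.
  by rewrite E1 vec2_1.
Qed.

Lemma der_mx_cont n (c : R -> 'rV[R]_n) (t : R) v :
  is_derive t (1 : R) c v -> {for t, continuous c}.
Proof.
by move=> [h _]; apply/differentiable_continuous; rewrite -derivable1_diffP.
Qed.

End RowVectors.

Section Plane.
Context {R : realType}.
Variables f g : {poly R}.
Let V := field_eval (lienard f g).

Lemma fieldE (q : 'rV[R]_2) : V q = vec2 (q 0 1) (acc f g (q 0 0) (q 0 1)).
Proof.
rewrite /V /field_eval /lienard /= hornerX hornerC; congr vec2.
by rewrite /acc hornerD !hornerN hornerM hornerX !hornerC !hornerE.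
Qed.

Lemma der_fieldE (c : R -> 'rV[R]_2) (t : R) : is_derive t (1 : R) c (V (c t)) <->
  solves f g (fun s => c s 0 0) (fun s => c s 0 1) t.
Proof.
rewrite fieldE /solves -der_vec2.
by rewrite (_ : (fun s => vec2 _ _) = c) //; apply/funext => s; rewrite vec2E.
Qed.

Lemma sol_der (x y : R -> R) : sol f g x y -> forall t,
  is_derive t (1 : R) (fun s => vec2 (x s) (y s)) (V (vec2 (x t) (y t))).
Proof. by move=> h t; rewrite fieldE vec2_0 vec2_1; apply/der_vec2; exact: h. Qed.

Lemma all_periodic_of_global_center : global_center V 0 -> all_periodic f g.
Proof.
move=> [_ [[_ H _] _]] x0 y0 nz.
have qn : ~ [set (0 : 'rV[R]_2)] (vec2 x0 y0).
  move=> /= e; case: nz => /eqP h; apply: h.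
    by rewrite -(vec2_0 x0 y0) e mxE.
  by rewrite -(vec2_1 x0 y0) e mxE.
have [Om [[c [T [T0 hc per nc ->]]] _ [t0 _ ct0] _]] := H _ qn.
exists (fun t => c (t + t0) 0 0), (fun t => c (t + t0) 0 1), T; split => //.
- have h : sol f g (fun t => c t 0 0) (fun t => c t 0 1) by move=> t; apply/der_fieldE.
  exact: (sol_shift t0 h).
- by move=> t; rewrite addrAC per.
- by rewrite add0r ct0 vec2_0.
- by rewrite add0r ct0 vec2_1.
Qed.

Lemma no_equilibrium_of_global_center (x : R) : global_center V 0 -> x != 0 -> g.[x] != 0.
Proof.
move=> [_ [[_ H _] _]] x0; apply/eqP => gx.
have qn : ~ [set (0 : 'rV[R]_2)] (vec2 x 0).
  by move=> /= e; move/eqP: x0; apply; rewrite -(vec2_0 x 0) e mxE.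
have [Om [[c [T [T0 hc per [t1 nc] ->]]] _ [t0 _ ct0] _]] := H _ qn.
have h : sol f g (fun t => c t 0 0) (fun t => c t 0 1) by move=> t; apply/der_fieldE.
have hz : sol f g (fun=> x) (fun=> 0).
  move=> s; split; first exact: derC.
  by apply: (der_eq (derC s 0)); rewrite /acc gx mulr0 subr0 oppr0.
have e0 : c t0 0 0 = x by rewrite ct0 vec2_0.
have e1 : c t0 0 1 = 0 by rewrite ct0 vec2_1.
have E := sol_unique h hz e0 e1.
move/eqP: nc; apply; apply: rV2_eq.
- by have [-> _] := E t1; have [-> _] := E 0.
- by have [_ ->] := E t1; have [_ ->] := E 0.
Qed.

Lemma field0_of_global_center : global_center V 0 -> g.[0] = 0.
Proof.
move=> [[+ _] _]; rewrite fieldE !mxE /acc mulr0 subr0 => /rowP /(_ 1).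
by rewrite vec2_1 mxE => /eqP; rewrite oppr_eq0 => /eqP.
Qed.

Hypothesis hfg : tame f g.
Hypothesis hb : balanced f g.
Let rg : restoring g. Proof. by case: hfg. Qed.

Definition cycle_level (q : 'rV[R]_2) : R := right_tip f g (q 0 0) (q 0 1).
Definition cycle_of (q : 'rV[R]_2) : set 'rV[R]_2 := [set q' | cycle_level q' = cycle_level q].

Lemma cycle_level0 : cycle_level 0 = 0.
Proof. by rewrite /cycle_level !mxE right_tip0. Qed.

Lemma cycle_level_gt0 q : q != 0 -> 0 < cycle_level q.
Proof. by move=> /rV2_neq0; exact: right_tip_gt0. Qed.

Lemma cycle_level_eq0 q : cycle_level q = 0 -> q = 0.
Proof.
move=> h; apply/eqP; apply: contraT => /cycle_level_gt0; by rewrite h ltxx.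
Qed.

Lemma cycle_level_continuous : continuous cycle_level.
Proof.
move=> q A /nbhs_ballP [e /= e0 he]; change (nbhs q (cycle_level @^-1` A)).
case: (eqVneq q 0) => [q0|qn].
- rewrite q0 in he *; have [d d0 hd] := right_tip_cont0 hfg hb e0.
  apply/nbhs_rV; exists d => // z hz; apply: he.
  have hz0 := hz 0; have hz1 := hz 1; rewrite !mxE !sub0r !normrN in hz0 hz1.
  have : `|cycle_level 0 - cycle_level z| < e.
    by rewrite cycle_level0 sub0r normrN ger0_norm ?right_tip_ge0 //; exact: hd.
  exact.
- have [d d0 hd] := right_tip_cont_pos hfg hb ((rV2_neq0 q).1 qn) e0.
  apply/nbhs_rV; exists d => // z hz; apply: he.
  have : `|cycle_level q - cycle_level z| < e.
    by rewrite distrC; apply: hd; rewrite distrC; exact: hz.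
  exact.
Qed.

Lemma cycle_level_solution (q q' : 'rV[R]_2) : q != 0 -> cycle_level q' = cycle_level q ->
  exists (x y : R -> R) (t : R), [/\ sol f g x y,
    vec2 (x 0) (y 0) = q & vec2 (x t) (y t) = q'].
Proof.
move=> qn e; have q'n : q' != 0.
  apply/eqP => e'; have := cycle_level_gt0 qn.
  by rewrite -e e' cycle_level0 ltxx.
have [l0 [u [v [t [h eu ev ut vt]]]]] := right_tipP hfg hb ((rV2_neq0 q).1 qn).
have [l0' [u' [v' [t' [h' eu' ev' ut' vt']]]]] := right_tipP hfg hb ((rV2_neq0 q').1 q'n).
rewrite -/(cycle_level q') e /cycle_level -ut in ut'.
have hs := sol_shift t h; have hs' := sol_shift t' h'.
have E := @sol_unique R f g _ _ _ _ 0 hs hs'; rewrite !add0r in E.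
have {}E := E (esym ut') (etrans vt (esym vt')).
exists u, v, (t - t'); split => //; first by rewrite eu ev vec2E.
by have := E (- t'); rewrite addrC addNr => -[-> ->]; rewrite eu' ev' vec2E.
Qed.

Lemma solution_level (x y : R -> R) (s t : R) : sol f g x y ->
  cycle_level (vec2 (x t) (y t)) = cycle_level (vec2 (x s) (y s)).
Proof.
move=> h; rewrite /cycle_level !vec2_0 !vec2_1.
by rewrite (right_tip_flow hfg hb t h) (right_tip_flow hfg hb s h).
Qed.

Lemma periodic_orbit_cycle q : q != 0 -> periodic_orbit V (cycle_of q).
Proof.
move=> qn; have nz := (rV2_neq0 q).1 qn.
have [x [y [T [h T0 per [ex ey] [[t t1 t2] [s s1 s2]]]]]] := has_cycle_all hfg hb nz.
have q0 : vec2 (x 0) (y 0) = q by rewrite ex ey vec2E.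
exists (fun t => vec2 (x t) (y t)), T; split => //.
- exact: sol_der.
- by move=> r; have [-> ->] := per r.
- case: (lerP (x 0) 0) => x0; [exists t | exists s]; apply/eqP => /rowP /(_ 0);
    rewrite !vec2_0 => e; linarith.
- apply/seteqP; split => z.
    rewrite /cycle_of /= => ez.
    have [u [v [r [h' e0 er]]]] := cycle_level_solution qn ez.
    exists r => //; rewrite -er; have := e0; rewrite -q0 => /rowP e1.
    have := e1 0; have := e1 1; rewrite !vec2_0 !vec2_1 => ev eu.
    by have [-> ->] := sol_unique h h' (esym eu) (esym ev) r.
  by move=> [r _ <-]; rewrite /cycle_of /= (solution_level 0 r h) q0.
Qed.

Lemma reach_level (N : set 'rV[R]_2) (q q' : 'rV[R]_2) :
  reach V N q q' -> cycle_level q' = cycle_level q.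
Proof.
move=> [c [tau [tau0 c0 ct hc]]].
have hs t : 0 <= t <= tau -> solves f g (fun s => c s 0 0) (fun s => c s 0 1) t.
  by move=> /hc [h _]; apply/der_fieldE.
case: (eqVneq q 0) => [q0|qn].
  have hz : sol f g (fun=> 0) (fun=> 0).
    move=> s; split; first exact: derC.
    by apply: (der_eq (derC s 0)); rewrite /acc restoring_0 // mulr0 subr0 oppr0.
  have [||e0 e1] := @solves_unique R f g 0 tau (fun s => c s 0 0) (fun s => c s 0 1) _ _ tau0 hs
    (fun t _ => hz t).
  + by rewrite c0 q0 mxE.
  + by rewrite c0 q0 mxE.
  by rewrite -ct q0 cycle_level0 /cycle_level e0 e1 right_tip0.
have [x [y [T [h T0 per [ex ey] _]]]] := has_cycle_all hfg hb ((rV2_neq0 q).1 qn).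
have [||e0 e1] := @solves_unique R f g 0 tau (fun s => c s 0 0) (fun s => c s 0 1) x y tau0 hs
    (fun t _ => h t).
+ by rewrite c0 ex.
+ by rewrite c0 ey.
rewrite -ct /cycle_level e0 e1 (right_tip_flow hfg hb tau h) ex ey //.
Qed.

Lemma flow_orbitE q : q != 0 -> flow_orbit V q = cycle_of q.
Proof.
move=> qn; apply/seteqP; split => z.
- move=> [|] h; rewrite /cycle_of /=; first exact: reach_level h.
  by rewrite (reach_level h).
- move=> ez; have [x [y [t [h e0 et]]]] := cycle_level_solution qn ez.
  case: (lerP 0 t) => t0; [left | right].
    exists (fun t => vec2 (x t) (y t)), t; split => // s _.
    by split => //; exact: sol_der.
  exists (fun s => vec2 (x (s + t)) (y (s + t))), (- t); split => //.
  + by linarith.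
  + by rewrite add0r.
  + by rewrite addNr.
  + by move=> s _; split => //; apply: (sol_der (sol_shift t h)).
Qed.

(** A connected set through the origin that avoids the cycle has, by continuity of the level, only
    levels up to that of [q]; these fill a bounded set. *)
Lemma surrounds_cycle q : q != 0 -> surrounds (cycle_of q) 0.
Proof.
move=> qn; split.
  move=> e; have e' : cycle_level 0 = cycle_level q := e.
  by have := cycle_level_gt0 qn; rewrite -e' cycle_level0 ltxx.
have [B B0 hB] := right_tip_proper hfg hb (cycle_level q).
suff sub : connected_component (~` cycle_of q) 0 `<=`
    [set z | `|z 0 0| <= B /\ `|z 0 1| <= B].
  exists B; split; first exact: num_real.
  move=> M BM z /sub [h0 h1].
  change (`|z| <= M); rewrite /Num.Def.normr /= mx_normrE; apply/bigmax_leP; split; first by linarith.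
  by move=> [i j] _ /=; rewrite ord1; elim/ord2_ind: j; linarith.
move=> z [C [C0 Cc Ccon] Cz]; apply: hB.
rewrite leNgt; apply/negP => lt_.
have Icon : connected (cycle_level @` C).
  by apply: connected_continuous_connected => //; apply: continuous_subspaceT;
    exact: cycle_level_continuous.
have /connected_intervalP Iint := Icon.
have : (cycle_level @` C) (cycle_level q).
  apply: (Iint (cycle_level 0) (cycle_level z)).
  - by exists 0.
  - by exists z.
  - by rewrite cycle_level0 ltW //= ?cycle_level_gt0 // ltW.
by move=> [w Cw ew]; apply: (Cc w Cw).
Qed.

(** Every cycle is connected and meets the positive half axis, so the punctured plane is a union of
    connected sets that share this half axis. *)
Lemma punctured_plane_connected : connected (~` [set (0 : 'rV[R]_2)]).
Proof.
pose P := (fun l => vec2 l 0) @` [set l : R | 0 < l].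
have lin_cont : continuous (fun l : R => vec2 l 0).
  move=> l; apply: (@der_mx_cont _ _ _ _ (vec2 1 0)); apply/der_vec2.
  by split; [exact: derI | exact: derC].
have Pcon : connected P.
  apply: connected_continuous_connected; last exact: continuous_subspaceT.
  by apply/connected_intervalP => a b /= a0 b0 z; linarith.
have -> : ~` [set (0 : 'rV[R]_2)] =
    \bigcup_(q in ~` [set (0 : 'rV[R]_2)]) (cycle_of q `|` P).
  apply/seteqP; split => [q qn|z [q qn [ez|[l /= l0 <-]]]].
  - by exists q => //; left.
  - move=> /= z0; apply: qn => /=; apply: cycle_level_eq0.
    by rewrite -ez z0 cycle_level0.
  - by move=> /= e; move: l0; rewrite -(vec2_0 l 0) e mxE ltxx.
apply: bigcup_connected.
  by exists (vec2 1 0) => q _; right; exists 1 => //=.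
move=> q /eqP qn; apply: connectedU => //.
- exists (vec2 (cycle_level q) 0); split; last first.
    by exists (cycle_level q) => //=; exact: cycle_level_gt0.
  rewrite /cycle_of /= {1}/cycle_level vec2_0 vec2_1 right_tip_axis //.
  exact: cycle_level_gt0.
- have [c [T [_ hc _ _ ->]]] := periodic_orbit_cycle qn.
  apply: connected_continuous_connected; last first.
    by apply: continuous_subspaceT => t; exact: der_mx_cont (hc t).
  by apply/connected_intervalP => a b _ _ z _.
Qed.

Lemma global_center_of_tame : global_center V 0.
Proof.
have Osub q : q != 0 -> cycle_of q `<=` ~` [set 0].
  move=> qn z; rewrite /cycle_of /= => ez z0.
  by have := cycle_level_gt0 qn; rewrite -ez z0 cycle_level0 ltxx.
split.
- split; first by apply: rV2_eq; rewrite fieldE ?vec2_0 ?vec2_1 !mxE // /acc restoring_0 // mulr0 subr0 oppr0.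
  exists setT; first exact: filterT.
  move=> q [_ /eqP qn]; exists (cycle_of q); split => //; first exact: periodic_orbit_cycle.
  by move=> z /(Osub q qn) z0; split.
split.
- split; first exact: punctured_plane_connected.
  + move=> q /eqP qn; exists (cycle_of q); split => //.
    * exact: periodic_orbit_cycle.
    * exact: surrounds_cycle.
    * exact: Osub.
  + split.
      move=> A /nbhs_rV [d d0 hd]; exists (vec2 (d / 2) 0); split.
        by move=> /= e; have := vec2_0 (d / 2) (0 : R); rewrite e mxE; linarith.
      apply: hd; apply: ord2_ind; rewrite ?vec2_0 ?vec2_1 mxE sub0r normrN ?normr0 //.
      by rewrite ger0_norm; linarith.
    by move=> /interior_subset; apply.
- move=> B [_ HB _] q Bq /= q0.
  by have [Om [_ [ O0 _] Oq _]] := HB q Bq; apply: O0; rewrite -q0.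
Qed.

End Plane.

(** * The linear part at the origin *)

Section LinearType.
Context {R : realType}.
Variables f g : {poly R}.
Let V := field_eval (lienard f g).

Lemma field_differentiable (q : 'rV[R]_2) : differentiable V q.
Proof.
have -> : V = (fun q : 'rV[R]_2 => q 0 1 *: vec2 1 0 +
    (- g.[q 0 0] - f.[q 0 0] * q 0 1) *: vec2 0 1).
  by apply/funext => p; rewrite /V fieldE; apply: rV2_eq;
    rewrite /acc !mxE /=; ring.
have d0 (p : {poly R}) : differentiable (fun q : 'rV[R]_2 => p.[q 0 0]) q.
  apply: (@differentiable_comp _ _ _ _ (fun q : 'rV[R]_2 => q 0 0) (fun t : R => p.[t])).
    exact: differentiable_coord.
  by apply/derivable1_diffP; exact: derivable_horner.
have d1 : differentiable (fun q : 'rV[R]_2 => q 0 1) q by exact: differentiable_coord.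
apply: differentiableD; first exact: differentiableZl.
apply: differentiableZl; apply: differentiableB; first exact/differentiableN/d0.
exact: differentiableM (d0 f) d1.
Qed.

(** The rows of the Jacobian are read off the derivatives at [0] of [t -> V (t v)]. *)
Lemma mul_jacobian0 (v : 'rV[R]_2) :
  v *m jacobian V 0 = vec2 (v 0 1) (- g`_1 * v 0 0 - f.[0] * v 0 1).
Proof.
rewrite -deriveEjacobian; last exact: field_differentiable.
have h : is_derive (0 : R) (1 : R) (fun t : R => V (t *: v))
    (vec2 (v 0 1) (- g`_1 * v 0 0 - f.[0] * v 0 1)).
  rewrite (_ : (fun t => _) =
      (fun t : R => vec2 (t * v 0 1) (acc f g (t * v 0 0) (t * v 0 1)))); last first.
    by apply/funext => t; rewrite /V fieldE !mxE.
  apply/der_vec2; split; first by der; ring.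
  have g1 : g^`().[0] = g`_1 by rewrite horner_coef0 coef_deriv.
  by rewrite /acc; der; rewrite !mul0r g1; ring.
case: h => _ <-; rewrite /derive; set p := (X in _ = lim (X @ _)); set q := (X in lim (X @ _) = _).
suff -> : q = p by [].
by apply/funext => t; rewrite /p /q /= scale0r !addr0 [t *: 1]mulr1.
Qed.

Lemma eigenvalue_jacobian0 (z : R[i]) :
  eigenvalue (map_mx (real_complex R) (jacobian V 0)) z <->
  z ^+ 2 + (f.[0])%:C%C * z + (g`_1)%:C%C = 0.
Proof.
have E (v : 'rV[R[i]]_2) : v *m map_mx (real_complex R) (jacobian V 0) =
    \row_(j < 2) [:: v 0 1; - (g`_1)%:C%C * v 0 0 - (f.[0])%:C%C * v 0 1]`_j.
  have J (i : 'I_2) : row i (jacobian V 0) = vec2 (i == 1)%:R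
      (- g`_1 * (i == 0)%:R - f.[0] * (i == 1)%:R).
    by rewrite rowE mul_jacobian0 !mxE /= ![_ == i]eq_sym.
  apply/rowP => j; rewrite !mxE big_ord_recl big_ord1 !mxE.
  have J0 := congr1 (fun w : 'rV_2 => w 0 j) (J 0).
  have J1 := congr1 (fun w : 'rV_2 => w 0 j) (J (lift 0 0)).
  rewrite !mxE in J0 J1; rewrite {}J0 {}J1.
  rewrite (_ : lift 0 0 = 1 :> 'I_2); last exact: val_inj.
  elim/ord2_ind: j => /=; rewrite ?mulr0 ?mulr1 ?sub0r ?subr0 ?rmorph0 ?rmorph1
    ?rmorphN /=; ring.
split.
- move=> /eigenvalueP [v]; rewrite E => ev vn.
  have e0 := congr1 (fun w : 'rV_2 => w 0 0) ev; have e1 := congr1 (fun w : 'rV_2 => w 0 1) ev.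
  rewrite !mxE /= in e0 e1.
  have v0 : v 0 0 != 0.
    apply: contra vn => /eqP v0; apply/eqP/rowP; apply: ord2_ind; rewrite mxE //.
    by rewrite e0 v0 mulr0.
  apply: (mulIf v0); rewrite mul0r.
  rewrite e0 in e1.
  rewrite (_ : _ * v 0 0 = z * (z * v 0 0) -
    (- (g`_1)%:C%C * v 0 0 - (f.[0])%:C%C * (z * v 0 0))); last by ring.
  by rewrite e1 subrr.
- move=> hz; apply/eigenvalueP.
  exists (\row_(j < 2) [:: 1; z]`_j); last first.
    apply/eqP => /rowP /(_ 0); rewrite !mxE /=; move/eqP; exact/negP/oner_neq0.
  rewrite E; apply/rowP; apply: ord2_ind; rewrite !mxE /= ?mulr1 //.
  apply/eqP; rewrite -subr_eq0 -oppr_eq0; apply/eqP; rewrite -hz; ring.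
Qed.

(** With a nonnegative discriminant there is a real eigenvalue, which is not a nonzero imaginary
    number; otherwise an eigenvalue has real part [- f(0) / 2]. *)
Lemma linear_typeP : linear_type V 0 <-> f.[0] = 0 /\ 0 < g`_1.
Proof.
split.
- move=> H; have [D0|D0] := lerP 0 (f.[0] ^+ 2 - 4 * g`_1).
    set d := Num.sqrt (f.[0] ^+ 2 - 4 * g`_1).
    have dd : d ^+ 2 = f.[0] ^+ 2 - 4 * g`_1 by rewrite sqr_sqrtr.
    have e0 : ((- f.[0] + d) / 2) ^+ 2 + f.[0] * ((- f.[0] + d) / 2) + g`_1 = 0.
      transitivity ((d ^+ 2 - (f.[0] ^+ 2 - 4 * g`_1)) / 4); first by field.
      by rewrite dd subrr mul0r.
    have [|w wn] := H (((- f.[0] + d) / 2)%:C)%C.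
      by apply/eigenvalue_jacobian0; rewrite -rmorphXn -rmorphM -!rmorphD /= e0.
    by move=> [_ w0]; rewrite -w0 eqxx in wn.
  pose d := Num.sqrt (4 * g`_1 - f.[0] ^+ 2).
  have dd : d ^+ 2 = 4 * g`_1 - f.[0] ^+ 2 by rewrite sqr_sqrtr //; linarith.
  have [|w wn] := H (Complex (- f.[0] / 2) (d / 2)).
    apply/eigenvalue_jacobian0; apply/eqP; rewrite expr2 eq_complex /=.
    by apply/andP; split; apply/eqP; [transitivity ((4 * g`_1 - f.[0] ^+ 2 - d ^+ 2) / 4);
      [field | rewrite dd subrr mul0r] | field].
  move=> [f0 _]; have {}f0 : f.[0] = 0 by linarith.
  by split => //; move: D0; rewrite f0 expr0n /=; linarith.
- move=> [f0 g1] z /eigenvalue_jacobian0; rewrite f0; case: z => a b.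
  move=> /eqP; rewrite expr2 eq_complex /= => /andP [/eqP e1 /eqP e2].
  have {}e1 : a ^+ 2 - b ^+ 2 + g`_1 = 0 by rewrite -[RHS]e1; ring.
  have {}e2 : a * b = 0 by linarith.
  have bn : b != 0.
    apply/eqP => b0; move: e1; rewrite b0 expr0n /=; have := sqr_ge0 a; linarith.
  exists b => //; congr Complex; apply: (mulIf bn); by rewrite mul0r.
Qed.

End LinearType.

(** * Hyperbolic sectors *)

Section Sectors.
Context {R : realType}.

(* Reachability under the saddle, in the coordinates [th = w0 - w1] and
   [rh = w0 * w1]; the axes [rh = 0] are cut at the corner. *)
Definition sector_order (th rh th' rh' : R) : Prop :=
  [/\ rh = rh', th <= th' & rh = 0 -> [\/ th = th', 0 < th | th' < 0]].

(** Cut out by bounds on the two coordinates of the saddle, so that a saddle arc between two of its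
    points never leaves it. *)
Definition corner (r0 : R) : set 'rV[R]_2 :=
  [set w | quadrant w /\ (`|w 0 0 - w 0 1| <= 1 /\ w 0 0 * w 0 1 <= r0)].

Lemma exp_flow (k tau : R) (u : R -> R) : 0 <= tau ->
  (forall t : R, 0 <= t <= tau -> is_derive t (1 : R) u (k * u t)) ->
  u tau = u 0 * expR (k * tau).
Proof.
move=> tau0 hu; pose v t := u t * expR (- (k * t)).
have hv t : 0 <= t <= tau -> is_derive t (1 : R) v 0.
  by move=> /hu h; rewrite /v; der; ring.
have e1 : v 0 <= v tau by apply: (nondecr tau0 hv).
have e2 : - v 0 <= - v tau.
  apply: (@nondecr _ 0 tau (fun t => - v t) (fun=> - 0) tau0) => [t /hv|t _].
    exact: derN.
  by rewrite oppr0.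
have : v 0 = v tau by linarith.
rewrite /v mulr0 oppr0 expR0 mulr1 => ->.
by rewrite -mulrA -expRD addNr expR0 mulr1.
Qed.

Lemma saddle_flow_order (w w' : 'rV[R]_2) (r0 : R) : quadrant w ->
  reach saddle (corner r0) w w' ->
  sector_order (w 0 0 - w 0 1) (w 0 0 * w 0 1) (w' 0 0 - w' 0 1) (w' 0 0 * w' 0 1).
Proof.
move=> [w0 w1] [c [tau [tau0 c0 ct hc]]].
have h0 t : 0 <= t <= tau -> is_derive t (1 : R) (fun s => c s 0 0) (1 * c t 0 0).
  by move=> /hc [/is_derive_mx /(_ 0 0) + _]; rewrite vec2_0 mul1r.
have h1 t : 0 <= t <= tau -> is_derive t (1 : R) (fun s => c s 0 1) (- 1 * c t 0 1).
  by move=> /hc [/is_derive_mx /(_ 0 1) + _]; rewrite vec2_1 mulN1r.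
have e0 := exp_flow tau0 h0; have e1 := exp_flow tau0 h1.
rewrite c0 ct mul1r in e0; rewrite c0 ct mulN1r in e1.
have E1 : 1 <= expR tau by rewrite -expR0 ler_expR.
have E2 : expR (- tau) <= 1 by rewrite -expR0 ler_expR oppr_le0.
have E3 : 0 < expR (- tau) by exact: expR_gt0.
have EE : expR tau * expR (- tau) = 1 by rewrite -expRD subrr expR0.
have l0 : w 0 0 <= w' 0 0 by rewrite e0 ler_peMr.
have l1 : w' 0 1 <= w 0 1 by rewrite e1 ler_piMr.
split.
- by rewrite e0 e1 mulrACA EE mulr1.
- by linarith.
- move=> /eqP; rewrite mulf_eq0 => /orP[] /eqP z.
  + move: w1; rewrite le_eqVlt => /predU1P[z1|w1].
      by apply: Or31; rewrite e0 e1 z -z1 !mul0r.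
    by apply: Or33; rewrite e0 e1 z mul0r sub0r oppr_lt0 mulr_gt0.
  + move: w0; rewrite le_eqVlt => /predU1P[z1|w0].
      by apply: Or31; rewrite e0 e1 z -z1 !mul0r.
    by apply: Or32; rewrite z subr0.
Qed.

Lemma hyperbola_inj (w w' : 'rV[R]_2) : quadrant w -> quadrant w' ->
  w 0 0 - w 0 1 = w' 0 0 - w' 0 1 -> w 0 0 * w 0 1 = w' 0 0 * w' 0 1 -> w = w'.
Proof.
move=> [w0 w1] [w0' w1'] ed ep.
have : (w 0 0 + w 0 1) ^+ 2 = (w' 0 0 + w' 0 1) ^+ 2.
  transitivity ((w 0 0 - w 0 1) ^+ 2 + 4 * (w 0 0 * w 0 1)); first by ring.
  by rewrite ed ep; ring.
move=> /eqP; rewrite eqrXn2 ?addr_ge0 // => /eqP es.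
by apply: rV2_eq; linarith.
Qed.

Lemma order_saddle_flow (w w' : 'rV[R]_2) (r0 : R) : corner r0 w -> corner r0 w' ->
  sector_order (w 0 0 - w 0 1) (w 0 0 * w 0 1) (w' 0 0 - w' 0 1) (w' 0 0 * w' 0 1) ->
  reach saddle (corner r0) w w'.
Proof.
move=> [[w0 w1] [wd wp]] [[w0' w1'] [wd' wp']] [ep ed ez].
suff [tau tau0 [e0 e1]] : exists2 tau : R, 0 <= tau &
    w' 0 0 = w 0 0 * expR tau /\ w' 0 1 = w 0 1 * expR (- tau).
  exists (fun t => vec2 (w 0 0 * expR t) (w 0 1 * expR (- t))), tau; split => //.
  - by rewrite oppr0 expR0 !mulr1 vec2E.
  - by rewrite -e0 -e1 vec2E.
  - move=> t /andP[t0 tt]; split.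
      rewrite /saddle vec2_0 vec2_1; apply/der_vec2; split; der; ring.
    have a0 : w 0 0 <= w 0 0 * expR t by rewrite ler_peMr // -expR0 ler_expR.
    have a1 : w 0 0 * expR t <= w' 0 0 by rewrite e0 ler_wpM2l // ler_expR.
    have b0 : w 0 1 * expR (- t) <= w 0 1 by rewrite ler_piMr // -expR0 ler_expR oppr_le0.
    have b1 : w' 0 1 <= w 0 1 * expR (- t) by rewrite e1 ler_wpM2l // ler_expR lerN2.
    split; rewrite /quadrant /= vec2_0 vec2_1; first by split; linarith.
    split; first by move: wd wd'; rewrite !ler_norml; linarith.
    by rewrite mulrACA -expRD subrr expR0 mulr1.
(* The travel time is the logarithm of the ratio of a nonzero coordinate: [key0] serves the interior
   and the horizontal axis, [key1] the vertical one. *)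
have key0 : 0 < w 0 0 -> w 0 0 <= w' 0 0 -> exists2 tau : R, 0 <= tau &
    w' 0 0 = w 0 0 * expR tau /\ w' 0 1 = w 0 1 * expR (- tau).
  move=> p le; have p' : 0 < w' 0 0 by linarith.
  exists (ln (w' 0 0 / w 0 0)); first by rewrite ln_ge0 // ler_pdivlMr // mul1r.
  rewrite expRN lnK ?posrE ?divr_gt0 //; split; first by field; rewrite gt_eqF.
  apply: (mulIf (lt0r_neq0 p')); rewrite [LHS]mulrC -ep; field.
  by rewrite !gt_eqF.
have key1 : 0 < w' 0 1 -> w' 0 1 <= w 0 1 -> exists2 tau : R, 0 <= tau &
    w' 0 0 = w 0 0 * expR tau /\ w' 0 1 = w 0 1 * expR (- tau).
  move=> p' le; have p : 0 < w 0 1 by linarith.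
  exists (ln (w 0 1 / w' 0 1)); first by rewrite ln_ge0 // ler_pdivlMr // mul1r.
  rewrite expRN lnK ?posrE ?divr_gt0 //; split; last by field; rewrite !gt_eqF.
  apply: (mulIf (lt0r_neq0 p')); rewrite -ep; field.
  by rewrite !gt_eqF.
case: (eqVneq (w 0 0 * w 0 1) 0) => [z|z]; last first.
  have p0 : 0 < w 0 0 by rewrite lt_def w0 andbT; apply: contra z => /eqP ->; rewrite mul0r.
  have p1 : 0 < w 0 1 by rewrite lt_def w1 andbT; apply: contra z => /eqP ->; rewrite mulr0.
  apply: key0 => //; rewrite leNgt; apply/negP => lt0.
  have lt1 : w' 0 1 < w 0 1 by linarith.
  have : w' 0 0 * w' 0 1 < w 0 0 * w 0 1.
    by apply: ltr_pM.
  by rewrite ep ltxx.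
have z' : w' 0 0 * w' 0 1 = 0 by rewrite -ep.
case: (ez z) => e.
- rewrite -(hyperbola_inj (conj w0 w1) (conj w0' w1') e ep); exists 0 => //.
  by rewrite oppr0 expR0 !mulr1.
- have p : 0 < w 0 0 by linarith.
  have p' : 0 < w' 0 0 by linarith.
  move/eqP: z; rewrite mulf_eq0 gt_eqF //= => /eqP z1.
  move/eqP: z'; rewrite mulf_eq0 gt_eqF //= => /eqP z1'.
  by apply: key0 => //; rewrite z1 z1' !subr0 in ed.
- have p' : 0 < w' 0 1 by linarith.
  have p : 0 < w 0 1 by linarith.
  move/eqP: z; rewrite mulf_eq0 orbC gt_eqF //= => /eqP z1.
  move/eqP: z'; rewrite mulf_eq0 orbC gt_eqF //= => /eqP z1'.
  by apply: key1 => //; rewrite z1 z1' !sub0r lerN2 in ed.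
Qed.

Lemma cvg_vec2 (T : Type) (F : set_system T) (FF : Filter F) (u v : T -> R) (x y : R) :
  u @ F --> x -> v @ F --> y -> (fun t => vec2 (u t) (v t)) @ F --> vec2 x y.
Proof.
move=> hu hv A /nbhs_rV [d d0 hA].
have {}hu : \forall t \near F, `|x - u t| < d by move/cvgrPdist_lt: hu; exact.
have {}hv : \forall t \near F, `|y - v t| < d by move/cvgrPdist_lt: hv; exact.
apply: filterS2 hu hv => t hu hv; apply: hA.
by apply: ord2_ind; rewrite ?vec2_0 ?vec2_1.
Qed.

(** The homeomorphism solves [w0 - w1 = theta], [w0 w1 = rho]: the pair [w0], [- w1] are the roots
    of a quadratic equation with discriminant [theta^2 + 4 rho]. It carries [N] onto [corner r0],
    where reachability is [sector_order]. *)
Theorem sector_of_coordinates (X : poly_field R) (e : 'rV[R]_3) (N : set 'rV[R]_3)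
    (theta rho : 'rV[R]_3 -> R) (r0 : R) : 0 < r0 ->
  N `<=` poincare_disc /\ within poincare_disc (nbhs e) N -> compact N ->
  {within N, continuous theta} -> {within N, continuous rho} ->
  (forall z, N z -> `|theta z| <= 1 /\ 0 <= rho z <= r0) ->
  (forall th rh : R, `|th| <= 1 -> 0 <= rh <= r0 ->
     exists z, [/\ N z, theta z = th & rho z = rh]) ->
  (forall z z', N z -> N z' -> theta z = theta z' -> rho z = rho z' -> z = z') ->
  theta e = 0 -> rho e = 0 ->
  (forall z z', N z -> N z' -> reach (poincare_field X) N z z' <->
     sector_order (theta z) (rho z) (theta z') (rho z')) ->
  one_hyperbolic_sector X e.
Proof.
move=> r00 hN cN cth crh hb hex hinj eth erh hr.
pose sq z := Num.sqrt (theta z ^+ 2 + 4 * rho z).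
pose h z := vec2 ((sq z + theta z) / 2) ((sq z - theta z) / 2).
have hE z : N z -> [/\ quadrant (h z), h z 0 0 - h z 0 1 = theta z &
    h z 0 0 * h z 0 1 = rho z].
  move=> /hb [_ /andP[r1 _]]; rewrite /quadrant /= /h vec2_0 vec2_1.
  have s2 : sq z ^+ 2 = theta z ^+ 2 + 4 * rho z.
    by rewrite /sq sqr_sqrtr // addr_ge0 ?sqr_ge0 // mulr_ge0.
  have sle : `|theta z| <= sq z.
    by rewrite -sqrtr_sqr; apply: ler_wsqrtr; rewrite lerDl mulr_ge0.
  move: sle; rewrite ler_norml => /andP[s3 s4]; split.
  - by split; linarith.
  - by field.
  - transitivity ((sq z ^+ 2 - theta z ^+ 2) / 4); first by field.
    by rewrite s2; field.
have hS z : N z -> corner r0 (h z).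
  move=> Nz; have [h1 h2 h3] := hE z Nz; have [b1 /andP[_ b2]] := hb z Nz.
  by split => //; rewrite h2 h3.
pose k w := xget e [set z | N z /\ h z = w].
have kE w : corner r0 w -> N (k w) /\ h (k w) = w.
  move=> [qw [dw pw]].
  have pw0 : 0 <= w 0 0 * w 0 1 <= r0 by rewrite pw andbT; case: qw => ? ?; exact: mulr_ge0.
  have [z [Nz tz rz]] := hex _ _ dw pw0.
  have zP : [set z | N z /\ h z = w] z.
    split => //; have [h1 h2 h3] := hE z Nz.
    by apply: hyperbola_inj => //; rewrite ?h2 ?h3.
  exact: (xgetI e zP).
have hK z : N z -> k (h z) = z.
  move=> Nz; have [Nk hk] := kE _ (hS z Nz).
  have [_ h2 h3] := hE z Nz; have [_ h2' h3'] := hE _ Nk.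
  by apply: hinj => //; rewrite -?h2' -?h2 -?h3' -?h3 hk.
have ch : {within N, continuous h}.
  move=> z; rewrite /h.
  have csq : sq @ (nbhs (z : subspace N)) --> sq z.
    apply: (@cvg_comp _ _ _ (fun z => theta z ^+ 2 + 4 * rho z) Num.sqrt); last exact: sqrt_continuous.
    apply: cvgD; first by apply: cvgM; exact: cth.
    by apply: cvgM; [exact: cvg_cst | exact: crh].
  by apply: cvg_vec2; apply: cvgM; try exact: cvg_cst;
    [apply: cvgD => //; exact: cth | apply: cvgB => //; exact: cth].
exists N, (corner r0), h, k; split => //.
- split; first by move=> w [].
  apply/nbhs_rV; pose d := Num.min (1 / 2) (r0 / 2).
  have d0 : 0 < d by rewrite lt_min; apply/andP; split; linarith.
  have d1 : d <= 1 / 2 by rewrite ge_min lexx.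
  have d2 : d <= r0 / 2 by rewrite ge_min lexx orbT.
  exists d => // w hw qw; have [q0 q1] := qw.
  have := hw 0; have := hw 1; rewrite !mxE !sub0r !normrN !ger0_norm // => b1 b0.
  split => //; split; first by rewrite ler_norml; linarith.
  by apply: (@le_trans _ _ (d * 1)); [apply: ler_pM => //; linarith | linarith].
- split => //.
  (* The part of [N] outside an open neighbourhood of [k w] is compact and its image misses [w];
     near [w] the inverse therefore stays in that neighbourhood. *)
  + apply/subspace_continuousP => w Sw A hA.
    have [Nk hk] := kE w Sw.
    pose C := N `&` ~` A°.
    have cC : compact C.
      apply: (@subclosed_compact _ _ N) => //.
        apply: closedI; last exact/open_closedC/open_interior.
        by apply: compact_closed => //; exact: norm_hausdorff.
      exact: subIsetl.
    have cI : closed (h @` C).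
      apply: compact_closed; first exact: norm_hausdorff.
      apply: continuous_compact => //; apply: continuous_subspaceW ch; exact: subIsetl.
    have wI : ~ (h @` C) w.
      move=> [z [Nz zA] hz]; apply: zA.
      by rewrite -(hK z Nz) hz; exact: hA.
    have : nbhs w (~` (h @` C)).
      by apply: open_nbhs_nbhs; split => //; exact: closed_openC.
    apply: filterS => w' w'I Sw'; have [Nk' hk'] := kE w' Sw'.
    apply: contrapT => nA; apply: w'I; exists (k w') => //; split => // /interior_subset.
    exact: nA.
  + by move=> z Nz; split; [exact: hS | exact: hK].
- rewrite /h /sq eth erh expr0n /= mulr0 !addr0 sqrtr0 subr0 mul0r.
  by apply: rV2_eq; rewrite !mxE.
- move=> z z' Nz Nz'; rewrite (hr z z' Nz Nz').
  have [q1 e1 e2] := hE z Nz; have [q2 e3 e4] := hE z' Nz'.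
  rewrite -e1 -e2 -e3 -e4; split.
    exact: order_saddle_flow (hS z Nz) (hS z' Nz').
  exact: saddle_flow_order.
Qed.

End Sectors.

(** * The Poincare compactification *)

Section Compactification.
Context {R : realType}.

(** [reach] fixes the parametrization, whereas central projection produces solutions only up to a
    positive factor. The new time is the primitive of that factor. *)
Lemma reparametrize n (V : 'rV[R]_n -> 'rV[R]_n) (N : set 'rV[R]_n) (c : R -> 'rV[R]_n)
    (lam : R -> R) (tau : R) : 0 <= tau ->
  (forall t : R, 0 <= t <= tau -> [/\ is_derive t (1 : R) c (lam t *: V (c t)), 0 < lam t,
     {for t, continuous lam} & N (c t)]) ->
  reach V N (c 0) (c tau).
Proof.
(* Clamping time to [[0, tau]] extends [lam] to a positive continuous function on the line; its
   primitive can then be inverted on a neighbourhood of the whole interval, endpoints included. *)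
move=> tau0 hc; pose cl (t : R) := Num.max 0 (Num.min tau t).
have clE t : 0 <= t <= tau -> cl t = t.
  by move=> /andP[t0 tt]; rewrite /cl min_r // max_r.
have clB t : 0 <= cl t <= tau by rewrite /cl le_max lexx /= ge_max tau0 ge_min lexx.
have cl_cont : continuous cl.
  move=> t; apply: (@continuous_max R R (fun=> 0) (fun t => Num.min tau t)).
    exact: cst_continuous.
  by apply: (@continuous_min R R (fun=> tau) (fun t => t)); [exact: cst_continuous | move=> ?].
have lcont : continuous (lam \o cl).
  by move=> t; apply: continuous_comp; [exact: cl_cont | have [_ _ + _] := hc _ (clB t)].
pose H := integral_from0 (lam \o cl).
have dH t : is_derive t (1 : R) H (lam (cl t)) by exact: der_integral.
have pos t : 0 < lam (cl t) by have [_ + _ _] := hc _ (clB t).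
have H0 : H 0 = 0 by exact: integral_from0_at0.
have Hincr a b : a < b -> H a < H b by move=> ab; apply: (incr ab (fun t _ => dH t)).
have [S [SH HS _ dS]] := @inverse_function R H (fun t => lam (cl t)) (-1) (tau + 1)
  ltac:(linarith) (fun t _ => dH t) (fun t _ => pos t).
have b1 : H (-1) < H 0 by apply: Hincr; linarith.
have b2 : H tau < H (tau + 1) by apply: Hincr; linarith.
have b3 : H 0 <= H tau.
  by move: tau0; rewrite le_eqVlt => /predU1P[<-//|/Hincr/ltW].
exists (c \o S), (H tau); split.
- by rewrite -H0.
- by rewrite /= -{1}H0 SH //; linarith.
- by rewrite /= SH //; linarith.
- move=> h /andP[h0 h1]; have hin : H (-1) < h < H (tau + 1).
    by rewrite (lt_le_trans b1) ?H0 //= (le_lt_trans h1).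
  have hin' : H (-1) <= h <= H (tau + 1) by case/andP: hin => /ltW -> /ltW ->.
  have [Sb dSh] := dS h hin; have [_ HSh] := HS h hin'.
  have Sin : 0 <= S h <= tau.
    apply/andP; split; rewrite leNgt; apply/negP => /Hincr.
      by rewrite HSh H0 ltNge h0.
    by rewrite HSh ltNge h1.
  have [dc lp _ Nc] := hc _ Sin; split => //.
  apply/is_derive_mx => i j; move/is_derive_mx: dc => /(_ i j); rewrite mxE => dc.
  apply: (der_eq (der_comp dSh dc)); rewrite clE //.
  by rewrite mulrC mulrA mulVf ?mul1r // gt_eqF.
Qed.

Definition plane_point (z : 'rV[R]_3) : 'rV[R]_2 := vec2 (z 0 0 / z 0 2) (z 0 1 / z 0 2).

Lemma radius_gt0 (q : 'rV[R]_2) : 0 < 1 + q 0 0 ^+ 2 + q 0 1 ^+ 2.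
Proof. by rewrite -addrA ltr_pwDl // addr_ge0 // sqr_ge0. Qed.

Lemma central_projection_disc (q : 'rV[R]_2) :
  poincare_disc (central_projection q) /\ 0 < central_projection q 0 2.
Proof.
have D0 := radius_gt0 q; have s0 : 0 < Num.sqrt (1 + q 0 0 ^+ 2 + q 0 1 ^+ 2) by rewrite sqrtr_gt0.
have s2 := sqr_sqrtr (ltW D0).
rewrite /central_projection; move: (Num.sqrt _) s0 s2 => d d0 d2.
rewrite /poincare_disc /= !mxE /= mulr1 invr_gt0; split => //; split; last by rewrite invr_ge0 ltW.
transitivity ((1 + q 0 0 ^+ 2 + q 0 1 ^+ 2) / d ^+ 2); first by field; exact: lt0r_neq0.
by rewrite d2 divff // gt_eqF.
Qed.

Lemma plane_pointK (q : 'rV[R]_2) : plane_point (central_projection q) = q.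
Proof.
have s0 : 0 < Num.sqrt (1 + q 0 0 ^+ 2 + q 0 1 ^+ 2) by rewrite sqrtr_gt0 radius_gt0.
rewrite /plane_point /central_projection; move: (Num.sqrt _) s0 => d d0.
by apply: rV2_eq; rewrite !mxE /= mulr1 invrK mulrAC mulVf ?mul1r // gt_eqF.
Qed.

Lemma central_projectionK (z : 'rV[R]_3) : poincare_disc z -> 0 < z 0 2 ->
  central_projection (plane_point z) = z.
Proof.
move=> [hz _] z2; rewrite /central_projection /plane_point vec2_0 vec2_1.
have -> : 1 + (z 0 0 / z 0 2) ^+ 2 + (z 0 1 / z 0 2) ^+ 2 = (z 0 2)^-1 ^+ 2.
  transitivity ((z 0 0 ^+ 2 + z 0 1 ^+ 2 + z 0 2 ^+ 2) / z 0 2 ^+ 2).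
    by field; exact: lt0r_neq0.
  by rewrite hz; field; exact: lt0r_neq0.
rewrite sqrtr_sqr gtr0_norm ?invr_gt0 // invrK.
by apply: rV3_eq; rewrite !mxE /= ?mulr1 // mulrC divfK // lt0r_neq0.
Qed.

Lemma plane_point_flow (X : poly_field R) (c : R -> 'rV[R]_3) (t : R) :
  (0 < field_degree X)%N -> 0 < c t 0 2 ->
  is_derive t (1 : R) c (poincare_field X (c t)) ->
  is_derive t (1 : R) (plane_point \o c)
    (c t 0 2 ^+ (field_degree X).-1 *: field_eval X (plane_point (c t))).
Proof.
move=> d0 z2 /is_derive_mx hc; have z2n : c t 0 2 != 0 by rewrite gt_eqF.
have h0 := hc 0 0; have h1 := hc 0 1; have h2 := hc 0 2.
rewrite /poincare_field vec3_0 !homogenizeE ?leq_maxl ?leq_maxr // in h0.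
rewrite /poincare_field vec3_1 !homogenizeE ?leq_maxl ?leq_maxr // in h1.
rewrite /poincare_field vec3_2 !homogenizeE ?leq_maxl ?leq_maxr // in h2.
rewrite (_ : _ *: _ = vec2
   (c t 0 2 ^+ (field_degree X).-1 * X.1.[(c t 0 1 / c t 0 2)%:P].[c t 0 0 / c t 0 2])
   (c t 0 2 ^+ (field_degree X).-1 * X.2.[(c t 0 1 / c t 0 2)%:P].[c t 0 0 / c t 0 2])); last first.
  by apply: rV2_eq; rewrite /field_eval /plane_point !mxE.
have E : c t 0 2 ^+ field_degree X = c t 0 2 * c t 0 2 ^+ (field_degree X).-1.
  by rewrite -exprS prednK.
rewrite !E in h0 h1 h2.
apply/der_vec2; split.
- apply: (der_eq (derM h0 (derV z2n h2))).
  move: X.1.[_].[_] X.2.[_].[_] (c t 0 2 ^+ _) => P Q zk.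
  move: (c t 0 0) (c t 0 1) (c t 0 2) z2n => x y z zn; clear -zn; by field.
- apply: (der_eq (derM h1 (derV z2n h2))).
  move: X.1.[_].[_] X.2.[_].[_] (c t 0 2 ^+ _) => P Q zk.
  move: (c t 0 0) (c t 0 1) (c t 0 2) z2n => x y z zn; clear -zn; by field.
Qed.

Lemma homogenize_bound (d : nat) (P : {poly {poly R}}) : exists2 C : R, 0 < C &
  forall x y z : R, `|x| <= 1 -> `|y| <= 1 -> `|z| <= 1 -> `|homogenize d P x y z| <= C.
Proof.
exists (1 + \sum_(j < size P) \sum_(i < size P`_j) `|P`_j`_i|).
  by rewrite ltr_pwDl // sumr_ge0 // => j _; rewrite sumr_ge0.
move=> x y z hx hy hz; rewrite /homogenize.
apply: (le_trans (ler_norm_sum _ _ _)); apply: ler_wpDl => //.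
apply: ler_sum => j _; apply: (le_trans (ler_norm_sum _ _ _)); apply: ler_sum => i _.
rewrite !normrM !normrX -!mulrA ler_piMr //.
by rewrite !mulr_ile1 // ?mulr_ge0 ?exprn_ge0 // exprn_ile1.
Qed.

End Compactification.

(** * The compactified system on the boundary circle *)

Section LienardInfinity.
Context {R : realType}.
Variables (f g : {poly R}) (n m : nat).
Hypothesis sf : size f = n.+1.
Hypothesis sg : size g = m.+1.
Hypothesis n0 : (0 < n)%N.
Hypothesis nm : (2 * n + 1 <= m)%N.

Lemma total_degreeX : total_degree ('X : {poly {poly R}}) = 1%N.
Proof.
rewrite /total_degree size_polyX big_mkcond /= !big_ord_recl big_ord0 /=.
by rewrite !coefX /= eqxx oner_eq0 /= size_poly1.
Qed.

Let f_neq0 : f != 0. Proof. by rewrite -size_poly_gt0 sf. Qed.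
Let g_neq0 : g != 0. Proof. by rewrite -size_poly_gt0 sg. Qed.

Lemma lienard_coef0 : (lienard f g).2`_0 = - g.
Proof. by rewrite /lienard /= coefB coefN coefC eqxx coefMX eqxx subr0. Qed.

Lemma lienard_coef1 : (lienard f g).2`_1 = - f.
Proof. by rewrite /lienard /= coefB coefN coefC /= coefMX /= coefC /= oppr0 sub0r. Qed.

Lemma size_lienard2 : size (lienard f g).2 = 2.
Proof.
apply/eqP; rewrite eqn_leq; apply/andP; split.
  apply/leq_sizeP => -[|[|j]] // _.
  by rewrite /lienard /= coefB coefN coefC /= coefMX /= coefC /= subr0 oppr0.
rewrite ltnNge; apply/negP => /leq_sizeP /(_ 1%N (leqnn _)) /eqP.
by rewrite lienard_coef1 oppr_eq0 (negbTE f_neq0).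
Qed.

Lemma total_degree_lienard2 : total_degree (lienard f g).2 = m.
Proof.
rewrite /total_degree size_lienard2 big_mkcond /= !big_ord_recl big_ord0 /=.
rewrite lienard_coef0 lienard_coef1 !oppr_eq0 f_neq0 g_neq0 /= !size_polyN sf sg /bump /=.
rewrite add0n maxn0; apply/maxn_idPl; clear -n0 nm; lia.
Qed.

Lemma field_degree_lienard : field_degree (lienard f g) = m.
Proof.
rewrite /field_degree total_degree_lienard2 total_degreeX; clear -n0 nm; lia.
Qed.

Lemma homogenizeX (d : nat) (x y z : R) :
  homogenize d ('X : {poly {poly R}}) x y z = y * z ^+ (d - 1).
Proof.
rewrite /homogenize size_polyX !big_ord_recl big_ord0 addr0.
rewrite !coefX /= size_poly0 big_ord0 add0r size_poly1 big_ord1.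
by rewrite coef1 eqxx mul1r expr0 mul1r expr1 add0n.
Qed.

Lemma homogenize_at_infinity (x y : R) :
  homogenize m (lienard f g).2 x y 0 = - g`_m * x ^+ m.
Proof.
rewrite /homogenize size_lienard2 !big_ord_recl big_ord0 addr0.
rewrite (_ : (lienard f g).2`_(lift ord0 ord0) = - f); last exact: lienard_coef1.
rewrite (_ : (lienard f g).2`_(@ord0 1) = - g); last exact: lienard_coef0.
rewrite !size_polyN sf sg big_ord_recr /= [X in X + _ + _]big1; last first.
  by move=> i _; rewrite addn0 expr0n subn_eq0 leqNgt ltn_ord mulr0.
rewrite [X in _ + X]big1; last first.
  move=> i _; rewrite expr0n subn_eq0 leqNgt.
  rewrite (_ : (i + bump 0 0 < m)%N) ?mulr0 //.
  by have := ltn_ord i; rewrite /bump /=; move: (nat_of_ord i) => k; clear -n0 nm; lia.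
by rewrite addr0 add0r addn0 subnn expr0 !mulr1 coefN.
Qed.

Let W := poincare_field (lienard f g).

(** Since [m >= 2 n + 1] with [n > 0], only the term [- a_m x^m] survives at infinity. The field is
    tangent to the circle and vanishes only where [z0 = 0], provided [a_m] is nonzero. *)
Lemma poincare_field_infinity (z : 'rV[R]_3) : poincare_disc z -> z 0 2 = 0 ->
  W z = (g`_m * z 0 0 ^+ m.+1) *: vec3 (z 0 1) (- z 0 0) 0.
Proof.
move=> [hz _] z2; rewrite /W /poincare_field field_degree_lienard.
rewrite z2 expr0n /= addr0 in hz.
rewrite z2 (homogenizeX m) homogenize_at_infinity expr0n.
rewrite (_ : (m - 1 == 0)%N = false); last by apply/negbTE; clear -n0 nm; lia.
rewrite mulr0n mulr0 mul0r add0r.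
apply: rV3_eq; rewrite !mxE /=.
all: rewrite exprS add0r; move: (z 0 0) (z 0 1) (z 0 0 ^+ m) (g`_m) hz => x y p a hz.
- by ring.
- transitivity (- a * p * (1 - y ^+ 2)); first by ring.
  by rewrite -hz; ring.
- by ring.
Qed.

Lemma equilibrium_at_infinityP (z : 'rV[R]_3) : g`_m != 0 ->
  equilibrium_at_infinity (lienard f g) z <-> z = vec3 0 1 0 \/ z = vec3 0 (-1) 0.
Proof.
move=> gm; split.
- move=> [[dz /= z2]]; rewrite -/W poincare_field_infinity // => e.
  have hz : z 0 0 ^+ 2 + z 0 1 ^+ 2 = 1 by case: dz => <- _; rewrite z2 expr0n /= addr0.
  have z0 : z 0 0 = 0.
    have := congr1 (fun w : 'rV_3 => w 0 1) e; rewrite !mxE /= => /eqP.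
    by rewrite mulf_eq0 mulf_eq0 (negbTE gm) /= oppr_eq0 expf_eq0 /= orbb => /eqP.
  move: hz; rewrite z0 expr0n /= add0r => /eqP; rewrite sqrf_eq1 => /orP[] /eqP z1.
    by left; apply: rV3_eq; rewrite !mxE.
  by right; apply: rV3_eq; rewrite !mxE.
- have key s : s ^+ 2 = 1 -> equilibrium_at_infinity (lienard f g) (vec3 0 s 0).
    move=> s2; have dz : poincare_disc (vec3 0 s 0).
      by rewrite /poincare_disc /= !mxE /= s2 expr0n /= add0r addr0.
    split; first by split => //=; rewrite mxE.
    rewrite -/W poincare_field_infinity ?vec3_2 //.
    by apply: rV3_eq; rewrite !mxE /= expr0n /=; ring.
  by move=> [->|->]; apply: key; ring.
Qed.

(** The boundary circle is invariant: the height solves a linear equation with bounded coefficient,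
    so that [linear_pos] and [linear_zero] apply along orbits. *)
Lemma poincare_z2_bound : exists2 C : R, 0 < C & forall z, poincare_disc z ->
  exists2 k : R, `|k| <= C & W z 0 2 = k * z 0 2.
Proof.
have [C1 C10 h1] := @homogenize_bound R m ('X : {poly {poly R}}).
have [C2 C20 h2] := @homogenize_bound R m (lienard f g).2.
exists (C1 + C2); first exact: addr_gt0.
move=> z [hz z20]; pose P := homogenize m ('X : {poly {poly R}}) (z 0 0) (z 0 1) (z 0 2).
pose Q := homogenize m (lienard f g).2 (z 0 0) (z 0 1) (z 0 2).
have s0 := sqr_ge0 (z 0 0); have s1 := sqr_ge0 (z 0 1); have s2 := sqr_ge0 (z 0 2).
have b j : j = 0 \/ j = 1 \/ j = 2 -> `|z 0 j| <= 1.
  by move=> hj; rewrite -(@expr_le1 _ 2) // real_normK ?num_real //; case: hj => [->|[->|->]]; linarith.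
have b0 : `|z 0 0| <= 1 by apply: b; left.
have b1 : `|z 0 1| <= 1 by apply: b; right; left.
have b2 : `|z 0 2| <= 1 by apply: b; right; right.
exists (- (P * z 0 0 + Q * z 0 1)); last first.
  by rewrite /W /poincare_field field_degree_lienard vec3_2.
rewrite normrN; apply: (le_trans (ler_normD _ _)); rewrite !normrM.
by apply: lerD; [rewrite -[C1]mulr1 | rewrite -[C2]mulr1]; apply: ler_pM => //;
  [exact: h1 | exact: h2].
Qed.

End LienardInfinity.

(** * The half turn exchanging the two ends of the vertical axis *)

Section Rotation.
Context {R : realType}.

Definition half_turn (z : 'rV[R]_3) : 'rV[R]_3 := vec3 (- z 0 0) (- z 0 1) (z 0 2).

Lemma half_turnK z : half_turn (half_turn z) = z.
Proof. by apply: rV3_eq; rewrite !mxE /= ?opprK. Qed.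

Lemma half_turn_disc z : poincare_disc (half_turn z) <-> poincare_disc z.
Proof. by rewrite /poincare_disc /= !mxE /= !sqrrN. Qed.

Lemma half_turn_nbhs z (A : set 'rV[R]_3) : nbhs (half_turn z) A ->
  nbhs z (half_turn @^-1` A).
Proof.
move=> /nbhs_rV [d d0 h]; apply/nbhs_rV; exists d => // w hw; apply: h.
by apply: ord3_ind; rewrite !mxE /= -?opprD ?normrN; exact: hw.
Qed.

Lemma half_turn_reach (W1 W2 : 'rV[R]_3 -> 'rV[R]_3) (N1 N2 : set 'rV[R]_3) (z z' : 'rV[R]_3) :
  (forall z, N1 z -> W2 (half_turn z) = half_turn (W1 z)) ->
  (forall z, N1 z -> N2 (half_turn z)) ->
  reach W1 N1 z z' -> reach W2 N2 (half_turn z) (half_turn z').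
Proof.
move=> hW hN [c [tau [tau0 c0 ct hc]]].
exists (half_turn \o c), tau; split => //=; rewrite ?c0 ?ct // => t /hc [dc Nc].
split; last exact: hN.
rewrite hW //; apply/is_derive_mx => i; rewrite ord1; move/is_derive_mx: dc => dc.
have E0 : (fun u => (half_turn \o c) u 0 0) = (fun u => - c u 0 0).
  by apply/funext => u; rewrite /= vec3_0.
have E1 : (fun u => (half_turn \o c) u 0 1) = (fun u => - c u 0 1).
  by apply/funext => u; rewrite /= vec3_1.
have E2 : (fun u => (half_turn \o c) u 0 2) = (fun u => c u 0 2).
  by apply/funext => u; rewrite /= vec3_2.
apply: ord3_ind; rewrite ?vec3_0 ?vec3_1 ?vec3_2.
- by rewrite E0; exact: derN (dc _ _).
- by rewrite E1; exact: derN (dc _ _).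
- by rewrite E2; exact: dc.
Qed.

Lemma half_turn_sector (X Y : poly_field R) (e : 'rV[R]_3) :
  (forall z, poincare_disc z ->
     poincare_field X (half_turn z) = half_turn (poincare_field Y z)) ->
  one_hyperbolic_sector Y e -> one_hyperbolic_sector X (half_turn e).
Proof.
move=> hXY [N [S [h [k [[ND Ne] hS [ch ck hNS hSN] he hr]]]]].
have hYX z : poincare_disc z -> poincare_field Y (half_turn z) = half_turn (poincare_field X z).
  move=> dz; rewrite -[z in RHS]half_turnK hXY ?half_turnK //; exact/half_turn_disc.
exists (half_turn @^-1` N), S, (h \o half_turn), (half_turn \o k); split.
- split; first by move=> z /ND /half_turn_disc.
  have : nbhs (half_turn (half_turn e)) [set z | poincare_disc z -> N z] by rewrite half_turnK.
  move=> /half_turn_nbhs; apply: filterS => z hz dz; apply: hz; exact/half_turn_disc.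
- exact: hS.
- split.
  + apply/subspace_continuousP => z Nz A hA.
    have /subspace_continuousP /(_ (half_turn z) Nz A hA) := ch.
    move=> /half_turn_nbhs; apply: filterS => w hw Nw; exact: hw.
  + apply/subspace_continuousP => w Sw A /half_turn_nbhs hA.
    by have /subspace_continuousP /(_ w Sw _ hA) := ck.
  + move=> z Nz; have [h1 h2] := hNS _ Nz; split => //=.
    by rewrite h2 half_turnK.
  + by move=> w Sw; have [h1 h2] := hSN _ Sw; rewrite /= half_turnK.
- by rewrite /= half_turnK.
- move=> z z' Nz Nz'; rewrite -(hr _ _ Nz Nz'); split.
  + apply: half_turn_reach => // w Nw; apply: hYX; apply/half_turn_disc; exact: ND.
  + move=> H; rewrite -(half_turnK z) -(half_turnK z').
    apply: half_turn_reach H => w Nw; first by apply: hXY; exact: ND.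
    by rewrite /= half_turnK.
Qed.

Lemma coef_flip (p : {poly R}) (i : nat) : (flip p)`_i = (-1) ^+ i * p`_i.
Proof.
rewrite /flip comp_polyE coef_sum.
under eq_bigr => j _ do rewrite coefZ exprNn -polyC1 -polyCN -polyC_exp coefCM coefXn.
case: (ltnP i (size p)) => hi; last first.
  rewrite nth_default // mulr0 big1 // => j _.
  rewrite (_ : (i == j) = false) ?mulr0 //; apply/negbTE/eqP => e.
  by have := ltn_ord j; rewrite -e ltnNge hi.
rewrite (bigD1 (Ordinal hi)) //= eqxx mulr1 big1 ?addr0 1?mulrC // => j ji.
rewrite (_ : (i == j) = false) ?mulr0 //; apply/negbTE; apply: contra ji => /eqP e.
by apply/eqP/val_inj.
Qed.

Lemma size_flip (p : {poly R}) : size (flip p) = size p.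
Proof. by rewrite /flip size_comp_poly2 // size_polyN size_polyX. Qed.

(** Off the boundary circle this is the planar half turn read through homogenization; on the circle
    only the top coefficients are left to compare. *)
Lemma lienard_half_turn (f g : {poly R}) (n m : nat) (z : 'rV[R]_3) :
  size f = n.+1 -> size g = m.+1 -> (0 < n)%N -> (2 * n + 1 <= m)%N -> odd m ->
  poincare_disc z ->
  poincare_field (lienard f g) (half_turn z) =
  half_turn (poincare_field (lienard (flip f) (- flip g)) z).
Proof.
move=> sf sg n0 nm om dz.
have sf' : size (flip f) = n.+1 by rewrite size_flip.
have sg' : size (- flip g) = m.+1 by rewrite size_polyN size_flip.
have EP : homogenize m (lienard f g).1 (half_turn z 0 0) (half_turn z 0 1) (half_turn z 0 2) =
    - homogenize m (lienard (flip f) (- flip g)).1 (z 0 0) (z 0 1) (z 0 2).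
  by rewrite /= !(homogenizeX m) !mxE /= mulNr.
have EQ : homogenize m (lienard f g).2 (half_turn z 0 0) (half_turn z 0 1) (half_turn z 0 2) =
    - homogenize m (lienard (flip f) (- flip g)).2 (z 0 0) (z 0 1) (z 0 2).
  rewrite vec3_0 vec3_1 vec3_2; case: (eqVneq (z 0 2) 0) => [->|z2].
    rewrite (homogenize_at_infinity sf sg n0 nm) (homogenize_at_infinity sf' sg' n0 nm).
    rewrite coefN coef_flip [(- z 0 0) ^+ m]exprNn -signr_odd om expr1; move: (z 0 0 ^+ m) => p; ring.
  rewrite !homogenizeE ?(total_degree_lienard2 sf sg n0 nm) //
    ?(total_degree_lienard2 sf' sg' n0 nm) //.
  have LE (p q : {poly R}) (x y : R) : (lienard p q).2.[y%:P].[x] = acc p q x y.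
    by rewrite /lienard /= /acc hornerD !hornerN hornerM hornerX !hornerC !hornerE.
  rewrite !LE /acc !mulNr hornerN !flipE; move: (z 0 2 ^+ m) => p; ring.
rewrite /poincare_field (field_degree_lienard sf sg n0 nm) (field_degree_lienard sf' sg' n0 nm).
rewrite EP EQ; apply: rV3_eq; rewrite /half_turn !mxE /=; ring.
Qed.

End Rotation.

(** * The sector at the end of the vertical axis *)

Section UpperArcs.
Context {R : realType}.
Variables (f g : {poly R}) (n : nat) (X eta : R).
Hypothesis hfg : tame f g.
Hypothesis hb : balanced f g.
Hypothesis n0 : (0 < n)%N.
Hypothesis X1 : 1 <= X.
Hypothesis eta0 : 0 < eta.
Hypothesis hrot : far_rotating f g n X eta.

Let L := right_tip f g.
(** The derivative of [x / y] has the sign of [y^2 + x f y + x g], which for large [|x|] is at least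
    [eta x^(2n+2) - n y^2]. The slope thus increases where [w = x^(2n+2) / y^2] exceeds [K]. *)
Let K : R := n%:R / eta.
Let K0 : 0 < K. Proof. by rewrite divr_gt0 // ltr0n. Qed.

(** A monotone continuous cutoff of the form [s^2 / (1 + s^2)]: multiplied out by powers of the
    sphere coordinates it becomes [share], which still makes sense on the boundary circle. *)
Definition cutoff (k w : R) : R := Num.max 0 (w - k) ^+ 2 / (1 + Num.max 0 (w - k) ^+ 2).

Lemma cutoff_small (k w : R) : w <= k -> cutoff k w = 0.
Proof. by move=> h; rewrite /cutoff max_l ?subr_le0 // expr0n mul0r. Qed.

Lemma cutoff_mono (k v w : R) : v <= w -> cutoff k v <= cutoff k w.
Proof.
move=> vw; rewrite /cutoff; set p := Num.max 0 (v - k); set q := Num.max 0 (w - k).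
have p0 : 0 <= p by rewrite le_max lexx.
have pq : p <= q by rewrite /p /q ge_max !le_max lexx /=; apply/orP; right; linarith.
clearbody p q.
have h : p ^+ 2 <= q ^+ 2 by rewrite ler_pXn2r // nnegrE; linarith.
have a0 : 0 < 1 + p ^+ 2 by rewrite ltr_pwDl // sqr_ge0.
have b0 : 0 < 1 + q ^+ 2 by rewrite ltr_pwDl // sqr_ge0.
rewrite ler_pdivrMr // mulrAC ler_pdivlMr //; linarith.
Qed.

Lemma cutoff_ge0 (k w : R) : 0 <= cutoff k w.
Proof. by rewrite divr_ge0 ?sqr_ge0 // addr_ge0 // sqr_ge0. Qed.

Lemma cutoff_half (k w : R) : k + 1 <= w -> 1 / 2 <= cutoff k w.
Proof.
move=> h; apply: (@le_trans _ _ (cutoff k (k + 1))); last exact: cutoff_mono.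
rewrite /cutoff (_ : k + 1 - k = 1); last by ring.
by rewrite max_r // expr1n.
Qed.

Lemma cutoff_cont (k : R) : continuous (cutoff k).
Proof.
move=> w; have c : (fun w : R => Num.max 0 (w - k)) @ w --> Num.max 0 (w - k).
  apply: (@continuous_max R R (fun=> 0) (fun w => w - k)); first exact: cst_continuous.
  by apply: cvgB; [exact: cvg_id | exact: cvg_cst].
rewrite /cutoff; apply: cvgM; first by apply: cvgM.
apply: cvgV; first by rewrite lt0r_neq0 // ltr_pwDl // sqr_ge0.
by apply: cvgD; [exact: cvg_cst | apply: cvgM].
Qed.

(** The planar expression of [theta]; [rh] is a parameter because it is constant along an orbit. *)
Definition arc_coord (rh x y : R) : R :=
  x / y * cutoff K (x ^+ (2 * n + 2) / y ^+ 2) + rh * (x / (1 + `|x|)).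

Lemma even_powE (x : R) : x ^+ (2 * n + 2) = (x ^+ n.+1) ^+ 2.
Proof.
rewrite -exprM; congr (_ ^+ _); clear; lia.
Qed.

Lemma even_powN (x : R) : (- x) ^+ (2 * n + 2) = x ^+ (2 * n + 2).
Proof. by rewrite !even_powE exprNn exprMn sqrr_sign mul1r. Qed.

Lemma even_pow_ge0 (x : R) : 0 <= x ^+ (2 * n + 2).
Proof. by rewrite even_powE sqr_ge0. Qed.

Lemma arc_coordN (rh x y : R) : arc_coord rh (- x) y = - arc_coord rh x y.
Proof. by rewrite /arc_coord even_powN normrN; ring. Qed.

Lemma bounded_frac_mono (s t : R) : s < t -> s / (1 + `|s|) < t / (1 + `|t|).
Proof.
move=> st; have a : 0 < 1 + `|s| by rewrite ltr_pwDl.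
have b : 0 < 1 + `|t| by rewrite ltr_pwDl.
rewrite ltr_pdivrMr // mulrAC ltr_pdivlMr //.
by case: (ger0P s) => hs; case: (ger0P t) => ht; nra.
Qed.

Lemma slope_nondecr (x y : R -> R) (a b : R) : sol f g x y -> a <= b ->
  (forall t : R, a <= t <= b -> [/\ 0 < y t, X <= `|x t| &
     K < x t ^+ (2 * n + 2) / y t ^+ 2]) ->
  x a / y a <= x b / y b.
Proof.
move=> h ab H.
have d t : a <= t <= b -> is_derive t (1 : R) (fun s => x s / y s)
    ((y t ^+ 2 + x t * f.[x t] * y t + x t * g.[x t]) / y t ^+ 2).
  move=> /H [y0 _ _]; have yn := lt0r_neq0 y0; have [hx hy] := h t.
  by apply: (der_eq (derM hx (derV yn hy))); rewrite /acc; field.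
apply: (nondecr ab d) => t /andP[t1 t2]; have tab : a <= t <= b by rewrite !ltW.
have [y0 xX w] := H t tab; apply: divr_ge0; last exact: sqr_ge0.
have y2 : 0 < y t ^+ 2 by rewrite exprn_gt0.
rewrite ltr_pdivlMr // /K mulrAC ltr_pdivrMr // in w.
have := hrot (y t) xX; rewrite -natr1; linarith.
Qed.

(** While [|x| >= X], the ratio [w] decreases on the left and increases on the right. Hence [w > K],
    under which the slope is monotone, propagates from the end of an arc nearer to the vertical
    axis. *)
Lemma ratio_monotone (sg : R) (x y : R -> R) (a b : R) : sg = 1 \/ sg = -1 ->
  sol f g x y -> a <= b ->
  (forall t : R, a <= t <= b -> 0 < y t /\ X <= sg * x t) ->
  sg * (x a ^+ (2 * n + 2) / y a ^+ 2) <= sg * (x b ^+ (2 * n + 2) / y b ^+ 2).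
Proof.
move=> hsg h ab H.
have d t : a <= t <= b -> is_derive t (1 : R) (fun s => sg * (x s ^+ (2 * n + 2) / y s ^+ 2))
    (2 * (sg * x t ^+ (2 * n).+1) *
     (n.+1%:R * y t ^+ 2 + x t * f.[x t] * y t + x t * g.[x t]) / y t ^+ 3).
  move=> /H [y0 _]; have yn := lt0r_neq0 y0; have [hx hy] := h t.
  have y2n : y t ^+ 2 != 0 by rewrite expf_neq0.
  apply: (der_eq (derM (derC t sg) (derM (derX (2 * n + 2) hx)
    (derV (u := fun s => y s ^+ 2) y2n (derX 2 hy))))).
  rewrite /acc (_ : (2 * n + 2 = (2 * n).+2)%N) ?addn2 //= exprS.
  rewrite (_ : (2 * n).+2%:R = 2 * n.+1%:R :> R); last by rewrite -natrM mulnS.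
  move: (x t ^+ (2 * n).+1) (n.+1%:R) => p N.
  move: (x t) (y t) yn => u v vn; by field.
apply: (nondecr ab d) => t /andP[t1 t2]; have tab : a <= t <= b by rewrite !ltW.
have [y0 xX] := H t tab; apply: divr_ge0; last by rewrite exprn_ge0 // ltW.
have xX' : X <= `|x t|.
  by case: hsg xX => ->; rewrite ?mul1r ?mulN1r => xX; rewrite ler_normr xX ?orbT.
apply: mulr_ge0; last first.
  apply: le_trans (hrot (y t) xX'); apply: mulr_ge0; [exact: ltW | exact: even_pow_ge0].
apply: mulr_ge0 => //; rewrite exprS mulrA; apply: mulr_ge0.
  exact: le_trans (le_trans ler01 X1) xX.
by rewrite mulnC exprM sqr_ge0.
Qed.

Lemma x_increasing (x y : R -> R) (a b : R) : sol f g x y -> a < b ->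
  (forall t : R, a <= t <= b -> 0 < y t) -> x a < x b.
Proof.
move=> h ab H; apply: (incr ab (fun t _ => (h t).1)) => t /andP[t1 t2].
by apply: H; rewrite !ltW.
Qed.

(** Slope times cutoff does not decrease. This is clear if [x] changes sign or the cutoff vanishes
    at the end nearer to the vertical axis; otherwise the slope and the cutoff are monotone on one
    side, and their signs fit. Strictness comes from the second term. *)
Lemma arc_coord_increasing (x y : R -> R) (a b rh : R) : sol f g x y -> a < b -> 0 < rh ->
  (forall t : R, a <= t <= b -> 0 < y t /\
     (X <= `|x t| \/ x t ^+ (2 * n + 2) <= K * y t ^+ 2)) ->
  arc_coord rh (x a) (y a) < arc_coord rh (x b) (y b).
Proof.
move=> h ab r0 H; have ya : 0 < y a by apply: (H a _).1; rewrite lexx ltW.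
have yb : 0 < y b by apply: (H b _).1; rewrite lexx ltW.
have mono s t : a <= s -> s <= t -> t <= b -> x s <= x t.
  move=> as_; rewrite le_eqVlt => /predU1P[->//|st] tb; apply/ltW/(x_increasing h st).
  by move=> r /andP[r1 r2]; apply: (H r _).1; apply/andP; split; linarith.
have xab : x a < x b by apply: (x_increasing h ab) => t /H [].
rewrite /arc_coord; apply: ler_ltD; last by rewrite ltr_pM2l // bounded_frac_mono.
have ra := cutoff_ge0 K (x a ^+ (2 * n + 2) / y a ^+ 2).
have rb := cutoff_ge0 K (x b ^+ (2 * n + 2) / y b ^+ 2).
case: (lerP (x a) 0) => xa0.
  case: (lerP 0 (x b)) => xb0.
    apply: (@le_trans _ _ 0).
      by rewrite mulr_le0_ge0 // mulr_le0_ge0 // invr_ge0 ltW.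
    by rewrite mulr_ge0 // divr_ge0 // ltW.
  case: (lerP (x b ^+ (2 * n + 2) / y b ^+ 2) K) => wb.
    rewrite (cutoff_small wb) mulr0 mulr_le0_ge0 // mulr_le0_ge0 //.
    by rewrite invr_ge0 ltW.
  have xbX : x b <= - X.
    have [|_ [|]] := H b _; first by rewrite lexx ltW.
      by rewrite ltr0_norm //; linarith.
    by move: wb; rewrite ltr_pdivlMr ?exprn_gt0 //; linarith.
  have hx t : a <= t <= b -> x t <= - X.
    by move=> /andP[t1 t2]; apply: le_trans xbX; exact: mono.
  have wt t : a <= t <= b -> x b ^+ (2 * n + 2) / y b ^+ 2 <= x t ^+ (2 * n + 2) / y t ^+ 2.
    move=> /andP[t1 t2].
    have := @ratio_monotone (-1) x y t b (or_intror erefl) h t2; rewrite !mulN1r lerN2; apply.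
    move=> r /andP[r1 r2]; have rab : a <= r <= b by apply/andP; split; linarith.
    by split; [exact: (H r rab).1 | rewrite mulN1r; have := hx r rab; linarith].
  have sl : x a / y a <= x b / y b.
    apply: (slope_nondecr h (ltW ab)) => t tab; split; first exact: (H t tab).1.
    - by have := hx t tab; rewrite ler_normr; linarith.
    - by apply: (lt_le_trans wb); exact: wt.
  have cm : cutoff K (x b ^+ (2 * n + 2) / y b ^+ 2) <= cutoff K (x a ^+ (2 * n + 2) / y a ^+ 2).
    by apply: cutoff_mono; apply: wt; rewrite lexx ltW.
  have ub : x b / y b <= 0 by apply: mulr_le0_ge0; [exact: ltW | rewrite invr_ge0 ltW].
  by nra.
case: (lerP (x a ^+ (2 * n + 2) / y a ^+ 2) K) => wa.
  rewrite (cutoff_small wa) mulr0 mulr_ge0 // divr_ge0 //; last exact: ltW.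
  by linarith.
have xaX : X <= x a.
  have [|_ [|]] := H a _; first by rewrite lexx ltW.
    by rewrite gtr0_norm.
  by move: wa; rewrite ltr_pdivlMr ?exprn_gt0 //; linarith.
have hx t : a <= t <= b -> X <= x t.
  by move=> /andP[t1 t2]; apply: (le_trans xaX); exact: mono.
have wt t : a <= t <= b -> x a ^+ (2 * n + 2) / y a ^+ 2 <= x t ^+ (2 * n + 2) / y t ^+ 2.
  move=> /andP[t1 t2].
  have := @ratio_monotone 1 x y a t (or_introl erefl) h t1; rewrite !mul1r; apply.
  move=> r /andP[r1 r2]; have rab : a <= r <= b by apply/andP; split; linarith.
  by split; [exact: (H r rab).1 | rewrite mul1r; exact: hx].
have sl : x a / y a <= x b / y b.
  apply: (slope_nondecr h (ltW ab)) => t tab; split; first exact: (H t tab).1.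
  - by have := hx t tab; rewrite ler_normr => ->.
  - by apply: (lt_le_trans wa); exact: wt.
have cm : cutoff K (x a ^+ (2 * n + 2) / y a ^+ 2) <= cutoff K (x b ^+ (2 * n + 2) / y b ^+ 2).
  by apply: cutoff_mono; apply: wt; rewrite lexx ltW.
have ua : 0 <= x a / y a by rewrite divr_ge0 // ltW.
by apply: ler_pM.
Qed.

(** A high level puts the point outside a given box, because the level is bounded on the box by
    compactness. With [|x| < X] the ordinate must then be large. *)
Lemma far_region : exists2 r0 : R, 0 < r0 & forall x y : R, 0 < y -> (L x y)^-1 <= r0 ->
  X <= `|x| \/ 1 <= y /\ x ^+ (2 * n + 2) <= K * y ^+ 2.
Proof.
(* Chosen so that [K Y0^2 >= X^(2n+2)] and [Y0 >= 1]. *)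
pose Y0 := X ^+ n.+1 * (1 + K^-1); pose B := X + Y0.
have Ki : 0 < K^-1 by rewrite invr_gt0.
have Xp : 1 <= X ^+ n.+1 by exact: exprn_ege1.
have Y01 : 1 <= Y0 by rewrite /Y0; nra.
have cB : compact [set v : 'rV[R]_2 | forall i, `[- B, B]%classic (v 0 i)].
  by apply: (@rV_compact R 2 (fun=> `[- B, B]%classic)) => i; exact: segment_compact.
have := continuous_compact (continuous_subspaceT (cycle_level_continuous hfg hb)) cB.
move=> /compact_bounded [M [_ hM]].
have hL x y : `|x| <= B -> `|y| <= B -> L x y <= `|M| + 1.
  move=> hx hy; have := hM (`|M| + 1); rewrite ltr_pwDr ?ler_norm //.
  have E : cycle_level f g (vec2 x y) = L x y by rewrite /cycle_level vec2_0 vec2_1.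
  move=> /(_ isT (L x y)); rewrite /= ger0_norm ?right_tip_ge0 //; apply.
  exists (vec2 x y); last exact: E.
  by move=> i; rewrite /= in_itv /= -ler_norml; elim/ord2_ind: i; rewrite ?vec2_0 ?vec2_1.
exists (`|M| + 2)^-1; first by rewrite invr_gt0 ltr_pwDr.
move=> x y y0 hr; case: (lerP X `|x|) => [xX|xX]; [by left | right].
have l0 : 0 < L x y by apply: right_tip_gt0 => //; right; rewrite gt_eqF.
have M2 : 0 < `|M| + 2 by rewrite ltr_pwDr.
have lM : `|M| + 2 <= L x y by rewrite -lef_pV2 // posrE.
have yY : Y0 < y.
  rewrite ltNge; apply/negP => yY.
  have h1 : `|x| <= B by rewrite /B ler_wpDr ?(ltW xX) // (le_trans ler01).
  have h2 : `|y| <= B by rewrite (gtr0_norm y0) /B ler_wpDl // (le_trans ler01).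
  by have := hL x y h1 h2; linarith.
split; first by linarith.
have e1 : x ^+ (2 * n + 2) = (`|x| ^+ n.+1) ^+ 2.
  by rewrite even_powE -normrX real_normK ?num_real.
have Xpos : 0 <= X by exact: le_trans ler01 X1.
have e2 : `|x| ^+ n.+1 <= X ^+ n.+1 by apply: lerXn2r; rewrite ?nnegrE // ltW.
have e3 : 0 <= `|x| ^+ n.+1 by rewrite exprn_ge0.
have Kpos : 0 < K by exact: K0.
have KK : K * K^-1 = 1 by rewrite divff // gt_eqF.
rewrite e1; apply: (@le_trans _ _ (K * Y0 ^+ 2)); last first.
  by rewrite ler_pM2l // ler_pXn2r // ?nnegrE; linarith.
apply: (@le_trans _ _ ((X ^+ n.+1) ^+ 2)); first by rewrite ler_pXn2r // ?nnegrE; linarith.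
rewrite /Y0; move: (X ^+ n.+1) Xp => p p1.
rewrite (_ : K * _ ^+ 2 = p ^+ 2 * (K + 2 * (K * K^-1) + K * K^-1 * K^-1)); last by ring.
by rewrite KK ler_peMr ?sqr_ge0 //; linarith.
Qed.

Lemma arc_coord_large (rh p x y : R) : 0 <= rh -> 0 < p -> p <= x -> 0 < y -> y <= p / 2 ->
  y <= p ^+ n.+1 / (K + 2) -> 1 <= arc_coord rh x y.
Proof.
have Kpos : 0 < K by exact: K0.
move=> rh0 p0 px y0 y1 y2; rewrite /arc_coord; apply: ler_wpDr.
  by rewrite mulr_ge0 // divr_ge0 ?addr_ge0 //; linarith.
have u2 : 2 <= x / y by rewrite ler_pdivlMr //; linarith.
have w : K + 1 <= x ^+ (2 * n + 2) / y ^+ 2.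
  rewrite ler_pdivlMr ?exprn_gt0 //.
  have e1 := even_powE x.
  have e2 : y * (K + 2) <= x ^+ n.+1.
    rewrite -ler_pdivlMr; last by linarith.
    apply: (le_trans y2); rewrite ler_pM2r; last by rewrite invr_gt0; linarith.
    by apply: lerXn2r; rewrite ?nnegrE; linarith.
  rewrite e1; apply: (@le_trans _ _ ((y * (K + 2)) ^+ 2)).
    by rewrite exprMn mulrC ler_pM2l ?exprn_gt0 //; nra.
  by rewrite ler_pXn2r ?nnegrE //; [rewrite mulr_ge0; linarith | rewrite exprn_ge0 //; linarith].
by have := cutoff_half w; move: (cutoff _ _) (x / y) u2 => c u u2 hc; nra.
Qed.

Lemma arc_coord_cont (rh : R) (x y : R -> R) (t : R) : sol f g x y -> 0 < y t ->
  {for t, continuous (fun s => arc_coord rh (x s) (y s))}.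
Proof.
move=> h y0; have cx := der_cont (h t).1; have cy := der_cont (h t).2.
have yn := lt0r_neq0 y0.
have cX (k : nat) : (fun s => x s ^+ k) @ t --> x t ^+ k.
  by have := der_cont (derX k (h t).1).
apply: cvgD; apply: cvgM.
- by apply: cvgM => //; apply: cvgV.
- apply: (@cvg_comp _ _ _ (fun s => x s ^+ (2 * n + 2) / y s ^+ 2) (cutoff K)); last exact: cutoff_cont.
  apply: cvgM => //; apply: cvgV; first by rewrite expf_neq0.
  exact: cvgM.
- exact: cvg_cst.
- apply: cvgM => //; apply: cvgV; first by rewrite lt0r_neq0 // ltr_pwDl.
  by apply: cvgD; [exact: cvg_cst | exact: cvg_norm].
Qed.

Lemma arc_ends (rh : R) (x y : R -> R) (a b : R) : sol f g x y -> a < b -> 0 <= rh ->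
  x a < 0 -> y a = 0 -> 0 < x b -> y b = 0 -> (forall t : R, a < t < b -> 0 < y t) ->
  exists s t : R, [/\ a < s, s < t, t < b,
    arc_coord rh (x s) (y s) <= -1 & 1 <= arc_coord rh (x t) (y t)].
Proof.
move=> h ab rh0 xa ya xb yb H.
(* At a point with [x >= p] the first bound on [y] gives a slope of at least [2], the second gives
   [w >= K + 1] and so a cutoff of at least [1 / 2]: the product reaches [1]. Near the tips [y]
   tends to [0], so both values [-1] and [1] of the coordinate are passed. *)
pose eps (p : R) := Num.min (p / 2) (p ^+ n.+1 / (K + 2)).
have e0 p : 0 < p -> 0 < eps p.
  by move=> p0; rewrite lt_min divr_gt0 //= divr_gt0 ?exprn_gt0 // addr_gt0.
have near (c : R) (p : R) : 0 < p -> exists2 d : R, 0 < d & forall t : R, `|c - t| < d ->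
    `|x c - x t| < p /\ `|y c - y t| < eps p.
  move=> p0; have /cvgrPdist_lt /(_ p p0) /nbhs_ballP [d1 /= d10 h1] := der_cont (h c).1.
  have /cvgrPdist_lt /(_ _ (e0 p p0)) /nbhs_ballP [d2 /= d20 h2] := der_cont (h c).2.
  exists (Num.min d1 d2); first by rewrite lt_min d10.
  by move=> t; rewrite lt_min => /andP[t1 t2]; split; [exact: h1 | exact: h2].
pose pa := - x a / 2; pose pb := x b / 2.
have [da da0 ha] := near a pa ltac:(rewrite /pa; linarith).
have [db db0 hb'] := near b pb ltac:(rewrite /pb; linarith).
pose q := (b - a) / 3; pose sa := Num.min (da / 2) q; pose sb := Num.min (db / 2) q.
have q0 : 0 < q by rewrite /q; linarith.
have sa0 : 0 < sa by rewrite lt_min; apply/andP; split; linarith.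
have sb0 : 0 < sb by rewrite lt_min; apply/andP; split; linarith.
have sa1 : sa <= da / 2 by rewrite ge_min lexx.
have sb1 : sb <= db / 2 by rewrite ge_min lexx.
have sa2 : sa <= q by rewrite ge_min lexx orbT.
have sb2 : sb <= q by rewrite ge_min lexx orbT.
clearbody sa sb; rewrite /q in sa2 sb2.
exists (a + sa), (b - sb); split; try by linarith.
- have [|h1 h2] := ha (a + sa); first by rewrite opprD addNKr normrN gtr0_norm //; linarith.
  have yp : 0 < y (a + sa) by apply: H; apply/andP; split; linarith.
  rewrite ya sub0r normrN gtr0_norm // lt_min in h2; move/andP: h2 => [h2 h3].
  rewrite -(opprK (x (a + sa))) arc_coordN lerN2.
  apply: (@arc_coord_large rh pa) => //; [by rewrite /pa; linarith | | exact: ltW | exact: ltW].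
  by move: h1; rewrite /pa ltr_norml; linarith.
- have [|h1 h2] := hb' (b - sb); first by rewrite opprB addrC subrK gtr0_norm //; linarith.
  have yp : 0 < y (b - sb) by apply: H; apply/andP; split; linarith.
  rewrite yb sub0r normrN gtr0_norm // lt_min in h2; move/andP: h2 => [h2 h3].
  apply: (@arc_coord_large rh pb) => //; [by rewrite /pb; linarith | | exact: ltW | exact: ltW].
  by move: h1; rewrite /pb ltr_norml; linarith.
Qed.

Lemma upper_arc (l : R) : 0 < l -> exists (x y : R -> R) (a b : R),
  [/\ [/\ sol f g x y, a < b, x a < 0 /\ y a = 0 & x b = l /\ y b = 0],
      forall t : R, L (x t) (y t) = l, forall t : R, a < t < b -> 0 < y t &
      forall x0 y0 : R, L x0 y0 = l -> 0 < y0 ->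
        exists2 t : R, a < t < b & x t = x0 /\ y t = y0].
Proof.
move=> l0; have [x [y [t1 [T [l' [[t10 t1T l'0 _] h per [x0 y0 xt yt] [lo up]]]]]]] :=
  cycle_structure hfg hb l0.
exists x, y, t1, T; split => //.
- have [e1 e2] := per 0; rewrite add0r in e1 e2.
  by split => //; [rewrite xt yt; split => //; linarith | rewrite e1 e2].
- by move=> t; rewrite /L (right_tip_flow hfg hb t h) x0 y0 right_tip_axis.
- move=> p q hL q0.
  have nz : p != 0 \/ q != 0 by right; rewrite gt_eqF.
  have [_ [u [v [t [h' eu ev ut vt]]]]] := right_tipP hfg hb nz.
  rewrite -/L hL in ut.
  have E := @sol_unique R f g _ _ _ _ 0 (sol_shift t h') h; rewrite !add0r in E.
  have {E} [Eu Ev] := E (etrans ut (esym x0)) (etrans vt (esym y0)) (- t).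
  rewrite addNr eu in Eu; rewrite addNr ev in Ev.
  have T0 : 0 < T by linarith.
  have [s /andP[s0 sT] [sx sy]] := periodic_reduce T0 per (- t).
  exists s; last by rewrite -sx -sy -Eu -Ev.
  rewrite sT andbT ltNge; apply/negP => st.
  have ys : y s = q by rewrite -sy -Ev.
  case: (eqVneq s t1) => [e|sn]; first by move: q0; rewrite -ys e yt ltxx.
  case: (eqVneq s 0) => [e|sn0]; first by move: q0; rewrite -ys e y0 ltxx.
  have : y s < 0 by apply: lo; rewrite !lt_neqAle eq_sym sn0 s0 sn st.
  by rewrite ys ltNge ltW.
Qed.

End UpperArcs.

(** * The two coordinates on the closed disc and their compact domain *)

Section SectorCoordinates.
Context {R : realType}.
Variables (f g : {poly R}) (n : nat) (X eta : R).
Hypothesis hfg : tame f g.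
Hypothesis hb : balanced f g.
Hypothesis n0 : (0 < n)%N.
Hypothesis X1 : 1 <= X.
Hypothesis eta0 : 0 < eta.
Hypothesis hrot : far_rotating f g n X eta.

Let K : R := n%:R / eta.
Let K0 : 0 < K. Proof. by rewrite divr_gt0 // ltr0n. Qed.

(** At infinity division by zero sends [plane_point] to the origin, whose level is [0], and the
    inverse of [0] is [0]: the conventions yield exactly the limit value. *)
Definition level_coord (z : 'rV[R]_3) : R := (cycle_level f g (plane_point z))^-1.

(* [z1^2 z2^(2n)] times [max 0 (w - K)], with [w = x^(2n+2) / y^2] in the plane. *)
Let excess (z : 'rV[R]_3) : R :=
  Num.max 0 (z 0 0 ^+ (2 * n + 2) - K * (z 0 1 ^+ 2 * z 0 2 ^+ (2 * n))).
Let weight (z : 'rV[R]_3) : R := z 0 1 ^+ 2 * z 0 2 ^+ (2 * n).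
Let share (z : 'rV[R]_3) : R := excess z ^+ 2 / (weight z ^+ 2 + excess z ^+ 2).

(* The slope [x / y = z0 / z1] is a coordinate on the boundary circle
   but is only known to increase along orbits where [w > K], so it is cut off
   elsewhere; the second term makes the sum strictly increasing. *)
Definition angle_coord (z : 'rV[R]_3) : R :=
  z 0 0 / z 0 1 * share z + level_coord z * (z 0 0 / (z 0 2 + `|z 0 0|)).

Definition upper_disc : set 'rV[R]_3 := [set z | poincare_disc z /\ 0 < z 0 1].

Lemma level_coord_ge0 (z : 'rV[R]_3) : 0 <= level_coord z.
Proof. by rewrite invr_ge0 right_tip_ge0. Qed.

Lemma level_coord_infinity (z : 'rV[R]_3) : z 0 2 = 0 -> level_coord z = 0.
Proof.
move=> z2; rewrite /level_coord /plane_point z2 invr0 !mulr0.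
by rewrite /cycle_level vec2_0 vec2_1 right_tip0 // invr0.
Qed.

Lemma level_coord_gt0 (z : 'rV[R]_3) : 0 < z 0 1 -> 0 < z 0 2 -> 0 < level_coord z.
Proof.
move=> z1 z2; rewrite invr_gt0; apply: cycle_level_gt0 => //; apply/rV2_neq0; right.
by rewrite /plane_point vec2_1 gt_eqF // divr_gt0.
Qed.

Lemma angle_coord_plane (z : 'rV[R]_3) : 0 < z 0 1 -> 0 < z 0 2 ->
  angle_coord z = arc_coord n eta (level_coord z) (z 0 0 / z 0 2) (z 0 1 / z 0 2).
Proof.
move=> z1 z2; rewrite /angle_coord /arc_coord -/K.
have n1 := lt0r_neq0 z1; have n2 := lt0r_neq0 z2.
have w0 : 0 < weight z by rewrite mulr_gt0 ?exprn_gt0.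
have wn := lt0r_neq0 w0.
congr (_ + _ * _); last first.
  rewrite normrM normfV (gtr0_norm z2).
  have p : z 0 2 + `|z 0 0| != 0 by rewrite lt0r_neq0 // ltr_pwDl.
  move: (`|z 0 0|) p => a p; rewrite (_ : 1 + a / z 0 2 = (z 0 2 + a) / z 0 2).
    by rewrite invf_div mulrA divfK.
  by rewrite mulrDl divff.
congr (_ * _); first by rewrite invf_div mulrA divfK.
rewrite /share /cutoff.
set w := (z 0 0 / z 0 2) ^+ _ / _.
have Ew : weight z * w = z 0 0 ^+ (2 * n + 2).
  rewrite /weight /w !expr_div_n [z 0 2 ^+ (2 * n + 2)]exprD.
  move: (z 0 2 ^+ (2 * n)) (expf_neq0 (2 * n) n2) => p pn.
  by move: (z 0 0 ^+ _) => q; field; rewrite n1 n2 pn.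
have -> : excess z = weight z * Num.max 0 (w - K).
  rewrite maxr_pMr ?ltW // mulr0 /excess; congr Num.max.
  by rewrite mulrBr Ew mulrC.
have pos : 1 + Num.max 0 (w - K) ^+ 2 != 0 by rewrite lt0r_neq0 // ltr_pwDl // sqr_ge0.
move: (Num.max _ _) pos (weight z) wn => s pos d dn.
rewrite (_ : d ^+ 2 + (d * s) ^+ 2 = d ^+ 2 * (1 + s ^+ 2)); last by ring.
by rewrite exprMn -mulf_div divff ?mul1r // expf_neq0.
Qed.

Lemma angle_coord_infinity (z : 'rV[R]_3) : 0 < z 0 1 -> z 0 2 = 0 -> angle_coord z = z 0 0 / z 0 1.
Proof.
move=> z1 z2; rewrite /angle_coord (level_coord_infinity z2) mul0r addr0.
case: (eqVneq (z 0 0) 0) => [->|z0]; first by rewrite !mul0r.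
have w0 : weight z = 0.
  rewrite /weight z2 expr0n (_ : (2 * n == 0)%N = false) ?mulr0 //.
  by apply/negbTE; rewrite muln_eq0 /= -lt0n.
have e0 : excess z != 0.
  rewrite /excess -/(weight z) w0 mulr0 subr0 max_r ?even_pow_ge0 //.
  by rewrite expf_neq0.
by rewrite /share w0 expr0n add0r divff ?mulr1 // expf_neq0.
Qed.

Lemma within_cvg (z : 'rV[R]_3) (u : 'rV[R]_3 -> R) : u @ z --> u z ->
  u @ within upper_disc (nbhs z) --> u z.
Proof. by move=> h; apply: cvg_trans h; apply: cvg_app; exact: cvg_within. Qed.

Lemma coord_cvg (z : 'rV[R]_3) (j : 'I_3) : (fun w : 'rV[R]_3 => w 0 j) @ z --> z 0 j.
Proof. exact: coord_continuous. Qed.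

Lemma cvg0_bounded (F : set_system 'rV[R]_3) (FF : Filter F) (u v : 'rV[R]_3 -> R) :
  u @ F --> (0 : R) -> (\forall z \near F, `|v z| <= 1) -> (fun z => u z * v z) @ F --> (0 : R).
Proof.
move=> /cvgrPdist_lt hu hv; apply/cvgrPdist_lt => e e0.
apply: filterS2 (hu e e0) hv => z; rewrite !sub0r !normrN => h1 h2.
by rewrite normrM; apply: le_lt_trans h1; rewrite ler_piMr.
Qed.

(** Approaching the circle with [z1 > 0], the ordinate in the plane exceeds every bound, and by
    properness so does the level. *)
Lemma level_coord_cont (z : 'rV[R]_3) : upper_disc z ->
  level_coord @ within upper_disc (nbhs z) --> level_coord z.
Proof.
move=> [[hz z20] z1]; move: z20; rewrite le_eqVlt => /predU1P[z2|z2].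
- rewrite (level_coord_infinity (esym z2)); apply/cvgrPdist_lt => e e0.
  have [B B0 hB] := right_tip_proper hfg hb (2 / e).
  pose d := Num.min (z 0 1 / 2) (z 0 1 / (2 * (B + 1))).
  have B1 : 0 < 2 * (B + 1) by rewrite mulr_gt0 // addr_gt0.
  have d0 : 0 < d by rewrite lt_min !divr_gt0.
  have d1 : d <= z 0 1 / 2 by rewrite ge_min lexx.
  have d2 : d <= z 0 1 / (2 * (B + 1)) by rewrite ge_min lexx orbT.
  apply/nbhs_rV; exists d => // w hw [[_ w2] w1].
  rewrite sub0r normrN ger0_norm ?level_coord_ge0 //.
  move: w2; rewrite le_eqVlt => /predU1P[w2|w2].
    by rewrite (level_coord_infinity (esym w2)).
  have h1 := hw 1; have h2 := hw 2; rewrite -z2 sub0r normrN gtr0_norm // in h2.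
  have y1 : B < w 0 1 / w 0 2.
    rewrite ltr_pdivlMr //; have h3 : w 0 2 < z 0 1 / (2 * (B + 1)) by lra.
    rewrite ltr_pdivlMr // in h3; rewrite ltr_norml in h1.
    have {}B0 : 0 < B := B0; nra.
  have lt : 2 / e < cycle_level f g (plane_point w).
    rewrite ltNge; apply/negP => /hB [_]; rewrite vec2_1 gtr0_norm ?divr_gt0 //; lra.
  have l0 : 0 < cycle_level f g (plane_point w) by apply: lt_trans lt; exact: divr_gt0.
  rewrite /level_coord -[e]invrK ltf_pV2 ?posrE ?invr_gt0 //.
  by apply: lt_trans lt; rewrite ltr_pdivlMr // mulVf ?gt_eqF //; lra.
- apply: within_cvg; have n2 := lt0r_neq0 z2.
  change ((fun w => (cycle_level f g (plane_point w))^-1) @ z -->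
    (cycle_level f g (plane_point z))^-1); apply: (@cvgV R _ (nbhs z) (nbhs_filter z)).
    by apply: lt0r_neq0; rewrite -invr_gt0; exact: level_coord_gt0.
  apply: (@cvg_comp _ _ _ plane_point (cycle_level f g)); last exact: cycle_level_continuous.
  by apply: cvg_vec2; apply: cvgM; try apply: cvgV => //; exact: coord_cvg.
Qed.

Lemma share_bound (z : 'rV[R]_3) : `|share z| <= 1.
Proof.
have a0 := sqr_ge0 (excess z); have b0 := sqr_ge0 (weight z).
rewrite ger0_norm /share; last by rewrite divr_ge0 // addr_ge0.
move: (excess z ^+ 2) (weight z ^+ 2) a0 b0 => a b a0 b0.
case: (eqVneq (b + a) 0) => [->|e]; first by rewrite invr0 mulr0.
have p : 0 < b + a by rewrite lt_def e addr_ge0.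
by rewrite ler_pdivrMr // mul1r; lra.
Qed.

Lemma share_cvg (z : 'rV[R]_3) : weight z ^+ 2 + excess z ^+ 2 != 0 -> share @ z --> share z.
Proof.
move=> h; have X_cvg (j : 'I_3) (k : nat) : (fun w : 'rV[R]_3 => w 0 j ^+ k) @ z --> z 0 j ^+ k.
  apply: (@cvg_comp _ _ _ (fun w : 'rV[R]_3 => w 0 j) (fun t : R => t ^+ k)); last exact: exprn_continuous.
  exact: coord_cvg.
have w_cvg : weight @ z --> weight z by exact: (cvgM (X_cvg 1 2%N) (X_cvg 2 (2 * n)%N)).
have e_cvg : excess @ z --> excess z.
  apply: (@continuous_max R _ (fun=> 0) (fun z : 'rV[R]_3 => z 0 0 ^+ (2 * n + 2) - K * weight z)).
    exact: cst_continuous.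
  exact: (cvgB (X_cvg 0 _) (cvgM (cvg_cst K) w_cvg)).
exact: (cvgM (cvgM e_cvg e_cvg)
  (cvgV h (cvgD (cvgM w_cvg w_cvg) (cvgM e_cvg e_cvg)))).
Qed.

(** The denominator of [share] vanishes only at the equilibrium [z0 = z2 = 0]; there the slope tends
    to [0] while [share] stays bounded. Likewise, at infinity the second term is a bounded quotient
    times a level coordinate tending to [0]. *)
Lemma angle_coord_cont (z : 'rV[R]_3) : upper_disc z ->
  angle_coord @ within upper_disc (nbhs z) --> angle_coord z.
Proof.
move=> Dz; have [[hz z20] z1] := Dz; have n1 := lt0r_neq0 z1.
have slope : (fun z : 'rV[R]_3 => z 0 0 / z 0 1) @ within upper_disc (nbhs z) --> z 0 0 / z 0 1.
  pose s (w : 'rV[R]_3) : R := w 0 0 / w 0 1; apply: (@within_cvg z s).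
  exact: (cvgM (@coord_cvg z 0) (cvgV n1 (@coord_cvg z 1))).
have quot_bound (w : 'rV[R]_3) : 0 <= w 0 2 -> `|w 0 0 / (w 0 2 + `|w 0 0|)| <= 1.
  move=> w2; have s0 : 0 <= w 0 2 + `|w 0 0| by rewrite addr_ge0.
  rewrite normrM normfV (ger0_norm s0); move: s0; rewrite le_eqVlt => /predU1P[<-|s0].
    by rewrite invr0 mulr0.
  by rewrite ler_pdivrMr // mul1r; lra.
rewrite /angle_coord; apply: cvgD.
- case: (eqVneq (weight z ^+ 2 + excess z ^+ 2) 0) => [e|e]; last first.
    by apply: cvgM => //; apply: within_cvg; exact: share_cvg.
  have z0 : z 0 0 = 0.
    apply/eqP; rewrite -[_ == 0]negbK; apply/negP => z0.
    move: e => /eqP; rewrite paddr_eq0 ?sqr_ge0 // !sqrf_eq0 => /andP[/eqP w0].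
    rewrite /excess -/(weight z) w0 mulr0 subr0 max_r ?even_pow_ge0 //.
    by rewrite expf_eq0 (negbTE z0) andbF.
  rewrite z0 !mul0r; rewrite z0 mul0r in slope.
  by apply: cvg0_bounded => //; apply: nearW => w; exact: share_bound.
- have rc := level_coord_cont Dz; move: (z20); rewrite le_eqVlt => /predU1P[z2|z2].
    rewrite (level_coord_infinity (esym z2)) mul0r in rc *.
    apply: cvg0_bounded => //; apply/nbhs_rV; exists 1 => // w _ [[_ w2] _].
    exact: quot_bound.
  apply: cvgM => //; pose s (w : 'rV[R]_3) : R := w 0 0 / (w 0 2 + `|w 0 0|).
  apply: (@within_cvg z s); have p : z 0 2 + `|z 0 0| != 0 by rewrite lt0r_neq0 // ltr_pwDl.
  exact: (cvgM (@coord_cvg z 0) (cvgV p (cvgD (@coord_cvg z 2) (cvg_norm (@coord_cvg z 0))))).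
Qed.

Variable r0 : R.
Hypothesis r00 : 0 < r0.
Hypothesis r01 : r0 <= 1.
Hypothesis region : forall x y : R, 0 < y -> (right_tip f g x y)^-1 <= r0 ->
  X <= `|x| \/ 1 <= y /\ x ^+ (2 * n + 2) <= K * y ^+ 2.

Definition sector : set 'rV[R]_3 :=
  [set z | upper_disc z /\ (`|angle_coord z| <= 1 /\ level_coord z <= r0)].

(** This keeps [sector] away from [z1 = 0], where the slope is singular: a limit of points of the
    sector has [z1 > 0], so the coordinates are continuous there and the sector is closed. *)
Lemma sector_height (z : 'rV[R]_3) : sector z -> 1 <= (2 * K + 36) * z 0 1 ^+ 2.
Proof.
move=> [[[hz z20] z1] [ha hl]]; have Kp : 0 < K := K0; have rp := r01; have Xp := X1.
move: (z20); rewrite le_eqVlt => /predU1P[z2|z2].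
  rewrite (angle_coord_infinity z1 (esym z2)) normrM normfV (gtr0_norm z1) in ha.
  rewrite ler_pdivrMr // mul1r in ha.
  have := sqr_ge0 (z 0 1); have : z 0 0 ^+ 2 <= z 0 1 ^+ 2.
    by rewrite -(real_normK (num_real (z 0 0))) ler_pXn2r // ?nnegrE ?normr_ge0 // ltW.
  by rewrite -z2 expr0n /= addr0 in hz; clear hl ha; nra.
rewrite (angle_coord_plane z1 z2) in ha.
set x := z 0 0 / z 0 2 in ha; set y := z 0 1 / z 0 2 in ha.
have y0 : 0 < y by rewrite divr_gt0.
have hl' : (right_tip f g x y)^-1 <= r0.
  by move: hl; rewrite /level_coord /cycle_level /plane_point vec2_0 vec2_1.
have reg := region y0 hl'.
have far : 1 <= x ^+ 2 \/ 1 <= y ^+ 2.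
  case: reg => [h|[h _]]; [left | right]; last by rewrite exprn_ege1.
  by rewrite -(real_normK (num_real x)) exprn_ege1 //; lra.
(* Where the cutoff is at least [1 / 2], the bounds [|theta| <= 1] and [rho <= 1] give
   [|x / y| <= 4]. Elsewhere [w < K + 1], which bounds [x^2] by [(K + 1) y^2] when [x^2 >= 1], and
   otherwise [y >= 1]. *)
have slope : x ^+ 2 <= (K + 17) * y ^+ 2.
  have y2 : 0 < y ^+ 2 by rewrite exprn_gt0.
  case: (lerP (K + 1) (x ^+ (2 * n + 2) / y ^+ 2)) => w.
    have c := cutoff_half w.
    have u4 : `|x / y| <= 4.
      move: ha; rewrite /arc_coord -/K; set c' := cutoff _ _ in c *.
      set u := x / y; set v := x / (1 + `|x|) => ha.
      have v1 : `|v| <= 1.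
        rewrite /v normrM normfV (@ger0_norm _ (1 + `|x|)) ?addr_ge0 //.
        by rewrite ler_pdivrMr ?mul1r ?lerDr // ltr_pwDl.
      have p1 : `|level_coord z * v| <= 1.
        by rewrite normrM mulr_ile1 // ger0_norm ?level_coord_ge0 //; lra.
      have p2 : `|u * c'| <= 2.
        have := ler_normB (u * c' + level_coord z * v) (level_coord z * v).
        by rewrite addrK; lra.
      rewrite normrM (@ger0_norm _ c') in p2; last by lra.
      have := normr_ge0 u; move: (`|u|) p2 => q p2 q0; nra.
    have : (x / y) ^+ 2 <= 16.
      rewrite -(real_normK (num_real (x / y))) (_ : 16 = 4 ^+ 2 :> R); last by ring.
      by rewrite ler_pXn2r // ?nnegrE.
    rewrite expr_div_n ler_pdivrMr //; move: (x ^+ 2) (y ^+ 2) y2 => p q q0 h.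
    by apply: le_trans h _; rewrite ler_wpM2r //; lra.
  rewrite ltr_pdivrMr // in w.
  case: (lerP 1 (x ^+ 2)) => x1; last first.
    by case: far => h; [lra | nra].
  have : x ^+ 2 <= x ^+ (2 * n + 2).
    by rewrite exprD exprM ler_peMl ?sqr_ge0 // exprn_ege1.
  by move: (x ^+ (2 * n + 2)) (x ^+ 2) (y ^+ 2) w x1 y2 => p a b *; nra.
have E0 : z 0 0 ^+ 2 = x ^+ 2 * z 0 2 ^+ 2 by rewrite /x; field; exact: lt0r_neq0.
have E1 : z 0 1 ^+ 2 = y ^+ 2 * z 0 2 ^+ 2 by rewrite /y; field; exact: lt0r_neq0.
rewrite E0 E1 in hz; rewrite E1; have z22 : 0 < z 0 2 ^+ 2 by rewrite exprn_gt0.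
have x2 := sqr_ge0 x; have y2 := sqr_ge0 y.
rewrite -[leLHS]hz -mulrDl -[X in _ + X]mul1r -mulrDl mulrA ler_pM2r //.
by move: (x ^+ 2) (y ^+ 2) slope far x2 y2 => p q h1 h2 p0 q0; case: h2 => h2; nra.
Qed.

Lemma disc_box (z : 'rV[R]_3) : poincare_disc z -> forall j, -1 <= z 0 j <= 1.
Proof.
move=> [hz _] j; rewrite -ler_norml -(@expr_le1 _ 2) // real_normK ?num_real //.
have s0 := sqr_ge0 (z 0 0); have s1 := sqr_ge0 (z 0 1); have s2 := sqr_ge0 (z 0 2).
by elim/ord3_ind: j; lra.
Qed.

Lemma sector_compact : compact sector.
Proof.
apply: (@subclosed_compact _ _ [set v : 'rV[R]_3 | forall i, `[-1, 1]%classic (v 0 i)]).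
- move=> z cz.
  have lim (u v : 'rV[R]_3 -> R) : u @ z --> u z -> v @ z --> v z ->
      (forall w, sector w -> u w <= v w) -> u z <= v z.
    move=> hu hv huv; rewrite leNgt; apply/negP => lt.
    have /cvgrPdist_lt h : (fun w => u w - v w) @ z --> u z - v z by exact: (cvgB hu hv).
    have [w [Sw hw]] := cz _ (h (u z - v z) ltac:(lra)).
    by have := huv w Sw; move: hw; rewrite /= ltr_norml; lra.
  have X_cvg (j : 'I_3) (k : nat) : (fun w : 'rV[R]_3 => w 0 j ^+ k) @ z --> z 0 j ^+ k.
    apply: (@cvg_comp _ _ _ (fun w : 'rV[R]_3 => w 0 j) (fun t : R => t ^+ k)); last exact: exprn_continuous.
    exact: coord_cvg.
  have S_cvg : (fun w : 'rV[R]_3 => w 0 0 ^+ 2 + w 0 1 ^+ 2 + w 0 2 ^+ 2) @ z -->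
      z 0 0 ^+ 2 + z 0 1 ^+ 2 + z 0 2 ^+ 2.
    exact: (cvgD (cvgD (X_cvg 0 2%N) (X_cvg 1 2%N)) (X_cvg 2 2%N)).
  have C_cvg (c : R) : (fun _ : 'rV[R]_3 => c) @ z --> c by exact: (@cst_continuous _ _ c z).
  have a1 : z 0 0 ^+ 2 + z 0 1 ^+ 2 + z 0 2 ^+ 2 <= 1.
    by apply: (lim _ _ S_cvg (C_cvg 1)) => w [[[+ _] _] _] /= => ->.
  have a2 : 1 <= z 0 0 ^+ 2 + z 0 1 ^+ 2 + z 0 2 ^+ 2.
    by apply: (lim _ _ (C_cvg 1) S_cvg) => w [[[+ _] _] _] /= => ->.
  have a3 : 0 <= z 0 2.
    by apply: (lim _ _ (C_cvg 0) (@coord_cvg z 2)) => w [[[_ h] _] _].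
  have a4 : 0 <= z 0 1.
    by apply: (lim _ _ (C_cvg 0) (@coord_cvg z 1)) => w [[_ /ltW h] _].
  have a5 : 1 <= (2 * K + 36) * z 0 1 ^+ 2.
    apply: (lim _ (fun w : 'rV[R]_3 => (2 * K + 36) * w 0 1 ^+ 2) (C_cvg 1)).
      exact: (cvgM (C_cvg _) (X_cvg 1 2)).
    exact: sector_height.
  have z1 : 0 < z 0 1.
    rewrite lt_def a4 andbT; apply/eqP => z1; move: a5; rewrite z1 expr0n mulr0.
    by rewrite ler10.
  have Dz : upper_disc z by split => //; split => //; apply: le_anti; rewrite a1 a2.
  have lim' (u : 'rV[R]_3 -> R) (c : R) : u @ within upper_disc (nbhs z) --> u z ->
      (forall w, sector w -> u w <= c) -> u z <= c.
    move=> /cvgrPdist_lt hu huc; rewrite leNgt; apply/negP => lt.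
    have [w [Sw hw]] := cz _ (hu (u z - c) ltac:(lra)).
    have := huc w Sw; have := hw Sw.1; rewrite /= ltr_norml; lra.
  have ca := angle_coord_cont Dz.
  split => //; split; last by apply: lim' (level_coord_cont Dz) _ => w [_ [_ h]].
  rewrite ler_norml; apply/andP; split.
    rewrite lerNl; apply: (lim' (fun z => - angle_coord z) 1); first exact: cvgN.
    by move=> w [_ [+ _]]; rewrite ler_norml lerNl => /andP[].
  by apply: (lim' _ _ ca) => w [_ [+ _]]; rewrite ler_norml => /andP[].
- by apply: (@rV_compact R 3 (fun=> `[-1, 1]%classic)) => i; exact: segment_compact.
- by move=> z [[Dz _] _] j; rewrite /= in_itv; exact: disc_box.
Qed.

Lemma sector_continuous (u : 'rV[R]_3 -> R) :
  (forall z, upper_disc z -> u @ within upper_disc (nbhs z) --> u z) ->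
  {within sector, continuous u}.
Proof.
move=> h; apply/subspace_continuousP => z [Dz Sz] A hA.
have H : nbhs z [set w | upper_disc w -> A (u w)] := h z Dz A hA.
suff : nbhs z [set w | sector w -> A (u w)] by [].
by apply: filterS H => w hw [Dw _]; exact: hw.
Qed.

Lemma sector_nbhs : within poincare_disc (nbhs (vec3 0 1 0 : 'rV[R]_3)) sector.
Proof.
set e : 'rV[R]_3 := vec3 0 1 0.
have De : upper_disc e.
  by split; [rewrite /poincare_disc /= !mxE /= expr0n expr1n /= add0r addr0 | rewrite mxE].
have e1 : 0 < e 0 1 by rewrite mxE.
have e2 : e 0 2 = 0 by rewrite mxE.
have ae : angle_coord e = 0 by rewrite angle_coord_infinity // mxE mul0r.
have /cvgrPdist_lt /(_ 1 ltr01) ha := angle_coord_cont De.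
have /cvgrPdist_lt /(_ r0 r00) hl := level_coord_cont De.
have {}ha : nbhs e [set w | upper_disc w -> `|angle_coord e - angle_coord w| < 1] := ha.
have {}hl : nbhs e [set w | upper_disc w -> `|level_coord e - level_coord w| < r0] := hl.
move/nbhs_rV: ha => [da da0 ha]; move/nbhs_rV: hl => [dl dl0 hl].
pose d := Num.min (Num.min da dl) 1.
have m1 : d <= da by rewrite !ge_min lexx.
have m2 : d <= dl by rewrite !ge_min lexx orbT.
have m3 : d <= 1 by rewrite ge_min lexx orbT.
apply/nbhs_rV; exists d; first by rewrite !lt_min da0 dl0 ltr01.
move=> w hw dw; have hwa := ha w (fun j => lt_le_trans (hw j) m1).
have hwl := hl w (fun j => lt_le_trans (hw j) m2); have hw1 := lt_le_trans (hw 1) m3.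
have w1 : 0 < w 0 1 by move: hw1; rewrite /= mxE /= ltr_norml; lra.
have Dw : upper_disc w by split.
have := hwa Dw; have := hwl Dw; rewrite ae (level_coord_infinity e2) !sub0r !normrN => b1 b2.
by split => //; split; [exact: ltW | apply: le_trans (ler_norm _) (ltW b1)].
Qed.

End SectorCoordinates.

(** * Reachability near the upper end of the vertical axis *)

Section SectorAtInfinity.
Context {R : realType}.
Variables (f g : {poly R}) (n m : nat) (X eta r0 : R).
Hypothesis hfg : tame f g.
Hypothesis hb : balanced f g.
Hypothesis n0 : (0 < n)%N.
Hypothesis X1 : 1 <= X.
Hypothesis eta0 : 0 < eta.
Hypothesis hrot : far_rotating f g n X eta.
Hypothesis sf : size f = n.+1.
Hypothesis sg : size g = m.+1.
Hypothesis nm : (2 * n + 1 <= m)%N.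
Hypothesis om : odd m.
Hypothesis gm : 0 < g`_m.
Hypothesis r00 : 0 < r0.
Hypothesis r01 : r0 <= 1.
Hypothesis region : forall x y : R, 0 < y -> (right_tip f g x y)^-1 <= r0 ->
  X <= `|x| \/ 1 <= y /\ x ^+ (2 * n + 2) <= n%:R / eta * y ^+ 2.

Let W := poincare_field (lienard f g).
Let V := field_eval (lienard f g).
Let theta := angle_coord f g n eta.
Let rho := level_coord f g.
Let N := sector f g n eta r0.
Let m0 : (0 < m)%N. Proof. by clear -nm; lia. Qed.

Lemma coords_of_projection (q : 'rV[R]_2) : 0 < q 0 1 ->
  [/\ upper_disc (central_projection q), 0 < central_projection q 0 2,
      theta (central_projection q) = arc_coord n eta (cycle_level f g q)^-1 (q 0 0) (q 0 1) &
      rho (central_projection q) = (cycle_level f g q)^-1].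
Proof.
move=> q1; have [dz z2] := central_projection_disc q.
have z1 : 0 < central_projection q 0 1.
  rewrite /central_projection mxE vec3_1 mulr_gt0 // invr_gt0 sqrtr_gt0.
  exact: radius_gt0.
have er : rho (central_projection q) = (cycle_level f g q)^-1.
  by rewrite /rho /level_coord plane_pointK.
split => //; rewrite /theta angle_coord_plane //.
rewrite -/rho er; congr arc_coord.
  by rewrite -{3}(plane_pointK q) vec2_0.
by rewrite -{3}(plane_pointK q) vec2_1.
Qed.

Definition infinity_point (u : R) : 'rV[R]_3 := (Num.sqrt (1 + u ^+ 2))^-1 *: vec3 u 1 0.

Lemma infinity_pointP (u : R) :
  [/\ upper_disc (infinity_point u), infinity_point u 0 2 = 0, theta (infinity_point u) = u &
      rho (infinity_point u) = 0].
Proof.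
have s0 : 0 < Num.sqrt (1 + u ^+ 2) by rewrite sqrtr_gt0 ltr_pwDl // sqr_ge0.
have s2 : Num.sqrt (1 + u ^+ 2) ^+ 2 = 1 + u ^+ 2 by rewrite sqr_sqrtr // addr_ge0 // sqr_ge0.
have z2 : infinity_point u 0 2 = 0 by rewrite mxE vec3_2 mulr0.
have z1 : 0 < infinity_point u 0 1 by rewrite mxE vec3_1 mulr1 invr_gt0.
split => //; last exact: level_coord_infinity.
- split => //; split; last by rewrite z2.
  rewrite z2 !mxE /= mulr1; move: (Num.sqrt _) s0 s2 => d d0 d2; have dn := lt0r_neq0 d0.
  transitivity ((1 + u ^+ 2) / d ^+ 2); first by field.
  by rewrite -d2 divff // expf_neq0.
- rewrite /theta (angle_coord_infinity _ hfg n0) // !mxE /= mulr1 invrK mulrAC mulVf ?mul1r //.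
  exact: lt0r_neq0.
Qed.

Lemma infinity_pointE (z : 'rV[R]_3) : upper_disc z -> z 0 2 = 0 -> z = infinity_point (theta z).
Proof.
move=> [[hz _] z1] z2; rewrite /theta (angle_coord_infinity _ hfg n0) // /infinity_point.
have n1 := lt0r_neq0 z1; rewrite z2 expr0n addr0 in hz.
have -> : 1 + (z 0 0 / z 0 1) ^+ 2 = (z 0 1)^-1 ^+ 2.
  transitivity ((z 0 0 ^+ 2 + z 0 1 ^+ 2) / z 0 1 ^+ 2); last by rewrite hz mul1r exprVn.
  by move: (z 0 0) (z 0 1) n1 => a b bn; field.
rewrite sqrtr_sqr gtr0_norm ?invr_gt0 // invrK.
by apply: rV3_eq; rewrite !mxE /= ?mulr1 ?mulr0 // mulrC divfK.
Qed.

(** On the circle the slope increases with speed of the sign of [u^(m+1)], positive off [u = 0] as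
    [m] is odd. The arc is parametrized by the slope and then turned into a solution by a time
    change. *)
Lemma infinity_flow (u v : R) : u <= v -> 0 < u \/ v < 0 -> -1 <= u -> v <= 1 ->
  reach W N (infinity_point u) (infinity_point v).
Proof.
move=> uv hs u1 v1; pose d (s : R) := Num.sqrt (1 + (u + s) ^+ 2).
have d0 s : 0 < d s by rewrite sqrtr_gt0 ltr_pwDl // sqr_ge0.
have d2 s : d s ^+ 2 = 1 + (u + s) ^+ 2 by rewrite sqr_sqrtr // addr_ge0 // sqr_ge0.
have dd s : is_derive s (1 : R) d ((u + s) / d s).
  have p : 0 < 1 + (u + s) ^+ 2 by rewrite ltr_pwDl // sqr_ge0.
  have h : is_derive s (1 : R) (fun s => 1 + (u + s) ^+ 2) (2 * (u + s)) by der; ring.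
  apply: (der_eq (der_sqrt (u := fun s => 1 + (u + s) ^+ 2) p h)); rewrite -/(d s); move: (d s) (lt0r_neq0 (d0 s)) => e en.
  by field.
have un s : 0 <= s <= v - u -> u + s != 0.
  by move=> hs'; apply/eqP => e; case: hs => hs; lra.
have -> : infinity_point u = infinity_point (u + 0) by rewrite addr0.
have -> : infinity_point v = infinity_point (u + (v - u)) by rewrite addrC subrK.
(* The curve has tangential coefficient [d^(-2)], the field has [a_m (u + s)^(m+1) / d^(m+1)]; the
   factor is their quotient. *)
apply: (@reparametrize R 3 W N (fun s => infinity_point (u + s))
  (fun s => d s ^+ m.-1 * (g`_m * (u + s) ^+ m.+1)^-1)); first by lra.
move=> s hs'; have us := un s hs'; have [Dz z2 tz rz] := infinity_pointP (u + s).
have pp : 0 < (u + s) ^+ m.+1.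
  by rewrite exprn_even_gt0 //= ?us ?orbT // om.
have gp : 0 < g`_m * (u + s) ^+ m.+1 by exact: mulr_gt0 gm pp.
split.
- have [h0 h1 h2] : [/\ is_derive s (1 : R) (fun s => (d s)^-1 * (u + s)) ((d s) ^- 3),
      is_derive s (1 : R) (fun s => (d s)^-1 * 1) (- (u + s) * (d s) ^- 3) &
      is_derive s (1 : R) (fun s => (d s)^-1 * 0) 0].
    have dn := lt0r_neq0 (d0 s); have dv := derV dn (dd s).
    have du : is_derive s (1 : R) (fun s => u + s) 1 by der; ring.
    split.
    + apply: (der_eq (derM dv du)).
      have e := d2 s; move: (d s) dn e => c cn e.
      transitivity ((c ^+ 2 - (u + s) ^+ 2) / c ^+ 3); first by field.
      by rewrite e addrK mul1r.
    + by apply: (der_eq (derM dv (derC s 1))); move: (d s) dn => c cn; field.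
    + by apply: (der_eq (derM dv (derC s 0))); rewrite !mulr0 addr0.
  rewrite /W (poincare_field_infinity sf sg n0 nm) //; last by case: Dz.
  have E : (d s ^+ m.-1 / (g`_m * (u + s) ^+ m.+1)) *
      (g`_m * infinity_point (u + s) 0 0 ^+ m.+1) = (d s) ^- 2.
    rewrite /infinity_point mxE vec3_0 exprMn exprVn -/(d s).
    rewrite (_ : m.+1 = (m.-1 + 2)%N); last by clear -m0; lia.
    have pn : (u + s) ^+ (m.-1 + 2) != 0 by rewrite expf_neq0.
    have gn : g`_m != 0 by rewrite gt_eqF.
    rewrite [d s ^+ (m.-1 + 2)]exprD.
    have dn := lt0r_neq0 (d0 s); move: (d s ^+ m.-1) (expf_neq0 m.-1 dn) => e en.
    move: (_ ^+ (m.-1 + 2)) (g`_m) (d s) pn gn dn => p a c pn an cn.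
    by field; rewrite en pn an cn.
  rewrite scalerA E /infinity_point -/(d s) !mxE /=.
  apply/is_derive_mx => i; rewrite ord1.
  apply: ord3_ind; rewrite !mxE /=.
  + rewrite (_ : (fun s => _) = (fun s => (d s)^-1 * (u + s))); last first.
      by apply/funext => r; rewrite !mxE.
    by apply: (der_eq h0); move: (d s) (lt0r_neq0 (d0 s)) => c cn; field.
  + rewrite (_ : (fun s => _) = (fun s => (d s)^-1 * 1)); last first.
      by apply/funext => r; rewrite !mxE.
    by apply: (der_eq h1); move: (d s) (lt0r_neq0 (d0 s)) => c cn; field.
  + rewrite (_ : (fun s => _) = (fun s => (d s)^-1 * 0)); last first.
      by apply/funext => r; rewrite !mxE.
    by apply: (der_eq h2); rewrite mulr0.
- by rewrite mulr_gt0 ?invr_gt0 // exprn_gt0.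
- have cd := der_cont (derX m.-1 (dd s)).
  have cu : is_derive s (1 : R) (fun s => g`_m * (u + s) ^+ m.+1)
      (g`_m * (m.+1%:R * (u + s) ^+ m)) by der; ring.
  exact: (cvgM cd (cvgV (lt0r_neq0 gp) (der_cont cu))).
- split => //; split; last by rewrite -/rho rz ltW.
  by rewrite -/theta tz ler_norml; lra.
Qed.

Lemma arc_order (x y : R -> R) (a b l : R) : 0 < l -> l^-1 <= r0 -> sol f g x y ->
  (forall t : R, right_tip f g (x t) (y t) = l) -> (forall t : R, a < t < b -> 0 < y t) ->
  forall s t : R, a < s -> s < t -> t < b ->
    arc_coord n eta l^-1 (x s) (y s) < arc_coord n eta l^-1 (x t) (y t).
Proof.
move=> l0 lr h hl hy s t as_ st tb.
apply: (@arc_coord_increasing R f g n X eta) => //; first by rewrite invr_gt0.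
move=> r /andP[r1 r2]; have yr : 0 < y r by apply: hy; apply/andP; split; lra.
split => //; have [|hX|[_ hX]] := @region (x r) (y r) yr; [by rewrite hl | by left | by right].
Qed.

Lemma sector_interior (z : 'rV[R]_3) : N z -> 0 < z 0 2 ->
  let l := right_tip f g (plane_point z 0 0) (plane_point z 0 1) in
  [/\ 0 < l, rho z = l^-1, l^-1 <= r0, 0 < plane_point z 0 1 &
      theta z = arc_coord n eta l^-1 (plane_point z 0 0) (plane_point z 0 1)].
Proof.
move=> [[dz z1] [_ hl]] z2 l.
have l0 : 0 < l by rewrite -invr_gt0; exact: (level_coord_gt0 hfg hb z1 z2).
split => //.
- by rewrite vec2_1 divr_gt0.
- by rewrite /theta angle_coord_plane // vec2_0 vec2_1.
Qed.

Lemma level_pos_interior (z : 'rV[R]_3) : N z -> (0 < z 0 2 <-> rho z != 0) /\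
  (z 0 2 = 0 <-> rho z = 0).
Proof.
move=> [[[_ z20] z1] _].
have h1 : 0 < z 0 2 -> rho z != 0 by move=> z2; rewrite gt_eqF // level_coord_gt0.
have h2 : z 0 2 = 0 -> rho z = 0 by exact: level_coord_infinity.
move: z20; rewrite le_eqVlt => /predU1P[/esym e|z2].
  split; split => h.
  - exact: h1.
  - by move: h; rewrite h2 // eqxx.
  - exact: h2.
  - exact: e.
split; split => h.
- exact: h1.
- exact: z2.
- exact: h2.
- by move: (h1 z2); rewrite h eqxx.
Qed.

(** At finite points [rho] determines the cycle and [theta] is strictly increasing along its upper
    arc; at infinity [theta] is the slope. *)
Lemma sector_coords_inj (z z' : 'rV[R]_3) : N z -> N z' ->
  theta z = theta z' -> rho z = rho z' -> z = z'.
Proof.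
move=> Nz Nz' et er; have [i1 i2] := level_pos_interior Nz; have [j1 j2] := level_pos_interior Nz'.
case: (eqVneq (rho z) 0) => e.
  rewrite (infinity_pointE Nz.1 (i2.2 e)) et -(infinity_pointE Nz'.1) //.
  by apply/j2; rewrite -er.
have z2 := i1.2 e; have z2' : 0 < z' 0 2 by apply/j1; rewrite -er.
have [l0 rl lr y0 tl] := sector_interior Nz z2.
have [l0' rl' lr' y0' tl'] := sector_interior Nz' z2'.
have el : right_tip f g (plane_point z' 0 0) (plane_point z' 0 1) =
    right_tip f g (plane_point z 0 0) (plane_point z 0 1).
  by apply: invr_inj; rewrite -rl -rl'.
have [x [y [a [b [[h ab _ _] hL hy hp]]]]] := upper_arc hfg hb l0.
have [s /andP[as_ sb] [xs ys]] := hp _ _ erefl y0.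
have [t /andP[at_ tb] [xt yt]] := hp _ _ el y0'.
set l := right_tip f g (plane_point z 0 0) (plane_point z 0 1) in l0 rl lr tl el hL.
rewrite tl tl' el -xs -ys -xt -yt in et.
have mono := arc_order l0 lr h hL hy.
have est : s = t.
  case: (ltgtP s t) => // lt; [have := mono s t as_ lt tb | have := mono t s at_ lt sb];
    by rewrite et ltxx.
have ep : plane_point z = plane_point z'.
  by apply: rV2_eq; rewrite -?xs -?ys -?xt -?yt est.
by rewrite -(central_projectionK Nz.1.1 z2) ep central_projectionK //; case: Nz' => -[].
Qed.

Lemma sector_coords_onto (th rh : R) : `|th| <= 1 -> 0 <= rh <= r0 ->
  exists z, [/\ N z, theta z = th & rho z = rh].
Proof.
move=> ht /andP[]; rewrite le_eqVlt => /predU1P[<- _|rh0 hr].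
  have [Dz z2 tz rz] := infinity_pointP th; exists (infinity_point th); split => //.
  by split => //; rewrite -/theta -/rho tz rz; split => //; exact: ltW.
have l0 : 0 < rh^-1 by rewrite invr_gt0.
have [x [y [a [b [[h ab [xa ya] [xb yb]] hL hy hp]]]]] := upper_arc hfg hb l0.
have xb0 : 0 < x b by rewrite xb.
have [s [t [as_ st tb e1 e2]]] := arc_ends n0 eta0 h ab (ltW rh0) xa ya xb0 yb hy.
have [||c /andP[c1 c2] ec] := @ivt_c R (fun r => arc_coord n eta rh (x r) (y r)) s t th (ltW st).
- apply: cont_within => r /andP[r1 r2]; apply: arc_coord_cont => //.
  by apply: hy; apply/andP; split; lra.
- by move: ht; rewrite ler_norml; lra.
have yc : 0 < y c by apply: hy; apply/andP; split; lra.
have [|Dz z2 tz rz] := @coords_of_projection (vec2 (x c) (y c)); first by rewrite vec2_1.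
have El : cycle_level f g (vec2 (x c) (y c)) = rh^-1 by rewrite /cycle_level vec2_0 vec2_1.
rewrite El invrK in rz; rewrite El invrK vec2_0 vec2_1 ec in tz.
by exists (central_projection (vec2 (x c) (y c))); split => //; split => //; rewrite -/theta -/rho tz rz.
Qed.

Lemma order_interior_flow (z z' : 'rV[R]_3) : N z -> N z' -> 0 < z 0 2 ->
  rho z = rho z' -> theta z <= theta z' -> reach W N z z'.
Proof.
move=> Nz Nz' z2 er et; have [i1 i2] := level_pos_interior Nz.
have [j1 j2] := level_pos_interior Nz'.
have z2' : 0 < z' 0 2 by apply/j1; rewrite -er; exact/i1.
have [l0 rl lr y0 tl] := sector_interior Nz z2.
have [l0' rl' lr' y0' tl'] := sector_interior Nz' z2'.
have el : right_tip f g (plane_point z' 0 0) (plane_point z' 0 1) =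
    right_tip f g (plane_point z 0 0) (plane_point z 0 1).
  by apply: invr_inj; rewrite -rl -rl'.
have [x [y [a [b [[h ab _ _] hL hy hp]]]]] := upper_arc hfg hb l0.
have [s /andP[as_ sb] [xs ys]] := hp _ _ erefl y0.
have [t /andP[at_ tb] [xt yt]] := hp _ _ el y0'.
set l := right_tip f g (plane_point z 0 0) (plane_point z 0 1) in l0 rl lr tl el hL.
rewrite tl tl' el -xs -ys -xt -yt in et.
have mono := arc_order l0 lr h hL hy.
have st : s <= t.
  by rewrite leNgt; apply/negP => lt; have := mono t s at_ lt sb; rewrite ltNge et.
have -> : z = central_projection (vec2 (x (s + 0)) (y (s + 0))).
  by rewrite addr0 xs ys vec2E central_projectionK //; case: Nz => -[].
have -> : z' = central_projection (vec2 (x (s + (t - s))) (y (s + (t - s)))).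
  by rewrite [s + _]addrC subrK xt yt vec2E central_projectionK //; case: Nz' => -[].
pose D (r : R) := Num.sqrt (1 + x (s + r) ^+ 2 + y (s + r) ^+ 2).
apply: (@reparametrize R 3 W N (fun r => central_projection (vec2 (x (s + r)) (y (s + r))))
  (fun r => D r ^+ m.-1)); first by lra.
move=> r /andP[r1 r2]; have yr : 0 < y (s + r) by apply: hy; apply/andP; split; lra.
have p : 0 < 1 + x (s + r) ^+ 2 + y (s + r) ^+ 2.
  by have := radius_gt0 (vec2 (x (s + r)) (y (s + r))); rewrite vec2_0 vec2_1.
have hs : sol f g (fun r => x (s + r)) (fun r => y (s + r)).
  have := sol_shift s h.
  by rewrite (_ : (fun r => x (r + s)) = (fun r => x (s + r))) 1?(_ : (fun r => y (r + s)) = (fun r => y (s + r)));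
    try (by apply/funext => q; rewrite addrC).
split.
- have hd := sol_der hs r; have dm := field_degree_lienard sf sg n0 nm.
  have := @central_projection_flow R (lienard f g) (fun r => vec2 (x (s + r)) (y (s + r))) r.
  by rewrite dm vec2_0 vec2_1 => /(_ m0 hd).
- by rewrite exprn_gt0 // sqrtr_gt0.
- have [hx hy'] := hs r.
  have h2 : is_derive r (1 : R) (fun r => 1 + x (s + r) ^+ 2 + y (s + r) ^+ 2)
      (2 * x (s + r) * y (s + r) + 2 * y (s + r) * acc f g (x (s + r)) (y (s + r))).
    by der; ring.
  exact: (der_cont (derX m.-1 (der_sqrt (u := fun r => 1 + x (s + r) ^+ 2 + y (s + r) ^+ 2) p h2))).
- have [|Dz w2 tz rz] := @coords_of_projection (vec2 (x (s + r)) (y (s + r))); first by rewrite vec2_1.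
  have El : cycle_level f g (vec2 (x (s + r)) (y (s + r))) = l by rewrite /cycle_level vec2_0 vec2_1.
  rewrite El in rz; rewrite El vec2_0 vec2_1 in tz.
  split => //; rewrite -/theta -/rho tz rz; split => //.
  have b1 : -1 <= arc_coord n eta l^-1 (x s) (y s).
    by rewrite xs ys -tl; case: Nz => _ [+ _]; rewrite ler_norml => /andP[].
  have b2 : arc_coord n eta l^-1 (x t) (y t) <= 1.
    by rewrite xt yt -el -tl'; case: Nz' => _ [+ _]; rewrite ler_norml => /andP[].
  rewrite ler_norml; apply/andP; split.
    case: (eqVneq r 0) => [->|rn]; first by rewrite addr0.
    apply/ltW/(le_lt_trans b1)/mono => //; last by lra.
    by rewrite ltrDl lt_def rn r1.
  case: (eqVneq r (t - s)) => [->|rn]; first by rewrite addrC subrK.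
  apply/ltW/(lt_le_trans _ b2)/mono => //; first by lra.
  by have : r < t - s by [rewrite lt_neqAle rn r2]; lra.
Qed.

Lemma height_along_flow : exists2 C : R, 0 < C & forall (c : R -> 'rV[R]_3) (tau : R),
  (forall t : R, 0 <= t <= tau -> is_derive t (1 : R) c (W (c t)) /\ N (c t)) ->
  exists k : R -> R, forall t : R, 0 <= t <= tau -> `|k t| <= C /\
    is_derive t (1 : R) (fun s => c s 0 2) (k t * c t 0 2).
Proof.
have [C C0 hC] := poincare_z2_bound sf sg n0 nm; exists C => // c tau hc.
(* Where the height vanishes the quotient is [0] by convention, and both sides of the linear
   equation are [0]. *)
exists (fun t => W (c t) 0 2 / c t 0 2) => t ht; have [/is_derive_mx /(_ 0 2) d [[dz _] _]] := hc t ht.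
have [k kC E] := hC _ dz; rewrite -/W in E.
case: (eqVneq (c t 0 2) 0) => e.
  rewrite E e !mulr0 invr0 mulr0 normr0; split; first exact: ltW.
  by apply: (der_eq d); rewrite E e mulr0.
by split; [rewrite E mulfK | rewrite divfK].
Qed.

(** Positivity of the height persists, so the arc projects to a planar one with [y > 0], on a single
    cycle. The abscissa increases both along it and along the reference upper arc; this decides
    which endpoint comes later, hence the order of [theta]. *)
Lemma interior_flow_order (z z' : 'rV[R]_3) : N z -> N z' -> 0 < z 0 2 -> reach W N z z' ->
  rho z = rho z' /\ theta z <= theta z'.
Proof.
move=> Nz Nz' z2 [c [tau [tau0 c0 ct hc]]].
have [C C0 hC] := height_along_flow; have [k hk] := hC c tau hc.
have pos t : 0 <= t <= tau -> 0 < c t 0 2.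
  move=> /andP[t0 tt]; apply: (@linear_pos R 0 t C (fun s => c s 0 2) k t0) => [s|s|].
  - by move=> /andP[s0 s1]; apply: (hk s _).2; rewrite s0 (le_trans s1).
  - by move=> /andP[s0 s1]; apply: (hk s _).1; rewrite s0 (le_trans s1).
  - by rewrite c0.
have : reach V [set q | 0 < q 0 1] ((plane_point \o c) 0) ((plane_point \o c) tau).
  apply: (@reparametrize R 2 V _ (plane_point \o c) (fun t => c t 0 2 ^+ m.-1)) => // t ht.
  have [dc Nc] := hc t ht; have p := pos t ht; split.
  - have dm := field_degree_lienard sf sg n0 nm.
    have := @plane_point_flow R (lienard f g) c t; rewrite dm; apply => //.
  - by rewrite exprn_gt0.
  - by move/is_derive_mx: dc => /(_ 0 2) d; exact: (der_cont (derX m.-1 d)).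
  - by rewrite /= vec2_1 divr_gt0 //; case: Nc => -[].
rewrite /= c0 ct => hr; have el := reach_level hfg hb hr.
have z2' : 0 < z' 0 2 by rewrite -ct; apply: pos; rewrite tau0 lexx.
have [l0 rl lr y0 tl] := sector_interior Nz z2.
have [l0' rl' lr' y0' tl'] := sector_interior Nz' z2'.
rewrite /cycle_level in el.
split; first by rewrite rl rl' el.
have xx : plane_point z 0 0 <= plane_point z' 0 0.
  move: hr => [q [T [T0 q0 qT hq]]]; rewrite -q0 -qT.
  apply: (@nondecr R 0 T (fun t => q t 0 0) (fun t => q t 0 1) T0) => [t ht|t /andP[t1 t2]].
    by have [/der_fieldE d _] := hq t ht; case: d.
  have ht : 0 <= t <= T by rewrite !ltW.
  by have [_ /ltW] := hq t ht.
have [x [y [a [b [[h ab _ _] hL hy hp]]]]] := upper_arc hfg hb l0.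
have [s /andP[as_ sb] [xs ys]] := hp _ _ erefl y0.
have [t /andP[at_ tb] [xt yt]] := hp _ _ el y0'.
set l := right_tip f g (plane_point z 0 0) (plane_point z 0 1) in l0 rl lr tl el hL.
rewrite tl tl' el -xs -ys -xt -yt.
have mono := arc_order l0 lr h hL hy.
case: (ltgtP s t) => [lt|lt|->//]; first exact: ltW (mono s t as_ lt tb).
have : x t < x s.
  apply: (x_increasing h lt) => r /andP[r1 r2]; apply: hy; apply/andP; split; lra.
by rewrite xs xt ltNge xx.
Qed.

(** On the circle [z0] solves a linear equation with bounded coefficient, so it keeps its sign or
    stays zero: the equilibrium is never crossed, while the slope does not decrease. *)
Lemma boundary_flow_order (z z' : 'rV[R]_3) : N z -> N z' -> z 0 2 = 0 -> reach W N z z' ->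
  sector_order (theta z) (rho z) (theta z') (rho z').
Proof.
move=> Nz Nz' z2 [c [tau [tau0 c0 ct hc]]].
have [C C0 hC] := height_along_flow; have [k hk] := hC c tau hc.
have zero t : 0 <= t <= tau -> c t 0 2 = 0.
  move=> /andP[t0 tt]; apply: (@linear_zero R 0 t C (fun s => c s 0 2) k t0) => [s|s|].
  - by move=> /andP[s0 s1]; apply: (hk s _).2; rewrite s0 (le_trans s1).
  - by move=> /andP[s0 s1]; apply: (hk s _).1; rewrite s0 (le_trans s1).
  - by rewrite c0.
have z2' : z' 0 2 = 0 by rewrite -ct; apply: zero; rewrite tau0 lexx.
have gp : 0 < g`_m by exact: gm.
pose k0 t := g`_m * c t 0 0 ^+ m * c t 0 1.
have hd t : 0 <= t <= tau -> [/\ is_derive t (1 : R) (fun s => c s 0 0) (k0 t * c t 0 0),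
    is_derive t (1 : R) (fun s => c s 0 1) (- (g`_m * c t 0 0 ^+ m.+1 * c t 0 0)),
    `|k0 t| <= g`_m & 0 < c t 0 1].
  move=> ht; have [/is_derive_mx d [[dz c1] _]] := hc t ht.
  have E := poincare_field_infinity sf sg n0 nm dz (zero t ht); rewrite -/W in E.
  rewrite E in d; have d0 := d 0 0; have d1 := d 0 1; rewrite !mxE /= in d0 d1.
  have b := disc_box dz; split => //.
  - by apply: (der_eq d0); rewrite /k0 exprS; move: (_ ^+ m) => p; ring.
  - by apply: (der_eq d1); rewrite mulrN.
  - rewrite /k0 -mulrA normrM (gtr0_norm gp) -[leRHS]mulr1 ler_pM2l // normrM normrX.
    by rewrite mulr_ile1 ?exprn_ge0 // ?exprn_ile1 // ler_norml; exact: b.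
have z1 : 0 < z 0 1 by case: Nz => -[].
have z1' : 0 < z' 0 1 by case: Nz' => -[].
have slope : theta z <= theta z'.
  rewrite /theta !(angle_coord_infinity _ hfg n0) // -c0 -ct.
  apply: (@nondecr R 0 tau (fun t => c t 0 0 / c t 0 1) (fun t => g`_m * c t 0 0 ^+ m.+1 *
    ((c t 0 1 ^+ 2 + c t 0 0 ^+ 2) / c t 0 1 ^+ 2)) tau0) => [t ht|t /andP[t1 t2]].
    have [d0 d1 _ c1] := hd t ht; have cn := lt0r_neq0 c1.
    apply: (der_eq (derM d0 (derV cn d1))); rewrite /k0 [c t 0 0 ^+ m.+1]exprS.
    move: (c t 0 0 ^+ m) (c t 0 0) (c t 0 1) cn (g`_m) => p u v vn w; by field.
  rewrite mulr_ge0 //; last by rewrite divr_ge0 ?sqr_ge0 // addr_ge0 // sqr_ge0.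
  by rewrite mulr_ge0 ?(ltW gp) // exprn_even_ge0 //= om.
split => //; first by rewrite ((level_pos_interior Nz).2.1 z2) ((level_pos_interior Nz').2.1 z2').
move=> _; rewrite /theta !(angle_coord_infinity _ hfg n0) //.
case: (ltgtP (z 0 0) 0) => h.
- apply: Or33; rewrite pmulr_llt0 ?invr_gt0 // -oppr_gt0 -ct.
  apply: (@linear_pos R 0 tau g`_m (fun s => - c s 0 0) k0 tau0) => [t ht|t ht|].
  + by have [d0 _ _ _] := hd t ht; apply: (der_eq (derN d0)); rewrite mulrN.
  + by have [_ _ b _] := hd t ht.
  + by rewrite c0 oppr_gt0.
- by apply: Or32; rewrite divr_gt0.
- have e : c tau 0 0 = 0.
    apply: (@linear_zero R 0 tau g`_m (fun s => c s 0 0) k0 tau0) => [t ht|t ht|].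
    + by have [d0 _ _ _] := hd t ht.
    + by have [_ _ b _] := hd t ht.
    + by rewrite c0.
  by apply: Or31; rewrite h -ct e !mul0r.
Qed.

Lemma order_boundary_flow (z z' : 'rV[R]_3) : N z -> N z' -> z 0 2 = 0 ->
  sector_order (theta z) (rho z) (theta z') (rho z') -> reach W N z z'.
Proof.
move=> Nz Nz' z2 [er et hs].
have rz := (level_pos_interior Nz).2.1 z2.
have z2' : z' 0 2 = 0 by apply/(level_pos_interior Nz').2; rewrite -er.
have b1 : -1 <= theta z by case: Nz => _ [+ _]; rewrite ler_norml => /andP[].
have b2 : theta z' <= 1 by case: Nz' => _ [+ _]; rewrite ler_norml => /andP[].
case: (boolP ((0 < theta z) || (theta z' < 0))) => [/orP h|].
  rewrite (infinity_pointE Nz.1 z2) (infinity_pointE Nz'.1 z2').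
  exact: infinity_flow.
rewrite negb_or -!leNgt => /andP[h1 h2].
have ez : theta z = theta z' by case: (hs rz) => // h; lra.
have t0 : theta z = 0 by lra.
rewrite -(sector_coords_inj Nz Nz' ez er).
exists (fun=> z), 0; split => // t _; split => //.
have z0 : z 0 0 = 0 by rewrite (infinity_pointE Nz.1 z2) t0 mxE vec3_0 mulr0.
rewrite /W (poincare_field_infinity sf sg n0 nm) //; last by case: Nz => -[].
rewrite z0 expr0n mulr0 scale0r; apply/is_derive_mx => i j; rewrite mxE; exact: derC.
Qed.

Lemma sector_at_infinity : one_hyperbolic_sector (lienard f g) (vec3 0 1 0).
Proof.
have e2 : (vec3 0 1 0 : 'rV[R]_3) 0 2 = 0 by rewrite vec3_2.
have e1 : 0 < (vec3 0 1 0 : 'rV[R]_3) 0 1 by rewrite vec3_1.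
apply: (@sector_of_coordinates R (lienard f g) _ N theta rho r0) => //.
- split; first by move=> z [[]].
  exact: (@sector_nbhs R f g n eta hfg hb n0).
- exact: (@sector_compact R f g n X eta hfg hb n0).
- by apply: sector_continuous => z; exact: angle_coord_cont.
- by apply: sector_continuous => z; exact: level_coord_cont.
- by move=> z [_ [h1 h2]]; split => //; rewrite h2 andbT; exact: level_coord_ge0.
- exact: sector_coords_onto.
- exact: sector_coords_inj.
- by rewrite /theta (angle_coord_infinity _ hfg n0) // vec3_0 mul0r.
- exact: level_coord_infinity.
- move=> z z' Nz Nz'; have [_ z20] := Nz.1.1.
  move: z20; rewrite le_eqVlt => /predU1P[/esym z2|z2].
    by split; [exact: boundary_flow_order | exact: order_boundary_flow].
  split=> [H|[er et _]]; last exact: order_interior_flow.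
  have [er et] := interior_flow_order Nz Nz' z2 H; split => // r.
  by move: ((level_pos_interior Nz).1.1 z2); rewrite r eqxx.
Qed.

End SectorAtInfinity.

(** * The equivalence, the finite equilibria and the two sectors *)

Section MainResults.
Context {R : realType}.
Implicit Types (f g : {poly R}).

Definition growth f g (m n : nat) : Prop :=
  [/\ odd m, (2 * n + 1 < m)%N & 0 < g`_m] \/
  (m = (2 * n + 1)%N /\ f`_n ^+ 2 < 4 * n.+1%:R * g`_m).

Lemma degree_gt0 f (n : nat) : size f = n.+1 -> f.[0] = 0 -> (0 < n)%N.
Proof.
case: n => // sf; rewrite horner_coef0 => f0.
by have := lead_coef_eq0 f; rewrite /lead_coef sf f0 eqxx -size_poly_eq0 sf.
Qed.

Lemma linear_global_centerP f g (m n : nat) : size f = n.+1 -> size g = m.+1 ->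
  let V := field_eval (lienard f g) in
  global_center V 0 /\ linear_type V 0 <->
  [/\ restoring g, f.[0] = 0 /\ 0 < g`_1, growth f g m n & balanced f g].
Proof.
move=> sf sg V; split.
- move=> [hc /linear_typeP [f0 g1]].
  have g0 := field0_of_global_center hc.
  have rg := restoring_of g0 g1 (fun x => @no_equilibrium_of_global_center R f g x hc).
  have ap := all_periodic_of_global_center hc.
  have H := growth_necessary rg ap sf sg.
  have hfg := tame_of_conditions rg f0 g1 sf sg (degree_gt0 sf f0) H.
  by split => //; exact: balanced_of_periodic.
- move=> [rg [f0 g1] H hb].
  have hfg := tame_of_conditions rg f0 g1 sf sg (degree_gt0 sf f0) H.
  by split; [exact: global_center_of_tame | exact/linear_typeP].
Qed.

Lemma growth_degree f g (m n : nat) : growth f g m n -> (2 * n + 1 <= m)%N.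
Proof. by move=> [[_ /ltnW]|[-> _]]. Qed.

Lemma upper_sector f g (m n : nat) : size f = n.+1 -> size g = m.+1 ->
  restoring g -> f.[0] = 0 -> 0 < g`_1 -> growth f g m n -> balanced f g ->
  one_hyperbolic_sector (lienard f g) (vec3 0 1 0).
Proof.
move=> sf sg rg f0 g1 H hb; have n0 := degree_gt0 sf f0.
have hfg := tame_of_conditions rg f0 g1 sf sg n0 H.
have [X [eta [X1 eta0 hrot]]] := far_rotating_of_conditions sf sg n0 H.
have [om gm] := restoring_lead rg sg.
have [r r0 hr] := far_region hfg hb n0 X1 eta0.
(* The bound by [1] on [rho] keeps the second term of [theta] at most [1] in absolute value, as used
   in [sector_height]. *)
apply: (@sector_at_infinity R f g n m X eta (Num.min r 1)) => //.
- exact: growth_degree H.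
- by rewrite lt_min r0 ltr01.
- by rewrite ge_min lexx orbT.
- by move=> x y y0 h; apply: hr => //; apply: le_trans h _; rewrite ge_min lexx.
Qed.

Lemma lower_sector f g (m n : nat) : size f = n.+1 -> size g = m.+1 ->
  restoring g -> f.[0] = 0 -> 0 < g`_1 -> growth f g m n -> balanced f g ->
  one_hyperbolic_sector (lienard f g) (vec3 0 (-1) 0).
Proof.
move=> sf sg rg f0 g1 H hb; have n0 := degree_gt0 sf f0.
have [om gm] := restoring_lead rg sg.
have -> : vec3 0 (-1) 0 = half_turn (vec3 0 1 0 : 'rV[R]_3).
  by apply: rV3_eq; rewrite !mxE /= ?oppr0.
apply: (@half_turn_sector R _ (lienard (flip f) (- flip g))).
  by move=> z; exact: (lienard_half_turn sf sg n0 (growth_degree H) om).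
apply: (@upper_sector (flip f) (- flip g) m n).
- by rewrite size_flip.
- by rewrite size_polyN size_flip.
- exact: restoring_flip.
- by rewrite flipE oppr0.
- by rewrite coefN coef_flip expr1 mulN1r opprK.
- have e : (- flip g)`_m = g`_m by rewrite coefN coef_flip -signr_odd om expr1 mulN1r opprK.
  by rewrite /growth e coef_flip exprMn sqrr_sign mul1r.
- exact: balanced_rot.
Qed.

Lemma equilibrium_lienard f g (q : 'rV[R]_2) : restoring g ->
  field_eval (lienard f g) q = 0 <-> q = 0.
Proof.
move=> rg; rewrite fieldE; split=> [e|->]; last first.
  by apply: rV2_eq; rewrite !mxE //= /acc restoring_0 // mulr0 subr0 oppr0.
have e0 := congr1 (fun w : 'rV_2 => w 0 0) e; have e1 := congr1 (fun w : 'rV_2 => w 0 1) e.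
rewrite vec2_0 mxE in e0; rewrite vec2_1 mxE /acc e0 mulr0 subr0 in e1.
apply: rV2_eq; rewrite mxE //; apply/eqP; apply: contraT => /rg.
by move/eqP: e1; rewrite oppr_eq0 => /eqP ->; rewrite mulr0 ltxx.
Qed.

Lemma growth_scaled f g (m n : nat) : size f = n.+1 ->
  growth f g m n <->
  [/\ odd m, (2 * n + 1 < m)%N & 0 < g`_m] \/
  (m = (2 * n + 1)%N /\ 1 < 4 * (n + 1)%:R * g`_m * f`_n ^- 2).
Proof.
move=> sf; have fn : f`_n != 0.
  have : lead_coef f != 0 by rewrite lead_coef_eq0 -size_poly_eq0 sf.
  by rewrite /lead_coef sf.
have p : 0 < f`_n ^+ 2 by rewrite exprn_even_gt0.
by rewrite /growth [(n + 1)%N]addn1 ltr_pdivlMr // mul1r.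
Qed.

End MainResults.

Theorem theorem1 (R : realType) (m n r s : nat) (a b : nat -> R)
    (hrm : (r <= m)%N) (hsn : (s <= n)%N)
    (hab : a r * a m * b s * b n != 0) :
  let g := poly_between r m a in
  let f := poly_between s n b in
  let F := integral_from0 (horner f) in
  let G := integral_from0 (horner g) in
  let X := lienard f g in
  let V := field_eval X in
  (global_center V 0 /\ linear_type V 0
   <->
   [/\ forall x : R, x != 0 -> 0 < x * g.[x],
       [/\ r = 1%N, (1 <= s)%N & 0 < a r],
       [/\ odd m, (2 * n + 1 < m)%N & 0 < a m] \/
       (m = (2 * n + 1)%N /\ 1 < 4 * (n + 1)%:R * a m * (b n) ^- 2) &
       forall x1 x2 : R, x1 < 0 -> 0 < x2 -> G x1 = G x2 -> F x1 = F x2]) /\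
  (global_center V 0 /\ linear_type V 0 ->
   [/\ forall q, V q = 0 <-> q = 0,
       forall q : 'rV[R]_2, q != 0 ->
         periodic_orbit V (flow_orbit V q) /\ surrounds (flow_orbit V q) 0,
       forall z, equilibrium_at_infinity X z <->
         z = vec3 0 1 0 \/ z = vec3 0 (-1) 0,
       one_hyperbolic_sector X (vec3 0 1 0) &
       one_hyperbolic_sector X (vec3 0 (-1) 0)]).
Proof.
move=> g f F G X V.
move: hab; rewrite !mulf_eq0 !negb_or => /andP[/andP[/andP[ar am] bs] bn].
have sf : size f = n.+1 by exact: size_between.
have sg : size g = m.+1 by exact: size_between.
have eam : g`_m = a m by rewrite coef_between hrm leqnn.
have ebn : f`_n = b n by rewrite coef_between hsn leqnn.
have P := linear_global_centerP sf sg.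
have Pg : growth f g m n <-> [/\ odd m, (2 * n + 1 < m)%N & 0 < a m] \/
    (m = (2 * n + 1)%N /\ 1 < 4 * (n + 1)%:R * a m * (b n) ^- 2).
  by rewrite -eam -ebn; exact: growth_scaled.
have Pb : balanced f g <->
    forall x1 x2 : R, x1 < 0 -> 0 < x2 -> G x1 = G x2 -> F x1 = F x2.
  rewrite /G /F; split=> H x1 x2 h1 h2; have := H x1 x2 h1 h2;
    by rewrite !integral_from0_poly.
have Pf : f.[0] = 0 <-> (1 <= s)%N.
  rewrite horner_coef0 coef_between leq0n andbT leqn0 lt0n.
  by case: eqP => [e|_]; split => // e'; move: bs; rewrite e e' eqxx.
(* Positivity of [x g(x)] forces [g(0) = 0], which excludes [r = 0] because [a r] is nonzero. *)
have Pr : restoring g -> 0 < g`_1 <-> r = 1%N /\ 0 < a r.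
  move=> rg; have := restoring_0 rg; rewrite horner_coef0 !coef_between leq0n andbT leqn0.
  case: (eqVneq r 0%N) => [e|r0 _].
    by move=> a0; move: ar; rewrite e a0 eqxx.
  case: (eqVneq r 1%N) => [e|r1].
    have -> : (1 <= m)%N by rewrite -e.
    by rewrite e leqnn; split => // -[].
  have -> : (r <= 1)%N = false by apply/negbTE; clear -r0 r1; lia.
  by rewrite /= ltxx; split => // -[e]; move: r1; rewrite e eqxx.
split.
- split.
    move=> /P [rg [/Pf s1 /(Pr rg) [r1 a0]] /Pg H /Pb hb]; by split.
  move=> [rg [r1 s1 a0] /Pg H /Pb hb]; apply/P; split => //; split; first exact/Pf.
  exact/(Pr rg).
move=> /P [rg [f0 g1] H hb].
have hfg := tame_of_conditions rg f0 g1 sf sg (degree_gt0 sf f0) H.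
have gm : g`_m != 0 by rewrite eam.
split.
- by move=> q; exact: equilibrium_lienard.
- move=> q qn; rewrite (flow_orbitE hfg hb qn).
  by split; [exact: periodic_orbit_cycle | exact: surrounds_cycle].
- by move=> z; exact: (equilibrium_at_infinityP sf sg (degree_gt0 sf f0) (growth_degree H) z gm).
- exact: (upper_sector sf sg).
- exact: (lower_sector sf sg).
Qed.
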